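(* For $T\ge 3$ let \[ I(T)=\int_{-T}^{T}\frac{\log|\zeta(\tfrac12+it)|}{\tfrac14+t^2}\,dt . \] Then, uniformly for $T\ge 3$, \[ I(T)=2\pi\sum_{\substack{-T\le\gamma\le T\\ \beta>1/2}}\log\left|\frac{\rho}{1-\rho}\right|+O\!\left(\frac{\log T}{T^2}\right), \] where the sum runs over the nontrivial zeros $\rho=\beta+i\gamma$ of $\zeta(s)$ (counted with multiplicity) with $\beta>1/2$ and $|\gamma|\le T$.
   Context: $\zeta(s)$ denotes the Riemann zeta-function; its nontrivial zeros are written $\rho=\beta+i\gamma$ with $\beta,\gamma$ real. No hypothesis (such as the Riemann Hypothesis) is assumed. *)

(* Defs.v *)
From HB Require Import structures.
From mathcomp Require Import all_boot all_order all_algebra.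
From mathcomp Require Import all_classical all_reals all_analysis.
From mathcomp Require Export complex.

Set Implicit Arguments.
Unset Strict Implicit.
Unset Printing Implicit Defensive.

Import Order.TTheory GRing.Theory Num.Theory.
Import numFieldNormedType.Exports.

Local Open Scope classical_set_scope.
Local Open Scope ring_scope.
Local Open Scope complex_scope.

(* Real-valued modulus: the norm `|z| of R[i] itself lives in R[i]. *)
Definition cabs (R : realType) (z : R[i]) : R := ComplexField.Normc.normc z.

Definition cexp (R : realType) (z : R[i]) : R[i] :=
  (expR (complex.Re z))%:C *
  (cos (complex.Im z) +i* sin (complex.Im z)).

(* R[i] is a normed space over itself, so the increment h in the difference
   quotient is complex and this is complex differentiability. *)
Definition cderivable (R : realType) (f : R[i] -> R[i]) (s : R[i]) : Prop :=
  derivable (f : R[i]^o -> R[i]^o) s 1.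

(* (k+1)^(-s), with the real logarithm of k+1. *)
Definition dirichlet_term (R : realType) (s : R[i]) (k : nat) : R[i] :=
  cexp (- (s * (ln k.+1%:R)%:C)).

(* zeta is the analytic continuation to C \ {1} of the Dirichlet series
   sum_(n >= 1) n^(-s), Re s > 1. By the identity theorem this determines
   zeta on C \ {1}; the value at the pole s = 1 is left arbitrary. *)
Definition is_riemann_zeta (R : realType) (zeta : R[i] -> R[i]) : Prop :=
  (forall s : R[i], 1 < complex.Re s ->
     series (dirichlet_term s : nat -> R[i]^o) @ \oo --> (zeta s : R[i]^o)) /\
  (forall s : R[i], s != 1 -> cderivable zeta s).

Definition has_zero_order (R : realType) (f : R[i] -> R[i]) (rho : R[i])
    (m : nat) : Prop :=
  exists g : R[i] -> R[i],
    [/\ \forall s \near (rho : R[i]^o), cderivable g s,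
        g rho != 0 &
        \forall s \near (rho : R[i]^o), f s = (s - rho) ^+ m * g s].

(* has_zero_order determines m; the default 0 is only used when f has no
   finite order of vanishing at rho. *)
Definition multiplicity (R : realType) (f : R[i] -> R[i]) (rho : R[i]) : nat :=
  xget 0%N [set m | has_zero_order f rho m].

Definition nontrivial_zero (R : realType) (zeta : R[i] -> R[i])
    (rho : R[i]) : Prop :=
  [/\ 0 < complex.Re rho, complex.Re rho < 1 & zeta rho = 0].

Definition log_zeta_integral (R : realType) (zeta : R[i] -> R[i]) (T : R)
    : \bar R :=
  \int[lebesgue_measure]_(t in `[- T, T])
    (ln (cabs (zeta (2^-1 +i* t))) / (4^-1 + t ^+ 2))%:E.

Definition right_zeros (R : realType) (zeta : R[i] -> R[i]) (T : R)
    : set R[i] :=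
  [set rho | [/\ nontrivial_zero zeta rho,
                 2^-1 < complex.Re rho
               & - T <= complex.Im rho <= T]].

Definition right_zeros_sum (R : realType) (zeta : R[i] -> R[i]) (T : R) : R :=
  \sum_(rho \in right_zeros zeta T)
    (multiplicity zeta rho)%:R * ln (cabs (rho / (1 - rho))).

(* Main.v *)
(** Fix [a > 1/2] close to [1/2] and write [(s - 1) zeta(s) = H(s) prod (s - z)] over the zeros
    [z] with [Re z > a] and [|Im z| < T]. Replacing these zeros and the pole [1] by their mirror
    images [z'] and [2a - 1] in the line [Re s = a] turns [log zeta] into a function [g] which is
    holomorphic to the right of that line and has real part [log |zeta|] on it. The kernel
    [K(s) = 1/(s - (2a - 1)) - 1/(s - 1)] is real on the line and has only the pole [1] to its
    right, so moving the line to the right gives [2 pi Re g(1)], which is the sum over the zeros,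
    up to integrals of [g K] along the horizontal sides.

    On these sides [g] is [log zeta] plus explicit logarithms [log ((s - z') / (s - z))], whose
    contribution to the imaginary part is seen to vanish by pushing the sides to [i oo], because
    such a logarithm is purely imaginary on [Re s = a]. Since [|K| <= T^-2], it remains to bound
    the mean of [|log zeta|] on a horizontal segment by [O(log T)]: remove the [O(log T)] nearby
    zeros by Blaschke factors, apply Borel-Caratheodory to what is left, and use that [log |x|] is
    integrable; far to the right [log zeta] decays exponentially.

    Finally [a] tends to [1/2], by dominated convergence with [sum |log |t - gamma||]. *)

Require Import Defs.
From mathcomp Require Import all_boot all_order all_algebra.
From mathcomp Require Import all_classical all_reals all_analysis.
From mathcomp Require Import measurable_realfun.
From mathcomp Require Import ring lra.

Set Implicit Arguments.
Unset Strict Implicit.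
Unset Printing Implicit Defensive.

Import Order.TTheory GRing.Theory Num.Theory.
Import numFieldNormedType.Exports.

Local Open Scope classical_set_scope.
Local Open Scope ring_scope.
Local Open Scope complex_scope.

(** Every integral is the increment of a primitive on a convex domain, and the estimates come from
    the mean value inequality. Subtracting the constant [g(1)] from [g] cancels the pole of the
    kernel; the constant itself is integrated explicitly, and the angles left over at the corners of
    the contour complete its integral to [2 pi]. The line cannot be [Re s = 1/2] from the start,
    because zeros on it are singularities of [log zeta]; nor can the height be [T], because zeros
    with [|gamma| = T] count in full. Both are displaced by the same [e], to the abscissa [1/2 + e]
    and the height [T + e]. Only finitely many zeros are near, so for small [e] none meets the sides
    and the same zeros lie inside. The horizontal sides may still pass arbitrarily close to zeros,
    so only the mean of [log zeta] on them is controlled, by a primitive of [log |x + iy|] that is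
    bounded uniformly in [y]. The work takes place in [Re s > 1/4], where [(s - 1) zeta(s)] has a
    convergent series. Its value 1 at [s = 1] normalizes the sum over zeros, and the non-vanishing
    of zeta for [Re s >= 1] keeps the zeros strictly to the left of that line. *)

Arguments cabs : simpl never.

(** * Moduli and coordinates of complex numbers *)

Section Basics.
Context {R : realType}.
Local Notation C := R[i].
Local Notation Re := complex.Re.
Local Notation Im := complex.Im.

Lemma cabs0 : cabs (0 : C) = 0. Proof. exact: ComplexField.Normc.normc0. Qed.
Lemma cabs1 : cabs (1 : C) = 1. Proof. exact: ComplexField.Normc.normc1. Qed.
Lemma cabsE (z : C) : cabs z = Num.sqrt (Re z ^+ 2 + Im z ^+ 2).
Proof. by case: z. Qed.
Lemma cabs_ge0 (z : C) : 0 <= cabs z. Proof. by rewrite cabsE sqrtr_ge0. Qed.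
Lemma cabsM (x y : C) : cabs (x * y) = cabs x * cabs y.
Proof. exact: ComplexField.Normc.normcM. Qed.
Lemma cabsV (x : C) : cabs x^-1 = (cabs x)^-1.
Proof. exact: ComplexField.Normc.normcV. Qed.
Lemma cabsN (x : C) : cabs (- x) = cabs x.
Proof. by rewrite !cabsE; case: x => a b /=; rewrite !sqrrN. Qed.
Lemma cabsB (x y : C) : cabs (x - y) = cabs (y - x).
Proof. by rewrite -cabsN opprB. Qed.
Lemma cabsD (x y : C) : cabs (x + y) <= cabs x + cabs y.
Proof. exact: le_normcD. Qed.
Lemma cabs_eq0 (x : C) : (cabs x == 0) = (x == 0).
Proof.
by apply/eqP/eqP => [/ComplexField.Normc.eq0_normc|->] //; rewrite cabs0.
Qed.
Lemma cabs_gt0 (x : C) : (0 < cabs x) = (x != 0).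
Proof. by rewrite lt_neqAle cabs_ge0 andbT eq_sym cabs_eq0. Qed.
Lemma cabs_real (x : R) : cabs x%:C = `|x|.
Proof. by rewrite cabsE /= expr0n /= addr0 sqrtr_sqr. Qed.
Lemma cabsX (x : C) n : cabs (x ^+ n) = cabs x ^+ n.
Proof. by elim: n => [|n IH]; rewrite ?expr0 ?cabs1 // !exprS cabsM IH. Qed.
Lemma cabs_prod (I : Type) (r : seq I) (F : I -> C) :
  cabs (\prod_(i <- r) F i) = \prod_(i <- r) cabs (F i).
Proof. by elim/big_rec2: _ => [|i y x _ <-]; rewrite ?cabs1 ?cabsM. Qed.
Lemma cabs_sum (I : Type) (r : seq I) (F : I -> C) :
  cabs (\sum_(i <- r) F i) <= \sum_(i <- r) cabs (F i).
Proof.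
elim/big_rec2: _ => [|i y x _ H]; rewrite ?cabs0 //.
by apply: le_trans (cabsD _ _) _; rewrite lerD2l.
Qed.
Lemma cabs_leD (x y z : C) : cabs (x - z) <= cabs (x - y) + cabs (y - z).
Proof. by rewrite (_ : x - z = (x - y) + (y - z)) ?cabsD //; ring. Qed.
Lemma cabs_ge_sub (x y : C) : cabs x - cabs y <= cabs (x + y).
Proof. by rewrite lerBlDr -{1}(addrK y x) -(cabsN y) cabsD. Qed.
Lemma Re_le_cabs (z : C) : `|Re z| <= cabs z.
Proof. by rewrite cabsE -sqrtr_sqr ler_wsqrtr// lerDl sqr_ge0. Qed.
Lemma Im_le_cabs (z : C) : `|Im z| <= cabs z.
Proof. by rewrite cabsE -sqrtr_sqr ler_wsqrtr// lerDr sqr_ge0. Qed.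
Lemma cabs_conj (z : C) : cabs (conjc z) = cabs z.
Proof. by rewrite !cabsE; case: z => a b /=; rewrite sqrrN. Qed.
Lemma cabs_sqr (z : C) : cabs z ^+ 2 = Re z ^+ 2 + Im z ^+ 2.
Proof. by rewrite cabsE sqr_sqrtr ?addr_ge0 ?sqr_ge0. Qed.
Lemma cabs_mul_conj (z : C) : z * conjc z = (cabs z ^+ 2)%:C.
Proof. by rewrite cabs_sqr; case: z => a b; simpc; congr (_ +i* _); ring. Qed.

Lemma ReD (x y : C) : Re (x + y) = Re x + Re y. Proof. by case: x; case: y. Qed.
Lemma ImD (x y : C) : Im (x + y) = Im x + Im y. Proof. by case: x; case: y. Qed.
Lemma ReN (x : C) : Re (- x) = - Re x. Proof. by case: x. Qed.
Lemma ImN (x : C) : Im (- x) = - Im x. Proof. by case: x. Qed.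
Lemma ReB (x y : C) : Re (x - y) = Re x - Re y. Proof. by case: x; case: y. Qed.
Lemma ImB (x y : C) : Im (x - y) = Im x - Im y. Proof. by case: x; case: y. Qed.
Lemma ReM (x y : C) : Re (x * y) = Re x * Re y - Im x * Im y.
Proof. by case: x; case: y. Qed.
Lemma ImM (x y : C) : Im (x * y) = Re x * Im y + Im x * Re y.
Proof. by case: x; case: y. Qed.
Lemma Re_realM (a : R) (y : C) : Re (a%:C * y) = a * Re y.
Proof. by case: y => x y /=; rewrite mul0r subr0. Qed.
Lemma Im_realM (a : R) (y : C) : Im (a%:C * y) = a * Im y.
Proof. by case: y => x y /=; rewrite mul0r addr0. Qed.
Lemma complex_ext (x y : C) : Re x = Re y -> Im x = Im y -> x = y.
Proof. by case: x; case: y => a b c d /= -> ->. Qed.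

Lemma cabs_i : cabs ('i : C) = 1.
Proof. by rewrite cabsE /= expr0n/= expr1n add0r sqrtr1. Qed.
Lemma cabs_le_ReIm (z : C) : cabs z <= `|Re z| + `|Im z|.
Proof.
case: z => a b; rewrite (_ : a +i* b = a%:C + 'i * b%:C) ?(le_trans (cabsD _ _))//.
  rewrite cabsM !cabs_real ReD ImD ReM ImM /= !(mul0r, mulr0, mul1r, addr0, add0r).
  by rewrite cabs_i mul1r subr0.
by simpc.
Qed.
(** * Continuity and derivatives *)

(** The distance is an arbitrary function, so that the same rules serve for a complex variable, a
    real variable, pairs of both, and the increments of [Dg]. *)
Definition cont (X : Type) (d : X -> X -> R) (f : X -> C) (x : X) :=
  forall e : R, 0 < e -> exists2 k : R, 0 < k &
    forall y, d x y < k -> cabs (f y - f x) < e.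

Definition dC (x y : C) := cabs (y - x).
Definition dR (x y : R) := `|y - x|.
Definition ccont := cont dC.
Definition rcont := cont dR.

Lemma cont_cst X d (c : C) (x : X) : cont d (fun=> c) x.
Proof. by move=> e e0; exists 1 => // y _; rewrite subrr cabs0. Qed.

Lemma ccont_id (x : C) : ccont id x.
Proof. by move=> e e0; exists e. Qed.

Lemma rcont_real (x : R) : rcont (fun t => t%:C) x.
Proof. by move=> e e0; exists e => // y; rewrite -rmorphB cabs_real. Qed.

Lemma cont_ext X d (f g : X -> C) x : (forall y, f y = g y) ->
  cont d f x -> cont d g x.
Proof. by move=> /funext ->. Qed.

Lemma cont_near X d (f g : X -> C) x (k : R) : 0 < k -> d x x < k ->
  (forall y, d x y < k -> f y = g y) -> cont d f x -> cont d g x.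
Proof.
move=> k0 dk fg cf e e0; have [k1 k10 H] := cf e e0.
exists (Num.min k k1); first by rewrite lt_min k0.
move=> y; rewrite lt_min => /andP[y1 y2]; rewrite -fg// -fg//; exact: H.
Qed.

Lemma contD X d (f g : X -> C) x : cont d f x -> cont d g x ->
  cont d (fun y => f y + g y) x.
Proof.
move=> cf cg e e0; have e2 : 0 < e / 2 by lra.
have [k k0 fk] := cf _ e2; have [l l0 gl] := cg _ e2.
exists (Num.min k l); first by rewrite lt_min k0.
move=> y; rewrite lt_min => /andP[yk yl].
rewrite (_ : _ - _ = (f y - f x) + (g y - g x)); last by ring.
rewrite (splitr e); exact: le_lt_trans (cabsD _ _) (ltrD (fk _ yk) (gl _ yl)).
Qed.

Lemma contN X d (f : X -> C) x : cont d f x -> cont d (fun y => - f y) x.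
Proof.
move=> cf e e0; have [k k0 fk] := cf _ e0; exists k => // y /fk.
by rewrite -opprD cabsN.
Qed.

Lemma contB X d (f g : X -> C) x : cont d f x -> cont d g x ->
  cont d (fun y => f y - g y) x.
Proof. by move=> cf cg; apply: contD cf (contN cg). Qed.

Lemma contM X d (f g : X -> C) x : cont d f x -> cont d g x ->
  cont d (fun y => f y * g y) x.
Proof.
move=> cf cg e e0.
set A := cabs (f x) + 1; set B := cabs (g x) + 1.
have A0 : 0 < A by rewrite ltr_wpDl ?cabs_ge0.
have B0 : 0 < B by rewrite ltr_wpDl ?cabs_ge0.
have eA : 0 < e / 2 / A by rewrite !divr_gt0.
have eB : 0 < Num.min 1 (e / 2 / B) by rewrite lt_min ltr01 !divr_gt0.
have [k k0 fk] := cf _ eB; have [l l0 gl] := cg _ eA.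
exists (Num.min k l); first by rewrite lt_min k0.
move=> y; rewrite lt_min => /andP[yk yl].
rewrite (_ : _ - _ = (f y - f x) * g x + f y * (g y - g x)); last by ring.
have := fk _ yk; rewrite lt_min => /andP[h1 h2].
have fyA : cabs (f y) <= A.
  rewrite /A addrC -lerBlDr -[f y](subrK (f x)).
  rewrite lerBlDr; apply: le_trans (cabsD _ _) _; rewrite lerD2r; exact: ltW.
rewrite (splitr e); apply: le_lt_trans (cabsD _ _) _; rewrite !cabsM ltr_leD//.
  have := h2; rewrite ltr_pdivlMr// => h3; apply: le_lt_trans h3.
  by rewrite ler_wpM2l ?cabs_ge0// /B lerDl.
have := ltW (gl _ yl); rewrite ler_pdivlMr// => h3; apply: le_trans h3.
by rewrite mulrC ler_wpM2l ?cabs_ge0.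
Qed.

Lemma cont_nz X d (f : X -> C) x : cont d f x -> f x != 0 ->
  exists2 k : R, 0 < k & forall y, d x y < k ->
    cabs (f x) / 2 < cabs (f y).
Proof.
move=> cf fx0; have e0 : 0 < cabs (f x) / 2 by rewrite divr_gt0 ?cabs_gt0.
have [k k0 fk] := cf _ e0; exists k => // y /fk h.
have := cabs_ge_sub (f x) (f y - f x); rewrite [f x + _]addrC subrK; lra.
Qed.

Lemma contV X d (f : X -> C) x : cont d f x -> f x != 0 ->
  cont d (fun y => (f y)^-1) x.
Proof.
move=> cf fx0 e e0; have [k k0 fk] := cont_nz cf fx0.
have a0 : 0 < cabs (f x) by rewrite cabs_gt0.
have e1 : 0 < e * cabs (f x) ^+ 2 / 2 by rewrite divr_gt0// mulr_gt0 // exprn_gt0.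
have [l l0 fl] := cf _ e1.
exists (Num.min k l); first by rewrite lt_min k0.
move=> y; rewrite lt_min => /andP[yk yl].
have b0 : 0 < cabs (f y) by apply: lt_trans (fk _ yk); rewrite divr_gt0.
have fy0 : f y != 0 by rewrite -cabs_gt0.
rewrite (_ : _ - _ = - (f y - f x) * (f x * f y)^-1); last by field; rewrite fx0 fy0.
rewrite cabsM cabsV cabsN cabsM ltr_pdivrMr ?mulr_gt0//.
apply: lt_le_trans (fl _ yl) _.
rewrite expr2 -!mulrA !ler_pM2l//; exact: ltW (fk _ yk).
Qed.

Lemma cont_comp X d (F : C -> C) (f : X -> C) x :
  ccont F (f x) -> cont d f x -> cont d (fun y => F (f y)) x.
Proof.
move=> cF cf e e0; have [k k0 Fk] := cF _ e0; have [l l0 fl] := cf _ k0.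
by exists l => // y /fl; exact: Fk.
Qed.

Lemma cont_comp_R X d (F : R -> C) (f : X -> R) x :
  rcont F (f x) -> cont d (fun y => (f y)%:C) x -> cont d (fun y => F (f y)) x.
Proof.
move=> cF cf e e0; have [k k0 Fk] := cF _ e0; have [l l0 fl] := cf _ k0.
exists l => // y /fl; rewrite -rmorphB cabs_real; exact: Fk.
Qed.

Lemma contX X d (f : X -> C) x n : cont d f x -> cont d (fun y => f y ^+ n) x.
Proof.
move=> cf; elim: n => [|n IH].
  by apply: cont_ext (cont_cst d 1 x) => y; rewrite expr0.
by apply: cont_ext (contM cf IH) => y; rewrite exprS.
Qed.

(* The increment is measured through [inc], so that one notion covers
   functions of a complex and of a real variable. *)
Definition Dg (X : Type) (inc : X -> C) (f : X -> C) (x : X) (l : C) :=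
  exists q : X -> C, exists2 k : R, 0 < k &
    [/\ cont (fun x y => cabs (inc y - inc x)) q x, q x = l &
      forall y, cabs (inc y - inc x) < k ->
        f y = f x + (inc y - inc x) * q y].

Definition rinc (t : R) : C := t%:C.
Definition cD := Dg (@id C).
Definition rD := Dg rinc.

Lemma rcontP f x : cont (fun x y => cabs (rinc y - rinc x)) f x <-> rcont f x.
Proof.
rewrite /rcont; suff -> : (fun x y : R => cabs (rinc y - rinc x)) = dR by [].
by apply/funext => u; apply/funext => v; rewrite /rinc -rmorphB cabs_real.
Qed.

Section Dgen.
Variables (X : Type) (inc : X -> C).
Local Notation d := (fun x y => cabs (inc y - inc x)).
Local Notation D := (Dg inc).

Lemma dgxx (x : X) : d x x = 0. Proof. by rewrite /= subrr cabs0. Qed.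

Lemma Dg_cst (c : C) x : D (fun=> c) x 0.
Proof.
exists (fun=> 0), 1 => //; split; [exact: cont_cst|by []|] => y _.
by rewrite mulr0 addr0.
Qed.

Lemma Dg_inc x : D inc x 1.
Proof.
exists (fun=> 1), 1 => //; split; [exact: cont_cst|by []|] => y _; ring.
Qed.

Lemma cont_inc x : cont d inc x.
Proof. by move=> e e0; exists e. Qed.

Lemma Dg_cont f x l : D f x l -> cont d f x.
Proof.
move=> [q [k k0 [cq _ fq]]].
apply: (@cont_near _ _ (fun y => f x + (inc y - inc x) * q y) _ _ k) => //.
- by rewrite dgxx.
- by move=> y yk; rewrite [RHS]fq.
- apply: contD (cont_cst _ _ _) _; apply: contM => //.
  apply: contB (cont_inc _) (cont_cst _ _ _).
Qed.

Lemma Dg_near f g x l (k : R) : 0 < k -> (forall y, d x y < k -> f y = g y) ->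
  D f x l -> D g x l.
Proof.
move=> k0 fg [q [k1 k10 [cq ql fq]]].
exists q, (Num.min k k1); first by rewrite lt_min k0.
split => // y; rewrite lt_min => /andP[y1 y2].
by rewrite -fg// -fg ?dgxx// fq.
Qed.

Lemma Dg_ext f g x l : (forall y, f y = g y) -> D f x l -> D g x l.
Proof. by move=> /funext ->. Qed.

Lemma Dg_eq f x l m : l = m -> D f x l -> D f x m.
Proof. by move=> ->. Qed.

Lemma DgD f g x l m : D f x l -> D g x m -> D (fun y => f y + g y) x (l + m).
Proof.
move=> [q [k k0 [cq ql fq]]] [p [j j0 [cp pm gp]]].
exists (fun y => q y + p y), (Num.min k j); first by rewrite lt_min k0.
split; [exact: contD|by rewrite ql pm|] => y; rewrite lt_min => /andP[y1 y2].
by rewrite fq// gp//; ring.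
Qed.

Lemma DgM f g x l m : D f x l -> D g x m ->
  D (fun y => f y * g y) x (l * g x + f x * m).
Proof.
move=> Df Dg; have cg := Dg_cont Dg; move: Df Dg.
move=> [q [k k0 [cq ql fq]]] [p [j j0 [cp pm gp]]].
exists (fun y => q y * g y + f x * p y), (Num.min k j); first by rewrite lt_min k0.
split; [|by rewrite ql pm|] => [|y].
  by apply: contD; apply: contM => //; exact: cont_cst.
rewrite lt_min => /andP[y1 y2].
by rewrite (fq y)// (gp y)//; ring.
Qed.

Lemma DgN f x l : D f x l -> D (fun y => - f y) x (- l).
Proof.
move=> Df; apply: Dg_ext (Dg_eq _ (DgM (Dg_cst (-1) x) Df)) => [y|]; ring.
Qed.

Lemma DgB f g x l m : D f x l -> D g x m -> D (fun y => f y - g y) x (l - m).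
Proof. by move=> Df Dg; apply: DgD Df (DgN Dg). Qed.

Lemma DgZ c f x l : D f x l -> D (fun y => c * f y) x (c * l).
Proof. by move=> Df; apply: Dg_eq (DgM (Dg_cst c x) Df); ring. Qed.

Lemma DgV f x l : D f x l -> f x != 0 ->
  D (fun y => (f y)^-1) x (- l / f x ^+ 2).
Proof.
move=> Df fx0; have cf := Dg_cont Df; have [j j0 fj] := cont_nz cf fx0.
move: Df => [q [k k0 [cq ql fq]]].
exists (fun y => - q y * (f x * f y)^-1), (Num.min k j).
  by rewrite lt_min k0.
split.
- apply: contM (contN cq) (contV _ _); rewrite ?mulf_neq0//.
  by apply: contM cf; exact: cont_cst.
- by rewrite ql expr2.
move=> y; rewrite lt_min => /andP[y1 y2].
have fy0 : f y != 0.
  by rewrite -cabs_gt0; apply: lt_trans (fj _ y2); rewrite divr_gt0 // cabs_gt0.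
apply: (@mulfI _ (f x * f y)); first by rewrite mulf_neq0.
rewrite mulrDr [X in X = _](_ : _ = f x); last by field.
rewrite [f x * f y / f x](_ : _ = f y); last by field.
rewrite (_ : _ * (_ * _) = - ((inc y - inc x) * q y)); last by field; rewrite fy0.
by rewrite (fq y)//; ring.
Qed.

(** In Caratheodory's form of the derivative the slope of the composite is [Q (f y) * q y], so
    points with [f y = f x] need no separate treatment. *)
Lemma Dg_comp F f x l m : cD F (f x) m -> D f x l ->
  D (fun y => F (f y)) x (m * l).
Proof.
move=> [Q [K K0 [cQ Qm FQ]]] Df; have cf := Dg_cont Df.
move: Df => [q [k k0 [cq ql fq]]].
have [j j0 fj] := cf _ K0.
exists (fun y => Q (f y) * q y), (Num.min k j); first by rewrite lt_min k0.
split; [|by rewrite Qm ql|] => [|y].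
  by apply: contM => //; apply: cont_comp cf.
rewrite lt_min => /andP[y1 y2].
rewrite FQ; last exact: fj.
by rewrite {1}(fq y)//; ring.
Qed.

Lemma DgX f x l n : D f x l -> D (fun y => f y ^+ n) x (n%:R * f x ^+ n.-1 * l).
Proof.
move=> Df; elim: n => [|n IH].
  apply: Dg_ext (Dg_eq _ (Dg_cst 1 x)) => [y|]; rewrite ?expr0 //; ring.
apply: Dg_ext (Dg_eq _ (DgM Df IH)) => [y|]; rewrite -?exprS //=.
case: n {IH} => [|n] /=; first by rewrite !expr0; ring.
rewrite -[in RHS]natr1 exprS; ring.
Qed.

Lemma Dg_prod (I : Type) (r : seq I) (F : I -> X -> C) x :
  (forall i, exists l, D (F i) x l) ->
  exists l, D (fun y => \prod_(i <- r) F i y) x l.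
Proof.
move=> H; elim: r => [|i r [l IH]].
  by exists 0; apply: Dg_ext (Dg_cst 1 x) => y; rewrite big_nil.
have [m Hm] := H i; eexists; apply: Dg_ext (DgM Hm IH) => y /=.
by rewrite big_cons.
Qed.

Lemma Dg_sum (I : Type) (r : seq I) (F : I -> X -> C) (L : I -> C) x :
  (forall i, D (F i) x (L i)) ->
  D (fun y => \sum_(i <- r) F i y) x (\sum_(i <- r) L i).
Proof.
move=> H; elim: r => [|i r IH].
  by rewrite big_nil; apply: Dg_ext (Dg_cst 0 x) => y; rewrite big_nil.
by rewrite big_cons; apply: Dg_ext (DgD (H i) IH) => y; rewrite big_cons.
Qed.
End Dgen.

Lemma cD_id (x : C) : cD id x 1. Proof. exact: Dg_inc. Qed.

Lemma cD_cont f x l : cD f x l -> ccont f x.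
Proof. by move=> h; exact: (Dg_cont h). Qed.
Lemma rD_cont f x l : rD f x l -> rcont f x.
Proof. by move=> h; apply/rcontP; exact: (Dg_cont h). Qed.

Lemma cD_unique f x l m : cD f x l -> cD f x m -> l = m.
Proof.
move=> [q [k k0 [cq <- fq]]] [p [j j0 [cp <- gp]]].
apply/eqP; rewrite -subr_eq0 -cabs_eq0; apply/negPn/negP => nz.
have e0 : 0 < cabs (q x - p x) by rewrite lt_neqAle cabs_ge0 andbT eq_sym.
have [i i0 H] := contB cq cp e0.
have [h h0 hh] : exists2 h : R, 0 < h & h < Num.min i (Num.min k j).
  have m0 : 0 < Num.min i (Num.min k j) by rewrite !lt_min i0 k0.
  by exists (Num.min i (Num.min k j) / 2); [rewrite divr_gt0|rewrite ltr_pdivrMr// mulr_natr mulr2n ltrDl].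
move: hh; rewrite !lt_min => /and3P[hi hk hj].
have E : cabs (x + h%:C - x) = h by rewrite addrC addKr cabs_real gtr0_norm.
have := H (x + h%:C); rewrite /= E => /(_ hi).
have := gp (x + h%:C); have := fq (x + h%:C); rewrite /= E => -> // /(_ hj).
move=> /addrI /mulfI -> //; first by rewrite subrr sub0r cabsN ltxx.
by rewrite addrC addKr -cabs_gt0 cabs_real gtr0_norm.
Qed.

Lemma cD_line (F : C -> C) (a v : C) (t : R) m : cD F (a + t%:C * v) m ->
  rD (fun u => F (a + u%:C * v)) t (m * v).
Proof.
move=> DF; apply: (@Dg_comp _ rinc F (fun u : R => a + u%:C * v) _ _ _ DF).
apply: Dg_eq (DgD (Dg_cst _ a t) (DgM (Dg_inc rinc t) (Dg_cst _ v t))); ring.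
Qed.

Lemma rD_affine (a v : C) (t : R) : rD (fun u => a + u%:C * v) t v.
Proof.
apply: Dg_eq (DgD (Dg_cst _ a t) (DgM (Dg_inc rinc t) (Dg_cst _ v t))); ring.
Qed.

(** * Link with real derivatives *)

Lemma rcont_real_cont (f : R -> R) x :
  rcont (fun t => (f t)%:C) x <-> {for x, continuous f}.
Proof.
split.
- move=> cf; apply/cvgrPdist_lt => e e0; have [k k0 H] := cf _ e0.
  near=> y; rewrite distrC -cabs_real rmorphB; apply: H.
  rewrite /dR distrC; near: y.
  by apply: (@cvgr_dist_lt _ _ _ (nbhs x)) => //; exact: cvg_id.
- move=> /cvgrPdist_lt cf e e0; have /= := cf _ e0.
  rewrite near_simpl => /nbhs_ballP [k /= k0 H]; exists k => // y yk.
  rewrite -rmorphB cabs_real distrC; apply: H.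
  by rewrite /ball /= distrC.
Unshelve. all: by end_near. Qed.

Lemma rcont_Re f x : rcont f x -> rcont (fun t => (Re (f t))%:C) x.
Proof.
move=> cf e e0; have [k k0 H] := cf _ e0; exists k => // y /H.
by apply: le_lt_trans; rewrite -rmorphB cabs_real -ReB Re_le_cabs.
Qed.

Lemma rcont_Im f x : rcont f x -> rcont (fun t => (Im (f t))%:C) x.
Proof.
move=> cf e e0; have [k k0 H] := cf _ e0; exists k => // y /H.
by apply: le_lt_trans; rewrite -rmorphB cabs_real -ImB Im_le_cabs.
Qed.

(** The bridge over which the real derivatives of [ln], [atan], [expR] and the real mean value
    theorem enter. *)
Lemma rD_realP (f : R -> R) (x l : R) :
  rD (fun t => (f t)%:C) x l%:C <-> is_derive x 1 f l.
Proof.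
split.
- move=> [q [k k0 [cq ql fq]]].
  have H : (fun h => h^-1 *: (f (h *: 1 + x) - f x)) @ 0^' --> (l : R^o).
    have H2 : Re (q (h + x)) @[h --> (0:R)^'] --> (l : R^o).
      apply: cvg_within_filter.
      have -> : l = Re (q (0 + x)) by rewrite add0r ql.
      have /rcontP/rcont_Re/rcont_real_cont/= := cq.
      rewrite -{1}[x in {for x, _}]add0r => H.
      apply: (@cvg_comp _ _ _ (fun h => h + x) (fun h => Re (q h)) _ (nbhs (0 + x))) H.
      apply: cvgD; [exact: cvg_id|exact: cvg_cst].
    apply: cvg_trans H2; apply: near_eq_cvg; near=> h.
    have h0 : h != 0 by near: h; exact: nbhs_dnbhs_neq.
    have hk : `|h| < k by near: h; apply: dnbhs0_lt.
    have := fq (h + x); rewrite /rinc -rmorphB addrK cabs_real => /(_ hk).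
    move=> /(congr1 (@complex.Re R)); rewrite ReD Re_realM /= => E.
    by rewrite /GRing.scale /= mulr1 E addrAC subrr add0r mulrA mulVf// mul1r.
  apply: DeriveDef; [by apply/cvg_ex; exists l|].
  by rewrite /derive; apply/cvg_lim.
- move=> [df <-]; set l' := 'D_1 f x.
  pose q y : R := if y == x then l' else (f y - f x) / (y - x).
  exists (fun y => (q y)%:C), 1 => //; split.
  + apply/rcontP/rcont_real_cont.
    have /cvgrPdist_lt H : (fun h => h^-1 *: (f (h *: 1 + x) - f x)) @ 0^' --> (l' : R^o).
      exact: df.
    apply/cvgrPdist_lt => e e0; have := H e e0.
    rewrite near_simpl => /nbhs_ballP [k /= k0 K].
    apply/nbhs_ballP; exists k => //= y; rewrite /ball /= => yk.
    rewrite /q eqxx; case: eqP => [_|/eqP yx]; first by rewrite subrr normr0.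
    have := K (y - x); rewrite /ball /= sub0r normrN distrC => /(_ yk).
    rewrite subr_eq0 => /(_ yx).
    by rewrite /GRing.scale /= mulr1 subrK mulrC.
  + by rewrite /q eqxx.
  + move=> y _; rewrite /rinc /q; case: eqP => [->|/eqP yx].
      by rewrite subrr mul0r addr0.
    rewrite -rmorphB -rmorphM -rmorphD; congr (_%:C).
    by rewrite mulrC divfK ?subr_eq0// addrC subrK.
Unshelve. all: by end_near. Qed.

Lemma rD_Re f (x : R) l : rD f x l -> rD (fun t => (Re (f t))%:C) x (Re l)%:C.
Proof.
move=> [q [k k0 [cq ql fq]]]; exists (fun t => (Re (q t))%:C), k => //; split.
- by apply/rcontP/rcont_Re/rcontP.
- by rewrite ql.
- move=> y /fq ->; rewrite /rinc -rmorphB -rmorphM -rmorphD ReD Re_realM //.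
Qed.

Lemma rD_Im f (x : R) l : rD f x l -> rD (fun t => (Im (f t))%:C) x (Im l)%:C.
Proof.
move=> [q [k k0 [cq ql fq]]]; exists (fun t => (Im (q t))%:C), k => //; split.
- by apply/rcontP/rcont_Im/rcontP.
- by rewrite ql.
- move=> y /fq ->; rewrite /rinc -rmorphB -rmorphM -rmorphD ImD Im_realM //.
Qed.

Lemma rD_ReIm f (x : R) (l m : R) :
  rD (fun t => (Re (f t))%:C) x l%:C -> rD (fun t => (Im (f t))%:C) x m%:C ->
  rD f x (l +i* m).
Proof.
move=> H1 H2.
apply: Dg_ext (Dg_eq _ (DgD H1 (DgZ 'i H2))) => [y|].
  by case: (f y) => a b /=; simpc.
by simpc.
Qed.

Lemma rcont_ReIm f (x : R) :
  rcont (fun t => (Re (f t))%:C) x -> rcont (fun t => (Im (f t))%:C) x ->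
  rcont f x.
Proof.
move=> H1 H2; apply: cont_ext (contD H1 (contM (cont_cst _ 'i x) H2)) => y.
by case: (f y) => a b /=; simpc.
Qed.

Definition cont_on (a b : R) (f : R -> C) := forall t, a <= t <= b -> rcont f t.

Lemma rcont_within (f : R -> R) a b :
  cont_on a b (fun t => (f t)%:C) -> {within `[a, b], continuous f}.
Proof.
move=> H; apply: continuous_in_subspaceT => x.
by rewrite inE /= in_itv /= => /H /rcont_real_cont.
Qed.

(* Comparing [m] with the projection of [f] on the direction of its total
   increment. *)
Lemma mvt_le (f : R -> C) (f' : R -> C) (m m' : R -> R) a b : a <= b ->
  cont_on a b f -> cont_on a b (fun t => (m t)%:C) ->
  (forall t, a < t < b -> rD f t (f' t)) ->
  (forall t, a < t < b -> is_derive t 1 m (m' t)) ->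
  (forall t, a < t < b -> cabs (f' t) <= m' t) ->
  cabs (f b - f a) <= m b - m a.
Proof.
rewrite le_eqVlt => /predU1P[->|ab]; first by rewrite !subrr cabs0.
move=> cf cm Df Dm le.
have [->|z0] := eqVneq (f b - f a) 0.
  rewrite cabs0 subr_ge0.
  have Dm' t : t \in `]a, b[ -> is_derive t 1 m (m' t).
    by rewrite in_itv /=; exact: Dm.
  have [c cab E] := MVT ab Dm' (rcont_within cm).
  rewrite -subr_ge0 E mulr_ge0 ?subr_ge0 ?(ltW ab)//.
  by apply: le_trans (le c _); rewrite ?cabs_ge0//; move: cab; rewrite in_itv.
set z := f b - f a in z0 *.
pose u := conjc z.
pose g t := cabs z * m t - Re (u * f t).
have Dg t : a < t < b -> is_derive t 1 g (cabs z * m' t - Re (u * f' t)).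
  move=> tab; apply/rD_realP.
  have H1 : rD (fun t => (Re (u * f t))%:C) t (Re (u * f' t))%:C.
    by apply: rD_Re; apply: DgZ; exact: Df.
  have H2 : rD (fun t => (cabs z)%:C * (m t)%:C) t ((cabs z)%:C * (m' t)%:C).
    by apply: DgZ; apply/rD_realP; exact: Dm.
  by apply: Dg_ext (Dg_eq _ (DgB H2 H1)) => [y|]; rewrite /g -?rmorphM -?rmorphB.
have cg : {within `[a, b], continuous g}.
  apply: rcont_within => t tab.
  have H1 : rcont (fun t => (Re (u * f t))%:C) t.
    by apply: rcont_Re; apply: contM (cont_cst _ _ _) (cf _ tab).
  apply: cont_ext (contB (contM (cont_cst _ (cabs z)%:C t) (cm _ tab)) H1) => y.
  by rewrite /g -rmorphM -rmorphB.
have Dg' t : t \in `]a, b[ -> is_derive t 1 g (cabs z * m' t - Re (u * f' t)).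
  by rewrite in_itv /=; exact: Dg.
have [c] := MVT ab Dg' cg; rewrite in_itv /= => cab E.
have : 0 <= g b - g a.
  rewrite E mulr_ge0 ?subr_ge0 ?(ltW ab)//.
  apply: le_trans (_ : cabs (u * f' c) <= _).
    exact: le_trans (ler_norm _) (Re_le_cabs _).
  by rewrite cabsM cabs_conj ler_wpM2l ?cabs_ge0 ?le.
have zp : 0 < cabs z by rewrite cabs_gt0.
rewrite /g (_ : _ - _ = cabs z * (m b - m a) - Re (u * z)); last first.
  have -> : Re (u * z) = Re (u * f b) - Re (u * f a) by rewrite -ReB -mulrBr.
  by ring.
have -> : Re (u * z) = cabs z * cabs z.
  by rewrite mulrC cabs_mul_conj /= expr2.
by rewrite -mulrBr pmulr_rge0// subr_ge0.
Qed.

Lemma mvt_cst (f f' : R -> C) (M : R) a b : a <= b ->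
  cont_on a b f -> (forall t, a < t < b -> rD f t (f' t)) ->
  (forall t, a < t < b -> cabs (f' t) <= M) ->
  cabs (f b - f a) <= M * (b - a).
Proof.
move=> ab cf Df le; rewrite mulrBr.
apply: (mvt_le (m := fun t => M * t) (m' := fun=> M) ab cf _ Df) => //.
- move=> t _; apply: cont_ext (contM (cont_cst _ M%:C t) (rcont_real t)) => y.
  by rewrite rmorphM.
- move=> t _; apply/rD_realP.
  apply: Dg_ext (Dg_eq _ (DgZ M%:C (Dg_inc rinc t))) => [y|]; rewrite ?mulr1//.
  by rewrite rmorphM.
Qed.

Lemma rD0_const (f : R -> C) a b : a <= b ->
  cont_on a b f -> (forall t, a < t < b -> rD f t 0) -> f b = f a.
Proof.
move=> ab cf Df; apply/eqP; rewrite -subr_eq0 -cabs_eq0 eq_le cabs_ge0 andbT.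
rewrite -(mul0r (b - a)); apply: (@mvt_cst f (fun=> 0)) => // t _.
by rewrite cabs0.
Qed.

End Basics.

(** * The complex exponential; integrals over [0, 1] as increments of primitives *)

Section Integrals.
Context {R : realType}.
Local Notation C := R[i].
Local Notation Re := complex.Re.
Local Notation Im := complex.Im.

Lemma Dg_comp_real X (inc : X -> C) (f : R -> R) (g : X -> R) x l m :
  is_derive (g x) 1 f l -> Dg inc (fun y => (g y)%:C) x m ->
  Dg inc (fun y => (f (g y))%:C) x (l%:C * m).
Proof.
move=> /rD_realP [Q [K K0 [cQ Qm FQ]]] Df; have cf := Dg_cont Df.
move: Df => [q [k k0 [cq ql fq]]].
have [j j0 fj] := cf _ K0.
exists (fun y => Q (g y) * q y), (Num.min k j); first by rewrite lt_min k0.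
split; [|by rewrite Qm ql|] => [|y].
  by apply: contM => //; apply: cont_comp_R cf; apply/rcontP.
rewrite lt_min => /andP[y1 y2].
rewrite FQ; last exact: fj.
by rewrite /rinc {1}(fq y)//; ring.
Qed.

Lemma rD_scale (x t : R) : rD (fun t => (t * x)%:C) t x%:C.
Proof.
apply: Dg_ext (Dg_eq _ (DgM (Dg_inc rinc t) (Dg_cst _ x%:C t))) => [y|].
  by rewrite rmorphM.
by ring.
Qed.

Lemma cexp0 : cexp (0 : C) = 1.
Proof. by rewrite /cexp /= expR0 cos0 sin0; simpc. Qed.

Lemma cexpD (x y : C) : cexp (x + y) = cexp x * cexp y.
Proof.
case: x => a b; case: y => c d; rewrite /cexp /= expRD cosD sinD.
by simpc; congr (_ +i* _); ring.
Qed.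

Lemma cexpN (x : C) : cexp (- x) * cexp x = 1.
Proof. by rewrite -cexpD addNr cexp0. Qed.

Lemma cexp_neq0 (x : C) : cexp x != 0.
Proof.
by apply/eqP => e; have := cexpN x; rewrite e mulr0 => /esym/eqP; rewrite oner_eq0.
Qed.

Lemma cabs_cexp (x : C) : cabs (cexp x) = expR (Re x).
Proof.
rewrite /cexp cabsM cabs_real gtr0_norm ?expR_gt0//.
by rewrite cabsE /= cos2Dsin2 sqrtr1 mulr1.
Qed.

Lemma rD_cexp_line (h : C) (t : R) :
  rD (fun t => cexp (t%:C * h)) t (h * cexp (t%:C * h)).
Proof.
case: h => x y.
have E (u : R) : cexp (u%:C * (x +i* y)) =
    (expR (u * x))%:C * ((cos (u * y))%:C + 'i * (sin (u * y))%:C).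
  by rewrite /cexp ReM ImM /= !mul0r subr0 addr0; simpc.
have De := Dg_comp_real (is_derive_expR _) (rD_scale x t).
have Dc := Dg_comp_real (is_derive_cos _) (rD_scale y t).
have Ds := Dg_comp_real (is_derive_sin _) (rD_scale y t).
apply: Dg_ext (Dg_eq _ (DgM De (DgD Dc (DgZ 'i Ds)))) => [u|]; first by rewrite E.
rewrite E (_ : x +i* y = x%:C + 'i * y%:C); last by simpc.
have i2 : ('i : C) * 'i = -1 by rewrite -expr2 sqrCi.
transitivity ((expR (t * x))%:C * (x%:C * ((cos (t * y))%:C + 'i * (sin (t * y))%:C)
  + y%:C * ('i * (cos (t * y))%:C - (sin (t * y))%:C))); first by ring.
transitivity ((expR (t * x))%:C * (x%:C * ((cos (t * y))%:C + 'i * (sin (t * y))%:C)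
  + y%:C * ('i * (cos (t * y))%:C + ('i * 'i) * (sin (t * y))%:C))); last by ring.
by rewrite i2; ring.
Qed.

Lemma cexp_sub1 (h : C) : cabs (cexp h - 1) <= cabs h * expR (cabs h).
Proof.
have -> : cexp h = cexp (1%:C * h) by rewrite mul1r.
have -> : (1 : C) = cexp (0%:C * h) by rewrite mul0r cexp0.
have := @mvt_cst R (fun t => cexp (t%:C * h)) (fun t => h * cexp (t%:C * h))
  (cabs h * expR (cabs h)) 0 1 ler01.
rewrite subr0 mulr1; apply.
- by move=> t _; exact: rD_cont (rD_cexp_line h t).
- by move=> t _; exact: rD_cexp_line.
- move=> t /andP[t0 t1]; rewrite cabsM ler_wpM2l ?cabs_ge0//.
  rewrite cabs_cexp Re_realM ler_expR.
  apply: le_trans (ler_norm _) _; rewrite normrM gtr0_norm//.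
  by apply: le_trans (Re_le_cabs h); apply: ler_piMl => //; exact: ltW.
Qed.

(** The derivative of [exp(th) - th] in [t] is [h (exp(th) - 1)], which the first-order bound
    controls. The resulting quadratic error is what differentiates [cexp]. *)
Lemma cexp_sub1h (h : C) : cabs (cexp h - 1 - h) <= cabs h * (cabs h * expR (cabs h)).
Proof.
have := @mvt_cst R (fun t => cexp (t%:C * h) - t%:C * h)
  (fun t => h * cexp (t%:C * h) - h)
  (cabs h * (cabs h * expR (cabs h))) 0 1 ler01.
rewrite subr0 mulr1 mul1r mul0r cexp0 subr0.
rewrite (_ : cexp h - h - 1 = cexp h - 1 - h); last by ring.
have H t : rD (fun t => cexp (t%:C * h) - t%:C * h) t (h * cexp (t%:C * h) - h).
  apply: DgB (rD_cexp_line h t) _; apply: Dg_ext (rD_affine 0 h t) => u.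
  by rewrite add0r.
apply.
- by move=> t _; exact: rD_cont (H t).
- by move=> t _; exact: H.
- move=> t /andP[t0 t1].
  rewrite (_ : _ - h = h * (cexp (t%:C * h) - 1)); last by ring.
  rewrite cabsM ler_wpM2l ?cabs_ge0//; apply: le_trans (cexp_sub1 _) _.
  have : cabs (t%:C * h) <= cabs h.
    by rewrite cabsM cabs_real gtr0_norm// ler_piMl ?cabs_ge0// ltW.
  by move=> th; rewrite ler_pM ?cabs_ge0 ?expR_ge0// ler_expR.
Qed.

Lemma cD_cexp (s : C) : cD (@cexp R) s (cexp s).
Proof.
pose q z := if z == s then cexp s else (cexp z - cexp s) / (z - s).
exists q, 1 => //; split.
- move=> e e0.
  pose A := cabs (cexp s) * expR 1.
  have A0 : 0 < A by rewrite mulr_gt0 ?expR_gt0// cabs_gt0 cexp_neq0.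
  exists (Num.min 1 (e / A)); first by rewrite lt_min ltr01 divr_gt0.
  move=> y; rewrite lt_min => /andP[y1 ye].
  rewrite /q eqxx; have [_|ys] := eqVneq y s; first by rewrite subrr cabs0.
  set h := y - s in y1 ye *.
  have h0 : h != 0 by rewrite subr_eq0.
  have -> : cexp y = cexp s * cexp h by rewrite -cexpD /h addrC subrK.
  rewrite (_ : _ - _ = cexp s * ((cexp h - 1 - h) / h)); last by field.
  rewrite cabsM cabsM cabsV.
  apply: le_lt_trans (_ : cabs (cexp s) * (cabs h * expR (cabs h)) < _).
    rewrite ler_wpM2l ?cabs_ge0// ler_pdivrMr ?cabs_gt0// mulrC.
    exact: cexp_sub1h.
  apply: le_lt_trans (_ : cabs h * A < _); last by rewrite -ltr_pdivlMr.
  rewrite /A mulrCA ler_wpM2l ?cabs_ge0// ler_wpM2l ?cabs_ge0// ler_expR; exact: ltW.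
- by rewrite /q eqxx.
- move=> y _; rewrite /q; case: eqP => [->|/eqP ys]; first by rewrite subrr mul0r addr0.
  by rewrite mulrC divfK ?subr_eq0// addrC subrK.
Qed.

Lemma Dg_cexp X (inc f : X -> C) x l : Dg inc f x l ->
  Dg inc (fun y => cexp (f y)) x (cexp (f x) * l).
Proof. by move=> H; apply: Dg_comp H; exact: cD_cexp. Qed.

Lemma prim_ex_real (f : R -> R) (a b : R) : a <= b -> (forall x, {for x, continuous f}) ->
  exists F : R -> R, forall x : R, a <= x <= b -> is_derive x 1 F (f x).
Proof.
move=> ab cf.
(* Starting at [a - 1] makes every point of [[a, b]], endpoints included, interior to
   [[a - 1, b + 1]], where the fundamental theorem applies. *)
exists (fun x => (\int[lebesgue_measure]_(t in [set` `[a - 1, x]]) (f t))%R).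
move=> x /andP[ax xb].
have xu : x < b + 1 by lra.
have ax1 : a - 1 < x by lra.
have int : lebesgue_measure.-integrable `[a - 1, b + 1] (EFin \o f).
  apply: continuous_compact_integrable; first exact: segment_compact.
  by apply: continuous_subspaceT => y; exact: cf.
have [d1 d2] := @continuous_FTC1_closed R f (a - 1) x (b + 1) xu int ax1 (cf x).
split; first exact: d1.
by rewrite -d2 derive1E.
Qed.

Definition is_prim (f F : R -> C) :=
  cont_on 0 1 F /\ forall t, 0 < t < 1 -> rD F t (f t).

(** Two primitives differ by a constant, so the value does not depend on the choice; the default 0
    is reached only if there is no primitive. Linearity and the fundamental theorem then hold almost
    by definition. *)
Definition cint (f : R -> C) : C :=
  xget 0 [set v | exists2 F, is_prim f F & v = F 1 - F 0].

(** The retraction of the line onto [[0, 1]]: composing with it extends a function continuous on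
    [[0, 1]] to the whole line, as [prim_ex_real] requires. *)
Definition clamp (t : R) : R := if t <= 0 then 0 else if 1 <= t then 1 else t.

Lemma clamp_itv (t : R) : 0 <= clamp t <= 1.
Proof. by rewrite /clamp; case: ifPn => ?; [lra|case: ifPn => ?; lra]. Qed.

Lemma clamp_id (t : R) : 0 <= t <= 1 -> clamp t = t.
Proof. by rewrite /clamp; case: ifPn => ?; [lra|case: ifPn => ?; lra]. Qed.

Lemma clamp_lip (s t : R) : `|clamp t - clamp s| <= `|t - s|.
Proof.
rewrite /clamp ler_norml; have := ler_norm (t - s); have := ler_norm (s - t).
rewrite [`|s - t|]distrC.
by case: ifPn => ?; case: ifPn => ?; try case: ifPn => ?; try case: ifPn => ?; lra.
Qed.

Lemma cint_ex f : cont_on 0 1 f -> exists F, is_prim f F.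
Proof.
move=> cf.
have cc t : rcont (fun t => f (clamp t)) t.
  move=> e e0; have [k k0 H] := cf _ (clamp_itv t) _ e0.
  by exists k => // y yk; apply: H; apply: le_lt_trans yk; exact: clamp_lip.
have [F1 D1] := prim_ex_real ler01 (fun x => (rcont_real_cont _ x).1 (rcont_Re (cc x))).
have [F2 D2] := prim_ex_real ler01 (fun x => (rcont_real_cont _ x).1 (rcont_Im (cc x))).
pose F t := F1 t +i* F2 t.
have D t : 0 <= t <= 1 -> rD F t (f t).
  move=> t01; apply: Dg_eq (_ : f (clamp t) = _) _; first by rewrite clamp_id.
  rewrite (_ : f (clamp t) = Re (f (clamp t)) +i* Im (f (clamp t))); last by case: (f _).
  by apply: rD_ReIm; apply/rD_realP; [exact: D1|exact: D2].
exists F; split=> [t /D /rD_cont//|t /andP[t0 t1]]; apply: D; lra.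
Qed.

Lemma cintP f F : is_prim f F -> cint f = F 1 - F 0.
Proof.
move=> PF; rewrite /cint; case: xgetP => [v -> [G [cG DG] ->]|/(_ (F 1 - F 0))]; last first.
  by case; exists F.
case: PF => cF DF.
have /eqP : F 1 - G 1 = F 0 - G 0.
  apply: (@rD0_const R (fun t => F t - G t) 0 1 ler01).
    by move=> t t01; exact: contB (cF _ t01) (cG _ t01).
  move=> t t01; apply: Dg_eq (DgB (DF _ t01) (DG _ t01)); exact: subrr.
by rewrite subr_eq => /eqP ->; ring.
Qed.

Lemma is_primD f g F G : is_prim f F -> is_prim g G ->
  is_prim (fun t => f t + g t) (fun t => F t + G t).
Proof.
move=> [cF DF] [cG DG]; split => t t01.
  exact: contD (cF _ t01) (cG _ t01).
exact: DgD (DF _ t01) (DG _ t01).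
Qed.

Lemma is_primZ c f F : is_prim f F -> is_prim (fun t => c * f t) (fun t => c * F t).
Proof.
move=> [cF DF]; split => t t01; first exact: contM (cont_cst _ _ _) (cF _ t01).
exact: DgZ (DF _ t01).
Qed.

Lemma cintD f g : cont_on 0 1 f -> cont_on 0 1 g ->
  cint (fun t => f t + g t) = cint f + cint g.
Proof.
move=> /cint_ex[F PF] /cint_ex[G PG].
by rewrite (cintP PF) (cintP PG) (cintP (is_primD PF PG)); ring.
Qed.

Lemma cintZ c f : cont_on 0 1 f -> cint (fun t => c * f t) = c * cint f.
Proof.
by move=> /cint_ex[F PF]; rewrite (cintP PF) (cintP (is_primZ c PF)); ring.
Qed.

Lemma cintB f g : cont_on 0 1 f -> cont_on 0 1 g ->
  cint (fun t => f t - g t) = cint f - cint g.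
Proof.
move=> cf cg.
have cNg : cont_on 0 1 (fun t => -1 * g t).
  by move=> t t01; exact: contM (cont_cst _ _ _) (cg _ t01).
rewrite -mulN1r -(cintZ _ cg) -cintD//.
by congr cint; apply/funext => t; rewrite mulN1r.
Qed.

Lemma cint_cst c : cint (fun=> c) = c.
Proof.
rewrite (@cintP _ (fun t => 0 + t%:C * c)) ?mul1r ?mul0r ?addr0 ?add0r ?subr0//.
split=> t _; [exact: rD_cont (rD_affine 0 c t)|exact: rD_affine].
Qed.

Lemma cint_le (f : R -> C) (M : R) : cont_on 0 1 f -> (forall t : R, 0 <= t <= 1 -> cabs (f t) <= M) ->
  cabs (cint f) <= M.
Proof.
move=> /cint_ex[F PF] le; rewrite (cintP PF); case: PF => cF DF.
have := @mvt_cst R F f M 0 1 ler01 cF DF; rewrite subr0 mulr1; apply.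
by move=> t /andP[t0 t1]; apply: le; lra.
Qed.

Lemma cint_ext (f g : R -> C) : (forall t : R, 0 <= t <= 1 -> f t = g t) -> cont_on 0 1 f ->
  cint f = cint g.
Proof.
move=> fg /cint_ex[F PF]; rewrite (cintP PF); apply/esym/cintP.
case: PF => cF DF; split => // t t01; rewrite -fg; first exact: DF.
by case/andP: t01 => ? ?; apply/andP; split; apply: ltW.
Qed.

(** Compactness of an interval as an induction principle: the supremum of the points reachable from
    [a] is reachable and cannot be smaller than [b]. It yields boundedness, uniform continuity in a
    parameter, the identity theorem and the finiteness of zeros. *)
Lemma cousin (P : R -> R -> Prop) (a b : R) : a <= b ->
  (forall x y z, P x y -> P y z -> P x z) ->
  (forall x, a <= x <= b -> exists2 k : R, 0 < k &
    forall u v, a <= u -> u <= x -> x <= v -> v <= b -> x - k < u -> v < x + k -> P u v) ->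
  P a b.
Proof.
move=> ab tr loc.
pose A := [set y | [/\ a <= y, y <= b & P a y]].
have Aa : A a.
  have [|k k0 H] := loc a; first by rewrite lexx.
  by split => //; apply: H => //; lra.
have ubA : ubound A b by move=> y [].
have hA : has_sup A by split; [exists a|exists b].
set s := sup A.
have sa : a <= s by apply: (ub_le_sup _ Aa); exists b.
have sb : s <= b by apply: ge_sup => //; exists a.
have [|k k0 H] := loc s; first by rewrite sa.
have [y [ay yb Py] ys] := sup_adherent k0 hA.
have ys' : y <= s by apply: ub_le_sup; [exists b|].
have Ps : P a s by apply: (tr _ y) => //; apply: H => //; rewrite -/s; lra.
have [sb'|bs] := ltP s b; last by have <- : s = b by lra.
have [v [vs vb vk]] : exists v, [/\ s < v, v <= b & v < s + k].
  have [h|h] := leP (s + k / 2) b; first by exists (s + k / 2); split; lra.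
  by exists b; split; lra.
suff : A v by move=> /(ub_le_sup (ex_intro _ b ubA)); rewrite -/s; lra.
split; [lra|by []|apply: (tr _ s) => //; apply: H => //; lra].
Qed.

Lemma cont_on_bounded (f : R -> C) (a b : R) : a <= b -> cont_on a b f ->
  exists M : R, forall t : R, a <= t <= b -> cabs (f t) <= M.
Proof.
move=> ab cf.
apply: (@cousin (fun u v => exists M : R, forall t, u <= t <= v -> cabs (f t) <= M)) => //.
- move=> x y z [M HM] [N HN]; exists (Num.max M N) => t /andP[t1 t2].
  rewrite le_max; have [ty|ty] := leP t y; first by rewrite HM ?t1.
  by rewrite HN ?orbT// t2 ltW.
- move=> x xab; have [k k0 H] := cf x xab 1 ltr01; exists k => // u v au ux xv vb h1 h2.
  exists (cabs (f x) + 1) => t /andP[t1 t2].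
  rewrite addrC -lerBlDr; apply: le_trans (_ : cabs (f t - f x) <= _).
    by have := cabs_ge_sub (f t) (- f x); rewrite cabsN.
  by apply/ltW/H; rewrite /dR ltr_norml; lra.
Qed.

(** Joint continuity at the points [(x, w)] becomes uniform in [x] by [cousin], and a uniformly
    small integrand has a small integral. *)
Lemma cint_cont (G : R -> C -> C) (w : C) (r : R) : 0 < r ->
  (forall w', cabs (w' - w) < r -> cont_on 0 1 (G^~ w')) ->
  (forall x, 0 <= x <= 1 -> forall e : R, 0 < e -> exists2 k : R, 0 < k &
     forall x' w', `|x' - x| < k -> cabs (w' - w) < k -> cabs (G x' w' - G x w) < e) ->
  ccont (fun w' => cint (G^~ w')) w.
Proof.
move=> r0 cG Hj e e0.
have e2 : 0 < e / 2 by lra.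
have [k k0 Hk] : exists2 k : R, 0 < k & forall x, 0 <= x <= 1 ->
    forall w', cabs (w' - w) < k -> cabs (G x w' - G x w) <= e / 2.
  apply: (@cousin (fun u v => exists2 k : R, 0 < k & forall x, u <= x <= v ->
    forall w', cabs (w' - w) < k -> cabs (G x w' - G x w) <= e / 2)) => //.
  - move=> x y z [k k0 H] [l l0 H']; exists (Num.min k l); first by rewrite lt_min k0.
    move=> t /andP[t1 t2] w'; rewrite lt_min => /andP[h1 h2].
    have [ty|ty] := leP t y; first by apply: H => //; rewrite t1.
    by apply: H' => //; rewrite t2 ltW.
  - have e4 : 0 < e / 4 by lra.
    move=> x x01; have [k k0 H] := Hj x x01 _ e4; exists k => // u v ? ? ? ? h1 h2.
    exists k => // t /andP[t1 t2] w' w'k.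
    apply: le_trans (cabs_leD _ (G x w) _) _.
    have tx : `|t - x| < k by rewrite ltr_norml; lra.
    have := H t w' tx w'k; have := H t w tx; rewrite subrr cabs0 => /(_ k0).
    rewrite [cabs (G x w - _)]cabsB; lra.
exists (Num.min k r); first by rewrite lt_min k0.
move=> w'; rewrite /dC lt_min => /andP[h1 h2].
rewrite -cintB; [|exact: cG|by apply: cG; rewrite subrr cabs0].
apply: le_lt_trans (_ : e / 2 < e); last by lra.
apply: cint_le => [t t01|t t01]; last exact: Hk.
apply: contB; first exact: cG.
by apply: cG => //; rewrite subrr cabs0.
Qed.

(** * Integrals along segments *)

Definition seg_in (U : set C) (a b : C) :=
  forall t : R, 0 <= t <= 1 -> U (a + t%:C * (b - a)).

Definition Sg (f : C -> C) (a b : C) : C :=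
  (b - a) * cint (fun t => f (a + t%:C * (b - a))).

Lemma seg_cont (f : C -> C) a b (U : set C) : seg_in U a b ->
  (forall z, U z -> ccont f z) -> cont_on 0 1 (fun t => f (a + t%:C * (b - a))).
Proof.
move=> ab cf t t01; apply: cont_comp; first exact/cf/ab.
exact: rD_cont (rD_affine a (b - a) t).
Qed.

Section Seg.
Variables (f : C -> C) (U : set C).
Hypothesis cf : forall z, U z -> ccont f z.

Lemma Sg_prim F a b : seg_in U a b -> (forall z, U z -> cD F z (f z)) ->
  Sg f a b = F b - F a.
Proof.
move=> ab DF; rewrite /Sg -cintZ; last exact: seg_cont ab cf.
rewrite (@cintP _ (fun t => F (a + t%:C * (b - a)))).
  by rewrite mul1r mul0r addr0 [a + _]addrC subrK.
have H t : 0 <= t <= 1 -> rD (fun t => F (a + t%:C * (b - a))) t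
    ((b - a) * f (a + t%:C * (b - a))).
  by move=> t01; rewrite mulrC; apply: cD_line; exact/DF/ab.
split => [t /H/rD_cont//|t /andP[t0 t1]]; apply: H; lra.
Qed.

Lemma Sg_le a b (M : R) : seg_in U a b -> (forall z, U z -> cabs (f z) <= M) ->
  cabs (Sg f a b) <= M * cabs (b - a).
Proof.
move=> ab le; rewrite /Sg cabsM mulrC ler_wpM2r ?cabs_ge0//.
by apply: cint_le => [|t t01]; [exact: seg_cont ab cf|exact/le/ab].
Qed.

(** One primitive along the whole segment serves for all its oriented subsegments. Splitting and
    reversal of segments are then identities between increments. *)
Lemma Sg_prim_line a b (u v : R) F : 0 <= u <= 1 -> 0 <= v <= 1 -> 
  is_prim (fun t => f (a + t%:C * (b - a))) F -> seg_in U a b ->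
  Sg f (a + u%:C * (b - a)) (a + v%:C * (b - a)) = (b - a) * (F v - F u).
Proof.
move=> u01 v01 [cF DF] ab.
have vu01 t : 0 <= t <= 1 -> 0 <= u + t * (v - u) <= 1.
  by move=> /andP[t0 t1]; nra.
have E (t : R) : a + u%:C * (b - a) +
     t%:C * (a + v%:C * (b - a) - (a + u%:C * (b - a))) =
     a + (u + t * (v - u))%:C * (b - a).
  by rewrite rmorphD rmorphM rmorphB; ring.
have -> : Sg f (a + u%:C * (b - a)) (a + v%:C * (b - a)) =
   (b - a) * cint (fun t => (v - u)%:C * f (a + (u + t * (v - u))%:C * (b - a))).
  rewrite cintZ; last first.
    move=> t t01; rewrite (_ : (fun _ => _) = (fun t => f (a + u%:C * (b - a) +
     t%:C * (a + v%:C * (b - a) - (a + u%:C * (b - a)))))); last first.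
      by apply/funext => s; rewrite E.
    by apply: (seg_cont _ cf t01) => s s01; rewrite E; apply: ab; exact: vu01.
  rewrite mulrA; congr (_ * _); first by rewrite rmorphB; ring.
  by congr cint; apply/funext => t; rewrite E.
congr (_ * _).
have L t : rcont (fun t => (u + t * (v - u))%:C) t.
  apply: cont_ext (rD_cont (rD_affine u%:C (v - u)%:C t)) => y.
  by rewrite -rmorphM -rmorphD.
rewrite (@cintP _ (fun t => F (u + t * (v - u)))).
  by rewrite mul1r mul0r addr0 [u + _]addrC subrK.
(* If [u = v] this point may be an endpoint of [[0, 1]], where [F] need not be differentiable.
   Otherwise interior points of the subsegment lie in the open interval. *)
have [uv|uv] := eqVneq u v.
  rewrite -uv subrr; split=> t _.
    by apply: cont_ext (cont_cst dR (F u) t) => y; rewrite mulr0 addr0.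
  rewrite rmorph0 mul0r; apply: Dg_ext (Dg_cst rinc (F u) t) => y.
  by rewrite mulr0 addr0.
split=> t t01.
  by apply: cont_comp_R (L t); apply: cF; exact: vu01.
have ut : 0 < u + t * (v - u) < 1.
  by case: (ltgtP u v) uv => // uv _; move: t01 u01 v01 => /andP[? ?] /andP[? ?] /andP[? ?]; nra.
have [q [k k0 [cq ql fq]]] := DF _ ut.
exists (fun s => q (u + s * (v - u)) * (v - u)%:C).
have [k1 k10 H1] := L t _ k0.
exists k1 => //; split.
- apply: contM (cont_cst _ _ _); apply/rcontP/cont_comp_R; last exact: L.
  exact/rcontP.
- by rewrite ql mulrC.
- move=> y; rewrite /rinc -rmorphB cabs_real => yk.
  rewrite fq; last by rewrite /rinc; exact: H1.
  by rewrite /rinc !rmorphD !rmorphM !rmorphB /=; ring.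
Qed.

Lemma Sg_split a b (t : R) : 0 <= t <= 1 -> seg_in U a b ->
  Sg f a b = Sg f a (a + t%:C * (b - a)) + Sg f (a + t%:C * (b - a)) b.
Proof.
move=> t01 ab; have [F PF] := cint_ex (seg_cont ab cf).
have z01 : 0 <= (0:R) <= 1 by rewrite lexx ler01.
have o01 : 0 <= (1:R) <= 1 by rewrite lexx ler01.
have E0 : a = a + 0%:C * (b - a) by rewrite mul0r addr0.
have E1 : b = a + 1%:C * (b - a) by rewrite mul1r addrC subrK.
have H1 := Sg_prim_line z01 t01 PF ab; rewrite -E0 in H1.
have H2 := Sg_prim_line t01 o01 PF ab; rewrite -E1 in H2.
have H3 := Sg_prim_line z01 o01 PF ab; rewrite -E1 -E0 in H3.
by rewrite H1 H2 H3; ring.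
Qed.

Lemma SgN a b : seg_in U a b -> Sg f b a = - Sg f a b.
Proof.
move=> ab; have [F PF] := cint_ex (seg_cont ab cf).
have z01 : 0 <= (0:R) <= 1 by rewrite lexx ler01.
have o01 : 0 <= (1:R) <= 1 by rewrite lexx ler01.
have E0 : a = a + 0%:C * (b - a) by rewrite mul0r addr0.
have E1 : b = a + 1%:C * (b - a) by rewrite mul1r addrC subrK.
have H3 := Sg_prim_line z01 o01 PF ab; rewrite -E1 -E0 in H3.
have H2 := Sg_prim_line o01 z01 PF ab; rewrite -E1 -E0 in H2.
by rewrite H2 H3; ring.
Qed.

Lemma SgB g a b : seg_in U a b -> (forall z, U z -> ccont g z) ->
  Sg (fun z => f z - g z) a b = Sg f a b - Sg g a b.
Proof.
move=> ab cg; rewrite /Sg cintB; [ring|exact: seg_cont ab cf|exact: seg_cont ab cg].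
Qed.
End Seg.
End Integrals.

(** * Goursat's theorem and primitives on convex domains *)

Section Goursat.
Context {R : realType}.
Local Notation C := R[i].
Local Notation Re := complex.Re.
Local Notation Im := complex.Im.

Definition opn (U : set C) := forall z, U z ->
  exists2 r : R, 0 < r & forall w, cabs (w - z) < r -> U w.
Definition cvx (U : set C) := forall a b, U a -> U b -> seg_in U a b.
Definition hol (U : set C) (f : C -> C) := forall z, U z -> exists l, cD f z l.

Lemma hol_cont U f : hol U f -> forall z, U z -> ccont f z.
Proof. by move=> H z /H[l /cD_cont]. Qed.

Lemma hol_sub (U V : set C) f : V `<=` U -> hol U f -> hol V f.
Proof. by move=> VU H z /VU /H. Qed.

Lemma cvx_ball (x : C) (r : R) : cvx [set z | cabs (z - x) < r].
Proof.
move=> a b /= ha hb t /andP[t0 t1] /=.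
rewrite (_ : _ - x = (1 - t)%:C * (a - x) + t%:C * (b - x)); last by ring.
apply: le_lt_trans (cabsD _ _) _; rewrite !cabsM !cabs_real !ger0_norm//; last by lra.
by have [h|h] := leP t (1/2); nra.
Qed.

Lemma cvxI U V : cvx U -> cvx V -> cvx (U `&` V).
Proof. by move=> cU cV a b [? ?] [? ?] t t01; split; [exact: cU|exact: cV]. Qed.

Lemma opnI U V : opn U -> opn V -> opn (U `&` V).
Proof.
move=> oU oV z [Uz Vz]; have [r r0 Hr] := oU _ Uz; have [s s0 Hs] := oV _ Vz.
exists (Num.min r s); first by rewrite lt_min r0.
by move=> w; rewrite lt_min => /andP[h1 h2]; split; [exact: Hr|exact: Hs].
Qed.

Lemma opn_ball (x : C) (r : R) : opn [set z | cabs (z - x) < r].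
Proof.
move=> z /= zr; exists (r - cabs (z - x)); first by rewrite subr_gt0.
by move=> w h; have := cabs_leD w z x; rewrite /=; lra.
Qed.

Definition T3 f (a b c : C) := Sg f a b + Sg f b c + Sg f c a.

Section T3.
Variables (f : C -> C) (U : set C).
Hypothesis cf : forall z, U z -> ccont f z.
Hypothesis cU : cvx U.

Let mid (a b : C) := a + (2^-1)%:C * (b - a).

Lemma mid_in a b : U a -> U b -> U (mid a b).
Proof. by move=> ha hb; apply: (cU ha hb); lra. Qed.

Lemma midC a b : mid a b = mid b a.
Proof.
rewrite /mid rmorphV ?unitfE//=; by field.
Qed.

Lemma T3_split a b c : U a -> U b -> U c ->
  T3 f a b c = T3 f a (mid a b) (mid a c) + T3 f (mid a b) b (mid b c) +
    T3 f (mid a c) (mid b c) c + T3 f (mid b c) (mid a c) (mid a b).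
Proof.
move=> ha hb hc; rewrite /T3.
have h01 : 0 <= (2^-1 : R) <= 1 by lra.
rewrite (Sg_split cf h01 (cU ha hb)) -/(mid a b).
rewrite (Sg_split cf h01 (cU hb hc)) -/(mid b c).
rewrite (Sg_split cf h01 (cU hc ha)) -/(mid c a) (midC c a).
have mab := mid_in ha hb; have mbc := mid_in hb hc; have mac := mid_in ha hc.
rewrite (SgN cf (cU mbc mac)) (SgN cf (cU mab mbc)) (SgN cf (cU mab mac)).
by ring.
Qed.

Lemma T3_le a b c (M r : R) : U a -> U b -> U c -> 0 <= M ->
  (forall z, U z -> cabs (f z) <= M) ->
  cabs (b - a) <= r -> cabs (c - b) <= r -> cabs (a - c) <= r ->
  cabs (T3 f a b c) <= 3 * M * r.
Proof.
move=> ha hb hc M0 le h1 h2 h3; rewrite /T3.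
have H x y : U x -> U y -> cabs (y - x) <= r -> cabs (Sg f x y) <= M * r.
  move=> Ux Uy xy; apply: le_trans (Sg_le cf (cU Ux Uy) le) _.
  by rewrite ler_wpM2l.
apply: le_trans (cabsD _ _) _; have := cabsD (Sg f a b) (Sg f b c).
have := H _ _ ha hb h1; have := H _ _ hb hc h2; have := H _ _ hc ha h3; lra.
Qed.
End T3.

Lemma T3_prim f F U a b c : cvx U -> (forall z, U z -> ccont f z) ->
  (forall z, U z -> cD F z (f z)) -> U a -> U b -> U c -> T3 f a b c = 0.
Proof.
move=> cU cf DF ha hb hc; rewrite /T3.
rewrite (Sg_prim cf (cU _ _ ha hb) DF) (Sg_prim cf (cU _ _ hb hc) DF).
by rewrite (Sg_prim cf (cU _ _ hc ha) DF); ring.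
Qed.

Lemma T3B f g U a b c : cvx U -> (forall z, U z -> ccont f z) ->
  (forall z, U z -> ccont g z) -> U a -> U b -> U c ->
  T3 (fun z => f z - g z) a b c = T3 f a b c - T3 g a b c.
Proof.
move=> cU cf cg ha hb hc; rewrite /T3.
rewrite (SgB cf (cU _ _ ha hb) cg) (SgB cf (cU _ _ hb hc) cg).
by rewrite (SgB cf (cU _ _ hc ha) cg); ring.
Qed.

(** Near a point of differentiability [f] is within [e * r] of an affine function, which has a
    primitive and contributes nothing. The 6 comes from three sides of length at most [2 * r]. *)
Lemma goursat_local f U x l (e : R) : cvx U -> (forall z, U z -> ccont f z) ->
  cD f x l -> 0 < e -> exists2 d : R, 0 < d & forall (r : R) a b c, r <= d ->
    (U `&` [set z | cabs (z - x) < r]) a -> (U `&` [set z | cabs (z - x) < r]) b ->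
    (U `&` [set z | cabs (z - x) < r]) c ->
    cabs (T3 f a b c) <= 6 * e * r ^+ 2.
Proof.
move=> cU cf [q [k k0 [cq ql fq]]] e0; have [d d0 H] := cq _ e0.
exists (Num.min k d); first by rewrite lt_min k0.
move=> r a b c; rewrite le_min => /andP[rk rd] [ha /= ra] [hb /= rb] [hc /= rc].
have r0 : 0 <= r by apply: le_trans (ltW ra); exact: cabs_ge0.
set V := U `&` [set z | cabs (z - x) < r].
have cV : cvx V by apply: cvxI => //; exact: cvx_ball.
have cfV z : V z -> ccont f z by move=> [/cf].
pose g (z : C) := f x + (z - x) * l.
pose G (z : C) := f x * z + (z - x) * (z - x) * (2^-1)%:C * l.
have Dg z : cD g z l.
  apply: Dg_eq (DgD (Dg_cst _ _ _) (DgM (DgB (cD_id z) (Dg_cst _ x z)) (Dg_cst _ l z))).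
  by ring.
have half : (2^-1)%:C = (2 : C)^-1 by rewrite rmorphV ?unitfE//= rmorph_nat.
have two0 : (2 : C) != 0.
  by rewrite pnatr_eq0.
have DG z : cD G z (g z).
  have Dz : cD (fun z => z - x) z (1 - 0) by apply: DgB (cD_id z) (Dg_cst _ x z).
  apply: Dg_eq (DgD (DgZ (f x) (cD_id z))
   (DgM (DgM (DgM Dz Dz) (Dg_cst _ (2^-1)%:C z)) (Dg_cst _ l z))).
  by rewrite /g half; field.
have cg z : V z -> ccont g z by move=> _; exact: cD_cont (Dg z).
have Tg : T3 g a b c = 0 by apply: (T3_prim cV cg (fun z _ => DG z)).
have -> : T3 f a b c = T3 (fun z => f z - g z) a b c.
  by rewrite (T3B cV)// Tg subr0.
have ab y z : cabs (y - x) < r -> cabs (z - x) < r -> cabs (y - z) <= 2 * r.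
  by move=> h1 h2; have := cabs_leD y x z; rewrite (cabsB x z); lra.
have cfg z : V z -> ccont (fun z => f z - g z) z.
  by move=> Vz; exact: contB (cfV _ Vz) (cg _ Vz).
apply: le_trans (T3_le cfg cV _ _ _ (M := r * e) (r := 2 * r) _ _ _ _ _) _; try exact: ab; try by [].
- by rewrite mulr_ge0// ltW.
- move=> z [Uz /= zr]; rewrite fq; last exact: lt_le_trans zr rk.
  rewrite /g (_ : _ - _ = (z - x) * (q z - l)); last by ring.
  rewrite cabsM ler_pM ?cabs_ge0 ?(ltW zr)// -ql.
  by apply/ltW/H; exact: lt_le_trans zr rd.
- by rewrite expr2; lra.
Qed.

Lemma exp2_small (c e : R) : 0 < e -> exists n, c * 2^-1 ^+ n < e.
Proof.
move=> e0; have [n nE] : exists n : nat, c / e < n%:R.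
  by exists (Num.truncn `|c / e|).+1; apply: le_lt_trans (ler_norm _) _; exact: truncnS_gt.
exists n; rewrite exprVn ltr_pdivrMr ?exprn_gt0//.
rewrite mulrC -ltr_pdivrMr//; apply: lt_le_trans nE _.
by rewrite -natrX ler_nat ltnW// ltn_expl.
Qed.

(** The intervals of radius [2 * 2^-1 ^+ n] about [u n] are nested, and the supremum of their left
    ends lies in all of them. *)
Lemma fast_cauchy (u : nat -> R) : (forall n, `|u n.+1 - u n| <= 2^-1 ^+ n) ->
  exists x, forall n, `|x - u n| <= 2 * 2^-1 ^+ n.
Proof.
move=> H; pose l n := u n - 2 * 2^-1 ^+ n; pose r n := u n + 2 * 2^-1 ^+ n.
have p0 n : 0 < (2^-1 : R) ^+ n by rewrite exprn_gt0.
have lS n : l n <= l n.+1.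
  by have := H n; rewrite /l ler_norml exprS; lra.
have rS n : r n.+1 <= r n.
  by have := H n; rewrite /r ler_norml exprS; lra.
have lr n m : l n <= r m.
  have h1 k : l n <= l (n + k)%N.
    by elim: k => [|k IH]; rewrite ?addn0 // addnS; exact: le_trans IH (lS _).
  have h2 k : r (m + k)%N <= r m.
    by elim: k => [|k IH]; rewrite ?addn0 // addnS; exact: le_trans (rS _) IH.
  apply: le_trans (h1 m) (le_trans _ (h2 n)); rewrite [(m + n)%N]addnC /l /r.
  by have := p0 (n + m)%N; lra.
have hs : has_sup (range l).
  by split; [exists (l 0%N), 0%N|exists (r 0%N) => y [n _ <-]].
exists (sup (range l)) => n.
have h1 : l n <= sup (range l) by apply: ub_le_sup; [case: hs|exists n].
have h2 : sup (range l) <= r n by apply: ge_sup; [case: hs|move=> y [m _ <-]].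
by move: h1 h2; rewrite /l /r ler_norml; lra.
Qed.

Lemma le_small (c y : R) : (forall n, y <= c * 2^-1 ^+ n) -> y <= 0.
Proof.
move=> H; rewrite leNgt; apply/negP => y0; have [n] := exp2_small c y0.
by rewrite ltNge H.
Qed.

Lemma cabs_sum4 (a b c d : C) :
  cabs (a + b + c + d) <= cabs a + cabs b + cabs c + cabs d.
Proof.
apply: le_trans (cabsD _ _) _; rewrite lerD2r.
by apply: le_trans (cabsD _ _) _; rewrite lerD2r cabsD.
Qed.

Lemma quarter_le (t a b c d : R) : t <= a + b + c + d ->
  4 * a < t -> 4 * b < t -> 4 * c < t -> t <= 4 * d.
Proof. lra. Qed.

Lemma dist_lin (a b x y p : R) : 0 <= a -> 0 <= b -> 0 <= x -> 0 <= y -> 0 < p ->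
  a <= 3 * p -> b <= 3 * p -> a * x + b * y < 6 * (x + y + 1) * p.
Proof. nra. Qed.

Lemma dist_shift (x y p d : R) : `|x - y| <= 2 * p -> `|d| <= p ->
  `|x - y| <= 3 * p /\ `|x - (y + d)| <= 3 * p.
Proof.
move=> h1 h2; have p0 : 0 <= p by apply: le_trans h2.
split; first by lra.
by rewrite opprD addrA; apply: le_trans (ler_normB _ _) _; lra.
Qed.

Section goursat.
Variables (f : C -> C) (U : set C).
Hypotheses (cU : cvx U) (hf : hol U f).
Variables z0 h k : C.
Hypotheses (U0 : U z0) (Uh : U (z0 + h)) (Uk : U (z0 + k)).

Let pt (u v : R) := z0 + u%:C * h + v%:C * k.
Let inD (u v : R) := [/\ 0 <= u, 0 <= v & u + v <= 1].

Let pt_in u v : inD u v -> U (pt u v).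
Proof.
move=> [u0 v0 uv1]; have [uv|uv] := eqVneq (u + v) 0.
  have [-> ->] : u = 0 /\ v = 0 by split; lra.
  by rewrite /pt !mul0r !addr0.
have uv0 : 0 < u + v by rewrite lt_neqAle eq_sym uv addr_ge0.
have v1 : 0 <= v / (u + v) <= 1.
  by rewrite divr_ge0//= ?(ltW uv0)// ler_pdivrMr// mul1r lerDr.
have := cU U0 (cU Uh Uk v1) (t := u + v); rewrite (ltW uv0) uv1 => /(_ isT).
rewrite (_ : z0 + _ = pt u v) // /pt.
have -> : v%:C = (u + v)%:C * (v / (u + v))%:C.
  by rewrite -rmorphM mulrCA mulfV// mulr1.
have -> : u%:C = (u + v)%:C * (1 - v / (u + v))%:C.
  by rewrite -rmorphM; congr _%:C; rewrite mulrBr mulr1 mulrCA mulfV// mulr1 addrK.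
by ring.
Qed.

(** A subtriangle is coded by a corner in affine coordinates and a signed size. The central one of
    the four halves is turned around, which is expressed by a negative size, so all four have the
    same form. *)
Let TT (s : R * R * R) :=
  T3 f (pt s.1.1 s.1.2) (pt (s.1.1 + s.2) s.1.2) (pt s.1.1 (s.1.2 + s.2)).
Let valid (s : R * R * R) :=
  [/\ inD s.1.1 s.1.2, inD (s.1.1 + s.2) s.1.2 & inD s.1.1 (s.1.2 + s.2)].

Let valid_half u v s : valid (u, v, s) -> [/\ valid (u, v, s / 2),
  valid (u + s / 2, v, s / 2), valid (u, v + s / 2, s / 2) &
  valid (u + s / 2, v + s / 2, - (s / 2))].
Proof.
rewrite /valid /inD /=; move=> [[? ? ?] [? ? ?] [? ? ?]].
by repeat split; lra.
Qed.

(** Validity is a premise inside the existential, so that the axiom of choice gives a total function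
    to iterate. One of the four parts carries at least a quarter of the integral. *)
Let step s : exists s', valid s -> [/\ valid s', cabs (TT s) <= 4 * cabs (TT s'),
  `|s'.2| = `|s.2| / 2, `|s'.1.1 - s.1.1| <= `|s.2| & `|s'.1.2 - s.1.2| <= `|s.2|].
Proof.
case: s => [[u v] s]; have [vs|] := pselect (valid (u, v, s)); last by exists (u, v, s).
have [/= d1 d2 d3] := vs.
have E : TT (u, v, s) = TT (u, v, s / 2) + TT (u + s / 2, v, s / 2) +
     TT (u, v + s / 2, s / 2) + TT (u + s / 2, v + s / 2, - (s / 2)).
  rewrite /TT /= (T3_split (hol_cont hf) cU (pt_in d1) (pt_in d2) (pt_in d3)).
  have half : (2^-1)%:C = (2 : C)^-1 by rewrite rmorphV ?unitfE//= rmorph_nat.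
  have two0 : (2 : C) != 0.
    by rewrite pnatr_eq0.
  have e1 : pt u v + (2^-1)%:C * (pt (u + s) v - pt u v) = pt (u + s / 2) v.
    by rewrite /pt; ring.
  have e2 : pt u v + (2^-1)%:C * (pt u (v + s) - pt u v) = pt u (v + s / 2).
    by rewrite /pt; ring.
  have e3 : pt (u + s) v + (2^-1)%:C * (pt u (v + s) - pt (u + s) v) =
     pt (u + s / 2) (v + s / 2).
    by rewrite /pt !rmorphD !rmorphM /= half; field.
  rewrite e1 e2 e3 !addrK -!addrA (_ : s / 2 + s / 2 = s)//; lra.
have s2 : `|s / 2| = `|s| / 2 by rewrite normrM (@ger0_norm _ 2^-1).
have s2' : `|s / 2| <= `|s| by rewrite s2; have := normr_ge0 s; lra.
have [V1 V2 V3 V4] := valid_half vs.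
have [h1|h1] := leP (cabs (TT (u, v, s))) (4 * cabs (TT (u, v, s / 2))).
  by exists (u, v, s / 2) => _; split => //=; rewrite subrr normr0.
have [h2|h2] := leP (cabs (TT (u, v, s))) (4 * cabs (TT (u + s / 2, v, s / 2))).
  exists (u + s / 2, v, s / 2) => _; split => //=; rewrite ?[_ + s / 2 - _]addrAC ?subrr ?add0r ?normr0//.
have [h3|h3] := leP (cabs (TT (u, v, s))) (4 * cabs (TT (u, v + s / 2, s / 2))).
  exists (u, v + s / 2, s / 2) => _; split => //=; rewrite ?[_ + s / 2 - _]addrAC ?subrr ?add0r ?normr0//.
exists (u + s / 2, v + s / 2, - (s / 2)) => _; split => //=; rewrite ?normrN ?[_ + s / 2 - _]addrAC ?subrr ?add0r//.
apply: quarter_le h1 h2 h3; rewrite {1}E; exact: cabs_sum4.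
Qed.

Lemma goursat_tri : T3 f z0 (z0 + h) (z0 + k) = 0.
Proof.
have [F HF] := choice step.
pose s n := iter n F (0, 0, 1 : R).
have v0 : valid (0, 0, 1 : R) by split; split => /=; lra.
have vs n : valid (s n).
  by elim: n => [//|n IH]; rewrite /s iterS -/(s n); have [] := HF _ IH.
have s2 n : `|(s n).2| = 2^-1 ^+ n.
  elim: n => [|n IH]; first by rewrite /= normr1.
  by have [_ _ + _ _] := HF _ (vs n); rewrite /s iterS -/(s n) => ->; rewrite IH exprS mulrC.
have [ux Hu] : exists x, forall n, `|x - (s n).1.1| <= 2 * 2^-1 ^+ n.
  apply: fast_cauchy => n; rewrite -s2 /s iterS -/(s n).
  by have [] := HF _ (vs n).
have [vx Hv] : exists x, forall n, `|x - (s n).1.2| <= 2 * 2^-1 ^+ n.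
  apply: fast_cauchy => n; rewrite -s2 /s iterS -/(s n).
  by have [] := HF _ (vs n).
have inx : inD ux vx.
  split.
  - rewrite -oppr_le0; apply: (@le_small 2) => n.
    by have [[+ _ _] _ _] := vs n; have := Hu n; rewrite ler_norml; lra.
  - rewrite -oppr_le0; apply: (@le_small 2) => n.
    by have [[_ + _] _ _] := vs n; have := Hv n; rewrite ler_norml; lra.
  - rewrite -subr_le0; apply: (@le_small 4) => n.
    have [[_ _ +] _ _] := vs n; have := Hu n; have := Hv n.
    by rewrite !ler_norml; lra.
set x := pt ux vx; have Ux : U x := pt_in inx.
pose H := cabs h + cabs k + 1.
have H0 : 0 < H by have := cabs_ge0 h; have := cabs_ge0 k; rewrite /H; lra.
have near u v n : `|ux - u| <= 3 * 2^-1 ^+ n -> `|vx - v| <= 3 * 2^-1 ^+ n ->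
    cabs (pt u v - x) < 6 * H * 2^-1 ^+ n.
  move=> h1 h2.
  have -> : pt u v - x = (u - ux)%:C * h + (v - vx)%:C * k by rewrite /pt /x /pt; ring.
  apply: le_lt_trans (cabsD _ _) _; rewrite !cabsM !cabs_real !(distrC _ ux) !(distrC _ vx).
  have p0 : 0 < (2^-1 : R) ^+ n by rewrite exprn_gt0.
  by apply: dist_lin; rewrite ?cabs_ge0 ?normr_ge0.
have T4 n : cabs (TT (0, 0, 1 : R)) <= 4 ^+ n * cabs (TT (s n)).
  elim: n => [|n IH]; first by rewrite expr0 mul1r.
  apply: le_trans IH _; rewrite exprSr -mulrA ler_pM2l ?exprn_gt0//.
  by rewrite /s iterS -/(s n); have [] := HF _ (vs n).
have -> : T3 f z0 (z0 + h) (z0 + k) = TT (0, 0, 1 : R).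
  by rewrite /TT /pt /= !add0r !mul0r !mul1r !addr0.
apply/eqP; rewrite -cabs_eq0 eq_le cabs_ge0 andbT.
apply/ler_addgt0Pl => e e0; rewrite addr0.
have [l Dl] := hf Ux.
(* Here [216 = 6 * 6 ^ 2] absorbs the 6 of [goursat_local] and the square of the radius
   [6 * H * 2^-1 ^+ n]; the factor [4 ^+ n] cancels against the square of [2^-1 ^+ n]. *)
have e1 : 0 < e / (216 * H ^+ 2).
  by apply: divr_gt0 e0 _; apply: mulr_gt0; [rewrite ltr0n|exact: exprn_gt0].
have [d d0 Hd] := goursat_local cU (hol_cont hf) Dl e1.
have [n nd] := exp2_small (6 * H) d0.
apply: le_trans (T4 n) _.
have p0 : 0 < (2^-1 : R) ^+ n by rewrite exprn_gt0.
have [a1 a2 a3] := vs n.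
have sn : `|(s n).2| <= 2^-1 ^+ n by rewrite s2.
have [u1 u2] := dist_shift (Hu n) sn; have [v1 v2] := dist_shift (Hv n) sn.
have := Hd (6 * H * 2^-1 ^+ n) (pt (s n).1.1 (s n).1.2) (pt ((s n).1.1 + (s n).2) (s n).1.2)
  (pt (s n).1.1 ((s n).1.2 + (s n).2)) (ltW nd).
have q1 : (U `&` [set z | cabs (z - x) < 6 * H * 2^-1 ^+ n]) (pt (s n).1.1 (s n).1.2).
  by split; [exact: pt_in|exact: near].
have q2 : (U `&` [set z | cabs (z - x) < 6 * H * 2^-1 ^+ n]) (pt ((s n).1.1 + (s n).2) (s n).1.2).
  by split; [exact: pt_in|exact: near].
have q3 : (U `&` [set z | cabs (z - x) < 6 * H * 2^-1 ^+ n]) (pt (s n).1.1 ((s n).1.2 + (s n).2)).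
  by split; [exact: pt_in|exact: near].
move=> /(_ q1 q2 q3) K.
apply: le_trans (_ : 4 ^+ n * (6 * (e / (216 * H ^+ 2)) * (6 * H * 2^-1 ^+ n) ^+ 2) <= _).
  by rewrite ler_pM2l ?exprn_gt0.
have P : 4 ^+ n * (2^-1 ^+ n) ^+ 2 = 1 :> R.
  rewrite [(_ ^+ n) ^+ 2]exprAC -exprMn (_ : 4 * 2^-1 ^+ 2 = 1 :> R) ?expr1n//.
  by field.
have Hn : H != 0 by rewrite gt_eqF.
rewrite (_ : _ * _ = e * (4 ^+ n * (2^-1 ^+ n) ^+ 2)); first by rewrite P mulr1.
move: (4 ^+ n) (2^-1 ^+ n) => A B; by field.
Qed.
End goursat.

Lemma goursat f U a b c : cvx U -> hol U f -> U a -> U b -> U c -> T3 f a b c = 0.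
Proof.
move=> cU hf ha hb hc; rewrite -(subrK a b) -(subrK a c) ![_ - a + a]addrC.
by apply: (goursat_tri cU hf) => //; rewrite addrC subrK.
Qed.

(** Integrate from the base point. Since triangles contribute nothing, the slope of this function
    between [z] and [y] is the mean of [f] over the segment, which is continuous at [z]. *)
Lemma prim_of_T3 f U z0 : opn U -> cvx U -> (forall z, U z -> ccont f z) -> U z0 ->
  (forall a b c, U a -> U b -> U c -> T3 f a b c = 0) ->
  exists F, forall z, U z -> cD F z (f z).
Proof.
move=> oU cU cf U0 T0; exists (Sg f z0) => z Uz.
have [r r0 Hr] := oU _ Uz.
exists (fun z' => cint (fun t => f (z + t%:C * (z' - z)))), r => //; split.
- move=> e e0; have e2 : 0 < e / 2 by lra.
  have [k k0 H] := cf _ Uz _ e2.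
  exists (Num.min k r); first by rewrite lt_min k0.
  move=> y; rewrite lt_min => /andP[yk yr].
  have -> : cint (fun t => f (z + t%:C * (z - z))) = cint (fun=> f z).
    by congr cint; apply/funext => t; rewrite subrr mulr0 addr0.
  have sg := cU _ _ Uz (Hr _ yr).
  rewrite -cintB; [|exact: seg_cont sg cf|by move=> t _; exact: cont_cst].
  apply: le_lt_trans (_ : e / 2 < e); last by lra.
  apply: cint_le => [t t01|t /andP[t0 t1]].
    by apply: contB (cont_cst _ _ _); exact: (seg_cont sg cf).
  apply/ltW/H; rewrite /dC addrAC subrr add0r cabsM cabs_real ger0_norm//.
  by apply: le_lt_trans yk; rewrite ler_piMl ?cabs_ge0.
- rewrite -[RHS](cint_cst (f z)); congr cint; apply/funext => t.
  by rewrite subrr mulr0 addr0.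
- move=> y /= yr; have Uy := Hr _ yr.
  have := T0 _ _ _ U0 Uz Uy; rewrite /T3 (SgN cf (cU _ _ U0 Uy)).
  by move=> /eqP; rewrite subr_eq0 => /eqP <-; rewrite /Sg.
Qed.

Lemma hol_prim f U : opn U -> cvx U -> hol U f ->
  exists F, forall z, U z -> cD F z (f z).
Proof.
move=> oU cU hf; have [[z0 U0]|nU] := pselect (exists z, U z).
  apply: (prim_of_T3 oU cU (hol_cont hf) U0) => a b c; exact: goursat.
by exists (fun=> 0) => z Uz; case: nU; exists z.
Qed.

Lemma T3_shift_cont f U a b c : opn U -> cvx U -> (forall z, U z -> ccont f z) ->
  U a -> U b -> U c -> ccont (fun w => T3 f (a + w) (b + w) (c + w)) 0.
Proof.
move=> oU cU cf ha hb hc.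
have H x y : U x -> U y -> ccont (fun w => Sg f (x + w) (y + w)) 0.
  move=> hx hy.
  apply: (@cont_ext _ _ _ (fun w => (y - x) * cint (fun t => f (x + w + t%:C * (y - x))))).
    by move=> w; rewrite /Sg (_ : y + w - (x + w) = y - x)//; ring.
  apply: contM; first exact: cont_cst.
  have [r r0 Hr] := oU _ hx; have [s s0 Hs] := oU _ hy.
  have Uw w : cabs w < Num.min r s -> seg_in U (x + w) (y + w).
    rewrite lt_min => /andP[h1 h2].
    by apply: cU; [apply: Hr|apply: Hs]; rewrite addrAC subrr add0r.
  apply: (@cint_cont _ (fun t w => f (x + w + t%:C * (y - x))) 0 (Num.min r s)).
  - by rewrite lt_min r0.
  - move=> w; rewrite subr0 => /Uw sg.
    have := seg_cont sg cf; congr cont_on; apply/funext => t.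
    by rewrite (_ : y + w - (x + w) = y - x)//; ring.
  - move=> t t01 e e0; rewrite addr0.
    have [k k0 Hk] := cf _ (cU _ _ hx hy _ t01) _ e0.
    pose M := 1 + cabs (y - x).
    have M0 : 0 < M by rewrite ltr_pwDl ?cabs_ge0.
    exists (k / M); first by rewrite divr_gt0.
    move=> t' w' h1; rewrite subr0 => h2; apply: Hk; rewrite /dC.
    rewrite (_ : _ - _ = w' + (t' - t)%:C * (y - x)); last by ring.
    apply: le_lt_trans (cabsD _ _) _; rewrite cabsM cabs_real.
    apply: lt_le_trans (_ : k / M + k / M * cabs (y - x) <= _).
      by rewrite ltr_leD// ler_wpM2r ?cabs_ge0// ltW.
    by rewrite -{1}[k / M]mulr1 -mulrDr -/M divfK ?gt_eqF.
by apply: contD; [apply: contD|]; exact: H.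
Qed.

(* Two vectors always lie in a closed half-plane; shifting the triangle into
   its interior makes it avoid the exceptional point. *)
Lemma goursat_vertex f U p a b : opn U -> cvx U -> (forall z, U z -> ccont f z) ->
  hol (U `\ p) f -> U p -> U a -> U b -> T3 f p a b = 0.
Proof.
move=> oU cU cf hf Up Ua Ub.
have [v [v0 va vb]] : exists v : C, [/\ v != 0, 0 <= Re ((a - p) * conjc v) &
    0 <= Re ((b - p) * conjc v)].
  have [ap|ap] := eqVneq a p.
    have [bp|bp] := eqVneq b p.
      by exists 1; rewrite ap bp !subrr !mul0r oner_eq0.
    exists (b - p); rewrite subr_eq0 bp ap subrr mul0r lexx; split => //.
    by rewrite cabs_mul_conj /= sqr_ge0.
  have nz : 'i * (a - p) != 0 by rewrite mulf_neq0 ?subr_eq0// -cabs_gt0 cabs_i.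
  have E : Re ((a - p) * conjc ('i * (a - p))) = 0.
    rewrite -complexiE; case: (a - p) => x y; rewrite /=; ring.
  have [h|h] := leP 0 (Re ((b - p) * conjc ('i * (a - p)))).
    by exists ('i * (a - p)); rewrite E lexx.
  exists (- ('i * (a - p))); rewrite oppr_eq0; split => //.
    by rewrite rmorphN mulrN ReN E oppr0.
  by rewrite rmorphN mulrN ReN oppr_ge0 ltW.
pose U' := [set z | U z /\ 0 < Re ((z - p) * conjc v)].
have cU' : cvx U'.
  move=> x y [Ux x0] [Uy y0] t t01; split; first exact: cU.
  rewrite (_ : _ * _ = (1 - t)%:C * ((x - p) * conjc v) + t%:C * ((y - p) * conjc v)); last by ring.
  rewrite ReD !Re_realM; case/andP: t01 => t0 t1.
  by have [h|h] := leP t (1/2); nra.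
have hf' : hol U' f.
  apply: hol_sub hf => z [Uz z0]; split => // /= zp.
  by move: z0; rewrite zp subrr mul0r ltxx.
have vv : 0 < Re (v * conjc v).
  by rewrite cabs_mul_conj /= exprn_gt0// cabs_gt0.
have Z (t : R) : 0 < t -> U (p + t%:C * v) -> U (a + t%:C * v) -> U (b + t%:C * v) ->
    T3 f (p + t%:C * v) (a + t%:C * v) (b + t%:C * v) = 0.
  move=> t0 U1 U2 U3; apply: (goursat cU' hf'); split => //.
  - by rewrite addrAC subrr add0r -mulrA Re_realM mulr_gt0.
  - by rewrite addrAC mulrDl ReD -mulrA Re_realM ltr_wpDl// mulr_gt0.
  - by rewrite addrAC mulrDl ReD -mulrA Re_realM ltr_wpDl// mulr_gt0.
apply/eqP; rewrite -cabs_eq0 eq_le cabs_ge0 andbT.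
apply/ler_addgt0Pl => e e0; rewrite addr0.
have [k k0 K] := T3_shift_cont oU cU cf Up Ua Ub e0.
have [r1 r10 H1] := oU _ Up; have [r2 r20 H2] := oU _ Ua; have [r3 r30 H3] := oU _ Ub.
have vp : 0 < cabs v by rewrite cabs_gt0.
have [d d0 dd] : exists2 d : R, 0 < d & d < Num.min (Num.min k r1) (Num.min r2 r3).
  have m0 : 0 < Num.min (Num.min k r1) (Num.min r2 r3) by rewrite !lt_min k0 r10 r20.
  by exists (Num.min (Num.min k r1) (Num.min r2 r3) / 2); [rewrite divr_gt0|rewrite ltr_pdivrMr// mulr_natr mulr2n ltrDl].
move: dd; rewrite !lt_min => /andP[/andP[dk d1] /andP[d2 d3]].
have tv : cabs ((d / cabs v)%:C * v) = d.
  by rewrite cabsM cabs_real ger0_norm ?divfK ?gt_eqF// divr_ge0 ?ltW.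
have sh x : cabs (x + (d / cabs v)%:C * v - x) = d by rewrite addrAC subrr add0r.
have := K ((d / cabs v)%:C * v); rewrite /dC subr0 tv => /(_ dk).
rewrite Z ?divr_gt0// ?addr0 ?sub0r ?cabsN; [exact: ltW|..].
- by apply: H1; rewrite sh.
- by apply: H2; rewrite sh.
- by apply: H3; rewrite sh.
Qed.

(** A triangle is cut into three with the common vertex [p], which reduces the matter to
    [goursat_vertex]. The exceptional point is the removable singularity of the difference quotient
    in Cauchy's formula. *)
Lemma prim_except f U p : opn U -> cvx U -> (forall z, U z -> ccont f z) ->
  hol (U `\ p) f -> U p -> exists F, forall z, U z -> cD F z (f z).
Proof.
move=> oU cU cf hf Up; apply: (prim_of_T3 oU cU cf Up) => a b c ha hb hc.
have Z x y := @goursat_vertex f U p x y oU cU cf hf Up.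
have := Z _ _ ha hb; have := Z _ _ hb hc; have := Z _ _ hc ha; rewrite /T3.
rewrite (SgN cf (cU _ _ Up ha)) (SgN cf (cU _ _ Up hb)) (SgN cf (cU _ _ Up hc)).
move=> h1 h2 h3; rewrite -[RHS](addr0 0) -{1}h3 -[in RHS](addr0 0) -{1}h2 -h1; ring.
Qed.
End Goursat.

(** * Integrals depending on a complex parameter *)

Section Cauchy.
Context {R : realType}.
Local Notation C := R[i].
Local Notation Re := complex.Re.
Local Notation Im := complex.Im.
Implicit Types (U V : set C) (f g : C -> C) (z w : C) (r x t : R).

Definition dRC (p q : R * C) : R := Num.max `|q.1 - p.1| (cabs (q.2 - p.2)).

Lemma dRC_lt p q k : (dRC p q < k) = (`|q.1 - p.1| < k) && (cabs (q.2 - p.2) < k).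
Proof. by rewrite /dRC gt_max. Qed.

Lemma jcont_fst (f : R -> C) x w : rcont f x -> cont dRC (fun p => f p.1) (x, w).
Proof.
move=> cf e e0; have [k k0 H] := cf e e0; exists k => // y.
by rewrite dRC_lt => /andP[h _]; exact: H.
Qed.

Lemma jcont_snd x w : cont dRC (fun p => p.2) (x, w).
Proof. by move=> e e0; exists e => // y; rewrite dRC_lt => /andP[_ h]. Qed.

Lemma cint_contj (G : R -> C -> C) (w : C) (r : R) : 0 < r ->
  (forall w', cabs (w' - w) < r -> cont_on 0 1 (G^~ w')) ->
  (forall x, 0 <= x <= 1 -> cont dRC (fun p => G p.1 p.2) (x, w)) ->
  ccont (fun w' => cint (G^~ w')) w.
Proof.
move=> r0 h1 h2; apply: (cint_cont r0 h1) => x x01 e e0.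
have [k k0 H] := h2 x x01 e e0; exists k => // x' w' a b.
by apply: (H (x', w')); rewrite dRC_lt a.
Qed.

(** With slopes as functions, differentiation under the integral sign is the continuity of the
    integrated slope: the expansion of [G] is exact and leaves no remainder to estimate. *)
Lemma cint_D (G Q : R -> C -> C) (w : C) (r : R) : 0 < r ->
  (forall w', cabs (w' - w) < r -> cont_on 0 1 (G^~ w')) ->
  (forall w', cabs (w' - w) < r -> cont_on 0 1 (Q^~ w')) ->
  (forall x, 0 <= x <= 1 -> cont dRC (fun p => Q p.1 p.2) (x, w)) ->
  (forall x w', 0 <= x <= 1 -> cabs (w' - w) < r -> G x w' = G x w + (w' - w) * Q x w') ->
  cD (fun w' => cint (G^~ w')) w (cint (Q^~ w)).
Proof.
move=> r0 cG cQ jQ E; exists (fun w' => cint (Q^~ w')), r => //; split => //.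
  exact: (cint_contj r0 cQ jQ).
move=> w' /= w'r.
have ww : cabs (w - w) < r by rewrite subrr cabs0.
have cwQ : cont_on 0 1 (fun x => (w' - w) * Q x w').
  by move=> x x01; apply: contM (cont_cst _ _ _) (cQ _ w'r _ x01).
rewrite -cintZ; last exact: cQ.
rewrite -cintD//; last exact: cG.
apply: cint_ext; last exact: cG.
by move=> x x01; exact: E.
Qed.

Section kernel.
Variables (phi zc : R -> C) (w : C) (r : R).
Hypotheses (r0 : 0 < r) (cphi : cont_on 0 1 phi) (cz : cont_on 0 1 zc).
Hypothesis far : forall x, 0 <= x <= 1 -> r <= cabs (zc x - w).

Let nz x w' : 0 <= x <= 1 -> cabs (w' - w) < r -> zc x - w' != 0.
Proof.
move=> x01 h; rewrite -cabs_gt0; have := cabs_leD (zc x) w' w.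
by have := far x01; lra.
Qed.

Let ww : cabs (w - w) < r. Proof. by rewrite subrr cabs0. Qed.

Lemma kernel1_D : cD (fun w' => cint (fun x => phi x / (zc x - w'))) w
  (cint (fun x => phi x / (zc x - w) ^+ 2)).
Proof.
have := @cint_D (fun x w' => phi x / (zc x - w'))
  (fun x w' => phi x / ((zc x - w) * (zc x - w'))) w r r0.
rewrite (_ : cint (fun x => phi x / ((zc x - w) * (zc x - w))) =
  cint (fun x => phi x / (zc x - w) ^+ 2)) //; apply.
- move=> w' h x x01; apply: contM (cphi x01) _; apply: contV; last exact: nz.
  exact: contB (cz x01) (cont_cst _ _ _).
- move=> w' h x x01; apply: contM (cphi x01) (contV _ _); last by rewrite mulf_neq0 ?nz.
  by apply: contM; exact: contB (cz x01) (cont_cst _ _ _).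
- move=> x x01; apply: contM; first exact: jcont_fst (cphi x01).
  apply: contV; last by rewrite mulf_neq0 //= nz.
  apply: contM; apply: contB; first exact: jcont_fst (cz x01).
  + exact: cont_cst.
  + exact: jcont_fst (cz x01).
  + exact: jcont_snd.
- by move=> x w' x01 h; have n1 := nz x01 h; have n2 := nz x01 ww; field; rewrite n1 n2.
Qed.

Lemma kernel2_D : exists l, cD (fun w' => cint (fun x => phi x / (zc x - w') ^+ 2)) w l.
Proof.
eexists; apply: (@cint_D (fun x w' => phi x / (zc x - w') ^+ 2)
  (fun x w' => phi x * ((zc x - w) + (zc x - w')) / ((zc x - w) ^+ 2 * (zc x - w') ^+ 2)) w r r0).
- move=> w' h x x01; apply: contM (cphi x01) (contV _ _); last by rewrite expf_neq0 ?nz.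
  by apply: contX; exact: contB (cz x01) (cont_cst _ _ _).
- move=> w' h x x01; apply: contM; first apply: contM (cphi x01) _.
    by apply: contD; exact: contB (cz x01) (cont_cst _ _ _).
  apply: contV; last by rewrite mulf_neq0 ?expf_neq0 ?nz.
  by apply: contM; apply: contX; exact: contB (cz x01) (cont_cst _ _ _).
- move=> x x01; apply: contM; first apply: contM (jcont_fst _ (cphi x01)) _.
    apply: contD; apply: contB (jcont_fst _ (cz x01)) _; [exact: cont_cst|exact: jcont_snd].
  apply: contV; last by rewrite mulf_neq0 ?expf_neq0 //= nz.
  by apply: contM; apply: contX; apply: contB (jcont_fst _ (cz x01)) _; [exact: cont_cst|exact: jcont_snd].
- by move=> x w' x01 h; have n1 := nz x01 h; have n2 := nz x01 ww; field; rewrite n1 n2.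
Qed.
End kernel.

(** * The Cauchy integral formula on circles *)

Definition circ (z0 : C) (r : R) (x : R) : C := z0 + r%:C * cexp (x%:C * ((2 * pi)%:C * 'i)).
Definition dcirc (r : R) (x : R) : C := r%:C * (((2 * pi)%:C * 'i) * cexp (x%:C * ((2 * pi)%:C * 'i))).

Lemma rD_circ z0 r x : rD (circ z0 r) x (dcirc r x).
Proof.
apply: Dg_eq (DgD (Dg_cst _ _ _) (DgZ r%:C (rD_cexp_line ((2 * pi)%:C * 'i) x))).
by rewrite add0r.
Qed.

Lemma cabs_circ z0 r x : 0 <= r -> cabs (circ z0 r x - z0) = r.
Proof.
move=> r0; rewrite /circ addrAC subrr add0r cabsM cabs_real ger0_norm//.
rewrite cabs_cexp Re_realM Re_realM -complexiE /= !mulr0.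
by rewrite expR0 mulr1.
Qed.

Lemma circ01 z0 r : circ z0 r 1 = circ z0 r 0.
Proof.
rewrite /circ mul1r mul0r cexp0; congr (_ + _ * _).
rewrite /cexp Re_realM Im_realM -complexiE /= mulr0 mulr1 expR0 mul1r.
by rewrite mulr_natl cos2pi sin2pi.
Qed.

Lemma rcont_circ z0 r : cont_on 0 1 (circ z0 r).
Proof. by move=> x _; exact: rD_cont (rD_circ z0 r x). Qed.

Lemma rcont_dcirc r : cont_on 0 1 (dcirc r).
Proof.
move=> x _; apply: contM (cont_cst _ _ _) (contM (cont_cst _ _ _) _).
exact: rD_cont (rD_cexp_line _ x).
Qed.

Definition oint z0 r (g : C -> C) : C := cint (fun x => g (circ z0 r x) * dcirc r x).

Lemma oint_prim z0 r g F : 0 <= r ->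
  (forall z, cabs (z - z0) = r -> cD F z (g z)) -> oint z0 r g = 0.
Proof.
move=> r0 DF; rewrite /oint (@cintP _ _ (fun x => F (circ z0 r x))).
  by rewrite circ01 subrr.
have H x : rD (fun x => F (circ z0 r x)) x (g (circ z0 r x) * dcirc r x).
  apply: (@Dg_comp _ _ rinc F (circ z0 r)); last exact: rD_circ.
  by apply: DF; rewrite cabs_circ.
by split=> x _; [exact: rD_cont (H x)|exact: H].
Qed.

Definition twopii : C := (2 * pi)%:C * 'i.

Lemma twopii_neq0 : twopii != 0.
Proof.
rewrite -cabs_gt0 cabsM cabs_i mulr1 cabs_real normr_gt0.
by rewrite mulf_neq0 ?pnatr_eq0// gt_eqF ?pi_gt0.
Qed.

Lemma circ_far z0 w (r : R) x : 0 <= r -> r - cabs (w - z0) <= cabs (circ z0 r x - w).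
Proof.
move=> r0; have := cabs_leD (circ z0 r x) w z0; rewrite cabs_circ//; lra.
Qed.

(** The derivative in [w] is the integral of [(z - w)^-2], which has a primitive near the circle and
    therefore vanishes. So the value is constant in the disc, and at the centre the integrand is
    constant. *)
Lemma oint_kernel z0 w (r : R) : cabs (w - z0) < r ->
  oint z0 r (fun z => (z - w)^-1) = twopii.
Proof.
move=> wr.
have r0 : 0 < r by apply: le_lt_trans wr; exact: cabs_ge0.
have nz v z : cabs (v - z0) < r -> cabs (z - z0) = r -> z - v != 0.
  move=> h1 h2; rewrite -cabs_gt0; have := cabs_leD z v z0; lra.
pose J v := oint z0 r (fun z => (z - v)^-1).
have DJ v : cabs (v - z0) < r -> cD J v 0.
  move=> vr.
  have h0 : 0 < r - cabs (v - z0) by lra.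
  have far x : 0 <= x <= 1 -> r - cabs (v - z0) <= cabs (circ z0 r x - v).
    by move=> _; apply: circ_far; exact: ltW.
  have := kernel1_D h0 (@rcont_dcirc r) (@rcont_circ z0 r) far.
  have -> : cint (fun x => dcirc r x / (circ z0 r x - v) ^+ 2) = 0.
    rewrite -[RHS](@oint_prim z0 r (fun z => (z - v) ^- 2) (fun z => - (z - v)^-1) (ltW r0)).
      by congr cint; apply/funext => x; rewrite mulrC.
    move=> z zr; have n := nz _ _ vr zr.
    apply: Dg_eq (DgN (DgV (DgB (cD_id z) (Dg_cst _ v z)) n)).
    by field.
  by apply: Dg_ext => y; congr cint; apply/funext => x; rewrite mulrC.
have -> : twopii = J z0.
  rewrite /J /oint -[LHS]cint_cst; congr cint; apply/funext => x.
  rewrite /circ /dcirc -/twopii addrAC subrr add0r.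
  have n1 : r%:C != 0 by rewrite fmorph_eq0 gt_eqF.
  have n2 := cexp_neq0 (x%:C * twopii).
  by field; rewrite n1 n2.
have sg := @cvx_ball R z0 r z0 w; rewrite /= subrr cabs0 in sg.
have {}sg := sg r0 wr.
have H t : 0 <= t <= 1 -> rD (fun t => J (z0 + t%:C * (w - z0))) t 0.
  by move=> t01; apply: Dg_eq (cD_line (DJ _ (sg t t01))); exact: mul0r.
have := @rD0_const R (fun t => J (z0 + t%:C * (w - z0))) 0 1 ler01.
rewrite mul1r mul0r addr0 [z0 + _]addrC subrK; apply.
- by move=> t /H/rD_cont.
- by move=> t /andP[t0 t1]; apply: H; rewrite !ltW.
Qed.

Section CIF.
Variables (f : C -> C) (z0 : C) (r r' : R).
Hypotheses (r0 : 0 < r) (rr' : r < r').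
Hypothesis hf : hol [set z | cabs (z - z0) < r'] f.

Lemma cont_circ_f : cont_on 0 1 (fun x => f (circ z0 r x)).
Proof.
move=> x x01; apply: cont_comp; last exact: rcont_circ.
by apply: (hol_cont hf); rewrite /= cabs_circ// ltW.
Qed.

Let phi x := f (circ z0 r x) * dcirc r x.
Let cphi : cont_on 0 1 phi.
Proof. by move=> x x01; exact: contM (cont_circ_f x01) (rcont_dcirc _ x01). Qed.

(** The quotient [(f z - f w) / (z - w)], completed at [w] by the derivative, is continuous and
    holomorphic off [w]. By [prim_except] it has a primitive, so its integral over the circle is
    zero. *)
Lemma CIF w : cabs (w - z0) < r ->
  twopii * f w = cint (fun x => phi x / (circ z0 r x - w)).
Proof.
move=> wr.
have [l Dl] := hf (lt_trans wr rr').
pose q z := if z == w then l else (f z - f w) / (z - w).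
have B0 := @opn_ball R z0 r'; have B1 := @cvx_ball R z0 r'.
have cq z : cabs (z - z0) < r' -> z != w -> exists l, cD q z l.
  move=> zr zw; have [m Dm] := hf zr.
  have zw0 : z - w != 0 by rewrite subr_eq0.
  eexists; apply: (@Dg_near _ _ id (fun z => (f z - f w) / (z - w)) _ _ _ (cabs (z - w))).
  - by rewrite cabs_gt0.
  - move=> y; rewrite /q; case: eqP => [->|//]; by rewrite cabsB ltxx.
  - exact: DgM (DgB Dm (Dg_cst _ _ _)) (DgV (DgB (cD_id z) (Dg_cst _ w z)) zw0).
have [F DF] : exists F, forall z, cabs (z - z0) < r' -> cD F z (q z).
  apply: (@prim_except R q [set z | cabs (z - z0) < r'] w) => //.
  - move=> z /= zr; have [->|zw] := eqVneq z w; last by have [m /cD_cont] := cq z zr zw.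
    have [p [k k0 [cp pl fp]]] := Dl.
    apply: (@cont_near _ _ _ p _ _ k) => //; first by rewrite /dC subrr cabs0.
    move=> y yk; rewrite /q; case: eqP => [->//|/eqP yw].
    by rewrite fp// addrAC subrr add0r mulrAC mulfV ?mul1r// subr_eq0.
  - by move=> z [/= zr zw]; apply: cq => //; apply/eqP.
  - exact: lt_trans wr rr'.
have : oint z0 r q = 0.
  by apply: (oint_prim (F := F) (ltW r0)) => z zr; apply: DF; rewrite zr.
have nz x : circ z0 r x - w != 0.
  by rewrite -cabs_gt0; apply: lt_le_trans (circ_far _ _ _ (ltW r0)); lra.
have cinv : cont_on 0 1 (fun x => (circ z0 r x - w)^-1).
  move=> x x01; apply: contV; last exact: nz.
  exact: contB (rcont_circ _ _ x01) (cont_cst _ _ _).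
rewrite /oint.
have -> : cint (fun x => q (circ z0 r x) * dcirc r x) =
   cint (fun x => phi x / (circ z0 r x - w) - f w * ((circ z0 r x - w)^-1 * dcirc r x)).
  congr cint; apply/funext => x; rewrite /q /phi ifN; last by rewrite -subr_eq0.
  by field.
have c2 : cont_on 0 1 (fun x => (circ z0 r x - w)^-1 * dcirc r x).
  by move=> x x01; exact: contM (cinv _ x01) (rcont_dcirc _ x01).
rewrite cintB.
- by rewrite cintZ// -/(oint z0 r (fun z => (z - w)^-1)) oint_kernel// mulrC => /eqP; rewrite subr_eq0 => /eqP <-.
- by move=> x x01; exact: contM (cphi x01) (cinv _ x01).
- by move=> x x01; exact: contM (cont_cst _ _ _) (c2 _ x01).
Qed.

Let far w : cabs (w - z0) < r -> forall x, 0 <= x <= 1 -> r - cabs (w - z0) <= cabs (circ z0 r x - w).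
Proof. by move=> wr x _; apply: circ_far; exact: ltW. Qed.

Lemma CIF_D w : cabs (w - z0) < r ->
  cD f w (twopii^-1 * cint (fun x => phi x / (circ z0 r x - w) ^+ 2)).
Proof.
move=> wr; have h0 : 0 < r - cabs (w - z0) by lra.
apply: (@Dg_near _ _ id (fun v => twopii^-1 * cint (fun x => phi x / (circ z0 r x - v))) _ _ _ _ h0).
  move=> y yw; rewrite -CIF ?mulKf ?twopii_neq0//.
  have := cabs_leD y w z0; lra.
by apply: DgZ; exact: kernel1_D h0 cphi (@rcont_circ z0 r) (far wr).
Qed.

Lemma CIF_le w (M : R) : cabs (w - z0) < r ->
  (forall x, 0 <= x <= 1 -> cabs (f (circ z0 r x)) <= M) ->
  cabs (f w) <= M * (r / (r - cabs (w - z0))).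
Proof.
move=> wr le; have := CIF wr => /(congr1 (@cabs R)); rewrite cabsM.
have h0 : 0 < r - cabs (w - z0) by lra.
have tp : cabs twopii = 2 * pi.
  by rewrite cabsM cabs_i mulr1 cabs_real ger0_norm// mulr_ge0// pi_ge0.
rewrite tp => E.
have M0 : 0 <= M by apply: le_trans (le 0 _); rewrite ?cabs_ge0 ?lexx ?ler01.
have p0 : 0 < 2 * pi :> R by rewrite mulr_gt0// pi_gt0.
rewrite -(ler_pM2l p0) E; apply: cint_le.
  move=> x x01; apply: contM (cphi x01) (contV _ _).
    exact: contB (rcont_circ _ _ x01) (cont_cst _ _ _).
  by rewrite -cabs_gt0; apply: lt_le_trans h0 (far wr x01).
move=> x x01; rewrite /phi cabsM cabsV cabsM.
have -> : cabs (dcirc r x) = r * (2 * pi).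
  rewrite /dcirc -/twopii 2!cabsM tp cabs_real gtr0_norm// cabs_cexp Re_realM.
  by rewrite /twopii Re_realM -complexiE /= !mulr0 expR0 mulr1.
rewrite (_ : _ * (M * _) = M * (r * (2 * pi)) * (r - cabs (w - z0))^-1); last by ring.
rewrite ler_pM ?mulr_ge0 ?invr_ge0 ?cabs_ge0 ?(ltW r0) ?pi_ge0//.
  by rewrite ler_wpM2r ?mulr_ge0 ?(ltW r0) ?pi_ge0// le.
by rewrite lef_pV2 ?posrE ?far//; apply: lt_le_trans h0 (far wr x01).
Qed.
End CIF.

Definition dv (f : C -> C) (z : C) : C := xget 0 [set l | cD f z l].

Lemma dvP f z l : cD f z l -> dv f z = l.
Proof.
rewrite /dv => D; case: xgetP => [m -> Dm|/(_ l)//]; exact: cD_unique Dm D.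
Qed.

Lemma hol_dvP U f z : hol U f -> U z -> cD f z (dv f z).
Proof. by move=> h /h[l D]; rewrite (dvP D). Qed.

Lemma opn_ball2 (U : set C) z : opn U -> U z -> exists2 r : R, 0 < r &
  [set w | cabs (w - z) < 2 * r] `<=` U.
Proof.
move=> oU /oU[r r0 H]; exists (r / 2); first by lra.
by move=> w /=; rewrite mulrC divfK ?pnatr_eq0//; exact: H.
Qed.

Lemma hol_dv U f : opn U -> hol U f -> hol U (dv f).
Proof.
move=> oU hf z Uz; have [r r0 H] := opn_ball2 oU Uz.
have rr : r < 2 * r by lra.
have hb : hol [set w | cabs (w - z) < 2 * r] f by exact: hol_sub H hf.
have zz : cabs (z - z) < r by rewrite subrr cabs0.
have h0 : 0 < r - cabs (z - z) by lra.
have [|||l Dl] := @kernel2_D (fun x => f (circ z r x) * dcirc r x) (circ z r) z _ h0.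
- move=> x x01; exact: contM (cont_circ_f r0 rr hb x01) (rcont_dcirc _ x01).
- exact: rcont_circ.
- by move=> x _; apply: circ_far; exact: ltW.
exists (twopii^-1 * l).
apply: (@Dg_near _ _ id _ _ _ _ r r0 _ (DgZ twopii^-1 Dl)) => y yr /=.
by rewrite (dvP (CIF_D r0 rr hb yr)).
Qed.

(** Near [p] the divided difference is itself a Cauchy integral, with density [f z / (z - p)], hence
    holomorphic at [p]. The factorization is an identity for all [s], in [U] or not, because off [p]
    the function [g] is simply the quotient. *)
Lemma hol_dd U f (p : C) : opn U -> hol U f -> U p ->
  exists2 g, hol U g & forall s, f s = f p + (s - p) * g s.
Proof.
move=> oU hf Up; have [l Dl] := hf _ Up.
pose q z := if z == p then l else (f z - f p) / (z - p).
exists q; last first.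
  move=> s; rewrite /q; case: eqP => [->|/eqP sp]; first by rewrite subrr mul0r addr0.
  by rewrite mulrC divfK ?subr_eq0// addrC subrK.
move=> z Uz; have [->|zp] := eqVneq z p; last first.
  have [m Dm] := hf _ Uz; have zp0 : z - p != 0 by rewrite subr_eq0.
  eexists; apply: (@Dg_near _ _ id (fun z => (f z - f p) / (z - p)) _ _ _ (cabs (z - p))).
  - by rewrite cabs_gt0.
  - move=> y; rewrite /q; case: eqP => [->|//]; by rewrite cabsB ltxx.
  - exact: DgM (DgB Dm (Dg_cst _ _ _)) (DgV (DgB (cD_id z) (Dg_cst _ p z)) zp0).
have [r r0 H] := opn_ball2 oU Up.
have rr : r < 2 * r by lra.
have hb : hol [set w | cabs (w - p) < 2 * r] f by exact: hol_sub H hf.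
have pp : cabs (p - p) < r by rewrite subrr cabs0.
have h0 : 0 < r - cabs (p - p) by lra.
pose phi x := f (circ p r x) * dcirc r x.
have cphi : cont_on 0 1 phi.
  by move=> x x01; exact: contM (cont_circ_f r0 rr hb x01) (rcont_dcirc _ x01).
have nz w x : cabs (w - p) < r -> circ p r x - w != 0.
  by move=> wr; rewrite -cabs_gt0; apply: lt_le_trans (circ_far _ _ _ (ltW r0)); lra.
have cinv w : cabs (w - p) < r -> cont_on 0 1 (fun x => (circ p r x - w)^-1).
  move=> wr x x01; apply: contV; last exact: nz.
  exact: contB (rcont_circ _ _ x01) (cont_cst _ _ _).
have cphi' : cont_on 0 1 (fun x => phi x / (circ p r x - p)).
  by move=> x x01; exact: contM (cphi _ x01) (cinv _ pp _ x01).
have D := kernel1_D h0 cphi' (@rcont_circ p r) (fun x _ => circ_far p p x (ltW r0)).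
eexists; apply: (@Dg_near _ _ id _ _ _ _ r r0 _ (DgZ twopii^-1 D)) => y yr /=.
rewrite /q; case: eqP => [->|/eqP yp].
  rewrite (cD_unique Dl (CIF_D r0 rr hb pp)); congr (_ * cint _); apply/funext => x.
  by rewrite /phi -mulrA -invfM -expr2.
apply: (mulfI twopii_neq0); rewrite mulVKf ?twopii_neq0// [RHS]mulrA.
rewrite mulrBr !(CIF r0 rr hb)//.
rewrite -cintB; first last.
- by move=> x x01; exact: contM (cphi _ x01) (cinv _ pp _ x01).
- by move=> x x01; exact: contM (cphi _ x01) (cinv _ yr _ x01).
apply: (mulIf (x := y - p)); first by rewrite subr_eq0.
rewrite divfK ?subr_eq0// mulrC -cintZ.
  congr cint; apply/funext => x; rewrite -/(phi x).
  by have n1 := nz _ x yr; have n2 := nz _ x pp; field; rewrite n1 n2.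
by move=> x x01; apply: contM (cphi' _ x01) (cinv _ yr _ x01).
Qed.

(** If [y < x], the powers of [x / y] grow at least linearly by Bernoulli's inequality and
    eventually exceed [c]. *)
Lemma pow_le_cancel (x y c : R) : 0 <= x -> 0 <= y -> (forall n, x ^+ n <= c * y ^+ n) -> x <= y.
Proof.
move=> x0 y0 H; rewrite leNgt; apply/negP => yx.
have [y00|yp] := eqVneq y 0.
  by have := H 1%N; rewrite !expr1 y00 mulr0; move: yx; rewrite y00; lra.
have {}yp : 0 < y by rewrite lt_neqAle eq_sym yp.
pose d := x / y - 1.
have d0 : 0 < d by rewrite subr_gt0 ltr_pdivlMr// mul1r.
have B n : 1 + n%:R * d <= (x / y) ^+ n.
  elim: n => [|n IH]; first by rewrite mul0r addr0 expr0.
  have xy : x / y = 1 + d by rewrite /d; ring.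
  rewrite exprS {1}xy -natr1; apply: le_trans (_ : (1 + d) * (1 + n%:R * d) <= _).
    have : 0 <= (n%:R : R) by []. by nra.
  by rewrite ler_wpM2l// addr_ge0// ltW.
have L n : 1 + n%:R * d <= c.
  by apply: le_trans (B n) _; rewrite exprMn exprVn ler_pdivrMr ?exprn_gt0.
have := L (Num.truncn `|c / d|).+1.
have : c / d < (Num.truncn `|c / d|).+1%:R.
  by apply: le_lt_trans (ler_norm _) _; exact: truncnS_gt.
rewrite ltr_pdivrMr//; lra.
Qed.

Lemma holX U f n : hol U f -> hol U (fun z => f z ^+ n).
Proof. by move=> hf z /hf[l Dl]; eexists; exact: DgX Dl. Qed.

(* The constant [r / (r - |w - z0|)] of the Cauchy estimate disappears on
   applying it to the powers of [f]. *)
Lemma max_modulus_circ f z0 (r r' : R) w (M : R) : 0 < r -> r < r' ->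
  hol [set z | cabs (z - z0) < r'] f -> cabs (w - z0) < r ->
  (forall x, 0 <= x <= 1 -> cabs (f (circ z0 r x)) <= M) -> cabs (f w) <= M.
Proof.
move=> r0 rr hf wr le.
have M0 : 0 <= M by apply: le_trans (le 0 _); rewrite ?cabs_ge0 ?lexx ?ler01.
apply: (@pow_le_cancel _ _ (r / (r - cabs (w - z0)))); rewrite ?cabs_ge0// => n.
rewrite -cabsX mulrC; apply: (CIF_le r0 rr (@holX _ _ n hf) wr) => x x01.
by rewrite cabsX lerXn2r ?nnegrE ?cabs_ge0 ?le.
Qed.

Lemma max_modulus f z0 (r r' : R) w (M : R) : 0 < r -> r < r' ->
  hol [set z | cabs (z - z0) < r'] f -> cabs (w - z0) < r ->
  (forall z, cabs (z - z0) = r -> cabs (f z) <= M) -> cabs (f w) <= M.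
Proof.
move=> r0 rr hf wr le; apply: (max_modulus_circ r0 rr hf wr) => x _.
by apply: le; rewrite cabs_circ// ltW.
Qed.
End Cauchy.

(** * Zeros of holomorphic functions *)

Section Zeros.
Context {R : realType}.
Local Notation C := R[i].
Local Notation Re := complex.Re.
Local Notation Im := complex.Im.
Implicit Types (U V : set C) (f g : C -> C) (z w p : C) (r x t : R).

Lemma hol_cst U (c : C) : hol U (fun=> c).
Proof. by move=> z _; exists 0; exact: Dg_cst. Qed.
Lemma hol_id U : hol U id.
Proof. by move=> z _; exists 1; exact: cD_id. Qed.
Lemma holD U f g : hol U f -> hol U g -> hol U (fun z => f z + g z).
Proof. by move=> hf hg z Uz; have [l ?] := hf _ Uz; have [m ?] := hg _ Uz; exists (l + m); exact: DgD. Qed.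
Lemma holB U f g : hol U f -> hol U g -> hol U (fun z => f z - g z).
Proof. by move=> hf hg z Uz; have [l ?] := hf _ Uz; have [m ?] := hg _ Uz; exists (l - m); exact: DgB. Qed.
Lemma holM U f g : hol U f -> hol U g -> hol U (fun z => f z * g z).
Proof. by move=> hf hg z Uz; have [l Dl] := hf _ Uz; have [m Dm] := hg _ Uz; eexists; exact: DgM Dl Dm. Qed.
Lemma holV U f : hol U f -> (forall z, U z -> f z != 0) -> hol U (fun z => (f z)^-1).
Proof. by move=> hf nz z Uz; have [l ?] := hf _ Uz; eexists; apply: DgV; [eassumption|exact: nz]. Qed.
Lemma hol_prod U (I : Type) (s : seq I) (F : I -> C -> C) : (forall i, hol U (F i)) ->
  hol U (fun z => \prod_(i <- s) F i z).
Proof. by move=> hF z Uz; apply: Dg_prod => i; exact: hF. Qed.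
Lemma hol_subc U (c : C) : hol U (fun z => z - c).
Proof. exact: holB (@hol_id U) (@hol_cst U c). Qed.
Definition near0 f p := exists2 r : R, 0 < r & forall s, cabs (s - p) < r -> f s = 0.

(** If every power [(s - p) ^+ m] divides [f], the maximum principle on a circle of radius [r]
    bounds the quotient by [M / r ^+ m], so that [|f| <= M 2^-m] at distance less than [r / 2] for
    all [m]. Otherwise the largest dividing power leaves a cofactor that does not vanish at [p], by
    [hol_dd]. *)
Lemma zero_order U f p : opn U -> hol U f -> U p ->
  near0 f p \/ exists m g, [/\ hol U g, g p != 0 & forall s, f s = (s - p) ^+ m * g s].
Proof.
move=> oU hf Up.
pose dvd m := exists2 g, hol U g & forall s, f s = (s - p) ^+ m * g s.
have [all|nall] := pselect (forall m, dvd m); [left|right].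
  have [r r0 Hr] := opn_ball2 oU Up.
  have rr : r < 2 * r by lra.
  have hb : hol [set w | cabs (w - p) < 2 * r] f by exact: hol_sub Hr hf.
  have [M HM] := cont_on_bounded ler01 (cont_circ_f r0 rr hb).
  have M0 : 0 <= M by apply: le_trans (HM 0 _); rewrite ?cabs_ge0 ?lexx ?ler01.
  exists (r / 2); first by lra.
  move=> s sr; apply/eqP; rewrite -cabs_eq0 eq_le cabs_ge0 andbT.
  apply: (@le_small _ M) => m; have [g hg E] := all m.
  have gs : cabs (g s) <= M / r ^+ m.
    apply: (@max_modulus_circ _ g p r (2 * r)) => //.
    - exact: hol_sub Hr hg.
    - lra.
    - move=> x x01; rewrite ler_pdivlMr ?exprn_gt0//; have := HM x x01.
      by rewrite E cabsM cabsX cabs_circ ?(ltW r0)// mulrC.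
  rewrite E cabsM cabsX.
  apply: le_trans (_ : (r / 2) ^+ m * (M / r ^+ m) <= _).
    by rewrite ler_pM ?exprn_ge0 ?cabs_ge0// lerXn2r ?nnegrE ?cabs_ge0// ltW// divr_gt0.
  rewrite exprMn le_eqVlt; apply/orP; left; apply/eqP.
  have rn : r ^+ m != 0 by rewrite expf_neq0// gt_eqF.
  by move: rn; move: (r ^+ m) (2^-1 ^+ m) => A B A0; field.
have [m [dm ndm]] : exists m, dvd m /\ ~ dvd m.+1.
  apply: contrapT => h; apply: nall; elim=> [|m IH].
    by exists f => // s; rewrite expr0 mul1r.
  by apply: contrapT => ndm; apply: h; exists m.
case: dm => g hg E; exists m, g; split => //; apply/eqP => gp.
have [g' hg' E'] := hol_dd oU hg Up; apply: ndm; exists g' => // s.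
by rewrite E E' gp add0r exprSr mulrA.
Qed.

Lemma near0_cont f p : ccont f p -> f p != 0 ->
  exists2 r : R, 0 < r & forall s, cabs (s - p) < r -> f s != 0.
Proof.
move=> cf fp; have [r r0 H] := cont_nz cf fp; exists r => // s /H h.
by rewrite -cabs_gt0; apply: lt_trans h; rewrite divr_gt0 ?cabs_gt0.
Qed.

Lemma zero_isolated U f p : opn U -> hol U f -> U p -> ~ near0 f p ->
  exists2 r : R, 0 < r & forall s, cabs (s - p) < r -> s != p -> f s != 0.
Proof.
move=> oU hf Up n0; have [//|[m [g [hg gp E]]]] := zero_order oU hf Up.
have [r r0 H] := near0_cont (hol_cont hg Up) gp; exists r => // s sr sp.
by rewrite E mulf_neq0 ?H// expf_neq0// subr_eq0.
Qed.

(** The property [near0] is carried along a segment by [cousin]. Where it fails, the zeros are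
    isolated, so it also fails at all nearby points of the segment and the local implication is
    vacuous. *)
Lemma identity_thm U f a : opn U -> cvx U -> hol U f -> U a -> near0 f a ->
  forall b, U b -> near0 f b.
Proof.
move=> oU cU hf Ua fa b Ub.
pose ga (t : R) := a + t%:C * (b - a).
suff : near0 f (ga 0) -> near0 f (ga 1).
  by rewrite /ga mul0r mul1r addr0 [a + _]addrC subrK; apply.
apply: (@cousin R (fun u v => near0 f (ga u) -> near0 f (ga v)) 0 1 ler01).
  by move=> x y z h1 h2 /h1/h2.
move=> x x01; have Ug : U (ga x) := cU _ _ Ua Ub _ x01.
have cg : rcont ga x by exact: rD_cont (rD_affine a (b - a) x).
have [[r r0 H]|n0] := pselect (near0 f (ga x)).
  have [k k0 Hk] := cg _ r0; exists k => // u v _ _ xv _ _ vk _.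
  have gv : cabs (ga v - ga x) < r by apply: Hk; rewrite /dR ltr_norml; lra.
  exists (r - cabs (ga v - ga x)); first by lra.
  by move=> s sv; apply: H; have := cabs_leD s (ga v) (ga x); lra.
have [r r0 H] := zero_isolated oU hf Ug n0.
have [k k0 Hk] := cg _ r0; exists k => // u v _ ux _ _ uk _ [e e0 He].
exfalso; have gu : cabs (ga u - ga x) < r by apply: Hk; rewrite /dR ltr_norml; lra.
have [E|ne] := eqVneq (ga u) (ga x).
  by apply: n0; rewrite -E; exists e.
have := H _ gu ne; rewrite He ?eqxx//; by rewrite subrr cabs0.
Qed.

Definition rect (a b c d : R) : set C :=
  [set z | a <= Re z <= b /\ c <= Im z <= d].

Lemma cabs_lt_ReIm z (k : R) : `|Re z| < k / 2 -> `|Im z| < k / 2 -> cabs z < k.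
Proof. by move=> h1 h2; apply: le_lt_trans (cabs_le_ReIm z) _; lra. Qed.

(** Two nested applications of [cousin]: the inner one covers a vertical segment, with a common
    width, by discs containing at most one zero; the outer one moves that segment across the
    rectangle. *)
Lemma finite_zeros U f (a b c d : R) : opn U -> hol U f ->
  (forall p, U p -> ~ near0 f p) -> a <= b -> c <= d -> rect a b c d `<=` U ->
  exists l : seq C, forall z, rect a b c d z -> f z = 0 -> z \in l.
Proof.
move=> oU hf n0 ab cd sub.
suff : exists l : seq C, forall z, a <= Re z <= b -> c <= Im z <= d -> f z = 0 -> z \in l.
  by move=> [l H]; exists l => z [h1 h2]; exact: H.
apply: (@cousin R (fun u v => exists l : seq C, forall z, u <= Re z <= v ->
  c <= Im z <= d -> f z = 0 -> z \in l) a b ab).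
  move=> u v w [l Hl] [l' Hl']; exists (l ++ l') => z /andP[h1 h2] h3 h4.
  rewrite mem_cat; have [h|h] := leP (Re z) v; first by rewrite Hl ?h1.
  by rewrite (Hl' z) ?orbT// h2 ltW.
move=> x xab.
have [k k0 [l Hl]] : exists2 k : R, 0 < k & exists l : seq C, forall z,
    `|Re z - x| < k -> c <= Im z <= d -> f z = 0 -> z \in l.
  apply: (@cousin R (fun u v => exists2 k : R, 0 < k & exists l : seq C, forall z,
    `|Re z - x| < k -> u <= Im z <= v -> f z = 0 -> z \in l) c d cd).
    move=> u v w [k k0 [l Hl]] [k' k'0 [l' Hl']].
    exists (Num.min k k'); first by rewrite lt_min k0.
    exists (l ++ l') => z; rewrite lt_min => /andP[z1 z2] /andP[h1 h2] h4.
    rewrite mem_cat; have [h|h] := leP (Im z) v; first by rewrite Hl ?h1.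
    by rewrite (Hl' z) ?orbT// h2 ltW.
  move=> y ycd; have Up : U (x +i* y) by apply: sub.
  have [r r0 H] := zero_isolated oU hf Up (n0 _ Up).
  exists (r / 2); first by lra.
  move=> u v _ uy yv _ h1 h2; exists (r / 2); first by lra.
  exists [:: x +i* y] => z zx /andP[z1 z2] fz; rewrite inE.
  apply/negPn/negP => zp; have := H z _ zp; rewrite fz eqxx => /(_ _)/negP; apply => //.
  by apply: cabs_lt_ReIm; rewrite ?ReB ?ImB //= ltr_norml; lra.
exists k => // u v _ ux xv _ h1 h2; exists l => z /andP[z1 z2] h3 h4.
by apply: Hl => //; rewrite ltr_norml; lra.
Qed.

(** Points of [l] at which [f] does not vanish have order 0 and contribute nothing to [zs]. A zero
    is repeated in [zs] according to its multiplicity, as its order is divided out when it is first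
    met. *)
Lemma factor_list U f (l : seq C) : opn U -> hol U f ->
  (forall p, U p -> ~ near0 f p) -> (forall z, z \in l -> U z) ->
  exists zs : seq C, exists H, [/\ hol U H,
    forall s, f s = (\prod_(z <- zs) (s - z)) * H s,
    forall z, z \in l -> H z != 0 & forall z, z \in zs -> z \in l].
Proof.
move=> oU; elim: l f => [|p l IH] f hf n0 lU.
  by exists [::], f; split => // s; rewrite big_nil mul1r.
have Up : U p by apply: lU; rewrite mem_head.
have [/(n0 _ Up)//|[m [g [hg gp E]]]] := zero_order oU hf Up.
have g0 q : U q -> ~ near0 g q.
  move=> Uq [r r0 H]; apply: (n0 _ Uq); exists r => // s sr.
  by rewrite E H ?mulr0.
have lU' z : z \in l -> U z by move=> zl; apply: lU; rewrite inE zl orbT.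
have [zs [H [hH EH Hl zsl]]] := IH g hg g0 lU'.
exists (nseq m p ++ zs), H; split => //.
- move=> s; rewrite E EH mulrA; congr (_ * _); rewrite big_cat /=; congr (_ * _).
  by elim: (m) => [|n IHn] /=; rewrite ?big_nil ?expr0// big_cons exprS IHn.
- move=> z; rewrite inE => /predU1P[->|/Hl//].
  by apply: contraNneq gp => Hp; rewrite EH Hp mulr0.
- by move=> z; rewrite mem_cat mem_nseq inE => /orP[/andP[_ ->]//|/zsl ->]; rewrite orbT.
Qed.

(** * Logarithms *)

(** The quantity [|z| + Re z] vanishes exactly on the closed negative real axis, and it is the
    denominator in [clog]. *)
Definition off_slit z := 0 < cabs z + Re z.

(* Half-angle formula: off the negative real axis, twice the arctangent is the principal
   argument. *)
Definition clog z : C := ln (cabs z) +i* (2 * atan (Im z / (cabs z + Re z))).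

Lemma off_slit_neq0 z : off_slit z -> z != 0.
Proof. by rewrite /off_slit => h; apply/eqP => z0; move: h; rewrite z0 cabs0 /= addr0 ltxx. Qed.

Lemma Re_gt0_off_slit z : 0 < Re z -> off_slit z.
Proof. by move=> h; rewrite /off_slit ltr_wpDl ?cabs_ge0. Qed.

Lemma Im_neq0_off_slit z : Im z != 0 -> off_slit z.
Proof.
move=> h; rewrite /off_slit -ltrBlDr sub0r.
apply: le_lt_trans (ler_norm _) _; rewrite normrN cabsE -sqrtr_sqr ltr_sqrt.
  by rewrite ltrDl exprn_even_gt0.
by rewrite ltr_pwDr ?sqr_ge0// exprn_even_gt0.
Qed.

Lemma cexp_clog z : off_slit z -> cexp (clog z) = z.
Proof.
move=> s; have z0 := off_slit_neq0 s.
have r0 : 0 < cabs z by rewrite cabs_gt0.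
rewrite /cexp /clog /= lnK ?posrE//.
set a := atan _; have ca : 0 < cos a by apply: cos_gt0_pihalf; rewrite atan_gtNpi2 atan_ltpi2.
have ta : tan a = Im z / (cabs z + Re z) by rewrite /a atanK.
(* The half-angle identity: [cos^2] of half the argument is [(1 + Re z / |z|) / 2]. Double-angle
   formulas then recover the argument itself. *)
have c2 : cos a ^+ 2 = (cabs z + Re z) / (2 * cabs z).
  have : (cos a ^+ 2)^-1 = 1 + tan a ^+ 2.
    by rewrite /tan -[1](divff (expf_neq0 2 (lt0r_neq0 ca))) expr_div_n -mulrDl cos2Dsin2 mul1r.
  rewrite ta => /(congr1 (fun x => x^-1)); rewrite invrK => ->.
  have E : Im z ^+ 2 = cabs z ^+ 2 - Re z ^+ 2 by rewrite cabs_sqr; ring.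
  have n1 : cabs z + Re z != 0 by rewrite gt_eqF.
  have n2 : cabs z != 0 by rewrite gt_eqF.
  rewrite expr_div_n E.
  have n3 : (cabs z + Re z) ^+ 2 + (cabs z ^+ 2 - Re z ^+ 2) != 0.
    rewrite (_ : _ + _ = 2 * cabs z * (cabs z + Re z)); last by ring.
    by rewrite !mulf_neq0.
  by field; rewrite n1 n2 n3.
have s1 : sin a = tan a * cos a by rewrite /tan divfK// gt_eqF.
have n1 : cabs z + Re z != 0 by rewrite gt_eqF.
have n2 : cabs z != 0 by rewrite gt_eqF.
rewrite mulr_natl mulr2n cosD sinD.
rewrite (_ : cos a * cos a - sin a * sin a = Re z / cabs z); last first.
  have -> : sin a * sin a = 1 - cos a ^+ 2 by rewrite -(cos2Dsin2 a); ring.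
  by rewrite -expr2 c2; field.
rewrite (_ : sin a * cos a + cos a * sin a = Im z / cabs z); last first.
  rewrite s1 (_ : _ + _ = 2 * tan a * cos a ^+ 2); last by ring.
  by rewrite c2 ta; field; rewrite n1 n2.
by apply: complex_ext; rewrite ?Re_realM ?Im_realM /= mulrCA mulfV// mulr1.
Qed.

Lemma cont_real_fun X d (g : R -> R) (f : X -> R) u :
  {for f u, continuous g} -> cont d (fun y => (f y)%:C) u ->
  cont d (fun y => (g (f y))%:C) u.
Proof.
by move=> cg cf; apply: (@cont_comp_R _ _ _ (fun t => (g t)%:C) f) => //; apply/rcont_real_cont.
Qed.

Lemma ccont_cabs z : ccont (fun w => (cabs w)%:C) z.
Proof.
move=> e e0; exists e => // y; rewrite /dC => h; apply: le_lt_trans h.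
rewrite -rmorphB cabs_real ler_norml.
have := cabs_leD y z 0; have := cabs_leD z y 0; rewrite !subr0 (cabsB z y); lra.
Qed.

Lemma ccont_Re z : ccont (fun w => (Re w)%:C) z.
Proof.
move=> e e0; exists e => // y; rewrite /dC => h; apply: le_lt_trans h.
by rewrite -rmorphB cabs_real -ReB Re_le_cabs.
Qed.

Lemma ccont_Im z : ccont (fun w => (Im w)%:C) z.
Proof.
move=> e e0; exists e => // y; rewrite /dC => h; apply: le_lt_trans h.
by rewrite -rmorphB cabs_real -ImB Im_le_cabs.
Qed.

Lemma ccont_clog z : off_slit z -> ccont clog z.
Proof.
move=> s; have z0 := off_slit_neq0 s.
have r0 : 0 < cabs z by rewrite cabs_gt0.
have c1 : ccont (fun w => (ln (cabs w))%:C) z.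
  by apply: cont_real_fun (ccont_cabs z); exact: continuous_ln.
have c2 : ccont (fun w => (atan (Im w / (cabs w + Re w)))%:C) z.
  apply: cont_real_fun; first exact: continuous_atan.
  apply: (@cont_ext _ _ _ (fun w => (Im w)%:C / ((cabs w)%:C + (Re w)%:C))).
    by move=> y; rewrite -rmorphD -fmorphV -rmorphM.
  apply: contM (ccont_Im z) _; apply: contV.
    exact: contD (ccont_cabs z) (ccont_Re z).
  by rewrite -rmorphD fmorph_eq0 gt_eqF.
apply: cont_ext (contD c1 (contM (cont_cst _ (2 * 'i) z) c2)) => y.
by rewrite /clog; apply: complex_ext; rewrite ?ReD ?ImD -complexiE /=; ring.
Qed.

Lemma off_slit_near z : off_slit z -> exists2 r : R, 0 < r &
  forall w, cabs (w - z) < r -> off_slit w.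
Proof.
move=> s; exists ((cabs z + Re z) / 2); first by rewrite divr_gt0.
move=> w h; rewrite /off_slit.
have := cabs_leD z w 0; have := Re_le_cabs (w - z); rewrite !subr0 ReB (cabsB z w).
rewrite ler_norml; lra.
Qed.

(** The slope of an inverse function is the reciprocal of the slope of [cexp], taken at [clog w]; it
    is continuous because [clog] is already known to be. *)
Lemma cD_clog z : off_slit z -> cD clog z z^-1.
Proof.
move=> s; have z0 := off_slit_neq0 s.
have [q [k k0 [cq ql fq]]] := cD_cexp (clog z).
have cl := ccont_clog s.
have cqc : ccont (fun w => q (clog w)) z by apply: cont_comp cl.
have qz : q (clog z) = z by rewrite ql cexp_clog.
have [r1 r10 H1] := off_slit_near s.
have [r2 r20 H2] := cl _ k0.
have qz0 : q (clog z) != 0 by rewrite qz.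
have [r3 r30 H3] := near0_cont cqc qz0.
exists (fun w => (q (clog w))^-1), (Num.min r1 (Num.min r2 r3)).
  by rewrite !lt_min r10 r20.
split; [|by rewrite qz|] => [|y].
  by apply: contV => //; rewrite qz.
rewrite !lt_min => /andP[y1 /andP[y2 y3]].
have := fq (clog y) (H2 _ y2); rewrite !cexp_clog//; last exact: H1.
move=> E; have qy := H3 _ y3.
have E' : y - z = (clog y - clog z) * q (clog y) by rewrite {1}E addrAC subrr add0r.
by rewrite /= E' mulfK// addrC subrK.
Qed.

Lemma cexp_surj z : z != 0 -> exists w, cexp w = z.
Proof.
move=> z0; have [s|ns] := boolP (off_slit z); first by exists (clog z); rewrite cexp_clog.
have i0 : Im z = 0 by apply/eqP; apply: contraNT ns => /Im_neq0_off_slit.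
have r0 : Re z < 0.
  rewrite ltNge; apply: contraNN ns; rewrite le_eqVlt => /predU1P[r0|/Re_gt0_off_slit//].
  by case/eqP: z0; apply: complex_ext.
exists ((ln (- Re z)) +i* pi); rewrite /cexp /= lnK ?posrE ?oppr_gt0//.
by rewrite cospi sinpi; apply: complex_ext; rewrite ?Re_realM ?Im_realM /= ?i0; ring.
Qed.

(** With [G] a primitive of [f' / f], the product [f * exp(- G)] has derivative zero, and a
    logarithm of its constant value is added to [G]. *)
Lemma log_convex U f : opn U -> cvx U -> hol U f -> (forall z, U z -> f z != 0) ->
  exists2 g, hol U g & forall z, U z -> cexp (g z) = f z.
Proof.
move=> oU cU hf nz.
have [[z0 U0]|nU] := pselect (exists z, U z); last first.
  by exists (fun=> 0) => z Uz; case: nU; exists z.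
have [G DG] := hol_prim oU cU (holM (hol_dv oU hf) (holV hf nz)).
pose k z := f z * cexp (- G z).
have Dk z : U z -> cD k z 0.
  move=> Uz; have fz := nz _ Uz.
  apply: Dg_eq (DgM (hol_dvP hf Uz) (Dg_cexp (DgN (DG _ Uz)))).
  by field.
have kE z : U z -> k z = k z0.
  move=> Uz.
  have H t : 0 <= t <= 1 -> rD (fun t => k (z0 + t%:C * (z - z0))) t 0.
    by move=> t01; apply: Dg_eq (cD_line (Dk _ (cU _ _ U0 Uz t t01))); exact: mul0r.
  have := @rD0_const R (fun t => k (z0 + t%:C * (z - z0))) 0 1 ler01.
  rewrite mul1r mul0r addr0 [z0 + _]addrC subrK; apply.
  - by move=> t /H/rD_cont.
  - by move=> t /andP[t0 t1]; apply: H; rewrite !ltW.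
have k0 : k z0 != 0 by rewrite mulf_neq0 ?nz// cexp_neq0.
have [c cE] := cexp_surj k0.
exists (fun z => G z + c).
  by apply: holD (@hol_cst _ c) => z Uz; eexists; exact: DG.
by move=> z Uz; rewrite cexpD cE -(kE z Uz) /k mulrCA -cexpD addrN cexp0 mulr1.
Qed.

Lemma rD_increment_eq (f g f' g' : R -> C) (a b : R) : a <= b ->
  (forall t, a <= t <= b -> rD f t (f' t)) -> (forall t, a <= t <= b -> rD g t (g' t)) ->
  (forall t, a < t < b -> f' t = g' t) -> f b - f a = g b - g a.
Proof.
move=> ab Df Dg E.
have := @rD0_const R (fun t => f t - g t) a b ab.
have H : cont_on a b (fun t => f t - g t).
  by move=> t tab; exact: contB (rD_cont (Df _ tab)) (rD_cont (Dg _ tab)).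
move=> /(_ H) h; have {}h : f b - g b = f a - g a.
  apply: h => t tab; have tab' : a <= t <= b by case/andP: tab => ? ?; rewrite !ltW.
  by apply: Dg_eq (DgB (Df _ tab') (Dg _ tab')); rewrite E// subrr.
by move/eqP: h; rewrite subr_eq => /eqP ->; ring.
Qed.

(** * Borel-Caratheodory and Weierstrass *)

(** The map [u / (2 A - u)] sends the half-plane [Re u <= A] into the unit disc and fixes 0.
    Schwarz's lemma, as the maximum principle for [ph] divided by [z - z0] on the circle of radius
    [r1], gives [|ph| <= r / r1], and the map is then inverted. *)
Lemma borel_caratheodory g z0 (r r1 r2 A : R) z : 0 < A -> 0 < r -> r < r1 -> r1 < r2 ->
  hol [set z | cabs (z - z0) < r2] g -> g z0 = 0 ->
  (forall z, cabs (z - z0) < r2 -> Re (g z) <= A) -> cabs (z - z0) <= r ->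
  cabs (g z) <= 2 * A * r / (r1 - r).
Proof.
move=> A0 r0 rr1 r12 hg g0 le zr.
set B := [set z | cabs (z - z0) < r2] in hg.
have ReA z' : B z' -> A <= Re ((2 * A)%:C - g z').
  by move=> h; have := le _ h; rewrite ReB /=; lra.
have nz z' : B z' -> (2 * A)%:C - g z' != 0.
  by move=> /ReA h; apply/eqP => e; move: h; rewrite e /=; lra.
pose ph z' := g z' / ((2 * A)%:C - g z').
have hph : hol B ph.
  by apply: holM => //; apply: holV => //; apply: holB hg; exact: hol_cst.
have ph1 z' : B z' -> cabs (ph z') <= 1.
  move=> Bz; rewrite cabsM cabsV ler_pdivrMr ?cabs_gt0 ?nz// mul1r.
  rewrite -ler_sqr ?nnegrE ?cabs_ge0// !cabs_sqr ReB ImB /=.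
  by have := le _ Bz; nra.
have Bz0 : B z0 by rewrite /B /= subrr cabs0; lra.
have [ps hps E] := hol_dd (@opn_ball _ z0 r2) hph Bz0.
have ph0 : ph z0 = 0 by rewrite /ph g0 mul0r.
have r10 : 0 < r1 by lra.
have psz : cabs (ps z) <= r1^-1.
  apply: (max_modulus r10 r12 hps); first by lra.
  move=> y yr; have := ph1 y; rewrite E ph0 add0r cabsM yr => h.
  by rewrite -[r1^-1]mul1r ler_pdivlMr// mulrC h// /B /= yr.
have phz : cabs (ph z) <= r / r1.
  rewrite E ph0 add0r cabsM ler_pM ?cabs_ge0//.
have Bz : B z by rewrite /B /=; lra.
have Eg : g z * (1 + ph z) = (2 * A)%:C * ph z.
  by move: (nz _ Bz); rewrite /ph; move: ((2 * A)%:C) (g z) => c u n; field.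
have q1 : r / r1 < 1 by rewrite ltr_pdivrMr// mul1r.
have h1 : 1 - r / r1 <= cabs (1 + ph z).
  by have := cabs_ge_sub 1 (ph z); rewrite cabs1; lra.
have := congr1 (@cabs R) Eg; rewrite cabsM [cabs (_%:C * _)]cabsM cabs_real gtr0_norm; last by lra.
move=> E2.
have h2 : cabs (g z) * (1 - r / r1) <= 2 * A * (r / r1).
  apply: le_trans (_ : cabs (g z) * cabs (1 + ph z) <= _).
    by rewrite ler_wpM2l ?cabs_ge0.
  by rewrite E2 ler_wpM2l//; lra.
have d0 : 0 < r1 - r by lra.
rewrite ler_pdivlMr//.
have := ler_wpM2r (ltW r10) h2.
rewrite (_ : _ * r1 = cabs (g z) * (r1 - r)); last by field; rewrite gt_eqF.
by rewrite (_ : 2 * A * (r / r1) * r1 = 2 * A * r)//; field; rewrite gt_eqF.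
Qed.

(** Cauchy's formula on the circle of radius [r] passes to the uniform limit, and a Cauchy integral
    of a continuous density is differentiable by [kernel1_D]. *)
Lemma weierstrass (fn : nat -> C -> C) f z0 (r : R) : 0 < r ->
  (forall n, hol [set z | cabs (z - z0) < 2 * r] (fn n)) ->
  (forall e : R, 0 < e -> exists n, forall z, cabs (z - z0) < 2 * r -> cabs (fn n z - f z) <= e) ->
  exists l, cD f z0 l.
Proof.
move=> r0 hfn un.
set B := [set z | cabs (z - z0) < 2 * r] in hfn.
have rr : r < 2 * r by lra.
have cf z : B z -> ccont f z.
  move=> Bz e e0; have e4 : 0 < e / 4 by lra.
  have [n Hn] := un _ e4; have [k k0 Hk] := hol_cont (hfn n) Bz e4.
  have [k' k'0 Hk'] := @opn_ball _ z0 (2 * r) z Bz.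
  exists (Num.min k k'); first by rewrite lt_min k0.
  move=> y; rewrite lt_min => /andP[y1 y2].
  have := Hn _ Bz; have := Hn _ (Hk' _ y2); have := Hk _ y1.
  rewrite (cabsB _ (f y)).
  have := cabs_leD (f y) (fn n y) (f z); have := cabs_leD (fn n y) (fn n z) (f z); lra.
have Bc x : B (circ z0 r x) by rewrite /B /= cabs_circ// ltW.
have cphi : cont_on 0 1 (fun x => f (circ z0 r x) * dcirc r x).
  move=> x x01; apply: contM (rcont_dcirc _ x01); apply: cont_comp (rcont_circ _ _ x01).
  exact: cf.
have nz w x : cabs (w - z0) < r -> circ z0 r x - w != 0.
  by move=> wr; rewrite -cabs_gt0; apply: lt_le_trans (circ_far _ _ _ (ltW r0)); lra.
have cinv w : cabs (w - z0) < r -> cont_on 0 1 (fun x => (circ z0 r x - w)^-1).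
  move=> wr x x01; apply: contV; last exact: nz.
  exact: contB (rcont_circ _ _ x01) (cont_cst _ _ _).
have cif w : cabs (w - z0) < r ->
    twopii * f w = cint (fun x => f (circ z0 r x) * dcirc r x / (circ z0 r x - w)).
  move=> wr; apply/eqP; rewrite -subr_eq0 -cabs_eq0 eq_le cabs_ge0 andbT.
  have [M HM] := cont_on_bounded ler01 (fun x x01 => contM (rcont_dcirc r x01) (cinv w wr x x01)).
  have M0 : 0 <= M by apply: le_trans (HM 0 _); rewrite ?cabs_ge0 ?lexx ?ler01.
  set K := cabs twopii + M + 1 : R.
  have K0 : 0 < K by rewrite /K; have := cabs_ge0 (twopii : C); lra.
  apply/ler_addgt0Pl => e e0; rewrite addr0.
  have [n Hn] := un _ (divr_gt0 e0 K0).
  have Bw : B w by rewrite /B /=; lra.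
  have En := CIF r0 rr (hfn n) wr.
  rewrite (_ : twopii * f w - _ = (twopii * f w - twopii * fn n w) + (twopii * fn n w -
    cint (fun x => f (circ z0 r x) * dcirc r x / (circ z0 r x - w)))); last by ring.
  apply: le_trans (cabsD _ _) _.
  have h1 : cabs (twopii * f w - twopii * fn n w) <= cabs (twopii : C) * (e / K).
    by rewrite -mulrBr cabsM ler_wpM2l ?cabs_ge0// cabsB Hn.
  have h2 : cabs (twopii * fn n w -
    cint (fun x => f (circ z0 r x) * dcirc r x / (circ z0 r x - w))) <= e / K * M.
    rewrite En -cintB; first last.
    - by move=> x x01; exact: contM (cphi _ x01) (cinv _ wr _ x01).
    - move=> x x01; apply: contM (cinv _ wr _ x01).
      exact: contM (cont_circ_f r0 rr (hfn n) x01) (rcont_dcirc _ x01).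
    apply: cint_le.
      move=> x x01; apply: contB; last exact: contM (cphi _ x01) (cinv _ wr _ x01).
      apply: contM (cinv _ wr _ x01).
      exact: contM (cont_circ_f r0 rr (hfn n) x01) (rcont_dcirc _ x01).
    move=> x x01.
    rewrite (_ : _ - _ = (fn n (circ z0 r x) - f (circ z0 r x)) * (dcirc r x / (circ z0 r x - w))); last by ring.
    by rewrite cabsM; apply: ler_pM; rewrite ?cabs_ge0//; [apply: Hn; exact: Bc|exact: HM].
  apply: le_trans (lerD h1 h2) _.
  have -> : cabs twopii * (e / K) + e / K * M = (cabs twopii + M) * (e / K) by ring.
  apply: le_trans (_ : K * (e / K) <= _); last by rewrite mulrCA mulfV ?mulr1// gt_eqF.
  by rewrite ler_wpM2r ?divr_ge0 ?(ltW e0) ?(ltW K0)// /K lerDl.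
have zz : 0 < r - cabs (z0 - z0) by rewrite subrr cabs0 subr0.
have D := kernel1_D zz cphi (@rcont_circ _ z0 r) (fun x _ => circ_far z0 z0 x (ltW r0)).
eexists; apply: (@Dg_near _ _ id _ _ _ _ r r0 _ (DgZ twopii^-1 D)) => y yr /=.
by rewrite -cif// mulKf ?twopii_neq0.
Qed.
End Zeros.

(** * Complex limits and derivatives of the statement in terms of the real modulus *)

Section Zeta.
Context {R : realType}.
Local Notation C := R[i].
Local Notation Re := complex.Re.
Local Notation Im := complex.Im.
Implicit Types (U V : set C) (f g : C -> C) (z w s : C) (r x t : R).

Lemma norm_cabs (z : R[i]^o) : `|z| = (cabs z)%:C.
Proof. by rewrite [LHS](@normc_def _ z) -cabsE. Qed.

Lemma gt0_complex (e : C) : 0 < e -> e = (Re e)%:C /\ 0 < Re e.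
Proof. by case: e => a b; rewrite ltcE /= => /andP[/eqP -> ->]. Qed.

Lemma cvgn_cabs (u : nat -> R[i]^o) (l : R[i]^o) : u @ \oo --> l ->
  forall e : R, 0 < e -> exists N, forall n, (N <= n)%N -> cabs (u n - l) < e.
Proof.
move=> /cvgrPdist_lt H e e0.
have e1 : 0 < e%:C :> R[i] by rewrite ltcR.
have [N _ HN] := H _ e1; exists N => n Nn.
by have := HN n Nn; rewrite /= norm_cabs ltcR cabsB.
Qed.

Lemma cD_cderivable f s : (exists l, cD f s l) <-> cderivable f s.
Proof.
split.
- move=> [l [q [k k0 [cq ql fq]]]]; apply/cvg_ex; exists (l : R[i]^o).
  apply/cvgrPdist_lt => e /gt0_complex[-> e0].
  have [k1 k10 H] := cq _ e0.
  have km : 0 < (Num.min k k1)%:C :> R[i] by rewrite ltcR lt_min k0.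
  apply/nbhs_ballP; exists (Num.min k k1)%:C => // h /=.
  rewrite /ball /= sub0r normrN norm_cabs ltcR lt_min => /andP[hk hk1] h0.
  have E : cabs (h + s - s) = cabs h by rewrite addrK.
  rewrite norm_cabs ltcR /GRing.scale /= mulr1 fq ?E//.
  rewrite addrAC subrr add0r addrK mulrA mulVf// mul1r cabsB -ql.
  by apply: H; rewrite E.
- move=> /cvg_ex[l /cvgrPdist_lt H]; exists l.
  pose q z := if z == s then l else (f z - f s) / (z - s).
  exists q, 1 => //; split; last first.
  + move=> y _; rewrite /q; case: eqP => [->|/eqP ys]; first by rewrite subrr mul0r addr0.
    by rewrite mulrC divfK ?subr_eq0// addrC subrK.
  + by rewrite /q eqxx.
  + move=> e e0; have e1 : 0 < e%:C :> R[i] by rewrite ltcR.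
    have /nbhs_ballP [d /= /gt0_complex[dE d0] K] := H _ e1.
    exists (Re d) => // y /= yd; rewrite /q eqxx.
    have [_|ys] := eqVneq y s; first by rewrite subrr cabs0.
    have := K (y - s); rewrite /ball /= sub0r normrN norm_cabs dE ltcR => /(_ yd).
    rewrite subr_eq0 => /(_ ys); rewrite norm_cabs ltcR /GRing.scale /= mulr1 subrK.
    by rewrite cabsB mulrC.
Qed.

(** * Analytic continuation of zeta *)

(** These are the powers [x^(-s)] and [x^(-a)], with the minus sign built in. *)
Definition cpw (x : R) (s : C) : C := cexp (- (s * (ln x)%:C)).
Definition rpw (a x : R) : R := expR (- (a * ln x)).

Lemma cabs_cpw x s : cabs (cpw x s) = rpw (Re s) x.
Proof. by rewrite cabs_cexp ReN mulrC Re_realM mulrC. Qed.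

Lemma cpw1 s : cpw 1 s = 1.
Proof. by rewrite /cpw ln1 rmorph0 mulr0 oppr0 cexp0. Qed.

Lemma cpwM x y s : 0 < x -> 0 < y -> cpw (x * y) s = cpw x s * cpw y s.
Proof. by move=> x0 y0; rewrite /cpw lnM ?posrE// -cexpD; congr cexp; ring. Qed.

Lemma cpw_sub1 x s : 0 < x -> cpw x (s - 1) = x%:C * cpw x s.
Proof.
move=> x0; rewrite /cpw (_ : - ((s - 1) * _) = (ln x)%:C + - (s * (ln x)%:C)); last by ring.
by rewrite cexpD; congr (_ * _); rewrite /cexp /= lnK ?posrE// cos0 sin0; simpc.
Qed.

Lemma rD_cpw x s : 0 < x -> rD (fun x => cpw x s) x (- s * cpw x s / x%:C).
Proof.
move=> x0.
have D : rD (fun x => (ln x)%:C) x (x^-1)%:C by apply/rD_realP; exact: is_derive1_ln.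
apply: Dg_eq (Dg_cexp (DgN (DgZ s D))).
by rewrite fmorphV -/(cpw x s) /=; ring.
Qed.

Lemma rpwD (a b x : R) : rpw (a + b) x = rpw a x * rpw b x.
Proof. by rewrite /rpw -expRD; congr expR; ring. Qed.

Lemma rpw1x x : 0 < x -> rpw 1 x = x^-1.
Proof. by move=> x0; rewrite /rpw mul1r expRN lnK ?posrE. Qed.

Lemma rpw_split (a b x : R) : rpw a x = rpw b x * rpw (a - b) x.
Proof. by rewrite -rpwD addrC subrK. Qed.

Lemma is_derive_rpw a x : 0 < x -> is_derive x 1 (rpw a) (- a * rpw (a + 1) x).
Proof.
move=> x0; apply/rD_realP.
have D : rD (fun x => (- (a * ln x))%:C) x (- (a * x^-1))%:C.
  have D : rD (fun x => (ln x)%:C) x (x^-1)%:C by apply/rD_realP; exact: is_derive1_ln.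
  by apply: Dg_ext (Dg_eq _ (DgN (DgZ a%:C D))) => [y|]; rewrite ?rmorphN ?rmorphM.
apply: Dg_eq (Dg_comp_real (is_derive_expR _) D); rewrite -rmorphM; congr (_%:C).
by rewrite rpwD rpw1x// /rpw; ring.
Qed.

Lemma rpw_gt0 a x : 0 < rpw a x. Proof. exact: expR_gt0. Qed.

Lemma rpw_le a (x y : R) : 0 <= a -> 0 < x -> x <= y -> rpw a y <= rpw a x.
Proof.
by move=> a0 x0 xy; rewrite ler_expR lerN2 ler_wpM2l// ler_ln ?posrE//; apply: lt_le_trans xy.
Qed.

Lemma rpw_le_exp (a b x : R) : a <= b -> 1 <= x -> rpw b x <= rpw a x.
Proof. by move=> ab x1; rewrite ler_expR lerN2 ler_wpM2r// ln_ge0. Qed.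

Lemma rpwM a (x y : R) : 0 < x -> 0 < y -> rpw a (x * y) = rpw a x * rpw a y.
Proof. by move=> x0 y0; rewrite /rpw lnM ?posrE// -expRD; congr expR; ring. Qed.

Lemma rpw2x x : 0 < x -> rpw 2 x = x ^- 2.
Proof. by move=> x0; rewrite (_ : 2 = 1 + 1)// rpwD rpw1x// expr2 invfM. Qed.

(** The mean value theorem for [x^(-a)]; this is the integral test in telescoping form. *)
Lemma rpw_step (a x : R) : 0 < a -> 1 <= x ->
  a * rpw (a + 1) (x + 1) <= rpw a x - rpw a (x + 1).
Proof.
move=> a0 x1; have xx : x < x + 1 by lra.
have D y : x <= y <= x + 1 -> is_derive y 1 (rpw a) (- a * rpw (a + 1) y).
  by move=> h; apply: is_derive_rpw; lra.
have D1 y : y \in `]x, x + 1[ -> is_derive y 1 (rpw a) (- a * rpw (a + 1) y).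
  by rewrite in_itv /= => /andP[h1 h2]; apply: D; lra.
have D2 : {within `[x, x + 1], continuous (rpw a)}.
  by apply: rcont_within => y /D /rD_realP; exact: rD_cont.
have [c] := MVT xx D1 D2.
rewrite in_itv /= => /andP[c1 c2] E.
have -> : rpw a x - rpw a (x + 1) = a * rpw (a + 1) c by move: E; rewrite addrAC subrr add0r mulr1; lra.
by rewrite ler_pM2l//; apply: rpw_le; lra.
Qed.

Lemma small_rpw (a e : R) : 0 < a -> 0 < e -> exists N, forall n, (N <= n)%N -> rpw a n.+1%:R < e.
Proof.
move=> a0 e0; have [N HN] : exists N : nat, expR (- ln e / a) < N%:R.
  by exists (Num.truncn (expR (- ln e / a))).+1; exact: truncnS_gt.
exists N => n Nn; rewrite /rpw -[e]lnK ?posrE// ltr_expR.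
have h : - ln e / a < ln n.+1%:R.
  rewrite -[X in X < _]expRK ltr_ln ?posrE ?expR_gt0//.
  by apply: lt_le_trans HN _; rewrite ler_nat ltnW.
by move: h; rewrite ltr_pdivrMr// mulrC; lra.
Qed.

(* Telescoping the powers [n^(1-s)] against the Dirichlet series gives
   [(s - 1) zeta(s) = 1 + sum_k bt k s], which converges for [Re s > 0]. *)
Definition bt (k : nat) (s : C) : C :=
  (s - 1) * cpw k.+1%:R s + cpw k.+2%:R (s - 1) - cpw k.+1%:R (s - 1).

(** The term [bt k s] is [(s - 1)] times the integral of [n^(-s) - x^(-s)] over [n <= x <= n + 1],
    with [n = k + 1]. One mean value estimate bounds the integrand, a second one the increment of
    its primitive [ph]. *)
Lemma cabs_bt k s : 0 <= Re s -> cabs (bt k s) <= cabs (s - 1) * cabs s * rpw (Re s + 1) k.+1%:R.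
Proof.
move=> s0; set n : R := k.+1%:R.
have n0 : 0 < n by [].
have nS : k.+2%:R = n + 1 :> R by rewrite natr1.
have step x : n <= x <= n + 1 -> cabs (cpw x s - cpw n s) <= cabs s * rpw (Re s + 1) n * (x - n).
  move=> /andP[nx xn].
  apply: (@mvt_cst R (fun x => cpw x s) (fun x => - s * cpw x s / x%:C)) => //.
  - by move=> y /andP[y1 _]; apply: rD_cont (rD_cpw _ _); lra.
  - by move=> y /andP[y1 _]; apply: rD_cpw; lra.
  - move=> y /andP[y1 _]; have y0 : 0 < y by lra.
    rewrite cabsM cabsV [cabs (- s * _)]cabsM cabsN cabs_cpw cabs_real gtr0_norm// -mulrA.
    by rewrite ler_wpM2l ?cabs_ge0// -rpw1x// -rpwD; apply: rpw_le; lra.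
pose ph x := (s - 1) * cpw n s * (x - n)%:C + cpw x (s - 1) - cpw n (s - 1).
have -> : bt k s = ph (n + 1) - ph n.
  by rewrite /bt /ph -/n nS; move: (cpw (n + 1) _) (cpw n _) (cpw n _) => A B D; ring.
have D x : 0 < x -> rD ph x ((s - 1) * (cpw n s - cpw x s)).
  move=> x0; have nx : x%:C != 0 by rewrite fmorph_eq0 gt_eqF.
  have D1 : rD (fun x => (x - n)%:C) x 1.
    by apply: Dg_ext (Dg_eq _ (DgB (Dg_inc rinc x) (Dg_cst _ n%:C x))) => [y|]; rewrite ?rmorphB ?subr0.
  apply: Dg_eq (DgB (DgD (DgZ _ D1) (rD_cpw (s - 1) x0)) (Dg_cst _ _ x)).
  rewrite cpw_sub1//; by field.
have := @mvt_cst R ph (fun x => (s - 1) * (cpw n s - cpw x s))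
  (cabs (s - 1) * cabs s * rpw (Re s + 1) n) n (n + 1).
rewrite [n + 1 - n]addrAC subrr add0r mulr1; apply.
- lra.
- by move=> y /andP[y1 _]; apply: rD_cont (D _ _); lra.
- by move=> y /andP[y1 _]; apply: D; lra.
- move=> y /andP[y1 y2]; rewrite cabsM cabsB -!mulrA ler_wpM2l ?cabs_ge0//.
  have := step y; rewrite (ltW y1) (ltW y2) => /(_ isT) h; apply: le_trans h _.
  rewrite ler_piMr ?mulr_ge0 ?cabs_ge0 ?(ltW (rpw_gt0 _ _))//; lra.
Qed.

(** A telescoping majorant for [n^(-5/4)], hence for the series on [Re s >= 1/4]. In [16 = 4 * 4]
    one factor is the reciprocal of the exponent, the other pays for replacing [n + 1] by [n], since
    [2^(5/4) <= 4]. *)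
Definition Vt (k : nat) : R := 16 * rpw 4^-1 k.+1%:R.

Lemma Vt_ge0 k : 0 <= Vt k. Proof. by rewrite mulr_ge0// ltW ?rpw_gt0. Qed.

Lemma Vt_step k : rpw (4^-1 + 1) k.+1%:R <= Vt k - Vt k.+1.
Proof.
set n : R := k.+1%:R; have n1 : 1 <= n by rewrite ler1n.
have nS : k.+2%:R = n + 1 :> R by rewrite natr1.
have h := @rpw_step 4^-1 n (ltac:(lra)) n1.
rewrite /Vt -/n nS.
have h2 : rpw (4^-1 + 1) n <= 4 * rpw (4^-1 + 1) (n + 1).
  apply: le_trans (_ : 4 * rpw (4^-1 + 1) (2 * n) <= _); last first.
    by rewrite ler_pM2l//; apply: rpw_le; lra.
  rewrite rpwM//.
  rewrite mulrA ler_peMl ?(ltW (rpw_gt0 _ _))//.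
  rewrite -ler_pdivrMl// mulr1.
  apply: le_trans (_ : rpw 2 2 <= _); first by rewrite rpw2x// -natrX.
  by apply: rpw_le_exp; lra.
lra.
Qed.

Lemma Vt_small (e : R) : 0 < e -> exists N, forall n, (N <= n)%N -> Vt n < e.
Proof.
move=> e0; have [||N HN] := @small_rpw 4^-1 (e / 16); [lra|lra|].
by exists N => n /HN; rewrite /Vt; lra.
Qed.

(** Under a telescoping majorant the intervals of radius [K * V n] about the real parts, and about
    the imaginary parts, are nested. The factor 2 adds the two coordinates. *)
Lemma complex_series_lim (u : nat -> C) (V : nat -> R) (K : R) : 0 <= K ->
  (forall n, 0 <= V n) -> (forall n, cabs (u n.+1 - u n) <= K * (V n - V n.+1)) ->
  exists L, forall n, cabs (L - u n) <= 2 * (K * V n).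
Proof.
move=> K0 V0 H.
have real_lim (v : nat -> R) : (forall n, `|v n.+1 - v n| <= K * (V n - V n.+1)) ->
    exists x, forall n, `|x - v n| <= K * V n.
  move=> Hv; pose l n := v n - K * V n; pose r n := v n + K * V n.
  have lS n : l n <= l n.+1 by have := Hv n; rewrite /l ler_norml mulrBr; lra.
  have rS n : r n.+1 <= r n by have := Hv n; rewrite /r ler_norml mulrBr; lra.
  have lr n m : l n <= r m.
    have h1 k : l n <= l (n + k)%N.
      by elim: k => [|k IH]; rewrite ?addn0 // addnS; exact: le_trans IH (lS _).
    have h2 k : r (m + k)%N <= r m.
      by elim: k => [|k IH]; rewrite ?addn0 // addnS; exact: le_trans (rS _) IH.
    apply: le_trans (h1 m) (le_trans _ (h2 n)); rewrite [(m + n)%N]addnC /l /r.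
    by have := mulr_ge0 K0 (V0 (n + m)%N); lra.
  have hs : has_sup (range l).
    by split; [exists (l 0%N), 0%N|exists (r 0%N) => y [n _ <-]].
  exists (sup (range l)) => n.
  have h1 : l n <= sup (range l) by apply: ub_le_sup; [case: hs|exists n].
  have h2 : sup (range l) <= r n by apply: ge_sup; [case: hs|move=> y [m _ <-]].
  by move: h1 h2; rewrite /l /r ler_norml; lra.
have [|x Hx] := real_lim (fun n => Re (u n)).
  by move=> n; apply: le_trans (H n); rewrite -ReB Re_le_cabs.
have [|y Hy] := real_lim (fun n => Im (u n)).
  by move=> n; apply: le_trans (H n); rewrite -ImB Im_le_cabs.
exists (x +i* y) => n; apply: le_trans (cabs_le_ReIm _) _; rewrite ReB ImB /=.
by have := Hx n; have := Hy n; lra.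
Qed.

Definition Sn (n : nat) (s : C) : C := 1 + \sum_(0 <= k < n) bt k s.

Definition Kt s : R := cabs (s - 1) * cabs s.

(** This is [(s - 1) zeta(s)] on [Re s >= 1/4], built from the series and not from [zeta], whose
    value at 1 is arbitrary; so it is holomorphic through [s = 1]. Since [Vt] tends to 0, the
    explicit error bound determines the limit, and it also gives locally uniform convergence and the
    growth estimate. *)
Definition Zt s : C :=
  xget 0 [set L | forall n, cabs (L - Sn n s) <= 2 * (Kt s * Vt n)].

Lemma ZtP s : 4^-1 <= Re s -> forall n, cabs (Zt s - Sn n s) <= 2 * (Kt s * Vt n).
Proof.
move=> hs; rewrite /Zt; case: xgetP => [L -> //|no]; exfalso.
have K0 : 0 <= Kt s by rewrite mulr_ge0 ?cabs_ge0.
have [|L HL] := complex_series_lim K0 Vt_ge0 (u := fun n => Sn n s).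
  move=> n; rewrite /Sn big_nat_recr//= addrA [_ + bt n s]addrC addrK.
  apply: le_trans (cabs_bt _ _) _; first by lra.
  rewrite ler_wpM2l//; apply: le_trans (Vt_step n); apply: rpw_le_exp; first by lra.
  by rewrite ler1n.
exact: (no L).
Qed.

Lemma cD_cpw x s : exists l, cD (cpw x) s l.
Proof.
eexists; apply: Dg_cexp; apply: DgN; apply: DgM; [exact: cD_id|exact: Dg_cst].
Qed.

Lemma cD_bt k s : exists l, cD (bt k) s l.
Proof.
have [l1 D1] := cD_cpw k.+1%:R s.
have [l2 D2] := cD_cpw k.+2%:R (s - 1); have [l3 D3] := cD_cpw k.+1%:R (s - 1).
have Ds : cD (fun s => s - 1) s (1 - 0) by apply: DgB (cD_id s) (Dg_cst _ 1 s).
by eexists; apply: Dg_ext (DgB (DgD (DgM Ds D1) (@Dg_comp _ _ id (cpw k.+2%:R) (fun s => s - 1) s _ _ D2 Ds))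
  (@Dg_comp _ _ id (cpw k.+1%:R) (fun s => s - 1) s _ _ D3 Ds)) => y.
Qed.

Definition Hp : set C := [set s | 4^-1 < Re s].

Lemma opn_Hp : opn Hp.
Proof.
move=> z; rewrite /Hp /= => hz; exists (Re z - 4^-1); first by lra.
move=> w h; have := Re_le_cabs (w - z); rewrite ReB ler_norml; lra.
Qed.

Lemma cvx_Hp : cvx Hp.
Proof.
move=> a b; rewrite /Hp /= => ha hb t /andP[t0 t1]; rewrite /= ReD Re_realM ReB.
by have [h|h] := leP t (1/2); nra.
Qed.

Lemma hol_Zt : hol Hp Zt.
Proof.
move=> z hz; have [r r0 Hr] := opn_ball2 opn_Hp hz.
apply: (@weierstrass _ (fun n => Sn n) Zt z r r0).
- move=> n w _; rewrite /Sn; eexists; apply: DgD; first exact: Dg_cst.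
  by apply: (@Dg_sum _ _ _ _ _ _ (fun k => dv (bt k) w)) => k; have [l D] := cD_bt k w; rewrite (dvP D).
- move=> e e0; set K := (cabs z + 2 * r + 1) ^+ 2.
  have A0 : 0 < cabs z + 2 * r + 1 by have := cabs_ge0 z; lra.
  have K0 : 0 < K by rewrite exprn_gt0.
  have [|N HN] := @Vt_small (e / (2 * K)); first by rewrite divr_gt0// mulr_gt0.
  exists N => w wz; rewrite cabsB; apply: le_trans (ZtP _ _) _; first by apply/ltW/Hr.
  have KK : Kt w <= K.
    rewrite /Kt /K expr2; have h1 : cabs w <= cabs z + 2 * r.
      by have := cabs_leD w z 0; rewrite !subr0; lra.
    have := cabsD w (-1); rewrite cabsN cabs1 => h2.
    by rewrite ler_pM ?cabs_ge0//; lra.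
  have := HN N (leqnn N); rewrite ltr_pdivlMr ?mulr_gt0// => h.
  have := Vt_ge0 N; nra.
Qed.

(** At [s = 1] the factor [Kt] of the error bound is 0, so the very first partial sum is already
    exact. In other words, the residue of zeta at 1 is 1. *)
Lemma Zt1 : Zt 1 = 1.
Proof.
have h14 : 4^-1 <= Re (1 : C) by rewrite /=; lra.
have := ZtP h14 0; rewrite /Kt subrr cabs0 !mul0r mulr0 => h.
have /eqP : cabs (Zt 1 - Sn 0 1) = 0 by apply/eqP; rewrite eq_le h cabs_ge0.
by rewrite cabs_eq0 subr_eq0 => /eqP ->; rewrite /Sn big_geq// addr0.
Qed.

Lemma cabs_Zt s : 4^-1 <= Re s -> cabs (Zt s) <= 1 + 32 * Kt s.
Proof.
move=> hs; have := ZtP hs 0; rewrite /Sn big_geq// addr0 /Vt /rpw ln1 mulr0 oppr0 expR0 => h.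
have := cabsD (Zt s - 1) 1; rewrite subrK cabs1; lra.
Qed.

Lemma Sn_eq n s : Sn n s = (s - 1) * \sum_(0 <= k < n) cpw k.+1%:R s + cpw n.+1%:R (s - 1).
Proof.
elim: n => [|n IH]; first by rewrite /Sn !big_geq// cpw1 mulr0 add0r addr0.
move: IH; rewrite /Sn !big_nat_recr//= addrA => ->; rewrite /bt; ring.
Qed.

Section zeta.
Variable zeta : C -> C.
Hypothesis hz : is_riemann_zeta zeta.

Lemma zeta_cvg s : 1 < Re s -> forall e : R, 0 < e ->
  exists N, forall n, (N <= n)%N -> cabs (\sum_(0 <= k < n) cpw k.+1%:R s - zeta s) < e.
Proof. by move=> hs; have := hz.1 s hs => /cvgn_cabs H. Qed.

Lemma zeta_Zt_gt1 s : 1 < Re s -> (s - 1) * zeta s = Zt s.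
Proof.
move=> hs; apply/eqP; rewrite -subr_eq0 -cabs_eq0 eq_le cabs_ge0 andbT.
apply/ler_addgt0Pl => e e0; rewrite addr0.
set K := cabs (s - 1) + 2 * Kt s + 1.
have K0 : 0 < K.
  by have := cabs_ge0 (s - 1); have := mulr_ge0 (cabs_ge0 (s - 1)) (cabs_ge0 s); rewrite /K /Kt; lra.
have eK : 0 < e / K by rewrite divr_gt0.
have [N1 H1] := zeta_cvg hs eK.
have [N2 H2] := Vt_small eK.
have [|N3 H3] := @small_rpw (Re s - 1) (e / K) _ eK; first by lra.
pose n := (N1 + N2 + N3)%N.
have h1 := H1 n (leq_trans (leq_addr N2 N1) (leq_addr _ _)).
have h2 := H2 n (leq_trans (leq_addl N1 N2) (leq_addr _ _)).
have h3 := H3 n (leq_addl _ _).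
have hs4 : 4^-1 <= Re s by lra.
have h4 := ZtP hs4 n; rewrite Sn_eq in h4.
set S := \sum_(0 <= k < n) cpw k.+1%:R s in h1 h4.
rewrite (_ : _ - Zt s = - ((s - 1) * (S - zeta s)) - cpw n.+1%:R (s - 1) -
  (Zt s - ((s - 1) * S + cpw n.+1%:R (s - 1)))); last by ring.
apply: le_trans (cabsD _ _) _; rewrite cabsN.
have := cabsD (- ((s - 1) * (S - zeta s))) (- cpw n.+1%:R (s - 1)); rewrite !cabsN.
rewrite cabsM cabs_cpw ReB /= => h5.
have a0 := cabs_ge0 (s - 1); have k0 : 0 <= Kt s by rewrite mulr_ge0 ?cabs_ge0.
have E : K * (e / K) = e by rewrite mulrCA mulfV ?mulr1// gt_eqF.
have q1 := ler_wpM2l a0 (ltW h1); have q2 := ler_wpM2l k0 (ltW h2).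
rewrite -[X in _ <= X]E /K; lra.
Qed.

Lemma zeta_hol : hol [set s | s != 1] zeta.
Proof. by move=> s /= s1; apply/cD_cderivable; exact: hz.2. Qed.

(** Without the pole the half-plane [Hp] is no longer convex, so the identity theorem is applied
    above and below the real axis separately, as the sign of [e] tells. The base point [2 + ie] lies
    where the Dirichlet series converges. The real axis follows by continuity in [zeta_Zt]. *)
Lemma zeta_Zt_side (e : R) s : e != 0 -> 4^-1 < Re s -> 0 < e * Im s -> (s - 1) * zeta s = Zt s.
Proof.
move=> e0 h1 h2.
pose U := Hp `&` [set s : C | 0 < e * Im s].
have oU : opn U.
  apply: opnI; first exact: opn_Hp.
  have en : 0 < `|e| by rewrite normr_gt0.
  move=> z /= zi; exists (e * Im z / `|e|); first by rewrite divr_gt0.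
  move=> w; rewrite ltr_pdivlMr// => h; have := Im_le_cabs (w - z); rewrite ImB => h3.
  have := le_lt_trans (ler_wpM2r (ltW en) h3) h; rewrite mulrC -normrM mulrBr ltr_norml; lra.
have cU : cvx U.
  apply: cvxI; first exact: cvx_Hp.
  by move=> a b /= ha hb t /andP[t0 t1]; rewrite /= ImD Im_realM ImB; have [h|h] := leP t (1/2); nra.
pose E s := (s - 1) * zeta s - Zt s.
have hE : hol U E.
  apply: holB; last by apply: hol_sub hol_Zt => z [].
  apply: holM; first exact: hol_subc.
  apply: hol_sub zeta_hol => z [_ /=]; apply: contraTneq => ->.
  by rewrite /= mulr0 ltxx.
pose a : C := 2 +i* e.
have Ua : U a.
  by split; [rewrite /Hp /=; lra|rewrite /= -expr2 exprn_even_gt0].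
have na : near0 E a.
  exists 1 => // z; rewrite /a => h; rewrite /E zeta_Zt_gt1 ?subrr//.
  have := Re_le_cabs (z - a); rewrite ReB /= ler_norml; lra.
have Us : U s by split.
have [r r0 H] := identity_thm oU cU hE Ua na Us.
by apply/eqP; rewrite -subr_eq0; apply/eqP/H; rewrite subrr cabs0.
Qed.

Lemma zeta_Zt s : 4^-1 < Re s -> s != 1 -> (s - 1) * zeta s = Zt s.
Proof.
move=> hs s1; have [i0|i0|i0] := ltgtP (Im s) 0.
- by apply: (@zeta_Zt_side (-1)); rewrite ?oppr_eq0 ?oner_eq0// mulN1r oppr_gt0.
- by apply: (@zeta_Zt_side 1); rewrite ?oner_eq0// mul1r.
have cE : ccont (fun s => (s - 1) * zeta s - Zt s) s.
  apply: contB; last exact: (hol_cont hol_Zt).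
  apply: contM; first exact: contB (ccont_id s) (cont_cst _ _ _).
  exact: (hol_cont zeta_hol).
apply/eqP; rewrite -subr_eq0 -cabs_eq0 eq_le cabs_ge0 andbT.
apply/ler_addgt0Pl => e e0; rewrite addr0.
have [k k0 H] := cE _ e0.
have k2 : 0 < k / 2 by lra.
pose z : C := s + 'i * (k / 2)%:C.
have zi : Im z = k / 2 by rewrite /z ImD i0 add0r -complexiE ImM /=; ring.
have zr : Re z = Re s by rewrite /z ReD -complexiE ReM /=; ring.
have := H z; rewrite /dC /z addrAC subrr add0r cabsM cabs_i mul1r cabs_real gtr0_norm//.
rewrite -/z (@zeta_Zt_side 1) ?oner_eq0 ?mul1r ?zi ?zr//.
rewrite subrr sub0r cabsN => h; apply/ltW/h; lra.
Qed.

(** Telescoping from [n = 2], with equality for the single term [1/4 = 3/4 - 1/2]. That [3/4 < 1]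
    puts zeta in the right half-plane for [Re s >= 2], where [clog] is its logarithm. *)
Lemma sum_inv_sq (N : nat) : \sum_(1 <= k < N.+2) (k.+1%:R : R) ^- 2 <= 3 / 4 - N.+2%:R^-1.
Proof.
elim: N => [|N IH]; first by rewrite big_nat1; lra.
rewrite big_nat_recr//=; apply: le_trans (lerD IH (lexx _)) _.
have -> : N.+3%:R = N.+2%:R + 1 :> R by rewrite natr1.
have n0 : 0 < N.+2%:R :> R by [].
move: n0; move: (N.+2%:R) => n n0.
have nz : n != 0 by rewrite gt_eqF.
have n1 : n + 1 != 0 by rewrite gt_eqF// addr_gt0.
have E : n^-1 - (n + 1)^-1 = n^-1 * (n + 1)^-1 by field; rewrite nz n1.
have y0 : 0 < (n + 1)^-1 by rewrite invr_gt0 addr_gt0.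
have xy : (n + 1)^-1 <= n^-1 by rewrite lef_pV2 ?posrE ?addr_gt0// lerDl.
rewrite -exprVn expr2; nra.
Qed.

(** Each [n^(-sigma)] splits into [n^(-2)] and [n^(-(sigma - 2))], and the latter is at most the
    same power of 2. This gives the exponential decay used far to the right. *)
Lemma zeta_sub1 s : 2 <= Re s -> cabs (zeta s - 1) <= 3 / 4 * rpw (Re s - 2) 2.
Proof.
move=> hs; apply/ler_addgt0Pl => e e0.
have [|N H] := zeta_cvg (s := s) _ e0; first by lra.
have := H N.+2 (leq_trans (leqnSn _) (leqnSn _)).
rewrite big_ltn// cpw1 => h.
set S := \sum_(1 <= k < N.+2) cpw k.+1%:R s in h.
rewrite (_ : zeta s - 1 = S - (1 + S - zeta s)); last by ring.
apply: le_trans (cabsD _ _) _; rewrite cabsN addrC lerD ?(ltW h)//.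
apply: le_trans (cabs_sum _ _) _.
set q := rpw (Re s - 2) 2.
apply: le_trans (_ : \sum_(1 <= k < N.+2) k.+1%:R ^- 2 * q <= _).
  rewrite big_nat_cond [X in _ <= X]big_nat_cond; apply: ler_sum => k /andP[/andP[k1 _] _].
  rewrite cabs_cpw (rpw_split (Re s) 2).
  rewrite rpw2x// ler_wpM2l ?invr_ge0 ?exprn_ge0//.
  by rewrite /q; apply: rpw_le; [lra|lra|rewrite ler_nat].
rewrite -mulr_suml ler_wpM2r ?/q ?(ltW (rpw_gt0 _ _))//.
apply: le_trans (sum_inv_sq N) _; rewrite gerBl invr_ge0//.
Qed.
End zeta.
End Zeta.

(** * Finite Euler products and non-vanishing of zeta for Re s >= 1 *)

Section Euler.
Context {R : realType}.
Local Notation C := R[i].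
Local Notation Re := complex.Re.
Local Notation Im := complex.Im.
Implicit Types (U V : set C) (f g : C -> C) (z w s : C) (r x t : R).

(** True when [n] has no prime factor up to [P]. The recursion on [P] makes the passage to the next
    prime a computation. *)
Fixpoint sieve (P n : nat) : bool :=
  if P is Q.+1 then sieve Q n && ~~ (prime P && (P %| n)%N) else true.

Lemma sieveP P n : sieve P n -> forall p, prime p -> (p <= P)%N -> ~~ (p %| n)%N.
Proof.
elim: P => [|P IH] /=; first by move=> _ p /prime_gt0; case: p.
move=> /andP[/IH h1 h2] p pp; rewrite leq_eqVlt => /predU1P[E|]; last by rewrite ltnS; exact: h1.
by move: h2; rewrite -E pp.
Qed.

Lemma sieve1 P : sieve P 1.
Proof.
elim: P => [//|P IH] /=; rewrite IH /= negb_and -implybE; apply/implyP => pp.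
by rewrite dvdn1; case: P pp {IH}.
Qed.

Lemma sieve_small P n : (1 < n)%N -> (n <= P)%N -> sieve P n = false.
Proof.
move=> n1 nP; apply/negP => /sieveP /(_ _ (pdiv_prime n1)).
by rewrite pdiv_dvd => /(_ (leq_trans (dvdn_leq (ltnW n1) (pdiv_dvd n)) nP)).
Qed.

Lemma sieve_mul P p n : prime p -> (P < p)%N -> sieve P (p * n) = sieve P n.
Proof.
move=> pp; elim: P => [//|P IH] /= Pp; rewrite IH; last exact: ltnW.
congr (_ && ~~ _); case: (boolP (prime P.+1)) => //= q.
by rewrite Euclid_dvdM// dvdn_prime2// (ltn_eqF Pp).
Qed.

Definition PS (P N : nat) s : C := \sum_(1 <= n < N.+1 | sieve P n) cpw n%:R s.
Definition ep (P : nat) s : C := \prod_(1 <= p < P.+1 | prime p) (1 - cpw p%:R s).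

Lemma sum_multiples (p N : nat) (F : nat -> C) : (0 < p)%N ->
  \sum_(1 <= m < (p * N).+1 | (p %| m)%N) F m = \sum_(1 <= n < N.+1) F (p * n)%N.
Proof.
move=> p0; elim: N => [|N IH]; first by rewrite muln0 !big_geq.
rewrite big_nat_recr//= -IH mulnS addnC.
rewrite (@big_cat_nat _ _ _ (p * N).+1)//=; last by rewrite ltnS leq_addr.
congr (_ + _).
case: p p0 {IH} => [//|p] _; rewrite addnS big_mkcond big_nat_recr//=; last first.
  by rewrite -addSn leq_addr.
rewrite -addnS addnC -mulnS dvdn_mulr// -[RHS]add0r; congr (_ + _).
rewrite big_nat_cond big1// => m /andP[/andP[h1 h2] _].
case: ifP => // /dvdnP[k E]; exfalso; move: h1 h2; rewrite E.
rewrite [(k * _)%N]mulnC ltn_mul2l /= => h1.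
rewrite ltn_mul2l /= ltnS => h2.
by move: (leq_trans h1 h2); rewrite ltnn.
Qed.

(** The multiples of [p] up to [p * N] that survive the sieve are [p] times the surviving [n <= N];
    a bound divisible by [p] makes this correspondence exact. *)
Lemma PS_step P p N s : prime p -> p = P.+1 ->
  PS P.+1 (p * N) s = PS P (p * N) s - cpw p%:R s * PS P N s.
Proof.
move=> pp pE; have p0 := prime_gt0 pp.
rewrite /PS [X in X - _](bigID (fun m => (p %| m)%N)) /=.
have -> : \sum_(1 <= i < (p * N).+1 | sieve P i && (p %| i)%N) cpw i%:R s =
   cpw p%:R s * (\sum_(1 <= n < N.+1 | sieve P n) cpw n%:R s).
  transitivity (\sum_(1 <= m < (p * N).+1 | (p %| m)%N) (if sieve P m then cpw m%:R s else 0)).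
    rewrite [RHS]big_mkcond [LHS]big_mkcond /=; apply: eq_bigr => m _.
    by case: (sieve P m); case: (p %| m)%N.
  rewrite sum_multiples// mulr_sumr [RHS]big_mkcond /= big_nat_cond [RHS]big_nat_cond.
  apply: eq_bigr => n /andP[/andP[n0 _] _].
  rewrite sieve_mul ?pE// -?pE//; case: ifP => // _.
  by rewrite natrM cpwM ?ltr0n.
rewrite addrAC subrr add0r; apply: eq_bigl => m; by rewrite -pE pp /=.
Qed.

Lemma rpw_tail (a : R) (N M : nat) : 1 < a -> (0 < N)%N -> (N <= M)%N ->
  (a - 1) * \sum_(N.+1 <= n < M.+1) rpw a n%:R <= rpw (a - 1) N%:R - rpw (a - 1) M%:R.
Proof.
move=> a1 N0; elim: M => [|M IH]; first by rewrite leqn0 => /eqP E; rewrite E in N0.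
rewrite leq_eqVlt => /predU1P[->|]; first by rewrite big_geq// mulr0 subrr.
rewrite ltnS => NM; rewrite big_nat_recr//= mulrDr.
have M1 : 1 <= M%:R :> R by rewrite ler1n (leq_trans N0 NM).
have a0 : 0 < a - 1 by lra.
have := rpw_step a0 M1; rewrite subrK -natr1; have := IH NM; lra.
Qed.

Definition tau (a : R) (N : nat) : R := rpw (a - 1) N%:R / (a - 1).

Lemma rpw_sum_tau (a : R) (N M : nat) : 1 < a -> (0 < N)%N -> (N <= M)%N ->
  \sum_(N.+1 <= n < M.+1) rpw a n%:R <= tau a N.
Proof.
move=> a1 N0 NM; rewrite /tau ler_pdivlMr; last by lra.
rewrite mulrC; apply: le_trans (rpw_tail a1 N0 NM) _.
by rewrite gerBl ltW ?rpw_gt0.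
Qed.

Lemma tau_small (a e : R) : 1 < a -> 0 < e -> exists N, forall n, (N < n)%N -> tau a n < e.
Proof.
move=> a1 e0; have a0 : 0 < a - 1 by lra.
have [N H] := small_rpw a0 (mulr_gt0 e0 a0).
by exists N => -[//|n]; rewrite ltnS => /H; rewrite /tau ltr_pdivrMr.
Qed.

Lemma PS_cut P (N M : nat) s : (0 < N)%N -> (N <= M)%N ->
  PS P M s = PS P N s + \sum_(N.+1 <= n < M.+1 | sieve P n) cpw n%:R s.
Proof. by move=> N0 NM; rewrite /PS (@big_cat_nat _ _ _ N.+1). Qed.

Lemma cabs_sieve_tail P (N M : nat) s : 1 < Re s -> (0 < N)%N -> (N <= M)%N ->
  cabs (\sum_(N.+1 <= n < M.+1 | sieve P n) cpw n%:R s) <= tau (Re s) N.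
Proof.
move=> s1 N0 NM; apply: le_trans (rpw_sum_tau s1 N0 NM).
rewrite big_mkcond /=; apply: le_trans (cabs_sum _ _) _; apply: ler_sum => n _.
by case: ifP => _; rewrite ?cabs_cpw// cabs0 ltW ?rpw_gt0.
Qed.

Lemma PS_near1 P (N : nat) s : 1 < Re s -> (0 < P)%N -> (P <= N)%N ->
  cabs (PS P N s - 1) <= tau (Re s) P.
Proof.
move=> s1 P0 PN; rewrite (PS_cut _ _ P0 PN).
have -> : PS P P s = 1.
  rewrite /PS big_mkcond big_ltn//= sieve1 cpw1 -[RHS]addr0; congr (_ + _).
  rewrite big_nat_cond big1// => n /andP[/andP[n1 nP] _].
  by rewrite sieve_small.
by rewrite addrAC subrr add0r; exact: cabs_sieve_tail.
Qed.

Lemma cabs_cpw_le1 (n : nat) s : (0 < n)%N -> 0 <= Re s -> cabs (cpw n%:R s) <= 1.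
Proof.
move=> n0 s0; rewrite cabs_cpw /rpw -[leRHS]expR0 ler_expR oppr_le0 mulr_ge0// ln_ge0//.
by rewrite ler1n.
Qed.

Section zeta.
Variable zeta : C -> C.
Hypothesis hz : is_riemann_zeta zeta.

(** By induction on [P]: sieving by one more prime multiplies the limit of the sums by [1 - p^(-s)].
    Finite products are enough for comparing zeta with its Euler product. *)
Lemma PS_lim P s : 1 < Re s -> forall e : R, 0 < e ->
  exists N0, forall N, (N0 <= N)%N -> cabs (PS P N s - zeta s * ep P s) < e.
Proof.
move=> s1; elim: P => [|P IH] e e0.
  have [N H] := zeta_cvg hz s1 e0; exists N => n /H.
  have -> : PS 0 n s = \sum_(0 <= k < n) cpw k.+1%:R s by rewrite /PS big_add1.
  have -> : ep 0 s = 1 by rewrite /ep big_geq.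
  by rewrite mulr1.
have [pp|np] := boolP (prime P.+1); last first.
  have [N H] := IH e e0; exists N => n /H.
  have -> : PS P.+1 n s = PS P n s.
    by apply: eq_bigl => m /=; rewrite (negPf np) andbT.
  have -> // : ep P.+1 s = ep P s.
  rewrite /ep (@big_cat_nat _ _ _ P.+1 1 P.+2)//= -[RHS]mulr1; congr (_ * _).
  by rewrite big_mkcond big_nat1 (negPf np).
have e4 : 0 < e / 4 by lra.
have [N1 H1] := IH _ e4; have [N2 H2] := tau_small s1 e4.
set p := P.+1 in pp *.
have p0 : (0 < p)%N by [].
exists (p * (N1 + N2).+1)%N => M HM.
(* A general bound [M] is rounded down to a multiple of [p]; the terms between [p * N] and [M] are
   part of a tail below [tau (Re s) (p * N)]. *)
pose N := (M %/ p)%N.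
have NN : (N1 + N2 < N)%N by rewrite /N leq_divRL// mulnC.
have pNM : (p * N <= M)%N by rewrite mulnC leq_trunc_div.
have NpN : (N <= p * N)%N by rewrite leq_pmull.
have N0 : (0 < p * N)%N by rewrite (leq_trans _ NpN)// (leq_ltn_trans _ NN).
rewrite (PS_cut _ _ N0 pNM) PS_step//.
have hN : (N1 <= N)%N by rewrite ltnW// (leq_ltn_trans (leq_addr N2 N1) NN).
have h1 := H1 _ hN; have h2 := H1 _ (leq_trans hN NpN).
have h3 := cabs_sieve_tail P.+1 s1 N0 pNM.
have h4 : tau (Re s) (p * N) < e / 4.
  by apply: H2; apply: leq_trans NpN; rewrite (leq_ltn_trans (leq_addl N1 N2) NN).
have -> : ep P.+1 s = ep P s * (1 - cpw p%:R s).
  rewrite /ep (@big_cat_nat _ _ _ P.+1 1 P.+2)//=; congr (_ * _).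
  by rewrite big_mkcond big_nat1 -/p pp.
set T := \sum_(_ <= n < _ | _) _ in h3 *.
rewrite (_ : _ - _ = (PS P (p * N) s - zeta s * ep P s) -
  cpw p%:R s * (PS P N s - zeta s * ep P s) + T); last by ring.
apply: le_lt_trans (cabsD _ _) _.
have := cabsD (PS P (p * N) s - zeta s * ep P s) (- (cpw p%:R s * (PS P N s - zeta s * ep P s))).
rewrite cabsN cabsM => h5.
have s0 : 0 <= Re s by lra.
have h6 := ler_wpM2r (cabs_ge0 (PS P N s - zeta s * ep P s)) (cabs_cpw_le1 p0 s0).
rewrite mul1r in h6; lra.
Qed.

Lemma euler_near1 P s : 1 < Re s -> (0 < P)%N -> cabs (zeta s * ep P s - 1) <= tau (Re s) P.
Proof.
move=> s1 P0; apply/ler_addgt0Pl => e e0; have [N H] := PS_lim P s1 e0.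
have h1 := H (N + P)%N (leq_addr _ _); have h2 := PS_near1 s1 P0 (leq_addl N P).
have := cabs_leD (zeta s * ep P s) (PS P (N + P) s) 1; rewrite (cabsB (zeta s * ep P s) (PS _ _ _)); lra.
Qed.

Lemma euler_close s (e : R) : 1 < Re s -> 0 < e -> exists P0, forall P, (P0 < P)%N ->
  cabs (zeta s * ep P s - 1) < e.
Proof.
move=> s1 e0; have [N H] := tau_small s1 e0; exists N => P NP.
by apply: le_lt_trans (euler_near1 _ _) (H _ NP) => //; rewrite (leq_ltn_trans _ NP).
Qed.

Lemma zeta_neq0_gt1 s : 1 < Re s -> zeta s != 0.
Proof.
move=> s1; have [P H] := euler_close s1 ltr01; apply/eqP => z0.
by have := H P.+1 (leqnn _); rewrite z0 mul0r sub0r cabsN cabs1 ltxx.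
Qed.

Lemma prod341_le (x y z X Y Z : R) : 0 <= x -> 0 <= y -> 0 <= z ->
  x <= X -> y <= Y -> z <= Z -> x ^+ 3 * y ^+ 4 * z <= X ^+ 3 * Y ^+ 4 * Z.
Proof.
move=> x0 y0 z0 xX yY zZ; have X0 := le_trans x0 xX; have Y0 := le_trans y0 yY.
rewrite ler_pM ?mulr_ge0 ?exprn_ge0//.
by rewrite ler_pM ?exprn_ge0// lerXn2r ?nnegrE.
Qed.

(* After division by [1 + r^2] each factor is at most [exp (- q cos)], and the
   exponents add up to [- 2 q (1 + c)^2]. *)
Lemma three_four_one (r : R) (u : C) : 0 <= r <= 1 -> cabs u = 1 ->
  cabs (1 - r%:C) ^+ 3 * cabs (1 - r%:C * u) ^+ 4 * cabs (1 - r%:C * u ^+ 2) <=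
  (1 + r ^+ 2) ^+ 4.
Proof.
move=> /andP[r0 r1] u1.
have rr : 0 < 1 + r ^+ 2 by rewrite ltr_pwDl ?sqr_ge0.
set q := 2 * r / (1 + r ^+ 2).
have q0 : 0 <= q by rewrite divr_ge0 ?(ltW rr)// mulr_ge0.
have qE : q * (1 + r ^+ 2) = 2 * r by rewrite /q divfK// gt_eqF.
case: u u1 => c d u1.
have cd : c ^+ 2 + d ^+ 2 = 1 by have := cabs_sqr (c +i* d); rewrite u1 expr1n /= => <-.
have F (v : C) : cabs v = 1 -> cabs (1 - r%:C * v) ^+ 2 <= (1 + r ^+ 2) * expR (- (q * Re v)).
  move=> v1; have := cabs_sqr v; rewrite v1 expr1n => E.
  have -> : cabs (1 - r%:C * v) ^+ 2 = (1 + r ^+ 2) * (1 - q * Re v).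
    rewrite cabs_sqr ReB ImB Re_realM Im_realM /= sub0r sqrrN mulrBr mulr1 mulrA [_ * q]mulrC qE.
    rewrite (_ : _ + _ = 1 - 2 * r * Re v + r ^+ 2 * (Re v ^+ 2 + Im v ^+ 2)); last by ring.
    by rewrite -E; ring.
  rewrite ler_pM2l//; exact: expR_ge1Dx.
have F1 := F 1 cabs1; rewrite mulr1 in F1.
have F2 := F (c +i* d) u1.
have F3 := F ((c +i* d) ^+ 2) (ltac:(by rewrite cabsX u1 expr1n)).
rewrite -ler_sqr ?nnegrE ?mulr_ge0 ?exprn_ge0 ?cabs_ge0// ?(ltW rr)//.
set X := cabs (1 - r%:C) in F1 *; set Y := cabs (1 - r%:C * (c +i* d)) in F2 *.
set Z := cabs _ in F3 *.
have -> : (X ^+ 3 * Y ^+ 4 * Z) ^+ 2 = (X ^+ 2) ^+ 3 * (Y ^+ 2) ^+ 4 * Z ^+ 2 by ring.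
apply: le_trans (_ : ((1 + r ^+ 2) * expR (- (q * Re (1 : C)))) ^+ 3 *
   ((1 + r ^+ 2) * expR (- (q * c))) ^+ 4 * ((1 + r ^+ 2) * expR (- (q * Re ((c +i* d) ^+ 2)))) <= _).
  by apply: prod341_le; rewrite ?sqr_ge0.
rewrite (_ : _ * _ * _ = ((1 + r ^+ 2) ^+ 4) ^+ 2 * (expR (- (q * Re (1 : C))) ^+ 3 *
  expR (- (q * c)) ^+ 4 * expR (- (q * Re ((c +i* d) ^+ 2))))); last first.
  by move: (expR _) (expR _) (expR _) => A B D; ring.
rewrite ler_piMr ?exprn_ge0 ?(ltW rr)//.
have -> : Re ((c +i* d) ^+ 2) = c ^+ 2 - d ^+ 2 by rewrite expr2 /=; ring.
rewrite -!expRM_natl -!expRD expR_le1 /=.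
rewrite (_ : _ + _ = - (2 * q * (1 + c) ^+ 2)).
  by rewrite oppr_le0 mulr_ge0 ?sqr_ge0// mulr_ge0.
have -> : d ^+ 2 = 1 - c ^+ 2 by rewrite -cd; ring.
by ring.
Qed.

Lemma cabs_prod_cond (I : Type) (l : seq I) (Q : pred I) (F : I -> C) :
  cabs (\prod_(i <- l | Q i) F i) = \prod_(i <- l | Q i) cabs (F i).
Proof. by elim/big_rec2: _ => [|i y x _ <-]; rewrite ?cabs1 ?cabsM. Qed.

(** The inequality is applied prime by prime: with [r = p^(-a)] each factor is at most
    [exp(4 p^-2)], because [r^2 <= p^-2]. The sum of [p^-2] over primes is below 1, hence the bound
    [exp 4], independent of [P] and [a]. *)
Lemma ep341 P (a t : R) : 1 < a ->
  cabs (ep P (a +i* 0)) ^+ 3 * cabs (ep P (a +i* t)) ^+ 4 * cabs (ep P (a +i* (2 * t))) <=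
  expR 4.
Proof.
move=> a1.
have -> : cabs (ep P (a +i* 0)) ^+ 3 * cabs (ep P (a +i* t)) ^+ 4 * cabs (ep P (a +i* (2 * t))) =
  \prod_(1 <= p < P.+1 | prime p) (cabs (1 - cpw p%:R (a +i* 0)) ^+ 3 *
    cabs (1 - cpw p%:R (a +i* t)) ^+ 4 * cabs (1 - cpw p%:R (a +i* (2 * t)))).
  by rewrite /ep !cabs_prod_cond -!prodrXl -!big_split.
apply: le_trans (_ : \prod_(1 <= p < P.+1 | prime p) expR (4 * p%:R ^- 2) <= _).
  rewrite big_nat_cond [leRHS]big_nat_cond.
  apply: ler_prod => p /andP[/andP[p0 _] pp].
  rewrite !mulr_ge0 ?exprn_ge0 ?cabs_ge0//=.
  have pr : 0 < p%:R :> R by rewrite ltr0n.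
  have p1 : 1 <= p%:R :> R by rewrite ler1n.
  pose r := rpw a p%:R; pose u : C := cexp (- ((0 +i* t) * (ln p%:R)%:C)).
  have e0 : cpw p%:R (a +i* 0) = r%:C.
    by rewrite /cpw /cexp /= !(mul0r, mulr0, subr0, addr0, oppr0) cos0 sin0; simpc.
  have eD v : cpw p%:R (a +i* v) = r%:C * cexp (- ((0 +i* v) * (ln p%:R)%:C)).
    rewrite -e0 /cpw -cexpD; congr cexp; rewrite -opprD -mulrDl; congr (- (_ * _)).
    by simpc.
  have e1 : cpw p%:R (a +i* t) = r%:C * u by rewrite eD.
  have e2 : cpw p%:R (a +i* (2 * t)) = r%:C * u ^+ 2.
    rewrite eD expr2 -cexpD; congr (_ * cexp _); rewrite -opprD -mulrDl; congr (- (_ * _)).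
    by simpc; congr (_ +i* _); ring.
  have u1 : cabs u = 1.
    by rewrite cabs_cexp ReN mulrC Re_realM /= mulr0 oppr0 expR0.
  have r01 : 0 <= r <= 1.
    by rewrite ltW ?rpw_gt0//= /r /rpw -[leRHS]expR0 ler_expR oppr_le0 mulr_ge0 ?ln_ge0//; lra.
  rewrite e0 e1 e2; apply: le_trans (three_four_one r01 u1) _.
  rewrite expRM_natl lerXn2r ?nnegrE ?expR_ge0 ?addr_ge0 ?sqr_ge0//.
  apply: le_trans (expR_ge1Dx _) _; rewrite ler_expR -rpw2x//.
  rewrite expr2 /r -rpwD; apply: rpw_le_exp => //; lra.
rewrite -expR_sum ler_expR -mulr_sumr ger_pMr//.
case: P => [|P]; first by rewrite big_geq.
rewrite big_mkcond big_ltn//= add0r.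
apply: le_trans (_ : \sum_(2 <= i < P.+2) i%:R ^- 2 <= _).
  by apply: ler_sum => i _; case: ifP => // _; rewrite invr_ge0 exprn_ge0.
case: P => [|P]; first by rewrite big_geq.
rewrite big_add1 /=; apply: le_trans (@sum_inv_sq R P) _.
have : 0 <= P.+2%:R^-1 :> R by rewrite invr_ge0.
by move: (P.+2%:R^-1) => v; lra.
Qed.

(** At each of the three points zeta times a long Euler product is within [1/8] of 1. The eight
    factors have product at least [(7/8)^8 >= 1/8], and the Euler products account for at most
    [exp 4]. *)
Lemma zeta341 (a t : R) : 1 < a ->
  (8 * expR 4)^-1 <=
  cabs (zeta (a +i* 0)) ^+ 3 * cabs (zeta (a +i* t)) ^+ 4 * cabs (zeta (a +i* (2 * t))).
Proof.
move=> a1.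
have e8 : 0 < 8^-1 :> R by lra.
have [P1 H1] := @euler_close (a +i* 0) 8^-1 a1 e8.
have [P2 H2] := @euler_close (a +i* t) 8^-1 a1 e8.
have [P3 H3] := @euler_close (a +i* (2 * t)) 8^-1 a1 e8.
pose P := (P1 + P2 + P3).+1.
have {}H1 := H1 P (leq_trans (leq_addr P2 P1) (leq_addr _ _)).
have {}H2 := H2 P (leq_trans (leq_addl P1 P2) (leq_addr _ _)).
have {}H3 := H3 P (leq_addl _ _).
have low w : cabs (w - 1) < 8^-1 -> 7 / 8 <= cabs w.
  by move=> h; have := cabs_leD 1 w 0; rewrite !subr0 cabs1 (cabsB 1 w); lra.
have := low _ H1; have := low _ H2; have := low _ H3; rewrite !cabsM => h3 h2 h1.
have := ep341 P t a1.
move: h1 h2 h3; set A := cabs (zeta (a +i* 0)); set B := cabs (zeta (a +i* t)).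
set D := cabs (zeta _); set x := cabs (ep _ _); set y := cabs (ep _ _); set z := cabs (ep _ _).
move=> h1 h2 h3 h4.
have p0 : 0 <= 7 / 8 :> R by lra.
have : (7 / 8) ^+ 3 * (7 / 8) ^+ 4 * (7 / 8) <= (A * x) ^+ 3 * (B * y) ^+ 4 * (D * z).
  exact: prod341_le.
rewrite (_ : _ * (D * z) = (A ^+ 3 * B ^+ 4 * D) * (x ^+ 3 * y ^+ 4 * z)); last by ring.
have ABD : 0 <= A ^+ 3 * B ^+ 4 * D by rewrite !mulr_ge0 ?exprn_ge0 ?cabs_ge0.
move=> h5; have := ler_wpM2l ABD h4 => h6; have h7 := le_trans h5 h6.
rewrite invfM ler_pdivrMr ?expR_gt0//; apply: le_trans h7.
by rewrite !exprS !expr0; lra.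
Qed.

(** If zeta vanished at [1 + it], the three factors at abscissa [1 + e] would be [O(e^-3)], [O(e^4)]
    and [O(1)]. Their product [e * M] would fall below the lower bound of [zeta341] for small
    [e]. *)
Lemma zeta_neq0_line1 (t : R) : t != 0 -> zeta (1 +i* t) != 0.
Proof.
move=> t0; apply/eqP => z0.
have n1 (x y : R) : y != 0 -> x +i* y != 1 :> C by move=> y0; apply: contra_neq y0 => -[].
pose s1 : C := 1 +i* t; pose s2 : C := 1 +i* (2 * t).
have t20 : 2 * t != 0 by rewrite mulf_neq0.
have [l1 [q1 [k1 k10 [c1 _ E1]]]] := zeta_hol hz (n1 1 t t0 : [set s | s != 1] s1).
have c2 := hol_cont (zeta_hol hz) (n1 1 (2 * t) t20 : [set s | s != 1] s2).
have Hp1 : Hp (1 : C) by rewrite /Hp /=; lra.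
have c0 := hol_cont (@hol_Zt R) Hp1.
have [d1 d10 F1] := c1 _ ltr01; have [d2 d20 F2] := c2 _ ltr01; have [d0 d00 F0] := c0 _ ltr01.
pose M := (cabs (Zt (1 : C)) + 1) ^+ 3 * (cabs (q1 s1) + 1) ^+ 4 * (cabs (zeta s2) + 1).
have M0 : 0 < M.
  rewrite /M; have a1 := cabs_ge0 (Zt (1 : C)); have a2 := cabs_ge0 (q1 s1).
  by have a3 := cabs_ge0 (zeta s2); rewrite !mulr_gt0 ?exprn_gt0//; lra.
pose e0 := (8 * expR 4)^-1 / M : R.
have e00 : 0 < e0 by rewrite divr_gt0// invr_gt0 mulr_gt0 ?expR_gt0.
have [e ep em] : exists2 e : R, 0 < e & e < Num.min (Num.min k1 d1) (Num.min (Num.min d2 d0) e0).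
  have m0 : 0 < Num.min (Num.min k1 d1) (Num.min (Num.min d2 d0) e0).
    by rewrite !lt_min k10 d10 d20 d00.
  by exists (Num.min (Num.min k1 d1) (Num.min (Num.min d2 d0) e0) / 2); [rewrite divr_gt0|rewrite ltr_pdivrMr// mulr_natr mulr2n ltrDl].
move: em; rewrite !lt_min => /andP[/andP[ek1 ed1] /andP[/andP[ed2 ed0] ee0]].
have sh v : (1 + e) +i* v - 1 +i* v = e%:C :> C by simpc; congr (_ +i* _); ring.
have ce : cabs e%:C = e by rewrite cabs_real gtr0_norm.
have a1 : 1 < 1 + e by lra.
have := zeta341 t a1; apply/negP; rewrite -ltNge.
have b1 : cabs (zeta ((1 + e) +i* t)) <= e * (cabs (q1 s1) + 1).
  have := E1 ((1 + e) +i* t); rewrite /= sh ce => -> //.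
  rewrite /s1 z0 add0r cabsM ce ler_wpM2l ?(ltW ep)//.
  have := F1 ((1 + e) +i* t); rewrite /= sh ce => /(_ ed1) h.
  by have := cabs_leD (q1 ((1 + e) +i* t)) (q1 s1) 0; rewrite !subr0; lra.
have b2 : cabs (zeta ((1 + e) +i* (2 * t))) <= cabs (zeta s2) + 1.
  have := F2 ((1 + e) +i* (2 * t)); rewrite /dC /= sh ce => /(_ ed2) h.
  by have := cabs_leD (zeta ((1 + e) +i* (2 * t))) (zeta s2) 0; rewrite !subr0; lra.
have b0 : cabs (zeta ((1 + e) +i* 0)) <= (cabs (Zt (1 : C)) + 1) / e.
  rewrite ler_pdivlMr//.
  have := F0 ((1 + e) +i* 0); rewrite /dC (_ : _ - 1 = e%:C) ?ce; last by rewrite -(sh 0).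
  move=> /(_ ed0) h.
  have := @zeta_Zt_gt1 R zeta hz ((1 + e) +i* 0) a1.
  rewrite (_ : _ - 1 = e%:C); last by rewrite -(sh 0).
  move=> /(congr1 (@cabs R)); rewrite cabsM ce mulrC => ->.
  by have := cabs_leD (Zt ((1 + e) +i* 0 : C)) (Zt 1) 0; rewrite !subr0; lra.
apply: le_lt_trans (_ : ((cabs (Zt (1 : C)) + 1) / e) ^+ 3 * (e * (cabs (q1 s1) + 1)) ^+ 4 *
   (cabs (zeta s2) + 1) < _).
  by apply: prod341_le; rewrite ?cabs_ge0.
rewrite (_ : _ * _ * _ = e * M).
  by move: ee0; rewrite /e0 ltr_pdivlMr.
by rewrite /M; field; rewrite gt_eqF.
Qed.

Lemma zeta_neq0 s : 1 <= Re s -> s != 1 -> zeta s != 0.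
Proof.
rewrite le_eqVlt => /predU1P[E s1|h _]; last exact: zeta_neq0_gt1.
case: s E s1 => a b /= <- h; apply: zeta_neq0_line1; apply: contra_neq h => ->.
by [].
Qed.
End zeta.
End Euler.

(** * Size of log zeta on horizontal segments *)

Section Local.
Context {R : realType}.
Local Notation C := R[i].
Local Notation Re := complex.Re.
Local Notation Im := complex.Im.
Implicit Types (U V : set C) (f g : C -> C) (z w s : C) (r x t : R).

Lemma rD_unique (f : R -> C) x l m : rD f x l -> rD f x m -> l = m.
Proof.
move=> h1 h2; apply: complex_ext.
  by have [_ <-] := (rD_realP _ _ _).1 (rD_Re h1); have [_ <-] := (rD_realP _ _ _).1 (rD_Re h2).
by have [_ <-] := (rD_realP _ _ _).1 (rD_Im h1); have [_ <-] := (rD_realP _ _ _).1 (rD_Im h2).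
Qed.

Lemma rD_near_ext (f g : R -> C) x l (a b : R) : a < x < b ->
  (forall t, a < t < b -> f t = g t) -> rD f x l -> rD g x l.
Proof.
move=> /andP[ax xb] fg; apply: (@Dg_near _ _ rinc f g x l (Num.min (x - a) (b - x))).
  by rewrite lt_min !subr_gt0 ax.
by move=> y; rewrite /rinc -rmorphB cabs_real lt_min !ltr_norml => h; apply: fg; lra.
Qed.

(** Logarithms of proportional functions have the same derivative. This compares two branches along
    a path without keeping track of multiples of [2 pi i]. *)
Lemma cexp_proportional (f g : R -> C) (c : C) (a b : R) : a <= b ->
  (forall t, a <= t <= b -> exists l, rD f t l) ->
  (forall t, a <= t <= b -> exists l, rD g t l) ->
  (forall t, a <= t <= b -> cexp (f t) = c * cexp (g t)) -> f b - f a = g b - g a.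
Proof.
move=> ab Df Dg E.
have {}Df t : a <= t <= b -> rD f t (xget 0 [set l | rD f t l]).
  by move=> /Df[l Dl]; case: xgetP => [m -> //|/(_ l)].
have {}Dg t : a <= t <= b -> rD g t (xget 0 [set l | rD g t l]).
  by move=> /Dg[l Dl]; case: xgetP => [m -> //|/(_ l)].
apply: (rD_increment_eq ab Df Dg) => t tab.
have tab' : a <= t <= b by case/andP: tab => ? ?; rewrite !ltW.
have D1 := Dg_cexp (Df _ tab'); have D2 := DgZ c (Dg_cexp (Dg _ tab')).
have D3 : rD (fun t => cexp (f t)) t (c * (cexp (g t) * xget 0 [set l | rD g t l])).
  apply: (@rD_near_ext _ _ _ _ a b tab _ D2) => u /andP[u1 u2].
  by rewrite -E// !ltW.
have := rD_unique D1 D3; rewrite mulrA -E//.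
exact: (mulfI (cexp_neq0 _)).
Qed.

Lemma rD_hline (F : C -> C) (T x : R) l : cD F (x +i* T) l -> rD (fun y => F (y +i* T)) x l.
Proof.
have E y : y +i* T = 0 +i* T + y%:C * 1 :> C by rewrite mulr1; simpc.
move=> D; rewrite E in D.
by apply: Dg_ext (Dg_eq _ (cD_line D)) => [y|]; [rewrite -E|rewrite mulr1].
Qed.

Lemma rD_vline (F : C -> C) (a t : R) l : cD F (a +i* t) l ->
  rD (fun y => F (a +i* y)) t (l * 'i).
Proof.
have E y : a +i* y = a +i* 0 + y%:C * 'i :> C by rewrite -complexiE; simpc.
move=> D; rewrite E in D.
by apply: Dg_ext (cD_line D) => y; rewrite -E.
Qed.

Lemma cabs_clog z : cabs (clog z) <= `|ln (cabs z)| + 4.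
Proof.
apply: le_trans (cabs_le_ReIm _) _; rewrite /clog /= lerD2l.
have h1 := atan_gtNpi2 (Im z / (cabs z + Re z)); have h2 := atan_ltpi2 (Im z / (cabs z + Re z)).
have /andP[_ p4] := pihalf_02 R.
by rewrite ler_norml; lra.
Qed.

Lemma ln_le_sub1 (x : R) : 0 < x -> ln x <= x - 1.
Proof. by move=> x0; have := @le_ln1Dx R (x - 1); rewrite [1 + _]addrC subrK; apply; lra. Qed.

(** The part of [Hp] on one side of the real axis: convex and free of the pole, so the identity
    theorem applies to zeta itself. *)
Definition side (e : R) : set C := Hp `&` [set s : C | 0 < e * Im s].

Lemma opn_side e : e != 0 -> opn (side e).
Proof.
move=> e0; apply: opnI; first exact: opn_Hp.
have en : 0 < `|e| by rewrite normr_gt0.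
move=> z /= zi; exists (e * Im z / `|e|); first by rewrite divr_gt0.
move=> w; rewrite ltr_pdivlMr// => h; have := Im_le_cabs (w - z); rewrite ImB => h3.
have := le_lt_trans (ler_wpM2r (ltW en) h3) h; rewrite mulrC -normrM mulrBr ltr_norml /=; lra.
Qed.

Lemma cvx_side e : cvx (side e).
Proof.
apply: cvxI; first exact: cvx_Hp.
by move=> a b /= ha hb t /andP[t0 t1]; rewrite /= ImD Im_realM ImB; have [h|h] := leP t (1/2); nra.
Qed.

Section zeta.
Variable zeta : C -> C.
Hypothesis hz : is_riemann_zeta zeta.

Lemma side_neq1 e s : side e s -> s != 1.
Proof. by move=> [_ /=]; apply: contraTneq => ->; rewrite /= mulr0 ltxx. Qed.

Lemma zeta_hol_side e : hol (side e) zeta.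
Proof. by apply: hol_sub (zeta_hol hz) => s /side_neq1. Qed.

Lemma zeta_ge_quarter s : 2 <= Re s -> 4^-1 <= cabs (zeta s).
Proof.
move=> hs; have := zeta_sub1 hz hs.
have h : rpw (Re s - 2) 2 <= 1.
  by rewrite /rpw -[leRHS]expR0 ler_expR oppr_le0 mulr_ge0 ?subr_ge0 ?ln_ge0 ?ler1n.
have := cabs_leD 1 (zeta s) 0; rewrite !subr0 cabs1 (cabsB 1); lra.
Qed.

Lemma zeta_nnear0 e p : e != 0 -> side e p -> ~ near0 zeta p.
Proof.
move=> e0 sp np.
have s2 : side e (2 +i* e) by split; [rewrite /Hp /=; lra|rewrite /= -expr2 exprn_even_gt0].
have [r r0 H] := identity_thm (opn_side e0) (@cvx_side e) (@zeta_hol_side e) sp np s2.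
have := @zeta_ge_quarter (2 +i* e) (lexx _).
by rewrite H ?cabs0 ?subrr ?cabs0//; lra.
Qed.

Lemma zeta_growth (T : R) s : 3 <= `|T| -> cabs (s - (2 +i* T)) <= 17 / 10 ->
  cabs (zeta s) <= 100 * `|T|.
Proof.
move=> hT hs.
have h1 : `|Re s - 2| <= 17 / 10 by have := Re_le_cabs (s - (2 +i* T)); rewrite ReB /=; lra.
have h2 : `|Im s - T| <= 17 / 10 by have := Im_le_cabs (s - (2 +i* T)); rewrite ImB /=; lra.
have re : 4^-1 < Re s by move: h1; rewrite ler_norml; lra.
have im : 1 <= `|Im s|.
  have := ler_normD (T - Im s) (Im s); rewrite subrK (distrC T); lra.
have ims1 : 1 <= cabs (s - 1) by apply: le_trans im _; have := Im_le_cabs (s - 1); rewrite ImB /= subr0.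
have s1 : s != 1 by rewrite -subr_eq0 -cabs_gt0; lra.
have := zeta_Zt hz re s1 => /(congr1 (@cabs R)); rewrite cabsM => E.
have := cabs_Zt (ltW re); rewrite -E /Kt => h3.
have h4 : cabs s <= 3 * `|T|.
  have := cabs_leD s (2 +i* T) 0; rewrite !subr0; have := cabs_le_ReIm (2 +i* T); rewrite /= ger0_norm//; lra.
rewrite -(ler_pM2l (lt_le_trans ltr01 ims1)).
apply: le_trans h3 _.
have := cabs_ge0 s; nra.
Qed.

(** All discs have centre [2 + iT], with radii [3/2 < 31/20 < 8/5 < 17/10 < 7/4]. The first contains
    the segment [1/2 <= x <= 2], the last just stays in [Re s > 1/4]. Zeros are removed up to [r1],
    the maximum is taken on the circle of radius [Rr], and [31/20] is the intermediate radius for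
    Borel-Caratheodory. The base of the logarithm in [K0] is [17/16 = Rr / r1]. *)
Let Rr : R := 17 / 10.
Let r1 : R := 8 / 5.
Let K0 : R := 7 / ln (17 / 16).

Lemma blaschke_den (a w : C) : cabs w = Rr ->
  cabs ((Rr ^+ 2)%:C - conjc a * w) = Rr * cabs (w - a).
Proof.
move=> wR; have -> : (Rr ^+ 2)%:C = w * conjc w by rewrite cabs_mul_conj wR.
rewrite (_ : _ - _ = w * (conjc w - conjc a)); last by ring.
by rewrite cabsM wR -rmorphB cabs_conj.
Qed.

Let z0 (T : R) : C := 2 +i* T.
(* [Rr (s - z) / Dn T z s] is the Blaschke factor of the disc of radius [Rr] about [z0 T]. *)
Let Dn (T : R) z s : C := (Rr ^+ 2)%:C - conjc (z - z0 T) * (s - z0 T).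

Lemma side_ball (T : R) z : 3 <= `|T| -> cabs (z - z0 T) < 7 / 4 -> side T z.
Proof.
move=> hT h; have := Re_le_cabs (z - z0 T); have := Im_le_cabs (z - z0 T).
rewrite ReB ImB /= => h1 h2; split; first by move: h2; rewrite ler_norml /Hp /=; lra.
rewrite /=; have -> : T * Im z = T * T + T * (Im z - T) by ring.
have : - (`|T| * (7 / 4)) < T * (Im z - T).
  have : `|T * (Im z - T)| < `|T| * (7 / 4).
    rewrite normrM ltr_pM2l; first by lra.
    by lra.
  by rewrite ltr_norml => /andP[].
have -> : T * T = `|T| * `|T| by rewrite -!expr2 real_normK ?num_real.
nra.
Qed.

Lemma local_factor (T : R) : 3 <= `|T| -> exists zs : seq C, exists H : C -> C,
  [/\ hol (side T) H, forall s, zeta s = (\prod_(z <- zs) (s - z)) * H s,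
   forall z, z \in zs -> [/\ cabs (z - z0 T) <= r1, zeta z = 0 & Re z < 1] &
   forall s, cabs (s - z0 T) <= r1 -> H s != 0].
Proof.
move=> hT.
have T0 : T != 0 by rewrite -normr_gt0; lra.
have [l Hl] : exists l : seq C, forall z, rect (2 / 5) (18 / 5) (T - r1) (T + r1) z -> zeta z = 0 -> z \in l.
  apply: (finite_zeros (opn_side T0) (@zeta_hol_side T)).
  - by move=> p sp; exact: zeta_nnear0 sp.
  - lra.
  - rewrite /r1; lra.
  - move=> z [h1 h2]; split; first by rewrite /Hp /=; lra.
    rewrite /=; case: (ltP 0 T) hT => [tp|tn].
      by rewrite gtr0_norm// => h3; apply: mulr_gt0 => //; move: h2; rewrite /r1; lra.
    rewrite ler0_norm// => h3; rewrite -mulrNN; apply: mulr_gt0; first by lra.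
    by move: h2; rewrite /r1; lra.
pose lf := [seq z <- l | cabs (z - z0 T) <= r1].
have lfU z : z \in lf -> side T z.
  by rewrite mem_filter => /andP[h _]; apply: side_ball => //; move: h; rewrite /r1; lra.
have [zs [H [hH EH Hlf zslf]]] := factor_list (opn_side T0) (@zeta_hol_side T)
  (fun p sp => @zeta_nnear0 T p T0 sp) lfU.
have zs1 z : z \in zs -> cabs (z - z0 T) <= r1.
  by move=> /zslf; rewrite mem_filter => /andP[].
have zs0 z : z \in zs -> zeta z = 0.
  move=> zz; rewrite EH (big_rem z)//= subrr !mul0r//.
have zsRe z : z \in zs -> Re z < 1.
  move=> zz; rewrite ltNge; apply/negP => h.
  have := zeta_neq0 hz h (side_neq1 (lfU _ (zslf _ zz))).
  by rewrite zs0 ?eqxx.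
have Hnz s : cabs (s - z0 T) <= r1 -> H s != 0.
  move=> sr; have [zE|] := eqVneq (zeta s) 0; last first.
    by rewrite EH; apply: contra_neq => ->; rewrite mulr0.
  apply: Hlf; rewrite mem_filter sr Hl//.
  have := Re_le_cabs (s - z0 T); have := Im_le_cabs (s - z0 T).
  by rewrite ReB ImB /= !ler_norml => h1 h2; move: sr; rewrite /r1 => sr; split; lra.
exists zs, H; split => // z zz; split; [exact: zs1|exact: zs0|exact: zsRe].
Qed.

Lemma Dn_bounds (T : R) z s : cabs (z - z0 T) <= r1 ->
  Rr ^+ 2 - r1 * cabs (s - z0 T) <= Re (Dn T z s) /\
  cabs (Dn T z s) <= Rr ^+ 2 + r1 * cabs (s - z0 T).
Proof.
move=> zz.
have h : cabs (conjc (z - z0 T) * (s - z0 T)) <= r1 * cabs (s - z0 T).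
  by rewrite cabsM cabs_conj ler_wpM2r ?cabs_ge0.
split.
  rewrite /Dn ReB lerD2l lerN2; apply: le_trans h.
  exact: le_trans (ler_norm _) (Re_le_cabs _).
by apply: le_trans (cabsD _ _) _; rewrite cabsN cabs_real ger0_norm ?sqr_ge0// lerD2l.
Qed.

Lemma Re_Dn_gt0 (T : R) z s : cabs (z - z0 T) <= r1 -> cabs (s - z0 T) < r1 -> 0 < Re (Dn T z s).
Proof.
move=> zz sr; have [h _] := Dn_bounds s zz; apply: lt_le_trans h.
by move: sr (cabs_ge0 (s - z0 T)); rewrite /Rr /r1; nra.
Qed.

Lemma hol_Dn (T : R) z U : hol U (Dn T z).
Proof. by apply: holB; [exact: hol_cst|apply: holM; [exact: hol_cst|exact: hol_subc]]. Qed.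

(** Exchanging the zeros for Blaschke denominators does not change the modulus on the circle of
    radius [Rr], so the growth bound for zeta passes to [Hb] inside. At the centre this is Jensen's
    bound for the number of zeros; and as [Hb] has no zeros in the disc, its logarithm [eta] is
    subject to Borel-Caratheodory. *)
Lemma local_eta (T : R) : 3 <= `|T| -> exists zs : seq C, exists eta : C -> C,
  [/\ (size zs)%:R <= K0 * ln `|T|,
    forall z, z \in zs -> [/\ cabs (z - z0 T) <= r1, zeta z = 0 & Re z < 1],
    hol [set z | cabs (z - z0 T) < r1] eta,
    forall s, cabs (s - z0 T) < r1 -> zeta s * \prod_(z <- zs) (Dn T z s / Rr%:C) =
      cexp (eta s) * \prod_(z <- zs) (s - z) &
    forall s, cabs (s - z0 T) <= 3 / 2 -> cabs (eta s - eta (z0 T)) <= 420 * ln `|T|].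
Proof.
move=> hT; have [zs [H [hH EH zsP Hnz]]] := local_factor hT.
have T0 : T != 0 by rewrite -normr_gt0; lra.
have zs1 z : z \in zs -> cabs (z - z0 T) <= r1 by move=> /zsP[].
pose Hb s := H s * \prod_(z <- zs) (Dn T z s / Rr%:C).
have Hb_hol : hol [set z | cabs (z - z0 T) < 7 / 4] Hb.
  apply: holM; first by apply: hol_sub hH => z; exact: side_ball.
  by apply: hol_prod => z; apply: holM (@hol_cst _ _ _); exact: hol_Dn.
have R0 : 0 < Rr by rewrite /Rr; lra.
have R74 : Rr < 7 / 4 by rewrite /Rr; lra.
set M := 100 * `|T|.
have M0 : 0 < M by rewrite /M; lra.
have Hb_le w : cabs (w - z0 T) < Rr -> cabs (Hb w) <= M.
  move=> wr; apply: (max_modulus R0 R74 Hb_hol wr) => s sr.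
  rewrite (_ : cabs (Hb s) = cabs (zeta s)); first by apply: zeta_growth => //; rewrite -/(z0 T) sr.
  rewrite /Hb EH !cabsM mulrC !cabs_prod; congr (_ * _); apply: eq_bigr => z _.
  rewrite cabsM cabsV cabs_real gtr0_norm// /Dn blaschke_den// mulrAC mulfV ?gt_eqF// mul1r.
  by congr cabs; ring.
have Hb_nz s : cabs (s - z0 T) < r1 -> Hb s != 0.
  move=> sr; rewrite mulf_neq0 ?Hnz ?ltW//; rewrite prodf_seq_neq0; apply/allP => z zz /=.
  rewrite mulf_neq0//; last by rewrite invr_eq0 fmorph_eq0 gt_eqF.
  by apply: off_slit_neq0; apply: Re_gt0_off_slit; apply: Re_Dn_gt0 => //; exact: zs1.
have Dzz z : Dn T z (z0 T) = (Rr ^+ 2)%:C by rewrite /Dn subrr mulr0 subr0.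
(* Each removed zero multiplies the modulus at the centre by at least [Rr / r1], starting from
   [|zeta| >= 1/4]. *)
have Hb_z0 : (Rr / r1) ^+ size zs / 4 <= cabs (Hb (z0 T)).
  have E : cabs (Hb (z0 T)) = cabs (H (z0 T)) * Rr ^+ size zs.
    rewrite /Hb cabsM cabs_prod; congr (_ * _).
    elim: (zs) => [|z zs' IH]; first by rewrite big_nil expr0.
    rewrite big_cons IH /= exprS; congr (_ * _).
    by rewrite Dzz -fmorphV -rmorphM cabs_real expr2 mulfK ?gt_eqF// gtr0_norm.
  have h1 : cabs (zeta (z0 T)) <= r1 ^+ size zs * cabs (H (z0 T)).
    rewrite EH cabsM cabs_prod ler_wpM2r ?cabs_ge0//.
    elim: (zs) zs1 => [|z zs' IH] zs1'; first by rewrite big_nil expr0.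
    rewrite big_cons /= exprS ler_pM ?cabs_ge0//.
    - by apply: prodr_ge0 => i _; exact: cabs_ge0.
    - by rewrite cabsB zs1'// mem_head.
    by apply: IH => y yz; apply: zs1'; rewrite inE yz orbT.
  have h2 := le_trans (@zeta_ge_quarter (z0 T) (lexx _)) h1.
  have q0 : 0 < r1 by rewrite /r1; lra.
  have rn : 0 < r1 ^+ size zs by rewrite exprn_gt0.
  rewrite E expr_div_n mulrAC ler_pdivrMr// (mulrC (cabs _)) -!mulrA ler_pM2l ?exprn_gt0//.
  by rewrite mulrC.
have q1 : 1 <= Rr / r1 by rewrite /Rr /r1; lra.
have Hb14 : 4^-1 <= cabs (Hb (z0 T)).
  by apply: le_trans Hb_z0; rewrite ler_peMl// exprn_ege1.
set A := ln (4 * M).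
have zz0 : cabs (z0 T - z0 T) = 0 by rewrite subrr cabs0.
(* [400 |T| <= |T|^7], because [3^6 = 729] exceeds 400. *)
have A7 : A <= 7 * ln `|T|.
  have t0 : 0 < `|T| by lra.
  have -> : 7 * ln `|T| = ln (`|T| ^+ 7) by rewrite lnXn// mulr_natl.
  rewrite /A ler_ln ?posrE ?exprn_gt0//; last by rewrite mulr_gt0.
  rewrite exprSr /M mulrA ler_pM2r//.
  have : 3 ^+ 6 <= `|T| ^+ 6 by rewrite lerXn2r ?nnegrE.
  by apply: le_trans; rewrite !exprS expr0; lra.
have A0 : 0 < A by rewrite /A ln_gt0// /M; lra.
have size_le : (size zs)%:R <= K0 * ln `|T|.
  have l0 : 0 < ln (17 / 16 : R) by rewrite ln_gt0//; lra.
  have h1 : (Rr / r1) ^+ size zs <= 4 * M.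
    have := Hb_le (z0 T); rewrite zz0 => /(_ R0); lra.
  have RE : Rr / r1 = 17 / 16 by rewrite /Rr /r1; field.
  have : ln ((Rr / r1) ^+ size zs) <= A.
    have q0 : 0 < Rr / r1 by apply: lt_le_trans q1.
    by rewrite ler_ln ?posrE ?exprn_gt0// mulr_gt0.
  rewrite lnXn; last by apply: lt_le_trans q1.
  rewrite RE => h2.
  rewrite /K0 mulrAC ler_pdivlMr//; apply: le_trans A7.
  by rewrite (mulr_natl (ln (17 / 16))).
have [eta heta Eeta] : exists2 eta, hol [set z | cabs (z - z0 T) < r1] eta &
    forall z, cabs (z - z0 T) < r1 -> cexp (eta z) = Hb z.
  apply: (log_convex (@opn_ball _ (z0 T) r1) (@cvx_ball _ (z0 T) r1)) => //.
  by apply: hol_sub Hb_hol => z /=; rewrite /r1; lra.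
have r10 : 0 < r1 by rewrite /r1; lra.
(* The radii give [2 * (3/2) / (31/20 - 3/2) = 60], and [420 = 60 * 7]. *)
have eta_le s : cabs (s - z0 T) <= 3 / 2 -> cabs (eta s - eta (z0 T)) <= 60 * A.
  move=> sr.
  have b1 : 0 < 3 / 2 :> R by lra.
  have b2 : 3 / 2 < 31 / 20 :> R by lra.
  have b3 : 31 / 20 < r1 by rewrite /r1; lra.
  have := @borel_caratheodory R (fun s => eta s - eta (z0 T)) (z0 T) (3 / 2) (31 / 20) r1 A s A0 b1 b2 b3.
  rewrite (_ : 2 * A * (3 / 2) / (31 / 20 - 3 / 2) = 60 * A); last by field.
  apply => //.
  - by apply: holB heta (@hol_cst _ _ _).
  - by rewrite subrr.
  - move=> z zr; have e1 := congr1 (@cabs R) (Eeta z zr).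
    have e2 := congr1 (@cabs R) (Eeta (z0 T) (ltac:(by rewrite zz0))).
    rewrite !cabs_cexp in e1 e2; rewrite ReB -(expRK (Re (eta z))) -(expRK (Re (eta (z0 T)))) e1 e2.
    rewrite /A lnM ?posrE//.
    have h1 : ln (cabs (Hb z)) <= ln M.
      rewrite ler_ln ?posrE ?cabs_gt0 ?Hb_nz// Hb_le//; move: zr; rewrite /r1 /Rr; lra.
    have h2 : - ln 4 <= ln (cabs (Hb (z0 T))).
      rewrite -lnV ?posrE// ler_ln ?posrE ?invr_gt0// cabs_gt0 -cabs_gt0; apply: lt_le_trans Hb14; rewrite invr_gt0//.
    lra.
exists zs, eta; split => //.
  move=> s sr; rewrite Eeta// /Hb EH; ring.
move=> s sr; apply: le_trans (eta_le s sr) _; lra.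
Qed.

(** Any branch [G] along the segment has the increments of [eta] plus principal logarithms of the
    Blaschke factors, by [cexp_proportional]. Near a zero the only unbounded contribution is
    [- ln |x + iT - z|], which is kept in the bound for later integration. *)
Lemma local_log (T : R) : 3 <= `|T| -> exists zs : seq C,
  [/\ (size zs)%:R <= K0 * ln `|T|,
  forall z, z \in zs -> cabs (z - (2 +i* T)) <= r1 /\ zeta z = 0 &
  forall (a : R) (G : R -> C), 2^-1 <= a <= 2 ->
    (forall x, a <= x <= 2 -> exists l, rD G x l) ->
    (forall x, a <= x <= 2 -> cexp (G x) = zeta (x +i* T)) ->
    forall x, a <= x <= 2 -> cabs (G x - G 2) <= 420 * ln `|T| +
      \sum_(z <- zs) (40 - ln (cabs (x +i* T - z)))].
Proof.
move=> hT; have [zs [eta [size_le zsP heta Eeta eta_le]]] := local_eta hT.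
have zs1 z : z \in zs -> cabs (z - z0 T) <= r1 by move=> /zsP[].
exists zs; split => //; first by move=> z /zsP[].
move=> a G /andP[a1 a2] DG EG x xa.
(* A zero at height exactly [T] must lie to the left of the segment, since zeta is an exponential on
   it; then [y + iT - z] is positive. *)
have slit y z : a <= y <= 2 -> z \in zs -> off_slit (y +i* T - z).
  move=> ya zz; have [E|ne] := eqVneq (Im z) T; last first.
    by apply: Im_neq0_off_slit; rewrite ImB /= subr_eq0 eq_sym.
  apply: Re_gt0_off_slit; rewrite ReB /= subr_gt0 ltNge; apply/negP => yz.
  have zE : z = Re z +i* T by case: (z) E => ? ? /= ->.
  have h : a <= Re z <= 2 by have [_ _ +] := zsP _ zz; lra.
  have [_ zz0 _] := zsP _ zz; have := EG _ h; rewrite -zE zz0 => /eqP; apply/negP; exact: cexp_neq0.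
have yz0 y : y +i* T - z0 T = (y - 2)%:C by rewrite /z0; simpc.
have yr y : a <= y <= 2 -> cabs (y +i* T - z0 T) <= 3 / 2.
  by move=> ya; rewrite yz0 cabs_real ler_norml; lra.
have yr1 y : a <= y <= 2 -> cabs (y +i* T - z0 T) < r1.
  by move=> /yr; rewrite /r1; lra.
pose L y := eta (y +i* T) + \sum_(z <- zs) (clog (y +i* T - z) - clog (Dn T z (y +i* T))).
have rDlog (f : C -> C) y : hol setT f -> off_slit (f (y +i* T)) ->
    exists l, rD (fun y => clog (f (y +i* T))) y l.
  move=> hf os; have [m Dm] := hf (y +i* T) I.
  by eexists; apply: rD_hline (Dg_comp (cD_clog os) Dm).
have DL y : a <= y <= 2 -> exists l, rD L y l.
  move=> ya.
  have [m Dm] := heta _ (yr1 y ya).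
  have [l Dl] : exists l, rD (fun y => \sum_(z <- zs) (clog (y +i* T - z) - clog (Dn T z (y +i* T)))) y l.
    have sl := slit y; elim: (zs) sl zs1 => [|z zs' IH] sl zs1'.
      by exists 0; apply: Dg_ext (Dg_cst _ 0 y) => u; rewrite big_nil.
    have [||n DIH] := IH.
    - by move=> z' h1 h2; apply: sl => //; rewrite inE h2 orbT.
    - by move=> z' h1; apply: zs1'; rewrite inE h1 orbT.
    have [|n1 D1] := rDlog (fun s => s - z) y (@hol_subc _ _ _).
      by apply: sl => //; rewrite mem_head.
    have [|n2 D2] := rDlog (Dn T z) y (@hol_Dn T z setT).
      by apply: Re_gt0_off_slit; apply: Re_Dn_gt0; [by apply: zs1'; rewrite mem_head|exact: yr1].
    exists (n1 - n2 + n); apply: Dg_ext (DgD (DgB D1 D2) DIH) => u.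
    by rewrite big_cons.
  by exists (m + l); apply: DgD (rD_hline Dm) Dl.
have Rn : Rr%:C != 0 :> C by rewrite fmorph_eq0 gt_eqF// /Rr; lra.
have PD y : a <= y <= 2 -> \prod_(z <- zs) (Dn T z (y +i* T) / Rr%:C) != 0.
  move=> ya; rewrite prodf_seq_neq0; apply/allP => z zz /=.
  rewrite mulf_neq0//; last by rewrite invr_eq0.
  by apply: off_slit_neq0; apply: Re_gt0_off_slit; apply: Re_Dn_gt0; [exact: zs1|exact: yr1].
have PE y : a <= y <= 2 -> cexp (\sum_(z <- zs) (clog (y +i* T - z) - clog (Dn T z (y +i* T)))) *
    \prod_(z <- zs) (Dn T z (y +i* T) / Rr%:C) * Rr%:C ^+ size zs = \prod_(z <- zs) (y +i* T - z).
  move=> ya; have sl := slit y; elim: (zs) sl zs1 => [|z zs' IH] sl zs1'.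
    by rewrite !big_nil expr0 cexp0 !mulr1.
  rewrite !big_cons cexpD -IH; first last.
  - by move=> z' h1; apply: zs1'; rewrite inE h1 orbT.
  - by move=> z' h1 h2; apply: sl => //; rewrite inE h2 orbT.
  have o1 : off_slit (y +i* T - z) by apply: sl => //; rewrite mem_head.
  have o2 : off_slit (Dn T z (y +i* T)).
    by apply: Re_gt0_off_slit; apply: Re_Dn_gt0; [by apply: zs1'; rewrite mem_head|exact: yr1].
  have E2 : cexp (clog (y +i* T - z) - clog (Dn T z (y +i* T))) * Dn T z (y +i* T) = y +i* T - z.
    by rewrite -{2}(cexp_clog o2) -cexpD subrK cexp_clog.
  rewrite /= exprS -[in RHS]E2.
  by move: (cexp _) (Dn T z _) (cexp _) (\prod_(j <- zs') _) (_ ^+ _) => c1 c2 c3 c4 c5; field.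
have EL y : a <= y <= 2 -> cexp (G y) = (Rr%:C ^+ size zs) * cexp (L y).
  move=> ya; rewrite EG//; apply: (mulIf (PD y ya)); rewrite Eeta ?yr1// -(PE y ya) /L cexpD.
  by ring.
have {}xa' : a <= x <= 2 := xa.
have E : G 2 - G x = L 2 - L x.
  have /andP[xa1 xa2] := xa.
  apply: (@cexp_proportional G L (Rr%:C ^+ size zs)) => //.
  - by move=> t /andP[t1 t2]; apply: DG; lra.
  - by move=> t /andP[t1 t2]; apply: DL; lra.
  - by move=> t /andP[t1 t2]; apply: EL; lra.
rewrite cabsB E cabsB /L -/(z0 T).
rewrite (_ : _ - _ = (eta (x +i* T) - eta (z0 T)) + (\sum_(z <- zs) (clog (x +i* T - z) - clog (Dn T z (x +i* T))) -
   \sum_(z <- zs) (clog (z0 T - z) - clog (Dn T z (z0 T))))); last by ring.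
apply: le_trans (cabsD _ _) _; rewrite lerD//.
  by exact: eta_le (yr _ xa).
rewrite -sumrB; apply: le_trans (cabs_sum _ _) _.
rewrite big_seq [leRHS]big_seq; apply: ler_sum => z zz.
have b1 : cabs (clog (z0 T - z)) <= 5.
  apply: le_trans (cabs_clog _) _; have h1 : 1 <= cabs (z0 T - z).
    apply: le_trans (le_trans (ler_norm _) (Re_le_cabs _)); rewrite ReB /=.
    by have [_ _ +] := zsP _ zz; lra.
  have h2 := zs1 _ zz.
  rewrite cabsB in h2; have h3 := @ln_le_sub1 (cabs (z0 T - z)) (lt_le_trans ltr01 h1).
  by rewrite ger0_norm ?ln_ge0//; move: h2; rewrite /r1; lra.
have bD s : cabs (s - z0 T) <= 3 / 2 -> cabs (clog (Dn T z s)) <= 9.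
  move=> sr; have sr1 : cabs (s - z0 T) < r1 by rewrite /r1; lra.
  have [d1 d2] := Dn_bounds s (zs1 _ zz); have h0 := cabs_ge0 (s - z0 T).
  have d3 : 2 / 5 <= cabs (Dn T z s).
    apply: le_trans (le_trans (ler_norm _) (Re_le_cabs _)); apply: le_trans d1.
    by rewrite /Rr /r1; lra.
  have d4 : cabs (Dn T z s) <= 6 by apply: le_trans d2 _; rewrite /Rr /r1; lra.
  have p : 0 < cabs (Dn T z s) by lra.
  apply: le_trans (cabs_clog _) _; rewrite -lerBrDr ler_norml.
  have h1 := ln_le_sub1 p.
  have h2 : ln (cabs (Dn T z s))^-1 <= (cabs (Dn T z s))^-1 - 1 by apply: ln_le_sub1; rewrite invr_gt0.
  rewrite lnV ?posrE// in h2.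
  have h3 : (cabs (Dn T z s))^-1 <= 5 / 2.
    by rewrite -[5 / 2]invrK lef_pV2 ?posrE ?invr_gt0//; lra.
  lra.
have b2 := bD _ (yr _ xa).
have b3 : cabs (clog (Dn T z (z0 T))) <= 9 by apply: bD; rewrite subrr cabs0; lra.
have b4 : cabs (clog (x +i* T - z)) <= 10 - ln (cabs (x +i* T - z)).
  apply: le_trans (cabs_clog _) _.
  have p : 0 < cabs (x +i* T - z) by rewrite cabs_gt0; apply: off_slit_neq0; exact: slit.
  have h1 := ln_le_sub1 p.
  have h2 : cabs (x +i* T - z) <= 31 / 10.
    have := cabs_leD (x +i* T) (z0 T) z; have := yr _ xa; have := zs1 _ zz.
    by rewrite (cabsB z) /r1; lra.
  have : `|ln (cabs (x +i* T - z))| <= 6 - ln (cabs (x +i* T - z)) by rewrite ler_norml; lra.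
  lra.
(* The four logarithms contribute [10 + 9 + 5 + 9 = 33], rounded up to 40. *)
apply: le_trans (cabsD _ _) _; rewrite cabsN.
have := cabsD (clog (x +i* T - z)) (- clog (Dn T z (x +i* T))).
have := cabsD (clog (z0 T - z)) (- clog (Dn T z (z0 T))); rewrite !cabsN.
lra.
Qed.
End zeta.
End Local.

(** * Integrals of log zeta along the horizontal sides *)

Section Horizontal.
Context {R : realType}.
Local Notation C := R[i].
Local Notation Re := complex.Re.
Local Notation Im := complex.Im.
Implicit Types (U V : set C) (f g : C -> C) (z w s : C) (r x t y : R).

Lemma mvt_closed (f f' : R -> C) (m m' : R -> R) (a b : R) : a <= b ->
  (forall t, a <= t <= b -> rD f t (f' t)) ->
  (forall t, a <= t <= b -> is_derive t 1 m (m' t)) ->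
  (forall t, a <= t <= b -> cabs (f' t) <= m' t) -> cabs (f b - f a) <= m b - m a.
Proof.
move=> ab Df Dm le.
have cl t : a < t < b -> a <= t <= b by case/andP=> ? ?; rewrite !ltW.
apply: (mvt_le ab (f' := f') (m' := m')).
- by move=> t /Df /rD_cont.
- by move=> t /Dm /(rD_realP _ _ _).2 /rD_cont.
- by move=> t /cl /Df.
- by move=> t /cl /Dm.
- by move=> t /cl /le.
Qed.

Lemma clog1 : clog 1 = 0 :> C.
Proof. by rewrite /clog cabs1 ln1 /= mul0r atan0 mulr0. Qed.

Lemma cabs_clog1p (u : C) : cabs u <= 3 / 4 -> cabs (clog (1 + u)) <= 4 * cabs u.
Proof.
move=> hu.
have os t : 0 <= t <= 1 -> 4^-1 <= Re (1 + t%:C * u).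
  move=> ht; rewrite ReD Re_realM /=; have := le_trans (Re_le_cabs u) hu.
  rewrite ler_norml => /andP[h1 h2]; nra.
have D t : 0 <= t <= 1 -> rD (fun t => clog (1 + t%:C * u)) t ((1 + t%:C * u)^-1 * u).
  move=> ht; apply: (@cD_line _ _ 1 u); apply: cD_clog; apply: Re_gt0_off_slit.
  by apply: lt_le_trans (os _ ht); rewrite invr_gt0.
have := @mvt_cst R (fun t => clog (1 + t%:C * u)) (fun t => (1 + t%:C * u)^-1 * u) (4 * cabs u) 0 1 ler01.
rewrite mul1r mul0r addr0 clog1 !subr0 mulr1; apply.
- by move=> t /D /rD_cont.
- by move=> t /andP[t0 t1]; apply: D; rewrite !ltW.
- move=> t /andP[t0 t1]; rewrite cabsM ler_wpM2r ?cabs_ge0// cabsV.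
  have h : 4^-1 <= cabs (1 + t%:C * u).
    by apply: le_trans (os t _) (le_trans (ler_norm _) (Re_le_cabs _)); rewrite !ltW.
  by rewrite -[4]invrK lef_pV2 ?posrE ?invr_gt0//; apply: lt_le_trans h; rewrite invr_gt0.
Qed.

Lemma rpw_le1 a x : 0 <= a -> 1 <= x -> rpw a x <= 1.
Proof. by move=> a0 x1; rewrite -[leRHS]expR0 ler_expR oppr_le0 mulr_ge0// ln_ge0. Qed.

(* A primitive of [ln |x + iy|] in [x]; for [y = 0] the junk value of [x / y] is harmless. *)
Definition lnprim y x := x * (ln (x ^+ 2 + y ^+ 2) / 2) - x + y * atan (x / y).

Lemma is_derive_lnprim y x : 0 < x ^+ 2 + y ^+ 2 ->
  is_derive x 1 (lnprim y) (ln (x ^+ 2 + y ^+ 2) / 2).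
Proof.
move=> p.
have D1 : is_derive x 1 (fun x => x ^+ 2 + y ^+ 2) (2 * x).
  apply: is_derive_eq; rewrite /GRing.scale /=; ring.
have D2 : is_derive x 1 (fun x => ln (x ^+ 2 + y ^+ 2)) ((x ^+ 2 + y ^+ 2)^-1 * (2 * x)).
  exact: (@is_derive1_comp _ (@ln R) (fun x => x ^+ 2 + y ^+ 2) x _ _ (is_derive1_ln p) D1).
have D3 : is_derive x 1 (fun x => y * atan (x / y)) (y ^+ 2 / (x ^+ 2 + y ^+ 2)).
  have [y0|y0] := eqVneq y 0.
    rewrite y0 expr0n /= mul0r.
    rewrite (_ : (fun x => _) = cst 0); last by apply/funext => u; rewrite mul0r.
    exact: is_derive_cst.
  have Da : is_derive x 1 (fun x => x / y) y^-1.
    apply: is_derive_eq; rewrite /GRing.scale /=; ring.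
  have Db := @is_derive1_comp _ (@atan R) (fun x => x / y) x _ _ (is_derive1_atan (x / y)) Da.
  rewrite /comp in Db.
  apply: is_derive_eq; rewrite /GRing.scale /=; field.
  by rewrite y0 gt_eqF.
rewrite /lnprim; apply: is_derive_eq; rewrite /GRing.scale /=; field.
by rewrite gt_eqF.
Qed.

(** The bound is uniform as [y] tends to 0, so it does not matter how close a zero is to the side.
    With [u = x^2 + y^2] and [ln u < 0], the dangerous product is controlled by [|x| <= sqrt u] and
    [- ln (sqrt u) <= 1 / sqrt u]. *)
Lemma lnprim_le (Q : R) y x : `|x| <= Q -> `|y| <= 2 ->
  `|lnprim y x| <= Q * ((Q ^+ 2 + 4) / 2) + Q + 5.
Proof.
move=> hx hy.
have Q0 : 0 <= Q by apply: le_trans hx.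
have /andP[_ p4] := pihalf_02 R.
have h1 := atan_gtNpi2 (x / y); have h2 := atan_ltpi2 (x / y).
have b1 : `|y * atan (x / y)| <= 4.
  rewrite normrM; apply: (@le_trans _ _ (2 * 2)); last by lra.
  by rewrite ler_pM// ler_norml; lra.
have Q2 : 0 <= Q ^+ 2 by rewrite sqr_ge0.
have QQ : 0 <= Q * ((Q ^+ 2 + 4) / 2) by rewrite mulr_ge0//; lra.
have b2 : `|x * (ln (x ^+ 2 + y ^+ 2) / 2)| <= Q * ((Q ^+ 2 + 4) / 2) + 1.
  have [p|p] := ltP 0 (x ^+ 2 + y ^+ 2); last first.
    by rewrite ln0// mul0r mulr0 normr0; lra.
  have ub := ln_le_sub1 p.
  have x2 : x ^+ 2 <= Q ^+ 2 by rewrite -(real_normK (num_real x)) lerXn2r ?nnegrE.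
  have y2 : y ^+ 2 <= 4.
    have -> : 4 = 2 ^+ 2 :> R by ring.
    by rewrite -(real_normK (num_real y)) lerXn2r ?nnegrE.
  have [q|q] := leP 0 (ln (x ^+ 2 + y ^+ 2)).
    rewrite normrM; apply: (@le_trans _ _ (Q * ((Q ^+ 2 + 4) / 2))); last by lra.
    by rewrite ler_pM// ger0_norm ?divr_ge0//; lra.
  set u := x ^+ 2 + y ^+ 2 in p ub q *.
  have lb := @ln_le_sub1 _ (Num.sqrt u)^-1.
  rewrite lnV ?posrE ?sqrtr_gt0// in lb.
  have su : Num.sqrt u ^+ 2 = u by rewrite sqr_sqrtr// ltW.
  have s0 : 0 < Num.sqrt u by rewrite sqrtr_gt0.
  have lns : ln u = 2 * ln (Num.sqrt u) by rewrite -{1}su lnXn// mulr_natl.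
  have xs : `|x| <= Num.sqrt u.
    by rewrite -sqrtr_sqr; apply: ler_wsqrtr; rewrite /u lerDl sqr_ge0.
  rewrite normrM (@ltr0_norm _ (ln u / 2)); last by lra.
  have {}lb : - ln (Num.sqrt u) <= (Num.sqrt u)^-1 by have := lb (ltac:(by rewrite invr_gt0)); lra.
  rewrite lns; apply: (@le_trans _ _ (Num.sqrt u * (Num.sqrt u)^-1)); last by rewrite mulfV ?gt_eqF//; lra.
  by rewrite ler_pM//; lra.
rewrite /lnprim; apply: le_trans (ler_normD _ _) _; apply: le_trans (lerD (ler_normB _ _) b1) _.
lra.
Qed.

(* Real and equal to [2 (1 - a) / ((1 - a)^2 + t^2)] at [s = a + it]. *)
Definition mirror_kernel (a : R) s : C := (s - (2 * a - 1)%:C)^-1 - (s - 1)^-1.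

(** The factored form shows the decay [|s|^-2], with a numerator at most 1 in modulus for
    [1/2 <= a < 1]; this is the origin of [T^-2] in the error term. *)
Lemma mirror_kernelE a s : s != 1 -> s != (2 * a - 1)%:C ->
  mirror_kernel a s = (2 * (a - 1))%:C * ((s - 1)^-1 * (s - (2 * a - 1)%:C)^-1).
Proof.
move=> s1 s2; rewrite /mirror_kernel.
have e1 : s - 1 != 0 by rewrite subr_eq0.
have e2 : s - (2 * a - 1)%:C != 0 by rewrite subr_eq0.
have -> : s - (2 * a - 1)%:C = (s - 1) - (2 * (a - 1))%:C.
  rewrite (_ : 2 * a - 1 = 2 * (a - 1) + 1) ?rmorphD; last by ring.
  by rewrite rmorph1; ring.
have e3 : (s - 1) - (2 * (a - 1))%:C != 0.
  apply: contra_neq e2 => <-; rewrite (_ : 2 * a - 1 = 2 * (a - 1) + 1) ?rmorphD; last by ring.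
  by rewrite rmorph1; ring.
move: e1 e3; move: (s - 1) ((2 * (a - 1))%:C) => u d e1 e3.
by field; rewrite e1 e3.
Qed.

Lemma mirror_kernel_vline a t : a < 1 -> mirror_kernel a (a +i* t) = (2 * (1 - a) / ((1 - a) ^+ 2 + t ^+ 2))%:C.
Proof.
move=> a1.
have p : 0 < (1 - a) ^+ 2 + t ^+ 2 by rewrite ltr_pwDl ?exprn_gt0 ?sqr_ge0 ?subr_gt0.
have E1 : a +i* t - (2 * a - 1)%:C = (1 - a) +i* t :> C by simpc; congr (_ +i* _); ring.
have E2 : a +i* t - 1 = - ((1 - a) +i* (- t)) :> C.
  by apply: complex_ext; rewrite ?ReB ?ImB ?ReN ?ImN /=; ring.
have n1 : (1 - a) +i* t != 0 :> C by rewrite eq_complex /= gt_eqF ?subr_gt0.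
have n2 : (1 - a) +i* (- t) != 0 :> C by rewrite eq_complex /= gt_eqF ?subr_gt0.
have pC : ((1 - a) ^+ 2 + t ^+ 2)%:C != 0 :> C by rewrite fmorph_eq0 gt_eqF.
have E3 : ((1 - a) +i* t) * ((1 - a) +i* (- t)) = ((1 - a) ^+ 2 + t ^+ 2)%:C :> C.
  by apply: complex_ext; rewrite ?ReM ?ImM /=; ring.
have E4 : ((1 - a) +i* t) + ((1 - a) +i* (- t)) = (2 * (1 - a))%:C :> C.
  by apply: complex_ext; rewrite ?ReD ?ImD /=; ring.
have -> : (2 * (1 - a) / ((1 - a) ^+ 2 + t ^+ 2))%:C = (2 * (1 - a))%:C / ((1 - a) ^+ 2 + t ^+ 2)%:C :> C.
  by rewrite rmorphM fmorphV.
rewrite /mirror_kernel E1 E2 -E3 -E4.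
move: n1 n2; move: (_ +i* _) (_ +i* _) => u v n1 n2.
by field; rewrite n1 n2.
Qed.

Lemma mirror_kernel_le_im a x t : 2^-1 <= a -> a < 1 -> t != 0 -> cabs (mirror_kernel a (x +i* t)) <= t ^- 2.
Proof.
move=> a1 a2 t0.
have n1 : x +i* t != 1 :> C by rewrite eq_complex /= (negbTE t0) andbF.
have n2 : x +i* t != (2 * a - 1)%:C :> C by rewrite eq_complex /= (negbTE t0) andbF.
have tp : 0 < `|t| by rewrite normr_gt0.
rewrite mirror_kernelE// cabsM cabs_real cabsM !cabsV.
have h1 : `|t| <= cabs (x +i* t - 1) by apply: le_trans (Im_le_cabs _); rewrite ImB /= subr0.
have h2 : `|t| <= cabs (x +i* t - (2 * a - 1)%:C) by apply: le_trans (Im_le_cabs _); rewrite ImB /= subr0.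
have h3 : `|2 * (a - 1)| <= 1 by rewrite ler_norml; lra.
have -> : t ^- 2 = 1 * (`|t|^-1 * `|t|^-1) by rewrite mul1r -invfM -expr2 real_normK// num_real.
by rewrite !ler_pM ?mulr_ge0 ?invr_ge0 ?cabs_ge0// lef_pV2 ?posrE//; exact: lt_le_trans tp _.
Qed.

Lemma mirror_kernel_le_re a x t : 2^-1 <= a -> a < 1 -> 1 < x -> cabs (mirror_kernel a (x +i* t)) <= (x - 1) ^- 2.
Proof.
move=> a1 a2 x1.
have n1 : x +i* t != 1 :> C by rewrite eq_complex /= gt_eqF.
have n2 : x +i* t != (2 * a - 1)%:C :> C by rewrite eq_complex /= gt_eqF//; lra.
have tp : 0 < x - 1 by rewrite subr_gt0.
rewrite mirror_kernelE// cabsM cabs_real cabsM !cabsV.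
have h1 : x - 1 <= cabs (x +i* t - 1).
  by apply: le_trans (le_trans (ler_norm _) (Re_le_cabs _)); rewrite ReB /=.
have h2 : x - 1 <= cabs (x +i* t - (2 * a - 1)%:C).
  by apply: le_trans (le_trans (ler_norm _) (Re_le_cabs _)); rewrite ReB /=; lra.
have h3 : `|2 * (a - 1)| <= 1 by rewrite ler_norml; lra.
have -> : (x - 1) ^- 2 = 1 * ((x - 1)^-1 * (x - 1)^-1) by rewrite mul1r -invfM -expr2.
by rewrite !ler_pM ?mulr_ge0 ?invr_ge0 ?cabs_ge0// lef_pV2 ?posrE//; exact: lt_le_trans tp _.
Qed.

Lemma sum_const_seq (I : Type) (l : seq I) (c : R) : \sum_(i <- l) c = c * (size l)%:R.
Proof.
elim: l => [|i l IH]; first by rewrite big_nil mulr0.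
by rewrite big_cons IH /= -natr1; ring.
Qed.

Lemma ln_ge_half (T : R) : 3 <= T -> 2^-1 <= ln T.
Proof.
move=> h; have T0 : 0 < T by lra.
have := @ln_le_sub1 _ T^-1; rewrite lnV ?posrE// invr_gt0 => /(_ T0).
have : T^-1 <= 3^-1 by rewrite lef_pV2 ?posrE.
lra.
Qed.

Section zeta.
Variable zeta : C -> C.
Hypothesis hz : is_riemann_zeta zeta.

Lemma Re_zeta_gt0 s : 2 <= Re s -> 0 < Re (zeta s).
Proof.
move=> hs; have h := zeta_sub1 hz hs.
have h2 : rpw (Re s - 2) 2 <= 1 by apply: rpw_le1; [rewrite subr_ge0|lra].
have := le_trans (Re_le_cabs _) h; rewrite ReB /= ler_norml => /andP[h3 _]; lra.
Qed.

Lemma clog_zeta_le s : 2 <= Re s -> cabs (clog (zeta s)) <= 3 * rpw (Re s - 2) 2.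
Proof.
move=> hs; have h := zeta_sub1 hz hs.
have h2 : rpw (Re s - 2) 2 <= 1 by apply: rpw_le1; [rewrite subr_ge0|lra].
have := @cabs_clog1p (zeta s - 1); rewrite subrKC => /(_ ltac:(lra)).
lra.
Qed.

Let K0 : R := 7 / ln (17 / 16).

(** The bound of [local_log] has an explicit primitive [m], built from [lnprim], so the mean value
    inequality turns it into a bound for the increment of [Y]. *)
Lemma horizontal_left (T a : R) (G Y : R -> C) :
  3 <= `|T| -> 2^-1 <= a < 1 ->
  (forall x, a <= x <= 2 -> exists l, rD G x l) ->
  (forall x, a <= x <= 2 -> cexp (G x) = zeta (x +i* T)) ->
  G 2 = clog (zeta (2 +i* T)) ->
  (forall x, a <= x <= 2 -> rD Y x (G x * mirror_kernel a (x +i* T))) ->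
  cabs (Y 2 - Y a) <= (639 + 160 * K0) * (ln `|T| / T ^+ 2).
Proof.
move=> hT /andP[a1 a2] DG EG E2 DY.
have [zs [size_le zsP Gle]] := local_log hz hT.
have lT := ln_ge_half hT.
have T0 : T != 0 by rewrite -normr_gt0; lra.
have T2 : 0 < T ^- 2 by rewrite invr_gt0 exprn_even_gt0.
have a12 : 2^-1 <= a <= 2 by lra.
have {}Gle x : a <= x <= 2 -> cabs (G x) <= 3 + 420 * ln `|T| + \sum_(z <- zs) (40 - ln (cabs (x +i* T - z))).
  move=> xa; have h := Gle a G a12 DG EG x xa.
  have h2 : cabs (G 2) <= 3.
    rewrite E2; apply: le_trans (clog_zeta_le _) _ => //=.
    by rewrite subrr /rpw mul0r oppr0 expR0 mulr1.
  have := cabsD (G x - G 2) (G 2); rewrite subrK; lra.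
pose P z := fun x => 40 * x - lnprim (T - Im z) (x - Re z).
have lnE x z : a <= x <= 2 -> z \in zs ->
  is_derive x 1 (P z) (40 - ln (cabs (x +i* T - z))).
  move=> xa zz; have [zr z0] := zsP _ zz.
  have n0 : x +i* T - z != 0.
    by rewrite subr_eq0; apply: contra_eq_neq (EG x xa) => ->; rewrite z0; exact: cexp_neq0.
  have E : (x - Re z) ^+ 2 + (T - Im z) ^+ 2 = cabs (x +i* T - z) ^+ 2 by rewrite cabs_sqr ReB ImB.
  have p : 0 < (x - Re z) ^+ 2 + (T - Im z) ^+ 2 by rewrite E exprn_gt0// cabs_gt0.
  have Da : is_derive x 1 (fun x => x - Re z) 1.
    apply: is_derive_eq; rewrite /GRing.scale /=; ring.
  have Db := @is_derive1_comp _ (lnprim (T - Im z)) (fun x => x - Re z) x _ _ (is_derive_lnprim p) Da.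
  rewrite /comp in Db.
  have El : ln ((x - Re z) ^+ 2 + (T - Im z) ^+ 2) / 2 * 1 = ln (cabs (x +i* T - z)).
    by rewrite E lnXn ?cabs_gt0// mulr2n; field.
  rewrite -El /P; apply: is_derive_eq; rewrite /GRing.scale /=; ring.
have Psum x : a <= x <= 2 -> is_derive x 1 (fun x => \sum_(z <- zs) P z x)
    (\sum_(z <- zs) (40 - ln (cabs (x +i* T - z)))).
  move=> xa; apply/rD_realP.
  have := lnE x ^~ xa; elim: (zs) => [|z zs' IH] H.
    by apply: Dg_ext (Dg_eq _ (Dg_cst _ 0 x)) => [y|]; rewrite big_nil rmorph0.
  apply: Dg_ext (Dg_eq _ (DgD ((rD_realP _ _ _).2 (H z (mem_head _ _))) (IH _))).
  - by move=> y; rewrite -rmorphD big_cons.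
  - by rewrite -rmorphD big_cons.
  - by move=> w ww; apply: H; rewrite inE ww orbT.
pose m x := T ^- 2 * ((3 + 420 * ln `|T|) * x + \sum_(z <- zs) P z x).
pose m' x := T ^- 2 * (3 + 420 * ln `|T| + \sum_(z <- zs) (40 - ln (cabs (x +i* T - z)))).
have Dm x : a <= x <= 2 -> is_derive x 1 m (m' x).
  move=> xa; have D := Psum x xa.
  rewrite /m /m'; apply: is_derive_eq; rewrite /GRing.scale /=; ring.
have Kle x : cabs (mirror_kernel a (x +i* T)) <= T ^- 2 by apply: mirror_kernel_le_im.
have aA : a <= 2 by lra.
have h1 : cabs (Y 2 - Y a) <= m 2 - m a.
  have le1 x : a <= x <= 2 -> cabs (G x * mirror_kernel a (x +i* T)) <= m' x.
    by move=> xa; rewrite cabsM mulrC ler_pM ?cabs_ge0// Gle.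
  exact: (mvt_closed aA DY Dm le1).
(* A zero contributes at most [40 * 3/2 + 2 * 49 <= 160], where 49 is the bound of [lnprim_le] for
   [Q = 4]. As [ln |T| >= 1/2], the remaining [(3 + 420 ln |T|) 3/2] is at most [639 ln |T|]. *)
have h2 : m 2 - m a <= (639 + 160 * K0) * (ln `|T| / T ^+ 2).
  have hs : \sum_(z <- zs) P z 2 - \sum_(z <- zs) P z a <= 160 * (size zs)%:R.
    rewrite -sumrB; apply: (@le_trans _ _ (\sum_(z <- zs) 160)); last first.
      by rewrite sum_const_seq.
    rewrite big_seq [leRHS]big_seq; apply: ler_sum => z zz; have [zr _] := zsP _ zz.
    have := le_trans (Re_le_cabs _) zr; have := le_trans (Im_le_cabs _) zr.
    rewrite ReB ImB /= !ler_norml /P => /andP[i1 i2] /andP[r1 r2].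
    clear -a1 a2 i1 i2 r1 r2.
    have := @lnprim_le 4 (T - Im z) (2 - Re z); have := @lnprim_le 4 (T - Im z) (a - Re z).
    rewrite !ler_norml => /(_ ltac:(lra) ltac:(lra)) h3 /(_ ltac:(lra) ltac:(lra)) h4; lra.
  rewrite /m -mulrBr (mulrC (ln _)) mulrCA ler_pM2l//.
  have h3 : 160 * (size zs)%:R <= 160 * (K0 * ln `|T|) by rewrite ler_pM2l.
  have h4 : (3 + 420 * ln `|T|) * (2 - a) <= (3 + 420 * ln `|T|) * (3 / 2).
    by clear -lT a1; apply: ler_wpM2l; lra.
  rewrite (_ : (639 + 160 * K0) * ln `|T| = 639 * ln `|T| + 160 * (K0 * ln `|T|)); last by ring.
  have := lerD hs h3; lra.
exact: le_trans h1 h2.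
Qed.

(** The majorant [3 * 2^(-(x - 2))] is integrable up to infinity with integral [3 / ln 2], so the
    bound does not depend on [A]; the lower bound for [ln |T|] is absorbed by doubling. *)
Lemma horizontal_right (T a A : R) (Y : R -> C) :
  3 <= `|T| -> 2^-1 <= a < 1 -> 2 <= A ->
  (forall x, 2 <= x <= A -> rD Y x (clog (zeta (x +i* T)) * mirror_kernel a (x +i* T))) ->
  cabs (Y A - Y 2) <= 6 / ln 2 * (ln `|T| / T ^+ 2).
Proof.
move=> hT /andP[a1 a2] A2 DY.
have lT := ln_ge_half hT.
have l2 : 0 < ln 2 :> R by rewrite ln_gt0//; lra.
have T0 : T != 0 by rewrite -normr_gt0; lra.
have T2 : 0 < T ^- 2 by rewrite invr_gt0 exprn_even_gt0.
have Kle x : cabs (mirror_kernel a (x +i* T)) <= T ^- 2 by apply: mirror_kernel_le_im.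
pose n x := - (3 / ln 2 * T ^- 2 * rpw (x - 2) 2).
have Dn x : is_derive x 1 n (3 * T ^- 2 * rpw (x - 2) 2).
  have Da : is_derive x 1 (fun x => - ((x - 2) * ln 2)) (- ln 2).
    apply: is_derive_eq; rewrite /GRing.scale /=; ring.
  have Db := @is_derive1_comp _ (@expR R) (fun x => - ((x - 2) * ln 2)) x _ _ (is_derive_expR _) Da.
  rewrite /comp in Db.
  rewrite /n /rpw; apply: is_derive_eq; rewrite /GRing.scale /=; field.
  by rewrite T0 gt_eqF.
have h3 : cabs (Y A - Y 2) <= n A - n 2.
  have le1 x : 2 <= x <= A -> cabs (clog (zeta (x +i* T)) * mirror_kernel a (x +i* T)) <= 3 * T ^- 2 * rpw (x - 2) 2.
    move=> xa; rewrite cabsM mulrAC ler_pM ?cabs_ge0//.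
    by apply: clog_zeta_le; rewrite /=; lra.
  exact: (mvt_closed A2 DY (fun x _ => Dn x) le1).
have h4 : n A - n 2 <= 6 / ln 2 * (ln `|T| / T ^+ 2).
  rewrite /n opprK subrr {2}/rpw mul0r oppr0 expR0 mulr1.
  have v0 : 0 < (ln 2)^-1 :> R by rewrite invr_gt0.
  have r0 := rpw_gt0 (A - 2) (2 : R).
  move: (rpw _ _) (ln 2)^-1 (T ^- 2) (ln `|T|) v0 r0 T2 lT => r v u l v0 r0 u0 l0.
  have vu := mulr_gt0 v0 u0.
  rewrite [leLHS](_ : _ = v * u * (3 - 3 * r)); last by ring.
  rewrite [leRHS](_ : _ = v * u * (6 * l)); last by ring.
  by rewrite ler_pM2l//; lra.
exact: le_trans h3 h4.
Qed.

(** The constant precedes all of [T], [a], [A] and the branch [G]: this is where the uniformity of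
    the theorem comes from. The integral appears as the increment of an arbitrary primitive [Y], and
    [T] may be negative for the lower side. *)
Lemma horizontal : exists2 D : R, 0 < D & forall (T a A : R) (G Y : R -> C),
  3 <= `|T| -> 2^-1 <= a < 1 -> 2 <= A ->
  (forall x, a <= x <= 2 -> exists l, rD G x l) ->
  (forall x, a <= x <= 2 -> cexp (G x) = zeta (x +i* T)) ->
  (forall x, 2 <= x <= A -> G x = clog (zeta (x +i* T))) ->
  (forall x, a <= x <= A -> rD Y x (G x * mirror_kernel a (x +i* T))) ->
  cabs (Y A - Y a) <= D * (ln `|T| / T ^+ 2).
Proof.
have l17 : 0 < ln (17 / 16 : R) by rewrite ln_gt0//; lra.
have K00 : 0 < K0 by rewrite /K0 divr_gt0.
have l2 : 0 < ln 2 :> R by rewrite ln_gt0//; lra.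
exists (639 + 160 * K0 + 6 / ln 2).
  by have : 0 < 6 / ln 2 :> R; [rewrite divr_gt0|lra].
move=> T a A G Y hT ha A2 DG EG E2 DY.
apply: le_trans (cabs_leD (Y A) (Y 2) (Y a)) _; rewrite addrC mulrDl; apply: lerD.
  apply: (horizontal_left hT ha DG EG); first by apply: E2; rewrite lexx.
  by move=> x xa; apply: DY; lra.
apply: (horizontal_right hT ha A2) => x xa; rewrite -E2//; apply: DY; lra.
Qed.
End zeta.
End Horizontal.

(** * Moving the line of integration *)

Section Strip.
Context {R : realType}.
Local Notation C := R[i].
Local Notation Re := complex.Re.
Local Notation Im := complex.Im.
Implicit Types (U V : set C) (f g : C -> C) (z w s : C) (r x t y a b d e T A : R).

Definition half_plane (p q m : R) : set C := [set s | m < p * Re s + q * Im s].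

Lemma opn_half_plane p q m : opn (half_plane p q m).
Proof.
move=> z /= hz; set k := `|p| + `|q| + 1.
have k0 : 0 < k by rewrite /k ltr_wpDl// addr_ge0.
exists ((p * Re z + q * Im z - m) / k); first by rewrite divr_gt0// subr_gt0.
move=> w; rewrite ltr_pdivlMr// /half_plane /= => h.
have h1 : `|p * (Re w - Re z)| <= `|p| * cabs (w - z).
  by rewrite normrM ler_wpM2l// -ReB Re_le_cabs.
have h2 : `|q * (Im w - Im z)| <= `|q| * cabs (w - z).
  by rewrite normrM ler_wpM2l// -ImB Im_le_cabs.
have h3 := cabs_ge0 (w - z).
have := ler_norm (- (p * (Re w - Re z))); have := ler_norm (- (q * (Im w - Im z))).
rewrite !normrN => h4 h5.
have h6 : cabs (w - z) * k = `|p| * cabs (w - z) + `|q| * cabs (w - z) + cabs (w - z) by rewrite /k; ring.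
clear -h h1 h2 h3 h4 h5 h6; lra.
Qed.

Lemma cvx_half_plane p q m : cvx (half_plane p q m).
Proof.
move=> a b; rewrite /half_plane /= => ha hb t /andP[t0 t1]; rewrite /= ReD ImD Re_realM Im_realM ReB ImB.
move: ha hb; set u := p * _ + _; set v := p * _ + _ => ha hb.
rewrite (_ : _ + _ = u + t * (v - u)); last by rewrite /u /v; ring.
have [h|h] := leP t (1/2); nra.
Qed.

Lemma rD_vline_scaled (F : C -> C) a e t l : cD F (a +i* (e * t)) l ->
  rD (fun y => F (a +i* (e * y))) t (l * (0 +i* e)).
Proof.
have E y : a +i* (e * y) = a%:C + y%:C * (0 +i* e) :> C by simpc; rewrite mulrC.
move=> D; rewrite E in D.
by apply: Dg_ext (cD_line D) => y; rewrite -E.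
Qed.

Lemma atan_inv x : 0 < x -> atan x^-1 = pi / 2 - atan x.
Proof.
move=> x0; have h1 := atan_gtNpi2 x; have h2 := atan_ltpi2 x.
have ax : 0 < atan x.
  by rewrite -(@atan0 R); apply: (@lt_atan R).
rewrite -[RHS]tanK; last by rewrite in_itv /=; lra.
congr atan; rewrite -{1}(atanK x) /tan sinB cosB sin_pihalf cos_pihalf invf_div.
by rewrite !mul1r !mul0r subr0 add0r.
Qed.

Lemma arg_conj x t : Im (clog (x +i* (- t))) = - Im (clog (x +i* t)).
Proof.
rewrite /clog /= mulNr atanN (_ : cabs (x +i* - t) = cabs (x +i* t)); first by ring.
by rewrite !cabsE /= sqrrN.
Qed.

(** Since [r^2 - b^2 = t^2], the half-angle tangents [t / (r - b)] and [t / (r + b)] are reciprocal,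
    and their arctangents add up to [pi / 2]. *)
Lemma arg_reflect b t : 0 < b -> 0 < t -> Im (clog ((- b) +i* t)) = pi - Im (clog (b +i* t)).
Proof.
move=> b0 t0; rewrite /clog /=.
have -> : cabs (- b +i* t) = cabs (b +i* t) by rewrite !cabsE /= sqrrN.
have h := cabs_sqr (b +i* t); rewrite /= in h.
have h0 := cabs_ge0 (b +i* t).
set r := cabs _ in h h0 *.
have rb : b < r.
  rewrite ltNge; apply/negP => rb; have := exprn_gt0 2 t0.
  have : r ^+ 2 <= b ^+ 2 by rewrite lerXn2r ?nnegrE// ltW.
  clear -h; lra.
have -> : t / (r - b) = (t / (r + b))^-1.
  have n1 : r - b != 0 by rewrite gt_eqF ?subr_gt0.
  have n2 : t != 0 by rewrite gt_eqF.
  rewrite invf_div; apply/eqP; rewrite eqr_div//; apply/eqP.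
  transitivity (r ^+ 2 - b ^+ 2); first by rewrite h; ring.
  by ring.
rewrite atan_inv; first by field.
by rewrite divr_gt0// addr_gt0//; apply: lt_trans rb.
Qed.

Lemma clog_shift w d : 0 < Re w -> 0 <= d -> cabs (clog w - clog (w + d%:C)) <= d / Re w.
Proof.
move=> w0 d0.
have os t : 0 <= t <= 1 -> Re w <= Re (w + t%:C * d%:C).
  by move=> /andP[t0 t1]; rewrite -rmorphM ReD /= lerDl mulr_ge0.
have D t : 0 <= t <= 1 -> rD (fun t => clog (w + t%:C * d%:C)) t ((w + t%:C * d%:C)^-1 * d%:C).
  move=> ht; apply: (@cD_line _ _ w d%:C); apply: cD_clog; apply: Re_gt0_off_slit.
  exact: lt_le_trans (os _ ht).
have := @mvt_cst R _ _ (d / Re w) 0 1 ler01 (fun t ht => rD_cont (D t ht)).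
rewrite mul1r mul0r addr0 subr0 mulr1 cabsB; apply.
- by move=> t /andP[t0 t1]; apply: D; rewrite !ltW.
- move=> t /andP[t0 t1]; rewrite cabsM cabs_real (ger0_norm d0) mulrC ler_wpM2l// cabsV.
  have h : Re w <= cabs (w + t%:C * d%:C).
    by apply: le_trans (os t _) (le_trans (ler_norm _) (Re_le_cabs _)); rewrite !ltW.
  by rewrite lef_pV2 ?posrE//; apply: lt_le_trans h.
Qed.

Definition mirror a z : C := (2 * a - Re z) +i* Im z.
(** A difference of principal logarithms, and not the logarithm of the quotient, so that it is
    holomorphic above and below [z] and matches the terms of [GG] and [gg] exactly. *)
Definition log_ratio a z s : C := clog (s - z) - clog (s - mirror a z).

Lemma mirror1 a : mirror a 1 = (2 * a - 1)%:C. Proof. by []. Qed.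

Lemma cabs_mirror a t z : cabs (a +i* t - mirror a z) = cabs (a +i* t - z).
Proof. by rewrite !cabsE !ReB !ImB /= (_ : a - (2 * a - Re z) = - (a - Re z)) ?sqrrN//; ring. Qed.

Lemma Re_log_ratio_vline a t z : Re (log_ratio a z (a +i* t)) = 0.
Proof. by rewrite /log_ratio ReB /clog /= cabs_mirror subrr. Qed.

Lemma Im_imag (u : C) x y : Re u = 0 -> Im (u * x%:C * (0 +i* y)) = 0.
Proof. by case: u => p q /= ->; ring. Qed.

(** As [z] and its mirror image are at distance at most 1, the logarithms of the two moduli differ
    by at most [1 / r]. The 8 bounds the two arguments. *)
Lemma log_ratio_le a z s r : 2^-1 <= a <= Re z -> Re z <= 1 -> 0 < r ->
  r <= cabs (s - z) -> r <= cabs (s - mirror a z) -> cabs (log_ratio a z s) <= r^-1 + 8.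
Proof.
move=> ha hz r0 h1 h2.
have E : cabs (z - mirror a z) <= 1.
  have -> : z - mirror a z = (2 * (Re z - a))%:C.
    by apply: complex_ext; rewrite ?ReB ?ImB /=; ring.
  by rewrite cabs_real ger0_norm; lra.
set p := cabs (s - z) in h1; set q := cabs (s - mirror a z) in h2.
have p0 : 0 < p by apply: lt_le_trans h1.
have q0 : 0 < q by apply: lt_le_trans h2.
have pq : p <= q + 1.
  have := cabs_leD s (mirror a z) z; rewrite -/p -/q (cabsB (mirror a z)); lra.
have qp : q <= p + 1.
  have := cabs_leD s z (mirror a z); rewrite -/p -/q; lra.
have key (u v : R) : r <= v -> u <= v + 1 -> 0 < u -> ln u - ln v <= r^-1.
  move=> rv uv u0; have v0 : 0 < v by apply: lt_le_trans rv.
  rewrite -ln_div ?posrE//; apply: le_trans (ln_le_sub1 _) _; first by rewrite divr_gt0.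
  apply: (@le_trans _ _ v^-1); last by rewrite lef_pV2 ?posrE.
  by rewrite lerBlDr ler_pdivrMr// mulrDl mulVf ?gt_eqF// mul1r; lra.
apply: le_trans (cabs_le_ReIm _) _; rewrite /log_ratio ReB ImB /clog /= -/p -/q.
apply: lerD; first by rewrite ler_norml; have := key p q h2 pq p0; have := key q p h1 qp q0; lra.
have /andP[_ p4] := pihalf_02 R.
have := atan_gtNpi2 (Im (s - z) / (p + Re (s - z))); have := atan_ltpi2 (Im (s - z) / (p + Re (s - z))).
have := atan_gtNpi2 (Im (s - mirror a z) / (q + Re (s - mirror a z))).
have := atan_ltpi2 (Im (s - mirror a z) / (q + Re (s - mirror a z))).
move: (atan _) (atan _) => u v; clear -p4; rewrite ler_norml; lra.
Qed.

Lemma cD_clog_sub z s : off_slit (s - z) -> cD (fun w => clog (w - z)) s (s - z)^-1.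
Proof.
move=> h; have D : cD (fun w => w - z) s 1.
  by have := DgB (cD_id s) (Dg_cst id z s); rewrite subr0.
by have := Dg_comp (f := fun w => w - z) (cD_clog h) D; rewrite mulr1.
Qed.

Lemma cD_log_ratio a z s : off_slit (s - z) -> off_slit (s - mirror a z) ->
  cD (log_ratio a z) s ((s - z)^-1 - (s - mirror a z)^-1).
Proof. by move=> h1 h2; apply: DgB; exact: cD_clog_sub. Qed.

Lemma hol_mirror_kernel a U : (forall s, U s -> s != 1) -> (forall s, U s -> s != (2 * a - 1)%:C) -> hol U (mirror_kernel a).
Proof.
move=> h1 h2; apply: holB; apply: holV; try exact: hol_subc.
  by move=> z /h2; rewrite subr_eq0.
by move=> z /h1; rewrite subr_eq0.
Qed.

Lemma inv_sq_le (A : R) : 2 <= A -> (A - 1) ^- 2 <= 4 * A ^- 2.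
Proof.
move=> A2; rewrite -[4]invrK -invfM lef_pV2 ?posrE ?mulr_gt0 ?exprn_gt0 ?invr_gt0//; try lra.
by rewrite !expr2; nra.
Qed.

(** The side is pushed outwards through [A + ieA] and [a + ieA]. On the first two legs the kernel is
    [O(A^-2)] over a length at most [A], giving [4 B / A] and [B / A]. On the third leg, along
    [Re s = a], the logarithm is imaginary and the kernel real, so the imaginary part of the
    primitive does not move. *)
Lemma log_ratio_int a z e T : 2^-1 <= a -> a < Re z < 1 -> e = 1 \/ e = -1 -> 0 < T -> e * Im z < T ->
  exists V : C -> C, exists2 D : R, 0 <= D &
    (forall x, cD V (x +i* (e * T)) (log_ratio a z (x +i* (e * T)) * mirror_kernel a (x +i* (e * T)))) /\
    forall A, 2 <= A -> T <= A -> `|Im (V (A +i* (e * T)) - V (a +i* (e * T)))| <= D / A.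
Proof.
move=> a1 /andP[az z1] he T0 hT.
have ee : e * e = 1 by case: he => ->; rewrite ?mulN1r ?opprK ?mul1r.
have e1 : `|e| = 1 by case: he => ->; rewrite ?normrN normr1.
(* Beyond [m], in the direction [e], lie neither [z] and its mirror image nor the real axis with the
   two poles of the kernel. *)
set m := Num.max (e * Im z) 0.
have mT : m < T by rewrite /m gt_max hT.
have mz : e * Im z <= m by rewrite /m le_max lexx.
have m0 : 0 <= m by rewrite /m le_max lexx orbT.
pose U := half_plane 0 e m.
have UE s : U s -> m < e * Im s by rewrite /U /half_plane /= mul0r add0r.
have Im0 s : U s -> Im s != 0.
  by move=> /UE h; apply: contraTneq h => ->; rewrite mulr0 ltNge m0.
have Imz s : U s -> Im s - Im z != 0.
  move=> /UE h; apply: contraTneq h => /eqP; rewrite subr_eq0 => /eqP ->; by rewrite ltNge mz.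
have os s : U s -> off_slit (s - z) by move=> us; apply: Im_neq0_off_slit; rewrite ImB Imz.
have os' s : U s -> off_slit (s - mirror a z) by move=> us; apply: Im_neq0_off_slit; rewrite ImB Imz.
have hU : hol U (fun s => log_ratio a z s * mirror_kernel a s).
  apply: holM; first by move=> s us; eexists; exact: cD_log_ratio (os s us) (os' s us).
  by apply: hol_mirror_kernel => s /Im0; apply: contraNneq => ->.
have [V DV] := hol_prim (@opn_half_plane 0 e m) (@cvx_half_plane 0 e m) hU.
have UT x t : T <= t -> U (x +i* (e * t)).
  by move=> tT; rewrite /U /half_plane /= mul0r add0r mulrA ee mul1r; exact: lt_le_trans mT tT.
set B := (T - m)^-1 + 8.
have Tm : 0 < T - m by rewrite subr_gt0.
have B0 : 0 < B by rewrite /B addr_gt0// invr_gt0.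
have ellB x t : T <= t -> cabs (log_ratio a z (x +i* (e * t))) <= B.
  move=> tT.
  have h : T - m <= `|e * t - Im z|.
    rewrite -[e * t - Im z]mul1r -ee -mulrA normrM e1 mul1r mulrBr mulrA ee mul1r.
    by apply: le_trans (ler_norm _); lra.
  have az' : 2^-1 <= a <= Re z by rewrite a1 ltW.
  apply: (log_ratio_le az' (ltW z1) Tm).
  - by apply: le_trans h _; apply: le_trans (Im_le_cabs _); rewrite ImB.
  - by apply: le_trans h _; apply: le_trans (Im_le_cabs _); rewrite ImB.
have a2 : a < 1 by lra.
exists V; exists (5 * B); first by rewrite mulr_ge0// ltW.
split; first by move=> x; apply: DV; apply: UT.
move=> A A2 TA.
have A0 : 0 < A by lra.
have v1 : cabs (V (A +i* (e * A)) - V (A +i* (e * T))) <= 4 * B / A.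
  have D t : T <= t <= A -> rD (fun t => V (A +i* (e * t))) t
     (log_ratio a z (A +i* (e * t)) * mirror_kernel a (A +i* (e * t)) * (0 +i* e)).
    by move=> /andP[t1 _]; apply: rD_vline_scaled; apply: DV; exact: UT.
  apply: (@le_trans _ _ (B * (4 * A ^- 2) * (A - T))).
    have Do t : T < t < A -> T <= t <= A by case/andP=> ? ?; rewrite !ltW.
    apply: (mvt_cst TA (fun t ht => rD_cont (D t ht)) (fun t ht => D t (Do t ht))).
    move=> t /andP[t1 t2]; rewrite !cabsM.
    have -> : cabs (0 +i* e) = 1 by rewrite cabsE /= expr0n add0r sqrtr_sqr e1.
    rewrite mulr1 ler_pM ?cabs_ge0//; first by apply: ellB; exact: ltW.
    by apply: le_trans (mirror_kernel_le_re _ _ _ _) (inv_sq_le A2); lra.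
  have -> : 4 * B / A = B * (4 * A ^- 2) * A by field; rewrite gt_eqF.
  by rewrite ler_wpM2l//; [rewrite !mulr_ge0 ?invr_ge0 ?exprn_ge0 ?ltW|lra].
have v2 : cabs (V (A +i* (e * A)) - V (a +i* (e * A))) <= B / A.
  have aA : a <= A by lra.
  have D x : rD (fun x => V (x +i* (e * A))) x (log_ratio a z (x +i* (e * A)) * mirror_kernel a (x +i* (e * A))).
    by apply: rD_hline; apply: DV; exact: UT.
  apply: (@le_trans _ _ (B * A ^- 2 * (A - a))).
    apply: (mvt_cst aA (fun t ht => rD_cont (D t)) (fun t ht => D t)) => x _.
    rewrite cabsM ler_pM ?cabs_ge0//; first exact: ellB.
    have -> : A ^- 2 = (e * A) ^- 2 by rewrite exprMn (expr2 e) ee mul1r.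
    by apply: mirror_kernel_le_im => //; rewrite mulf_neq0//; [rewrite -normr_gt0 e1|rewrite gt_eqF].
  have -> : B / A = B * A ^- 2 * A by field; rewrite gt_eqF.
  by rewrite ler_wpM2l//; [rewrite !mulr_ge0 ?invr_ge0 ?exprn_ge0 ?ltW|lra].
(* An imaginary number times a real kernel times the factor [ie] of the path is real, so this
   imaginary part has derivative 0. *)
have v3 : Im (V (a +i* (e * A))) = Im (V (a +i* (e * T))).
  have D t : T <= t <= A -> rD (fun t => (Im (V (a +i* (e * t))))%:C) t 0.
    move=> /andP[t1 _].
    have := rD_Im (rD_vline_scaled (DV _ (UT a t t1))).
    by rewrite mirror_kernel_vline// Im_imag// Re_log_ratio_vline.
  have Do t : T < t < A -> T <= t <= A by case/andP=> ? ?; rewrite !ltW.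
  by have /(congr1 (@complex.Re R)) := rD0_const TA (fun t ht => rD_cont (D t ht)) (fun t ht => D t (Do t ht)).
have h1 := le_trans (Im_le_cabs _) v1; have h2 := le_trans (Im_le_cabs _) v2.
rewrite ImB in h1; rewrite ImB in h2; rewrite ImB -v3.
have := ler_distD (Im (V (A +i* (e * A)))) (Im (V (A +i* (e * T)))) (Im (V (a +i* (e * A)))).
rewrite distrC in h1; have -> : 5 * B / A = 4 * B / A + B / A by ring.
clear -h1 h2; lra.
Qed.

Lemma log_ratio_int_sum a e T (Zs : seq C) : 2^-1 <= a -> e = 1 \/ e = -1 -> 0 < T ->
  (forall z, z \in Zs -> a < Re z < 1 /\ - T < Im z < T) ->
  exists V : C -> C, exists2 D : R, 0 <= D &
    (forall x, cD V (x +i* (e * T))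
      ((\sum_(z <- Zs) log_ratio a z (x +i* (e * T))) * mirror_kernel a (x +i* (e * T)))) /\
    forall A, 2 <= A -> T <= A -> `|Im (V (A +i* (e * T)) - V (a +i* (e * T)))| <= D / A.
Proof.
move=> a1 he T0; elim: Zs => [|z Zs IH] HZ.
  exists (fun=> 0), 0 => //; split => [x|A _ _]; last by rewrite subrr mul0r normr0.
  by rewrite big_nil mul0r; exact: Dg_cst.
have [|V1 [D1 D10 [DV1 V1le]]] := IH; first by move=> w ww; apply: HZ; rewrite inE ww orbT.
have [hz1 hz2] := HZ z (mem_head _ _).
have [|V2 [D2 D20 [DV2 V2le]]] := log_ratio_int a1 hz1 he T0.
  by case: he => ->; rewrite ?mul1r ?mulN1r; lra.
exists (fun s => V2 s + V1 s), (D2 + D1); first by rewrite addr_ge0.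
split => [x|A A2 TA].
  by rewrite big_cons mulrDl; apply: (DgD (DV2 x) (DV1 x)).
have := V1le A A2 TA; have := V2le A A2 TA.
set u := Im _; set v := Im _ => h1 h2.
rewrite (_ : Im _ = u + v); last by rewrite /u /v !ImB !ImD; ring.
by apply: le_trans (ler_normD _ _) _; rewrite mulrDl lerD.
Qed.

(** For the pole the logarithmic ratio is, up to sign, a primitive of the kernel. Its product with
    the kernel and the kernel itself therefore have explicit primitives, [- l^2 / 2] and [- l] for
    [l = log_ratio a 1]. *)
Lemma cD_log_ratio1 a s : off_slit (s - 1) -> off_slit (s - mirror a 1) -> cD (log_ratio a 1) s (- mirror_kernel a s).
Proof. by move=> h1 h2; apply: Dg_eq (cD_log_ratio h1 h2); rewrite /mirror_kernel mirror1 opprB. Qed.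

Lemma log_ratio1_le a A t : 2^-1 <= a < 1 -> 2 <= A -> cabs (log_ratio a 1 (A +i* t)) <= 2 / A.
Proof.
move=> ha A2; have := @clog_shift (A +i* t - 1) (2 * (1 - a)).
rewrite /log_ratio mirror1 (_ : A +i* t - 1 + (2 * (1 - a))%:C = A +i* t - (2 * a - 1)%:C); last first.
  by apply: complex_ext; rewrite ?ReD ?ReB ?ImD ?ImB /=; ring.
rewrite ReB /= => h; apply: le_trans (h _ _) _; try lra.
have p : 0 < A - 1 by lra.
have q : 0 < A by lra.
by rewrite ler_pdivrMr// mulrAC ler_pdivlMr//; nra.
Qed.

(** By [arg_reflect] both arguments reduce to that of [1 - a + iT]. This corner value is the angle
    by which the integral of the kernel over the line falls short of [2 pi], halved and signed. *)
Lemma log_ratio1_vline a e T : a < 1 -> 0 < T -> e = 1 \/ e = -1 ->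
  log_ratio a 1 (a +i* (e * T)) = 0 +i* (e * (pi - 2 * Im (clog ((1 - a) +i* T)))).
Proof.
move=> a1 T0 he; apply: complex_ext; first by rewrite Re_log_ratio_vline.
have b0 : 0 < 1 - a by lra.
rewrite /log_ratio ImB mirror1.
have -> : a +i* (e * T) - 1 = (- (1 - a)) +i* (e * T) :> C.
  by apply: complex_ext; rewrite ?ReB ?ImB /=; ring.
have -> : a +i* (e * T) - (2 * a - 1)%:C = (1 - a) +i* (e * T) :> C.
  by apply: complex_ext; rewrite ?ReB ?ImB /=; ring.
case: he => ->; first by rewrite !mul1r arg_reflect//=; ring.
by rewrite !mulN1r !arg_conj arg_reflect//=; ring.
Qed.


Lemma half_add_le (k1 k2 k3 k4 : R) : k1 <= k2 -> k3 <= k4 -> 0 <= k2 -> 2^-1 * k1 + k3 <= k2 + k4.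
Proof. lra. Qed.

Lemma norm_add3_le (k1 k2 k3 k4 k5 k6 : R) : `|k1 + k2 + k3| <= k6 -> `|k2| <= k4 -> `|k3| <= k5 ->
  `|k1| <= k6 + (k4 + k5).
Proof. by rewrite !ler_norml => /andP[? ?] /andP[? ?] /andP[? ?]; apply/andP; split; lra. Qed.

Lemma norm_combine (k1 k2 k3 k4 k5 k6 k7 k8 k9 e : R) :
  `|k1 - k2 + k5| <= k9 + k6 -> `|k3 - k4 - k5| <= k9 + k7 -> `|k1 - k3| <= k8 ->
  k6 + k7 + k8 <= e -> `|k2 - k4 - 2 * k5| <= 2 * k9 + e.
Proof. by rewrite !ler_norml => /andP[? ?] /andP[? ?] /andP[? ?] ?; apply/andP; split; lra. Qed.

Lemma Im_mul_i (u : C) x : Im (u * x%:C * 'i) = Re u * x.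
Proof. by case: u => p q; rewrite -complexiE /=; ring. Qed.

Lemma real_addM (x y t : R) : x%:C + y%:C * t%:C = (x + y * t)%:C :> C.
Proof. by rewrite rmorphD rmorphM. Qed.

Lemma seg_ge (m x y t : R) : 0 <= t <= 1 -> m <= x -> m <= y -> m <= x + t * (y - x).
Proof. by move=> /andP[? ?] ? ?; nra. Qed.

Lemma seg_le (m x y t : R) : 0 <= t <= 1 -> x <= m -> y <= m -> x + t * (y - x) <= m.
Proof. by move=> /andP[? ?] ? ?; nra. Qed.

Lemma cexp_sum (I : Type) (l : seq I) (F : I -> C) :
  cexp (\sum_(i <- l) F i) = \prod_(i <- l) cexp (F i).
Proof. by elim: l => [|i l IH]; rewrite ?big_nil ?cexp0// !big_cons cexpD IH. Qed.

Lemma cexp_clog_sum (l : seq C) (F : C -> C) : (forall z, z \in l -> off_slit (F z)) ->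
  cexp (\sum_(z <- l) clog (F z)) = \prod_(z <- l) F z.
Proof.
move=> h; rewrite cexp_sum big_seq [RHS]big_seq; apply: eq_bigr => z zl.
by rewrite cexp_clog// h.
Qed.

Lemma cexpB (u v : C) : cexp (u - v) = cexp u / cexp v.
Proof. by apply: (mulIf (cexp_neq0 v)); rewrite mulfVK ?cexp_neq0// -cexpD subrK. Qed.

Lemma ex_cD_sum (l : seq C) (F : C -> C -> C) s : (forall z, z \in l -> exists m, cD (F z) s m) ->
  exists m, cD (fun s => \sum_(z <- l) F z s) s m.
Proof.
elim: l => [|z l IH] h.
  by exists 0; apply: Dg_ext (Dg_cst _ 0 s) => u; rewrite big_nil.
have [|m Dm] := IH; first by move=> w wl; apply: h; rewrite inE wl orbT.
have [n Dn] := h z (mem_head _ _).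
by exists (n + m); apply: Dg_ext (DgD Dn Dm) => u; rewrite big_cons.
Qed.

Section zeta.
Variable zeta : C -> C.
Hypothesis hz : is_riemann_zeta zeta.
Variables (a T d : R) (Zs : seq C) (H : C -> C).
Hypotheses (ha : 2^-1 < a) (ha1 : a < 3 / 4) (hT : 3 <= T) (d0 : 0 < d) (d1 : d < 1 / 8).

(** The margin [d] makes the left and horizontal sides of the region interior. Zeros to the right of
    [a + d] have mirror images to the left of [a - d], outside the strip. *)
Definition strip (a T d : R) : set C :=
  half_plane 1 0 (a - d) `&` (half_plane 0 1 (- (T + d)) `&` half_plane 0 (-1) (- (T + d))).
Let Om := strip a T d.

Lemma stripP s : strip a T d s <-> [/\ a - d < Re s, - (T + d) < Im s & Im s < T + d].
Proof.
rewrite /strip /half_plane; split => [[/= h1 [/= h2 h3]]|[h1 h2 h3]]; first by split; lra.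
by split => /=; [lra|split => /=; lra].
Qed.

Let bounds : [/\ 2^-1 < a, a < 3 / 4, 3 <= T, 0 < d & d < 1 / 8].
Proof. by split. Qed.

Lemma opn_strip : opn Om.
Proof. by apply: opnI; [|apply: opnI]; exact: opn_half_plane. Qed.

Lemma cvx_strip : cvx Om.
Proof. by apply: cvxI; [|apply: cvxI]; exact: cvx_half_plane. Qed.

Hypotheses (hH : hol Om H) (Hnz : forall s, Om s -> H s != 0).
Hypothesis EH : forall s, Zt s = \prod_(z <- Zs) (s - z) * H s.
Hypothesis HZ : forall z, z \in Zs -> a + d < Re z < 1 /\ - T < Im z < T.

(** With [LH] a logarithm of [H], this is [log zeta], and [gg] is the function [g] of the overview.
    They differ by the [log_ratio] terms of the zeros and of the pole. *)
Let GG (LH : C -> C) s := LH s + \sum_(z <- Zs) clog (s - z) - clog (s - 1).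
Let gg (LH : C -> C) s := LH s + \sum_(z <- Zs) clog (s - mirror a z) - clog (s - mirror a 1).

Let slits s := (forall z, z \in Zs -> off_slit (s - z)) /\ off_slit (s - 1).

Lemma slits_re s : 2 <= Re s -> slits s.
Proof.
move=> hs; split => [z /HZ[/andP[_ h] _]|]; apply: Re_gt0_off_slit; rewrite ReB /=; lra.
Qed.

Lemma slits_im s : T <= `|Im s| -> slits s.
Proof.
move=> hs; split => [z /HZ[_ h]|]; apply: Im_neq0_off_slit; rewrite ImB /= subr_eq0.
  by apply: contraTneq hs => ->; rewrite -ltNge ltr_norml.
by apply: contraTneq hs => ->; rewrite -ltNge normr0; have [_ _ h _ _] := bounds; lra.
Qed.

Lemma cexp_GG LH s : Om s -> cexp (LH s) = H s -> slits s -> cexp (GG LH s) = zeta s.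
Proof.
move=> /stripP[s1 _ _] EL [sl sl1]; rewrite /GG cexpB cexpD EL cexp_clog_sum// cexp_clog//.
have n1 := off_slit_neq0 sl1.
have s14 : 4^-1 < Re s by have [? ? ? ? ?] := bounds; lra.
have s1' : s != 1 by rewrite -subr_eq0.
apply: (mulfI n1); rewrite [RHS](zeta_Zt hz s14 s1') EH.
by move: (\prod_(_ <- _) _) (H s) (s - 1) n1 => u v w n1; field.
Qed.

Lemma ex_cD_GG LH s : hol Om LH -> Om s -> slits s -> exists l, cD (GG LH) s l.
Proof.
move=> hL us [sl sl1]; have [m Dm] := hL _ us.
have [|n Dn] := @ex_cD_sum Zs (fun z s => clog (s - z)) s.
  by move=> z /sl h; eexists; exact: cD_clog_sub h.
by eexists; apply: DgB (DgD Dm Dn) (cD_clog_sub sl1).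
Qed.

Lemma off_slit_mirror z s : Om s -> z \in Zs -> off_slit (s - mirror a z).
Proof.
by move=> /stripP[h _ _] /HZ[h2 _]; apply: Re_gt0_off_slit; rewrite ReB /=; lra.
Qed.

Lemma off_slit_mirror1 s : Om s -> off_slit (s - mirror a 1).
Proof.
move=> /stripP[h _ _]; apply: Re_gt0_off_slit; rewrite ReB /=.
by have [? ? ? ? ?] := bounds; lra.
Qed.

Lemma hol_gg LH : hol Om LH -> hol Om (gg LH).
Proof.
move=> hL s us; have [m Dm] := hL _ us.
have [|n Dn] := @ex_cD_sum Zs (fun z s => clog (s - mirror a z)) s.
  by move=> z zz; eexists; exact: cD_clog_sub (off_slit_mirror us zz).
by eexists; apply: DgB (DgD Dm Dn) (cD_clog_sub (off_slit_mirror1 us)).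
Qed.

Lemma GG_gg LH s : GG LH s = gg LH s + \sum_(z <- Zs) log_ratio a z s - log_ratio a 1 s.
Proof.
rewrite /GG /gg /log_ratio sumrB.
move: (LH s) (\sum_(_ <- _) _) (\sum_(_ <- _) _) (clog _) (clog _) => u v w x y; ring.
Qed.

(** The branch is adjusted by a constant [k] with [exp k = 1] so as to be principal at [s = 2].
    Along segments from 2 it then stays equal to [clog (zeta s)], which has no slit to cross as
    [Re (zeta s) > 0]. *)
Lemma normalized_log : exists LH, [/\ hol Om LH, forall s, Om s -> cexp (LH s) = H s &
  forall s, 2 <= Re s -> - T <= Im s <= T -> GG LH s = clog (zeta s)].
Proof.
have [L hL EL] := log_convex opn_strip cvx_strip hH Hnz.
have E2 s : 2 <= Re s -> off_slit (zeta s).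
  by move=> hs; apply: Re_gt0_off_slit; exact: Re_zeta_gt0.
have inOm s : 2 <= Re s -> - T <= Im s <= T -> Om s 
  by have [? ? ? ? ?] := bounds; move=> h1 h2; apply/stripP; split; lra.
pose k := GG L 2 - clog (zeta 2).
have r2 : 2 <= Re (2 : C) by rewrite (_ : 2 = 2%:C)//; rewrite rmorph_nat.
have i2 : - T <= Im (2 : C) <= T.
  by have [? ? ? ? ?] := bounds; rewrite (_ : 2 = 2%:C) /=; [lra|rewrite rmorph_nat].
have ek : cexp k = 1.
  have e1 : cexp (GG L 2) = zeta 2 by apply: cexp_GG; [exact: inOm|exact/EL/inOm|exact: slits_re].
  by rewrite /k cexpB e1 cexp_clog ?E2// mulfV// off_slit_neq0// E2.
exists (fun s => L s - k); split.
- exact: holB hL (@hol_cst _ _ _).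
- by move=> s us; rewrite cexpB ek divr1 EL.
move=> s hs1 hs2.
suff : GG L s - GG L 2 = clog (zeta s) - clog (zeta 2).
  by rewrite /GG /k /GG; move: (clog (zeta _)) (clog (zeta _)) (\sum_(_ <- _) _) (\sum_(_ <- _) _) => u v w y E;
  apply/eqP; rewrite -subr_eq0; apply/eqP; move/eqP: E; rewrite -subr_eq0 => /eqP <-; ring.
pose p t := 2 + t%:C * (s - 2) : C.
have pR t : 0 <= t <= 1 -> 2 <= Re (p t) /\ - T <= Im (p t) <= T.
  move=> /andP[t0 t1]; rewrite /p ReD ImD Re_realM Im_realM ReB ImB.
  have t01 : 0 <= t <= 1 by rewrite t0.
  by split; [exact: seg_ge|apply/andP; split; [apply: seg_ge|apply: seg_le]; case/andP: i2; case/andP: hs2].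
have p1 : p 1 = s by rewrite /p mul1r subrKC.
have p0 : p 0 = 2 by rewrite /p mul0r addr0.
rewrite -p1 -p0; apply: (@cexp_proportional R (fun t => GG L (p t)) (fun t => clog (zeta (p t))) 1 0 1 ler01).
- move=> t /pR[h1 h2]; have [l Dl] := ex_cD_GG hL (inOm _ h1 h2) (slits_re h1).
  by eexists; apply: (cD_line (a := 2) (v := s - 2) Dl).
- move=> t /pR[h1 h2].
  have n1 : p t != 1 by apply: contraTneq h1 => ->; rewrite /= -ltNge; lra.
  have [l Dl] := zeta_hol hz n1.
  have D := Dg_comp (f := zeta) (cD_clog (E2 _ h1)) Dl.
  by eexists; apply: (cD_line (a := 2) (v := s - 2) D).
- move=> t /pR[h1 h2]; rewrite mul1r cexp_clog ?E2//.
  by apply: cexp_GG; [exact: inOm|exact/EL/inOm|exact: slits_re].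
Qed.

(** Subtracting [f 1] cancels the simple pole of the kernel at 1, so a primitive on the convex strip
    does the work of the residue theorem. The pole of the kernel at the mirror image of 1 lies
    outside. *)
Lemma ex_W f : hol Om f -> exists W : C -> C, forall s, Om s -> s != 1 ->
  cD W s ((f s - f 1) * mirror_kernel a s).
Proof.
move=> hf; have O1 : Om 1 by have [? ? ? ? ?] := bounds; apply/stripP; split => /=; lra.
have [q hq Eq] := hol_dd opn_strip hf O1.
have hw : hol Om (fun s => q s * ((s - 1) / (s - mirror a 1) - 1)).
  apply: holM hq _; apply: holB (@hol_cst _ _ _); apply: holM (@hol_subc _ _ _) _.
  by apply: holV (@hol_subc _ _ _) _ => s us; exact: off_slit_neq0 (off_slit_mirror1 us).
have [W DW] := hol_prim opn_strip cvx_strip hw.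
exists W => s us s1; apply: Dg_eq (DW s us).
have n1 : s - 1 != 0 by rewrite subr_eq0.
have n2 := off_slit_neq0 (off_slit_mirror1 us).
rewrite [f s]Eq /mirror_kernel -mirror1; move: (s - mirror a 1) (s - 1) n1 n2 (q s) (f 1) => u v n1 n2 k c.
by field; rewrite n1 n2.
Qed.


Lemma strip_hline e x : e = 1 \/ e = -1 -> a <= x -> Om (x +i* (e * T)) /\ slits (x +i* (e * T)).
Proof.
have [? ? ? ? ?] := bounds; move=> he ax; split.
  by apply/stripP; case: he => ->; split => /=; lra.
by apply: slits_im; case: he => ->; rewrite /= ?mul1r ?mulN1r ?normrN; exact: ler_norm.
Qed.

Let b := 1 - a.
(** On the line [2 * al] is a primitive of the kernel, whose integral from [- T] to [T] is thus
    [4 * al T = 2 * (pi - th)]. *)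
Let al (t : R) := Im (clog (b +i* t)).
Let th := pi - 2 * al T.

(* Adding the primitives of the terms by which [gg - c] differs from [log zeta] turns [W]
   into a primitive of [log zeta] times the kernel, to which [horizontal] applies. *)
Lemma W_horizontal (D : R) LH W e :
  (forall (T a A : R) (G Y : R -> C),
    3 <= `|T| -> 2^-1 <= a < 1 -> 2 <= A ->
    (forall x, a <= x <= 2 -> exists l, rD G x l) ->
    (forall x, a <= x <= 2 -> cexp (G x) = zeta (x +i* T)) ->
    (forall x, 2 <= x <= A -> G x = clog (zeta (x +i* T))) ->
    (forall x, a <= x <= A -> rD Y x (G x * mirror_kernel a (x +i* T))) ->
    cabs (Y A - Y a) <= D * (ln `|T| / T ^+ 2)) ->
  hol Om LH -> (forall s, Om s -> cexp (LH s) = H s) ->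
  (forall s, 2 <= Re s -> - T <= Im s <= T -> GG LH s = clog (zeta s)) ->
  (forall s, Om s -> s != 1 -> cD W s ((gg LH s - gg LH 1) * mirror_kernel a s)) ->
  e = 1 \/ e = -1 ->
  exists2 M : R, 0 <= M & forall A, 2 <= A -> T <= A ->
    `|Im (W (A +i* (e * T)) - W (a +i* (e * T))) + e * (th * Re (gg LH 1))| <=
    D * (ln T / T ^+ 2) + M / A.
Proof.
move=> HD hL EL E2 DW he; have [b1 b2 b3 b4 b5] := bounds.
have T0 : 0 < T by lra.
have HZ' z : z \in Zs -> a < Re z < 1 /\ - T < Im z < T by move=> /HZ[? ?]; split => //; lra.
have [V [M M0 [DV Vle]]] := log_ratio_int_sum (ltW b1) he T0 HZ'.
set c := gg LH 1 in DW *.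
pose Y x := W (x +i* (e * T)) + V (x +i* (e * T)) + 2^-1 * (log_ratio a 1 (x +i* (e * T)) ^+ 2)
  - c * log_ratio a 1 (x +i* (e * T)).
exists (M + 2 + 2 * cabs c); first by rewrite !addr_ge0// mulr_ge0// cabs_ge0.
move=> A A2 TA.
have nT : `|e * T| = T by case: he => ->; rewrite ?mul1r ?mulN1r ?normrN gtr0_norm.
have eT2 : (e * T) ^+ 2 = T ^+ 2 by case: he => ->; rewrite ?mul1r ?mulN1r ?sqrrN.
have imT (x : R) : - T <= Im (x +i* (e * T)) <= T.
  by case: he => ->; rewrite /= ?mul1r ?mulN1r; lra.
have DY x : a <= x <= A -> rD Y x (GG LH (x +i* (e * T)) * mirror_kernel a (x +i* (e * T))).
  move=> /andP[ax _]; have [us sl] := strip_hline he ax.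
  have n1 : x +i* (e * T) != 1 by rewrite -subr_eq0; exact: off_slit_neq0 sl.2.
  have D1 := rD_hline (DW _ us n1); have D2 := rD_hline (DV x).
  have D3 := rD_hline (cD_log_ratio1 sl.2 (off_slit_mirror1 us)).
  have D4 := DgB (DgD (DgD D1 D2) (DgZ 2^-1 (DgX 2 D3))) (DgZ c D3).
  apply: Dg_eq D4; rewrite GG_gg -/c.
  move: (gg LH _) (\sum_(_ <- _) _) (log_ratio a 1 _) (mirror_kernel a _) => u v w k.
  by rewrite /= expr1; field.
have h := @HD (e * T) a A (fun x => GG LH (x +i* (e * T))) Y.
rewrite nT eT2 in h.
have a1 : 2^-1 <= a < 1 by lra.
have {}h : cabs (Y A - Y a) <= D * (ln T / T ^+ 2).
  apply: h => //.
  - move=> x /andP[ax _]; have [us sl] := strip_hline he ax.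
    by have [l Dl] := ex_cD_GG hL us sl; exists l; exact: rD_hline.
  - by move=> x /andP[ax _]; have [us sl] := strip_hline he ax; apply: cexp_GG; rewrite ?EL.
  - by move=> x /andP[x2 _]; apply: E2.
have {}h := le_trans (Im_le_cabs _) h.
have hV := Vle A A2 TA.
have hl := @log_ratio1_le a A (e * T) a1 A2.
(* At the left corner the ratio is purely imaginary: its square is real, and its product with [c]
   leaves [e * (th * Re c)] in the imaginary part. *)
have ev : log_ratio a 1 (a +i* (e * T)) = 0 +i* (e * th) by apply: log_ratio1_vline => //; lra.
set l := log_ratio a 1 (A +i* (e * T)) in hl.
have A0 : 0 < A by lra.
have hl2 : `|Im (2^-1 * l ^+ 2 - c * l)| <= (2 + 2 * cabs c) / A.
  apply: le_trans (Im_le_cabs _) _.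
  apply: le_trans (cabsD _ _) _; rewrite cabsN (cabsM 2^-1) cabsX (cabsM c).
  have -> : cabs (2^-1 : C) = 2^-1 by rewrite cabsV -(rmorph_nat (real_complex R)) cabs_real normr_nat.
  have l0 := cabs_ge0 l; have c0 := cabs_ge0 c.
  have q : 2 / A <= 1 by rewrite ler_pdivrMr// mul1r.
  have h1 : cabs l ^+ 2 <= 2 / A by rewrite expr2; move: (2 / A) q hl => k q hl; nra.
  have h2 : cabs c * cabs l <= cabs c * (2 / A) by rewrite ler_wpM2l.
  have -> : (2 + 2 * cabs c) / A = 2 / A + cabs c * (2 / A) by ring.
  have : 0 <= 2 / A by rewrite divr_ge0// ltW.
  exact: half_add_le.
have EY : Im (Y A - Y a) = Im (W (A +i* (e * T)) - W (a +i* (e * T))) + e * (th * Re c) +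
    Im (V (A +i* (e * T)) - V (a +i* (e * T))) + Im (2^-1 * l ^+ 2 - c * l).
  rewrite /Y ev -/l !(ImB, ImD).
  have -> : Im (2^-1 * (0 +i* (e * th)) ^+ 2) = 0.
    have -> : 2^-1 = (2^-1)%:C :> C by rewrite fmorphV rmorph_nat.
    by rewrite Im_realM expr2 ImM /= !mul0r mulr0 addr0 mulr0.
  have -> : Im (c * (0 +i* (e * th))) = e * (th * Re c).
    by rewrite ImM /= mulr0 addr0; ring.
  ring.
move: h hV hl2; rewrite EY.
have -> : (M + 2 + 2 * cabs c) / A = M / A + (2 + 2 * cabs c) / A by ring.
exact: norm_add3_le.
Qed.

(** On [Re s = A] the function [gg] stays bounded while the kernel is [O(A^-2)] over the fixed
    length [2 * T]; the far side disappears as [A] grows. *)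
Lemma W_right LH W :
  (forall s, 2 <= Re s -> - T <= Im s <= T -> GG LH s = clog (zeta s)) ->
  (forall s, Om s -> s != 1 -> cD W s ((gg LH s - gg LH 1) * mirror_kernel a s)) ->
  exists2 M : R, 0 <= M & forall A, 2 <= A -> cabs (W (A +i* T) - W (A +i* (- T))) <= M / A.
Proof.
move=> E2 DW; have [b1 b2 b3 b4 b5] := bounds.
set c := gg LH 1 in DW *.
pose B := 3 + 9 * (size Zs)%:R + 9 + cabs c.
have B0 : 0 <= B by rewrite /B !addr_ge0 ?mulr_ge0 ?cabs_ge0.
exists (4 * B * (2 * T)); first by rewrite !mulr_ge0//; lra.
move=> A A2.
have A0 : 0 < A by lra.
have log_ratio9 z t : a <= Re z <= 1 -> cabs (log_ratio a z (A +i* t)) <= 9.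
  move=> /andP[hz1 hz2].
  have p1 : 2^-1 <= a <= Re z by rewrite hz1 ltW.
  have -> : (9 : R) = 1^-1 + 8 by rewrite invr1; ring.
  apply: (log_ratio_le p1 hz2 ltr01).
    by apply: le_trans (le_trans (ler_norm _) (Re_le_cabs _)); rewrite ReB /=; lra.
  by apply: le_trans (le_trans (ler_norm _) (Re_le_cabs _)); rewrite ReB /=; lra.
have gle t : - T <= t <= T -> cabs (gg LH (A +i* t) - c) <= B.
  move=> tT; have := GG_gg LH (A +i* t); rewrite E2//= => E.
  have -> : gg LH (A +i* t) - c = clog (zeta (A +i* t)) - \sum_(z <- Zs) log_ratio a z (A +i* t) + log_ratio a 1 (A +i* t) - c.
    by rewrite E; ring.
  have h1 : cabs (clog (zeta (A +i* t))) <= 3.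
    have hA : 2 <= Re (A +i* t : C) by [].
    apply: le_trans (clog_zeta_le hz hA) _.
    have : rpw (A - 2) 2 <= 1 by apply: rpw_le1; lra.
    by rewrite /=; lra.
  have h2 : cabs (\sum_(z <- Zs) log_ratio a z (A +i* t)) <= 9 * (size Zs)%:R.
    apply: le_trans (cabs_sum _ _) _; rewrite -sum_const_seq big_seq [leRHS]big_seq.
    by apply: ler_sum => z /HZ[hz1 _]; apply: log_ratio9; lra.
  have h3 : cabs (log_ratio a 1 (A +i* t)) <= 9 by apply: log_ratio9 => /=; lra.
  have := cabsD (clog (zeta (A +i* t)) - \sum_(z <- Zs) log_ratio a z (A +i* t) + log_ratio a 1 (A +i* t)) (- c).
  have := cabsD (clog (zeta (A +i* t)) - \sum_(z <- Zs) log_ratio a z (A +i* t)) (log_ratio a 1 (A +i* t)).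
  have := cabsD (clog (zeta (A +i* t))) (- \sum_(z <- Zs) log_ratio a z (A +i* t)).
  rewrite !cabsN /B; lra.
have TT : - T <= T by lra.
have D t : - T <= t <= T -> rD (fun t => W (A +i* t)) t ((gg LH (A +i* t) - c) * mirror_kernel a (A +i* t) * 'i).
  move=> tT; apply: rD_vline; apply: DW; first by apply/stripP; split => /=; lra.
  by rewrite eq_complex /= gt_eqF//; lra.
have Do t : - T < t < T -> - T <= t <= T by case/andP=> ? ?; rewrite !ltW.
apply: (@le_trans _ _ (B * (4 * A ^- 2) * (T - - T))).
  apply: (mvt_cst TT (fun t ht => rD_cont (D t ht)) (fun t ht => D t (Do t ht))).
  move=> t ht; rewrite !cabsM cabs_i mulr1 ler_pM ?cabs_ge0//; first exact/gle/Do.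
  by apply: le_trans (mirror_kernel_le_re _ _ _ _) (inv_sq_le A2); lra.
have -> : B * (4 * A ^- 2) * (T - - T) = 4 * B * (2 * T) / A * A^-1 by field; rewrite gt_eqF.
have T0 : 0 < T by lra.
rewrite ler_piMr//; first by rewrite !mulr_ge0 ?invr_ge0 ?(ltW A0) ?(ltW T0).
by rewrite invf_le1//; lra.
Qed.

Lemma cabs_gg LH s : Om s -> cexp (LH s) = H s ->
  expR (Re (gg LH s)) = cabs (H s) * (\prod_(z <- Zs) cabs (s - mirror a z)) / cabs (s - mirror a 1).
Proof.
move=> us EL; rewrite -cabs_cexp /gg cexpB cexpD EL cexp_clog; last exact: off_slit_mirror1.
rewrite cexp_clog_sum; last by move=> z; exact: off_slit_mirror.
by rewrite cabsM cabsV cabsM cabs_prod.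
Qed.

Lemma Re_gg_vline LH t : (forall s, Om s -> cexp (LH s) = H s) -> - T <= t <= T ->
  Re (gg LH (a +i* t)) = ln (cabs (zeta (a +i* t))).
Proof.
move=> EL tT; have [b1 b2 b3 b4 b5] := bounds.
have us : Om (a +i* t) by apply/stripP; split => /=; lra.
rewrite -[LHS]expRK (cabs_gg us (EL _ us)); congr ln.
have n1 : a +i* t != 1 by rewrite eq_complex /= lt_eqF//; lra.
have h4 : 4^-1 < Re (a +i* t) by rewrite /=; lra.
have n0 : cabs (a +i* t - 1) != 0 by rewrite cabs_eq0 subr_eq0.
have E := congr1 (@cabs R) (zeta_Zt hz h4 n1).
rewrite EH !cabsM cabs_prod in E.
apply: (mulfI n0); rewrite E cabs_mirror mulrCA mulfV// mulr1 mulrC; congr (_ * _).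
by apply: eq_bigr => z _; rewrite cabs_mirror.
Qed.

Lemma ln_prod_seq (l : seq C) (F : C -> R) : (forall z, z \in l -> 0 < F z) ->
  ln (\prod_(z <- l) F z) = \sum_(z <- l) ln (F z).
Proof.
elim: l => [|z l IH] h; first by rewrite !big_nil ln1.
rewrite !big_cons lnM ?posrE ?h ?mem_head// ?IH//.
  by move=> w wl; apply: h; rewrite inE wl orbT.
rewrite big_seq; apply: prodr_gt0 => w wl; apply: h; by rewrite inE wl orbT.
Qed.

(** [Zt 1 = 1] makes [H 1] the inverse of the product of the [1 - z]. The mirrored pole leaves
    [ln (2 - 2 * a)], which tends to 0 as [a] tends to [1/2]. *)
Lemma Re_gg1 LH : (forall s, Om s -> cexp (LH s) = H s) ->
  Re (gg LH 1) = \sum_(z <- Zs) ln (cabs (1 - mirror a z) / cabs (1 - z)) - ln (2 - 2 * a).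
Proof.
move=> EL; have [b1 b2 b3 b4 b5] := bounds.
have us : Om 1 by apply/stripP; split => /=; lra.
have p z : z \in Zs -> 0 < cabs (1 - mirror a z) / cabs (1 - z).
  move=> zz; rewrite divr_gt0// cabs_gt0; first by apply: off_slit_neq0; exact: off_slit_mirror.
  rewrite subr_eq0; apply: contraTneq (HZ zz).1 => <- /=; lra.
have p2 : 0 < 2 - 2 * a by lra.
rewrite -ln_prod_seq// -ln_div ?posrE//; last by rewrite big_seq; apply: prodr_gt0.
rewrite -[LHS]expRK (cabs_gg us (EL _ us)); congr ln.
have -> : 1 - mirror a 1 = (2 - 2 * a)%:C by rewrite mirror1 -(rmorph1 (real_complex R)) -rmorphB; congr (_%:C); ring.
rewrite cabs_real (gtr0_norm p2); congr (_ / _).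
have E := congr1 (@cabs R) (EH 1); rewrite Zt1 cabs1 cabsM cabs_prod in E.
rewrite big_split /= mulrC; congr (_ * _).
have E2 : (\prod_(z <- Zs) (cabs (1 - z))^-1) * \prod_(z <- Zs) cabs (1 - z) = 1.
  rewrite -big_split /= big_seq big1// => z zz; rewrite mulVf//.
  by have := p z zz; apply: contraTneq => ->; rewrite invr0 mulr0 ltxx.
transitivity (((\prod_(z <- Zs) (cabs (1 - z))^-1) * \prod_(z <- Zs) cabs (1 - z)) * cabs (H 1)).
  by rewrite E2 mul1r.
by rewrite -mulrA -E mulr1.
Qed.

Lemma rD_al t : rD (fun t => (al t)%:C) t (b / (b ^+ 2 + t ^+ 2))%:C.
Proof.
have [b1 b2 b3 b4 b5] := bounds.
have bp : 0 < b by rewrite /b; lra.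
have os : off_slit (b +i* t) by apply: Re_gt0_off_slit.
have := rD_Im (rD_vline (cD_clog os)); apply: Dg_eq; congr (_%:C).
have p : 0 < b ^+ 2 + t ^+ 2 by rewrite ltr_pwDl ?exprn_gt0 ?sqr_ge0.
have -> : (b +i* t)^-1 = (b / (b ^+ 2 + t ^+ 2)) +i* (- t / (b ^+ 2 + t ^+ 2)) :> C.
  apply: (mulfI (off_slit_neq0 os)); rewrite mulfV ?off_slit_neq0//.
  by apply: complex_ext; rewrite ?ReM ?ImM /=; field; rewrite gt_eqF.
by rewrite -complexiE ImM /= mulr0 mulr1 addr0.
Qed.

Lemma strip_phi (D : R) :
  (forall (T a A : R) (G Y : R -> C),
    3 <= `|T| -> 2^-1 <= a < 1 -> 2 <= A ->
    (forall x, a <= x <= 2 -> exists l, rD G x l) ->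
    (forall x, a <= x <= 2 -> cexp (G x) = zeta (x +i* T)) ->
    (forall x, 2 <= x <= A -> G x = clog (zeta (x +i* T))) ->
    (forall x, a <= x <= A -> rD Y x (G x * mirror_kernel a (x +i* T))) ->
    cabs (Y A - Y a) <= D * (ln `|T| / T ^+ 2)) ->
  exists2 F : R -> R,
    (forall t, - T <= t <= T -> is_derive t 1 F
      (ln (cabs (zeta (a +i* t))) * (2 * (1 - a) / ((1 - a) ^+ 2 + t ^+ 2)))) &
    `|F T - F (- T) - 2 * pi *
      (\sum_(z <- Zs) ln (cabs (1 - mirror a z) / cabs (1 - z)) - ln (2 - 2 * a))| <=
    2 * D * (ln T / T ^+ 2).
Proof.
move=> HD; have [b1 b2 b3 b4 b5] := bounds.
have [LH [hL EL E2]] := normalized_log.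
have [W DW] := ex_W (hol_gg hL).
rewrite -(Re_gg1 EL).
have [M1 M10 P] := W_horizontal HD hL EL E2 DW (or_introl erefl).
have [M2 M20 N] := W_horizontal HD hL EL E2 DW (or_intror erefl).
have [M3 M30 Q] := W_right E2 DW.
set c := gg LH 1 in DW P N *.
(* The derivative of the first term is [Re (gg - c)] times the real kernel; the second restores the
   constant [Re c] that was subtracted in [W]. *)
exists (fun t => Im (W (a +i* t)) + Re c * (2 * al t)).
  move=> t tT; apply/rD_realP.
  have us : Om (a +i* t) by apply/stripP; split => /=; lra.
  have n1 : a +i* t != 1 by rewrite eq_complex /= lt_eqF//; lra.
  have D1 := rD_Im (rD_vline (DW _ us n1)).
  have D2 := DgD D1 (DgZ (Re c * 2)%:C (rD_al t)).
  apply: Dg_ext (Dg_eq _ D2) => [u|].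
    by rewrite real_addM; congr (_%:C); ring.
  rewrite real_addM; congr (_%:C); rewrite -(Re_gg_vline EL tT) mirror_kernel_vline ?/b; last by lra.
  by rewrite Im_mul_i ReB; move: (_ ^+ 2 + _) => k; ring.
rewrite -/b.
have al_odd : al (- T) = - al T by rewrite /al arg_conj.
rewrite al_odd.
set X := (X in `|X| <= _).
(* The line gives [4 * al T = 2 * pi - 2 * th] times [Re c]; the two missing [th] are exactly those
   of the horizontal sides in [P] and [N]. *)
have EX : X = Im (W (a +i* T)) - Im (W (a +i* (- T))) - 2 * (th * Re c).
  by rewrite /X /th; ring.
apply/ler_addgt0Pr => e e0.
pose A := 2 + T + (M1 + M2 + M3) / e.
have Me : 0 <= (M1 + M2 + M3) / e by rewrite divr_ge0 ?addr_ge0// ltW.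
have A2 : 2 <= A by rewrite /A; lra.
have TA : T <= A by rewrite /A; lra.
have {}P := P A A2 TA; have {}N := N A A2 TA; have {}Q := le_trans (Im_le_cabs _) (Q A A2).
rewrite !mul1r ImB in P; rewrite !mulN1r ImB in N; rewrite ImB in Q.
have hA : M1 / A + M2 / A + M3 / A <= e.
  rewrite -!mulrDl ler_pdivrMr; last by lra.
  by rewrite mulrC -ler_pdivrMr// /A; lra.
have -> : 2 * D * (ln T / T ^+ 2) = 2 * (D * (ln T / T ^+ 2)) by ring.
by rewrite EX; exact: (norm_combine P N Q hA).
Qed.

End zeta.

Theorem strip_formula (zeta : C -> C) : is_riemann_zeta zeta -> exists2 D : R, 0 < D &
  forall (a T d : R) (Zs : seq C) (H : C -> C),
  2^-1 < a -> a < 3 / 4 -> 3 <= T -> 0 < d -> d < 1 / 8 ->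
  hol (strip a T d) H -> (forall s, strip a T d s -> H s != 0) ->
  (forall s, Zt s = \prod_(z <- Zs) (s - z) * H s) ->
  (forall z, z \in Zs -> a + d < Re z < 1 /\ - T < Im z < T) ->
  exists2 F : R -> R,
    (forall t, - T <= t <= T -> is_derive t 1 F
      (ln (cabs (zeta (a +i* t))) * (2 * (1 - a) / ((1 - a) ^+ 2 + t ^+ 2)))) &
    `|F T - F (- T) - 2 * pi *
      (\sum_(z <- Zs) ln (cabs (1 - mirror a z) / cabs (1 - z)) - ln (2 - 2 * a))| <=
    D * (ln T / T ^+ 2).
Proof.
move=> hz; have [D D0 HD] := horizontal hz.
exists (2 * D); first by rewrite mulr_gt0.
by move=> a T d Zs H h1 h2 h3 h4 h5 h6 h7 h8 h9; apply: (strip_phi hz h1 h2 h3 h4 h5 h6 h7 h8 h9 HD).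
Qed.
End Strip.

(** * Passing to the critical line *)

Section LogIntegrable.
Context {R : realType}.
Local Notation C := R[i].
Local Notation Re := complex.Re.
Local Notation Im := complex.Im.
Local Notation mu := (@lebesgue_measure R).
Implicit Types (x t y : R).

Lemma FTC_is_derive (f F : R -> R) (a b : R) : a < b ->
  (forall t, a <= t <= b -> {for t, continuous f}) ->
  (forall t, a <= t <= b -> is_derive t 1 F (f t)) ->
  (\int[mu]_(t in `[a, b]) (f t)%:E = (F b - F a)%:E)%E.
Proof.
move=> ab cf DF.
have cF t : a <= t <= b -> {for t, continuous F}.
  by move=> /DF Dt; apply: differentiable_continuous; apply/derivable1_diffP; exact: ex_derive.
rewrite (@continuous_FTC2 R f F a b)//.
- by apply: continuous_in_subspaceT => t; rewrite inE /= in_itv /= => /cf.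
- split.
  + move=> t; rewrite in_itv /= => /andP[t1 t2].
    by have := DF t; rewrite !ltW// => /(_ isT) Dt; exact: ex_derive.
  + by apply: cvg_at_right_filter; apply: cF; rewrite lexx ltW.
  + by apply: cvg_at_left_filter; apply: cF; rewrite lexx ltW.
- move=> t; rewrite in_itv /= => /andP[t1 t2].
  by rewrite derive1E; have := DF t; rewrite !ltW// => /(_ isT) Dt; exact: derive_val.
Qed.

Lemma measurable_lnabs (g : R) : measurable_fun [set: R] (fun t : R => ln `|t - g|).
Proof.
apply: (@measurableT_comp _ _ _ _ _ _ (@ln R)); first exact: measurable_ln.
apply: continuous_measurable_fun => t.
by apply: cvg_norm; apply: cvgB; [exact: cvg_id|exact: cvg_cst].
Qed.

Section regularized.
Variables (g lo hi : R).
Hypothesis lohi : lo < hi.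
Let Q := `|lo - g| + `|hi - g| + 1.
Let K := ln (Q ^+ 2 + 1) / 2.
(** A regularization whose primitive is given by [lnprim d], with integral bounded uniformly in [d].
    The constant [K] makes it nonnegative on the interval for [d <= 1], and it increases as [d]
    decreases, as monotone convergence demands. *)
Let u (d t : R) := K - ln ((t - g) ^+ 2 + d ^+ 2) / 2.

Let tQ t : lo <= t <= hi -> `|t - g| <= Q.
Proof.
move=> /andP[h1 h2]; rewrite /Q ler_norml.
have := ler_norm (hi - g); have := ler_norm (- (lo - g)); rewrite normrN => h3 h4.
have := normr_ge0 (hi - g); have := normr_ge0 (lo - g); lra.
Qed.

Let sq_le t : lo <= t <= hi -> (t - g) ^+ 2 <= Q ^+ 2.
Proof.
move=> /tQ h; rewrite -(real_normK (num_real (t - g))) lerXn2r ?nnegrE//.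
exact: le_trans h.
Qed.

Let u_ge0 d t : lo <= t <= hi -> 0 < d <= 1 -> 0 <= u d t.
Proof.
move=> ht /andP[d0 d1]; rewrite /u /K -mulrBl divr_ge0// subr_ge0.
have d2 : d ^+ 2 <= 1 by rewrite expr_le1// ltW.
have := sq_le ht; have := exprn_gt0 2 d0; have := sqr_ge0 (t - g) => h1 h2 h3.
by rewrite ler_ln ?posrE ?lerD//; lra.
Qed.

Let is_derive_u d t : d != 0 ->
  is_derive t 1 (fun t => K * t - lnprim d (t - g)) (u d t).
Proof.
move=> d0.
have p : 0 < (t - g) ^+ 2 + d ^+ 2 by rewrite ltr_wpDl ?sqr_ge0// exprn_even_gt0.
have Da : is_derive t 1 (fun x => x - g) 1.
  apply: is_derive_eq; rewrite /GRing.scale /=; ring.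
have Db := @is_derive1_comp _ (lnprim d) (fun x => x - g) t _ _ (is_derive_lnprim p) Da.
rewrite /comp in Db.
rewrite /u; apply: is_derive_eq; rewrite /GRing.scale /=; ring.
Qed.

Let cont_u d t : d != 0 -> {for t, continuous (u d)}.
Proof.
move=> d0; have p : 0 < (t - g) ^+ 2 + d ^+ 2 by rewrite ltr_wpDl ?sqr_ge0// exprn_even_gt0.
have D1 : is_derive t 1 (fun t => (t - g) ^+ 2 + d ^+ 2) (2 * (t - g)).
  apply: is_derive_eq; rewrite /GRing.scale /=; ring.
have D2 := @is_derive1_comp _ (@ln R) (fun t => (t - g) ^+ 2 + d ^+ 2) t _ _ (is_derive1_ln p) D1.
rewrite /comp in D2.
apply: differentiable_continuous; apply/derivable1_diffP; rewrite /u; exact: ex_derive.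
Qed.

Let B := K * (hi - lo) + 2 * (Q * ((Q ^+ 2 + 4) / 2) + Q + 5).

Let int_u d : 0 < d <= 1 -> (\int[mu]_(t in `[lo, hi]) (u d t)%:E <= B%:E)%E.
Proof.
move=> /andP[d0 d1]; have dn : d != 0 by rewrite gt_eqF.
rewrite (FTC_is_derive lohi (fun t _ => @cont_u d t dn) (fun t _ => @is_derive_u d t dn)) lee_fin.
have hd : `|d| <= 2 by rewrite ler_norml; lra.
have lo1 : lo <= lo <= hi by rewrite lexx ltW.
have hi1 : lo <= hi <= hi by rewrite lexx ltW.
have := lnprim_le (tQ lo1) hd; have := lnprim_le (tQ hi1) hd.
rewrite /B !ler_norml; move: (Q * _) => k; lra.
Qed.

Let ud n t := (u (n.+1%:R^-1) t)%:E.

Let dn n : 0 < (n.+1%:R^-1 : R) <= 1.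
Proof. by rewrite invr_gt0 ltr0n /= invf_le1 ?ler1n ?ltr0n. Qed.

Let ud_homo t : {homo ud ^~ t : n m / (n <= m)%N >-> (n <= m)%E}.
Proof.
move=> n m nm; rewrite /ud lee_fin /u lerD2l lerN2 ler_pM2r ?invr_gt0//.
have p k : 0 < (t - g) ^+ 2 + k.+1%:R^-1 ^+ 2 by rewrite ltr_wpDl ?sqr_ge0// exprn_gt0// invr_gt0 ltr0n.
rewrite ler_ln ?posrE// lerD2l lerXn2r ?nnegrE ?invr_ge0 ?ler0n//.
by rewrite lef_pV2 ?posrE ?ltr0n// ler_nat.
Qed.

(** For [t] different from [g] there is equality, by continuity of [ln]. At [t = g] the limit is
    infinite while the default [ln 0 = 0] makes the left side [K]; the inequality covers both. *)
Let u_le_lim t : ((K - ln `|t - g|)%:E <= limn (ud ^~ t))%E.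
Proof.
have [->|tg] := eqVneq t g.
  apply: (lime_ge (ereal_nondecreasing_is_cvgn (@ud_homo g))); apply: nearW => n; rewrite /ud lee_fin /u subrr normr0 (ln0 (lexx 0)) lerD2l lerN2.
  rewrite expr0n add0r pmulr_lle0 ?invr_gt0// -ln1 ler_ln ?posrE//; last first.
    by have /andP[h1 h2] := dn n; rewrite exprn_ile1// ltW.
suff h : (fun n => u (n.+1%:R^-1) t) @ \oo --> K - ln `|t - g|.
  have h2 : ud ^~ t @ \oo --> (K - ln `|t - g|)%:E by apply: cvg_EFin => //; exact: nearW.
  by rewrite (cvg_lim _ h2).
have p : 0 < `|t - g| by rewrite normr_gt0 subr_eq0.
have -> : ln `|t - g| = ln ((t - g) ^+ 2 + 0 ^+ 2) / 2.
  by rewrite expr0n addr0 -(real_normK (num_real (t - g))) lnXn// mulr2n; field.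
apply: cvgB; first exact: cvg_cst.
apply: cvgM; last exact: cvg_cst.
apply: continuous_cvg.
  by apply: continuous_ln; rewrite ltr_pwDl ?sqr_ge0// exprn_even_gt0//= subr_eq0.
apply: cvgD; first exact: cvg_cst.
by apply: cvgM; exact: cvg_harmonic.
Qed.

Lemma integrable_lnabs_reg : mu.-integrable `[lo, hi] (fun t => (K - ln `|t - g|)%:E).
Proof.
have mD : measurable (`[lo, hi]%classic : set R) by exact: measurable_itv.
have mf : measurable_fun `[lo, hi] (fun t : R => (K - ln `|t - g|)%:E).
  apply/measurable_EFinP; apply: measurable_funB => //.
  by apply: measurable_funTS; exact: measurable_lnabs.
have mud n : measurable_fun `[lo, hi] (ud n).
  apply/measurable_EFinP; apply: measurable_funTS; apply: continuous_measurable_fun => t.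
  by apply: cont_u; rewrite gt_eqF//; have /andP[] := dn n.
have ge0 t : lo <= t <= hi -> 0 <= K - ln `|t - g|.
  move=> ht; have [->|tg] := eqVneq t g.
    rewrite subrr normr0 (ln0 (lexx 0)) subr0 /K divr_ge0// ln_ge0// lerDr sqr_ge0//.
  have p : 0 < `|t - g| by rewrite normr_gt0 subr_eq0.
  have -> : ln `|t - g| = ln ((t - g) ^+ 2) / 2.
    by rewrite -(real_normK (num_real (t - g))) lnXn// mulr2n; field.
  rewrite /K -mulrBl divr_ge0// subr_ge0 ler_ln ?posrE ?exprn_even_gt0//= ?subr_eq0//.
    by have := sq_le ht; lra.
  by have := sqr_ge0 Q; lra.
apply/integrableP; split => //.
apply: (@le_lt_trans _ _ B%:E); last exact: ltry.
apply: (@le_trans _ _ (\int[mu]_(t in `[lo, hi]) limn (ud ^~ t))%E).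
  apply: ge0_le_integral => //.
  - exact: measurableT_comp.
  - apply: emeasurable_fun_cvg mud _ => t _.
    exact: ereal_nondecreasing_is_cvgn (@ud_homo t).
  - move=> t; rewrite /= in_itv /= => ht.
    by rewrite ger0_norm ?ge0//; exact: u_le_lim.
rewrite monotone_convergence//.
- apply: lime_le; last by apply: nearW => n; apply: int_u; exact: dn.
  apply: ereal_nondecreasing_is_cvgn => n m nm.
  apply: ge0_le_integral => //.
  + by move=> t; rewrite /= in_itv /= => ht; rewrite lee_fin u_ge0//; exact: dn.
  + exact: mud.
  + exact: mud.
  + by move=> t _; exact: ud_homo.
- by move=> n t; rewrite /= in_itv /= => ht; rewrite lee_fin u_ge0//; exact: dn.
Qed.
End regularized.

Lemma integrable_cst_itv (k lo hi : R) : mu.-integrable `[lo, hi] (fun=> k%:E).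
Proof.
apply: (@continuous_compact_integrable R (fun=> k)); first exact: segment_compact.
by apply: continuous_subspaceT => t; exact: cvg_cst.
Qed.

Lemma integrable_lnabs (g lo hi : R) : lo < hi ->
  mu.-integrable `[lo, hi] (fun t => `|ln `|t - g| |%:E).
Proof.
move=> h; set k := ln ((`|lo - g| + `|hi - g| + 1) ^+ 2 + 1) / 2.
have h1 : mu.-integrable `[lo, hi] ((fun=> k%:E) \- (fun t => (k - ln `|t - g|)%:E))%E.
  by apply: integrableB => //; [exact: integrable_cst_itv|exact: integrable_lnabs_reg].
apply: le_integrable h1 => //.
  apply/measurable_EFinP; apply: measurableT_comp => //.
  by apply: measurable_funTS; exact: measurable_lnabs.
by move=> t _ /=; rewrite lee_fin normr_id opprB addrC subrK.
Qed.

End LogIntegrable.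

(** * Multiplicities and the sum over zeros *)

Section Multiplicity.
Context {R : realType}.
Local Notation C := R[i].
Local Notation Re := complex.Re.
Local Notation Im := complex.Im.
Implicit Types (U V : set C) (f g H : C -> C) (z w s p : C) (r x t : R).

Lemma near_cabs (P : C -> Prop) p :
  (\forall s \near (p : R[i]^o), P s) <-> exists2 r : R, 0 < r & forall s, cabs (s - p) < r -> P s.
Proof.
split=> [/nbhs_ballP[e /= /gt0_complex[eE e0] He]|[r r0 Hr]].
  exists (Re e) => // s sr; apply: He.
  by rewrite /ball /= norm_cabs eE ltcR cabsB.
apply/nbhs_ballP; exists r%:C; first by rewrite /= ltcR.
by move=> s; rewrite /ball /= norm_cabs ltcR cabsB => /Hr.
Qed.

(** If [m < n], dividing by [(s - p) ^+ m] near [p] identifies [g1] with a function that vanishes at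
    [p], contrary to continuity and [g1 p != 0]. Used in both directions it shows that the order is
    unique. *)
Lemma zero_order_le f p (m n : nat) : has_zero_order f p m -> has_zero_order f p n -> (n <= m)%N.
Proof.
move=> [g1 [/near_cabs[r1 r10 D1] g1p /near_cabs[r2 r20 E1]]].
move=> [g2 [/near_cabs[r3 r30 D2] _ /near_cabs[r4 r40 E2]]].
rewrite leqNgt; apply/negP => mn.
have cg g r : 0 < r -> (forall s, cabs (s - p) < r -> cderivable g s) -> ccont g p.
  move=> r0 D; have /cD_cderivable[l] : cderivable g p by apply: D; rewrite subrr cabs0.
  exact: cD_cont.
have c1 := cg _ _ r10 D1; have c2 := cg _ _ r30 D2.
have ch : ccont (fun s => g1 s - (s - p) ^+ (n - m) * g2 s) p.
  by apply: contB => //; apply: contM => //; apply: contX; apply: contB; [exact: ccont_id|exact: cont_cst].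
have hp : g1 p - (p - p) ^+ (n - m) * g2 p != 0.
  by rewrite subrr expr0n subn_eq0 leqNgt mn /= mul0r subr0.
have [r r0 Hr] := near0_cont ch hp.
pose k := Num.min r (Num.min r2 r4) / 2.
have k0 : 0 < k by rewrite /k divr_gt0// !lt_min r0 r20.
have km : k < Num.min r (Num.min r2 r4) by rewrite /k ltr_pdivrMr// ltr_pMr ?ltr1n// !lt_min r0 r20.
have ks : cabs (p + k%:C - p) = k by rewrite addrC addKr cabs_real gtr0_norm.
move: km; rewrite !lt_min => /andP[kr /andP[k2 k4]].
have := Hr (p + k%:C); rewrite ks => /(_ kr)/negP; apply; apply/eqP.
have := E1 (p + k%:C); rewrite ks => /(_ k2) e1.
have := E2 (p + k%:C); rewrite ks => /(_ k4); rewrite e1 => e2.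
have kn : p + k%:C - p != 0 by rewrite addrC addKr fmorph_eq0 gt_eqF.
apply: (mulfI (expf_neq0 m kn)); rewrite mulr0 mulrBr e2 mulrA -exprD subnKC ?subrr//.
exact: ltnW.
Qed.

Lemma multiplicityE f p (m : nat) : has_zero_order f p m -> multiplicity f p = m.
Proof.
move=> h; rewrite /multiplicity; case: xgetP => [n -> /= hn|/(_ m)//].
by apply/eqP; rewrite eqn_leq !(zero_order_le h, zero_order_le hn).
Qed.

Lemma prod_count (zs : seq C) s p : \prod_(z <- zs) (s - z) =
  (s - p) ^+ count_mem p zs * \prod_(z <- zs | z != p) (s - z).
Proof.
elim: zs => [|z zs IH]; first by rewrite !big_nil mulr1.
rewrite !big_cons /= IH; have [->|zp] := eqVneq z p; first by rewrite /= exprS mulrA.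
by rewrite /= add0n mulrCA.
Qed.

Section zeta.
Variable zeta : C -> C.
Hypothesis hz : is_riemann_zeta zeta.

Lemma zeta_zero_order (zs : seq C) H p : hol Hp H ->
  (forall s, Zt s = \prod_(z <- zs) (s - z) * H s) -> 4^-1 < Re p -> p != 1 -> H p != 0 ->
  has_zero_order zeta p (count_mem p zs).
Proof.
move=> hH EH p4 p1 Hp0.
have [r1 r10 h1] : exists2 r, 0 < r & forall s, cabs (s - p) < r -> s - 1 != 0.
  apply: (@near0_cont R (fun s => s - 1)); last by rewrite subr_eq0.
  by apply: contB; [exact: ccont_id|exact: cont_cst].
have [r2 r20 h2] := @opn_Hp R p p4.
have near (P : C -> Prop) : (forall s, cabs (s - p) < r1 -> cabs (s - p) < r2 -> P s) ->
    \forall s \near (p : R[i]^o), P s.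
  move=> h; apply/near_cabs; exists (Num.min r1 r2); first by rewrite lt_min r10.
  by move=> s; rewrite lt_min => /andP[? ?]; apply: h.
exists (fun s => (\prod_(z <- zs | z != p) (s - z)) * H s / (s - 1)); split.
- apply: near => s s1 s2; apply/cD_cderivable.
  pose V := Hp `&` [set s : C | s - 1 != 0].
  suff : hol V (fun s => (\prod_(z <- zs | z != p) (s - z)) * H s / (s - 1)).
    by apply; split; [exact: h2|exact: h1].
  apply: holM; last by apply: holV; [exact: hol_subc|move=> z []].
  apply: holM; last by apply: hol_sub hH => z [].
  rewrite (_ : (fun _ => _) = fun s => \prod_(z <- [seq z <- zs | z != p]) (s - z)); last first.
    by apply/funext => u; rewrite big_filter.
  by apply: hol_prod => z; exact: hol_subc.
- rewrite !mulf_neq0 ?invr_eq0 ?subr_eq0//.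
  by rewrite prodf_seq_neq0; apply/allP => z _ /=; apply/implyP; rewrite subr_eq0 eq_sym.
- apply: near => s s1 s2; have n1 := h1 _ s1.
  have s1' : s != 1 by rewrite -subr_eq0.
  apply: (mulfI n1); rewrite (zeta_Zt hz (h2 _ s2) s1') EH (prod_count _ _ p).
  by move: (_ ^+ _) (\prod_(_ <- _ | _) _) (H s) (s - 1) n1 => a b c d n1; field.
Qed.

Lemma Zt_not_near0 p : Hp p -> ~ near0 (@Zt R) p.
Proof.
move=> hp h.
have h1 : Hp (1 : C) by rewrite /Hp /=; lra.
have [r r0 /(_ 1)] := identity_thm (@opn_Hp R) (@cvx_Hp R) (@hol_Zt R) hp h h1.
by rewrite subrr cabs0 Zt1 => /(_ r0)/eqP; rewrite oner_eq0.
Qed.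

Lemma Zt_neq0 s : 1 <= Re s -> Zt s != 0.
Proof.
move=> hs; have [->|s1] := eqVneq s 1; first by rewrite Zt1 oner_eq0.
rewrite -(zeta_Zt hz _ s1); last by lra.
by rewrite mulf_neq0 ?subr_eq0// (zeta_neq0 hz).
Qed.

(** The height [T + 1] leaves room for strips slightly taller than [T]. Zeros on the critical line
    are factored out as well, so that [H] has no zeros on or near it within that height. *)
Lemma zeros_factor (T : R) : 3 <= T -> exists zs : seq C, exists H, [/\ hol Hp H,
  forall s, Zt s = \prod_(z <- zs) (s - z) * H s,
  forall z, z \in zs -> [/\ Zt z = 0, 2^-1 <= Re z, Re z < 1 & `|Im z| <= T + 1] &
  forall s, 2^-1 <= Re s -> `|Im s| <= T + 1 -> H s != 0].
Proof.
move=> hT.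
have sub : rect 2^-1 2 (- (T + 1)) (T + 1) `<=` (Hp : set C).
  by move=> z [/andP[h _] _]; rewrite /Hp /=; lra.
have h12 : 2^-1 <= 2 :> R by lra.
have hTT : - (T + 1) <= T + 1 by lra.
have [l Hl] := finite_zeros (@opn_Hp R) (@hol_Zt R) Zt_not_near0 h12 hTT sub.
pose l' := [seq z <- l | [&& Zt z == 0, 2^-1 <= Re z & `|Im z| <= T + 1]].
have l'P z : z \in l' -> [/\ Zt z = 0, 2^-1 <= Re z & `|Im z| <= T + 1].
  by rewrite mem_filter => /andP[/and3P[/eqP ? ? ?] _].
have [|zs [H [hH EH Hl' zsl]]] := factor_list (l := l') (@opn_Hp R) (@hol_Zt R) Zt_not_near0.
  by move=> z /l'P[_ h _]; rewrite /Hp /=; lra.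
have lt1 z : Zt z = 0 -> Re z < 1.
  by move=> z0; rewrite ltNge; apply/negP => /Zt_neq0; rewrite z0 eqxx.
exists zs, H; split => //; first by move=> z /zsl /l'P[? ? ?]; split => //; exact: lt1.
move=> s h1 h2; apply/negP => /eqP H0.
have Z0 : Zt s = 0 by rewrite EH H0 mulr0.
suff : s \in l' by move=> /Hl'; rewrite H0 eqxx.
rewrite mem_filter Z0 eqxx h1 h2 /=; apply: Hl => //; split; last by rewrite -ler_norml.
by rewrite h1 ltW//; apply: lt_trans (lt1 _ Z0) _; lra.
Qed.

Lemma sum_count (zs : seq C) (F : C -> R) :
  \sum_(z <- undup zs) (count_mem z zs)%:R * F z = \sum_(z <- zs) F z.
Proof.
rewrite -[RHS]big_undup_iterop_count; apply: eq_bigr => z _.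
by rewrite mulr_natl.
Qed.

(** Repetitions in [zs] encode multiplicities, so a weighted sum over distinct zeros is a plain sum
    over the list. That every zero in the region occurs in [zs] is the non-vanishing of [H]. *)
Lemma right_zeros_sumE (T : R) (zs : seq C) H : hol Hp H ->
  (forall s, Zt s = \prod_(z <- zs) (s - z) * H s) ->
  (forall z, z \in zs -> [/\ Zt z = 0, 2^-1 <= Re z, Re z < 1 & `|Im z| <= T + 1]) ->
  (forall s, 2^-1 <= Re s -> `|Im s| <= T + 1 -> H s != 0) ->
  right_zeros_sum zeta T =
  \sum_(z <- [seq z <- zs | (2^-1 < Re z) && (`|Im z| <= T)]) ln (cabs (z / (1 - z))).
Proof.
move=> hH EH zsP Hnz; set l := [seq z <- zs | _].
have lP z : z \in l <-> right_zeros zeta T z.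
  rewrite mem_filter; split.
    move=> /andP[/andP[h1 h2] /zsP[z0 h3 h4 _]]; split => //; last by rewrite -ler_norml.
    split => //; first by lra.
    have z1 : z != 1 by apply: contraTneq h4 => ->; rewrite /= ltxx.
    have z4 : 4^-1 < Re z by lra.
    by have := zeta_Zt hz z4 z1; rewrite z0 => /eqP; rewrite mulf_eq0 subr_eq0 (negbTE z1) => /eqP.
  move=> [[h1 h2 h3] h4]; rewrite -ler_norml => h5; rewrite h4 h5 /=.
  have z1 : z != 1 by apply: contraTneq h2 => ->; rewrite /= ltxx.
  have z4 : 4^-1 < Re z by lra.
  have := zeta_Zt hz z4 z1; rewrite h3 mulr0 EH => /esym/eqP; rewrite mulf_eq0.
  rewrite (negbTE (Hnz _ (ltW h4) _)) ?orbF; last by lra.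
  rewrite prodf_seq_eq0 => /hasP[w wz /=]; rewrite subr_eq0 => /eqP ->; exact: wz.
rewrite /right_zeros_sum (_ : right_zeros zeta T = [set` undup l]); last first.
  by apply/seteqP; split => z /=; rewrite mem_undup => /lP.
rewrite -fsbig_seq ?undup_uniq// -[RHS]sum_count.
rewrite big_seq [RHS]big_seq; apply: eq_bigr => z; rewrite mem_undup => zl.
congr (_%:R * _); have [[h1 h2 h3] h4 h5] := (lP z).1 zl.
rewrite (@multiplicityE _ _ (count_mem z zs)).
  rewrite count_filter; apply: eq_in_count => w _ /=.
  by have [->|] := eqVneq w z; rewrite //= h4 ler_norml h5.
apply: zeta_zero_order hH EH _ _ _; first by lra.
  by apply: contraTneq h2 => ->; rewrite /= ltxx.
by apply: Hnz; [exact: ltW|move: h5; rewrite -ler_norml; lra].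
Qed.

End zeta.
End Multiplicity.

(** * The limit as a tends to 1/2 *)

Section Limit.
Context {R : realType}.
Local Notation C := R[i].
Local Notation Re := complex.Re.
Local Notation Im := complex.Im.
Local Notation mu := (@lebesgue_measure R).
Implicit Types (f g H : C -> C) (z w s p : C) (r x t a e : R).

Lemma ae_off_finite (P : R -> Prop) (l : seq R) : (forall t, t \notin l -> P t) ->
  \forall t \ae mu, P t.
Proof.
move=> h; apply: (@negligibleS _ _ _ mu [set` l]).
  by move=> t /= nP; apply/negPn/negP => /h.
have c : countable [set` l] by apply: finite_set_countable; exact: finite_seq.
apply/negligibleP; last exact: countable_lebesgue_measure0.
exact: countable_measurable.
Qed.

(** By [cousin], local bounds around the points of a vertical segment combine into one bound on a
    thin rectangle; it will be uniform in the displacement [e]. *)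
Lemma near_line_bounded f x (c d : R) : c <= d ->
  (forall t, c <= t <= d -> ccont f (x +i* t)) ->
  exists2 k : R, 0 < k & exists M : R, forall z, `|Re z - x| < k -> c <= Im z <= d -> cabs (f z) <= M.
Proof.
move=> cd cf.
apply: (@cousin R (fun u v => exists2 k : R, 0 < k & exists M : R, forall z,
  `|Re z - x| < k -> u <= Im z <= v -> cabs (f z) <= M) c d cd).
  move=> u v w [k k0 [M HM]] [k' k'0 [M' HM']].
  exists (Num.min k k'); first by rewrite lt_min k0.
  exists (Num.max M M') => z; rewrite lt_min => /andP[z1 z2] /andP[h1 h2].
  rewrite le_max; have [h|h] := leP (Im z) v; first by rewrite HM ?h1.
  by rewrite (HM' z) ?orbT// h2 ltW.
move=> y ycd; have [r r0 Hr] := cf y ycd 1 ltr01.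
exists (r / 2); first by lra.
move=> u v _ uy yv _ h1 h2; exists (r / 2); first by lra.
exists (cabs (f (x +i* y)) + 1) => z zx /andP[z1 z2].
have := Hr z; rewrite /dC => /(_ _)/wrap[].
  by apply: cabs_lt_ReIm; rewrite ?ReB ?ImB //= ltr_norml; lra.
by move=> h; have := cabs_leD (f z) (f (x +i* y)) 0; rewrite !subr0; lra.
Qed.

(** At [a = 1/2] the weight is [1 / (1/4 + t^2)], the one of the theorem. *)
Definition weighted_log (zeta : C -> C) a t :=
  ln (cabs (zeta (a +i* t))) * (2 * (1 - a) / ((1 - a) ^+ 2 + t ^+ 2)).

Lemma den_gt0 a t : a < 1 -> 0 < (1 - a) ^+ 2 + t ^+ 2.
Proof. by move=> a1; rewrite ltr_pwDl ?exprn_gt0 ?sqr_ge0 ?subr_gt0. Qed.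

Lemma rcont_poly (f : R -> R) x l : is_derive x 1 f l -> rcont (fun t => (f t)%:C) x.
Proof. by move=> /rD_realP /rD_cont. Qed.

Lemma real_div (x y : R) : x%:C / y%:C = (x / y)%:C :> C.
Proof. by rewrite rmorphM fmorphV. Qed.

Lemma rcont_kernel_t a t : a < 1 ->
  rcont (fun t => (2 * (1 - a) / ((1 - a) ^+ 2 + t ^+ 2))%:C) t.
Proof.
move=> a1; have D : is_derive t 1 (fun t => (1 - a) ^+ 2 + t ^+ 2) (2 * t).
  apply: is_derive_eq; rewrite /GRing.scale /=; ring.
apply: cont_ext (contM (cont_cst _ (2 * (1 - a))%:C t) (contV (rcont_poly D) _)) => [y|].
  by rewrite real_div.
by rewrite fmorph_eq0 gt_eqF// den_gt0.
Qed.

Lemma rcont_kernel_a a t : a < 1 ->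
  rcont (fun a => (2 * (1 - a) / ((1 - a) ^+ 2 + t ^+ 2))%:C) a.
Proof.
move=> a1; have D : is_derive a 1 (fun a => (1 - a) ^+ 2 + t ^+ 2) (- 2 * (1 - a)).
  apply: is_derive_eq; rewrite /GRing.scale /=; ring.
have D2 : is_derive a 1 (fun a => 2 * (1 - a)) (- 2).
  apply: is_derive_eq; rewrite /GRing.scale /=; ring.
apply: cont_ext (contM (rcont_poly D2) (contV (rcont_poly D) _)) => [y|].
  by rewrite real_div.
by rewrite fmorph_eq0 gt_eqF// den_gt0.
Qed.

Lemma abs_ln_le (x A B : R) : 0 < x -> x <= A -> x^-1 <= B -> `|ln x| <= A + B.
Proof.
move=> x0 xA xB; have y0 : 0 < x^-1 by rewrite invr_gt0.
have := ln_le_sub1 x0; have := ln_le_sub1 y0; rewrite lnV ?posrE// ler_norml; lra.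
Qed.

Lemma kernel_le a t : 2^-1 <= a <= 3 / 4 -> `|2 * (1 - a) / ((1 - a) ^+ 2 + t ^+ 2)| <= 8.
Proof.
move=> ha; have a1 : a < 1 by lra.
rewrite ger0_norm; last by rewrite divr_ge0 ?ltW ?den_gt0//; lra.
rewrite ler_pdivrMr ?den_gt0//; have := sqr_ge0 t; rewrite (expr2 (1 - a)).
move: (t ^+ 2) => u; nra.
Qed.

Lemma ln_over_sq_shift (T e : R) : 3 <= T -> 0 < e <= 1 ->
  ln (T + e) / (T + e) ^+ 2 <= 2 * (ln T / T ^+ 2).
Proof.
move=> hT he; have T0 : 0 < T by lra.
have Te : 0 < T + e by lra.
rewrite mulrA ler_pM//.
- by rewrite ln_ge0//; lra.
- by rewrite invr_ge0 sqr_ge0.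
- have -> : 2 * ln T = ln (T ^+ 2) by rewrite lnXn// mulr_natl.
  by rewrite ler_ln ?posrE ?exprn_gt0//; rewrite expr2; nra.
- by rewrite lef_pV2 ?posrE ?exprn_gt0// lerXn2r ?nnegrE ?ltW//; lra.
Qed.

(** A finite list has a smallest positive gap. For [e <= e0], zeros right of the critical line are
    right of [1/2 + 2 e], and zeros higher than [T] are higher than [T + 2 e], so the strip at
    [1/2 + e] and [T + e], margins included, meets none of the zeros that are not counted. *)
Lemma strip_eps (zs : seq C) (T : R) : exists2 e0 : R, 0 < e0 & forall z, z \in zs ->
  (2^-1 < Re z -> 2 * e0 < Re z - 2^-1) /\ (T < `|Im z| -> 2 * e0 < `|Im z| - T).
Proof.
elim: zs => [|z zs [e0 e00 He]]; first by exists 1.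
pose p := if 2^-1 < Re z then Re z - 2^-1 else 1.
pose q := if T < `|Im z| then `|Im z| - T else 1.
have p0 : 0 < p by rewrite /p; case: ifPn => //; rewrite subr_gt0.
have q0 : 0 < q by rewrite /q; case: ifPn => //; rewrite subr_gt0.
exists (Num.min e0 (Num.min (p / 3) (q / 3))); first by rewrite !lt_min e00; lra.
set m := Num.min _ _.
have m1 : m <= e0 by rewrite /m ge_min lexx.
have m2 : m <= p / 3 by rewrite /m !ge_min (lexx (p / 3)) orbT.
have m3 : m <= q / 3 by rewrite /m !ge_min (lexx (q / 3)) !orbT.
move=> w; rewrite inE => /predU1P[->|/He[h1 h2]].
  by split => h; [move: m2; rewrite /p h|move: m3; rewrite /q h]; lra.
by split => [/h1|/h2]; lra.
Qed.

Lemma cvg_comp_cont (h : R -> R) (u : nat -> R) x : {for x, continuous h} ->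
  u @ \oo --> x -> h (u n) @[n --> \oo] --> h x.
Proof. by move=> c cu; exact: (cvg_comp _ _ cu c). Qed.

Lemma cvg_sum_seq (I : eqType) (l : seq I) (F : I -> nat -> R) (L : I -> R) :
  (forall i, i \in l -> F i @ \oo --> L i) ->
  (fun n => \sum_(i <- l) F i n) @ \oo --> \sum_(i <- l) L i.
Proof.
elim: l => [|i l IH] h.
  by rewrite big_nil (_ : (fun _ => _) = cst 0); [exact: cvg_cst|apply/funext => n; rewrite big_nil].
rewrite big_cons (_ : (fun _ => _) = (fun n => F i n + \sum_(j <- l) F j n)); last first.
  by apply/funext => n; rewrite big_cons.
apply: cvgD (h i (mem_head _ _)) (IH _) => j jl; apply: h; by rewrite inE jl orbT.
Qed.

Section zeta.
Variable zeta : C -> C.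
Hypothesis hz : is_riemann_zeta zeta.

Lemma rcont_cabs_zeta_t a t : a < 1 -> rcont (fun t => (cabs (zeta (a +i* t)))%:C) t.
Proof.
move=> a1; have n1 : a +i* t != 1 :> C by rewrite eq_complex /= lt_eqF.
have [l Dl] := zeta_hol hz n1.
by apply: (cont_comp (F := fun w => (cabs w)%:C) (@ccont_cabs _ _)); apply: rD_cont (rD_vline Dl).
Qed.

Lemma rcont_cabs_zeta_a a t : a < 1 -> rcont (fun a => (cabs (zeta (a +i* t)))%:C) a.
Proof.
move=> a1; have n1 : a +i* t != 1 :> C by rewrite eq_complex /= lt_eqF.
have [l Dl] := zeta_hol hz n1.
by apply: (cont_comp (F := fun w => (cabs w)%:C) (@ccont_cabs _ _)); apply: rD_cont (rD_hline Dl).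
Qed.

Lemma cont_weighted_log_t a t : a < 1 -> zeta (a +i* t) != 0 -> {for t, continuous (weighted_log zeta a)}.
Proof.
move=> a1 z0; apply/rcont_real_cont.
have c : {for cabs (zeta (a +i* t)), continuous (@ln R)} by apply: continuous_ln; rewrite cabs_gt0.
have h := cont_real_fun (f := fun t => cabs (zeta (a +i* t))) c (@rcont_cabs_zeta_t a t a1).
by apply: cont_ext (contM h (@rcont_kernel_t a t a1)) => y; rewrite /weighted_log -rmorphM.
Qed.

Lemma cont_weighted_log_a a t : a < 1 -> zeta (a +i* t) != 0 -> {for a, continuous (weighted_log zeta ^~ t)}.
Proof.
move=> a1 z0; apply/rcont_real_cont.
have c : {for cabs (zeta (a +i* t)), continuous (@ln R)} by apply: continuous_ln; rewrite cabs_gt0.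
have h := cont_real_fun (f := fun a => cabs (zeta (a +i* t))) c (@rcont_cabs_zeta_a a t a1).
by apply: cont_ext (contM h (@rcont_kernel_a a t a1)) => y; rewrite /weighted_log -rmorphM.
Qed.

Lemma measurable_weighted_log a : a < 1 -> measurable_fun [set: R] (weighted_log zeta a).
Proof.
move=> a1; apply: measurable_funM.
  apply: (@measurableT_comp _ _ _ _ _ _ (@ln R)); first exact: measurable_ln.
  by apply: continuous_measurable_fun => t; apply/rcont_real_cont; exact: rcont_cabs_zeta_t.
by apply: continuous_measurable_fun => t; apply/rcont_real_cont; exact: rcont_kernel_t.
Qed.

Section fixedT.
Variables (T : R) (zs : seq C) (H : C -> C) (e0 : R).
Hypotheses (hT : 3 <= T) (hH : hol Hp H)
  (EH : forall s, Zt s = \prod_(z <- zs) (s - z) * H s)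
  (zsP : forall z, z \in zs -> [/\ Zt z = 0, 2^-1 <= Re z, Re z < 1 & `|Im z| <= T + 1])
  (Hnz : forall s, 2^-1 <= Re s -> `|Im s| <= T + 1 -> H s != 0).
Hypotheses (e00 : 0 < e0) (e08 : e0 < 1 / 8)
  (e0P : forall z, z \in zs ->
    (2^-1 < Re z -> 2 * e0 < Re z - 2^-1) /\ (T < `|Im z| -> 2 * e0 < `|Im z| - T)).

Let bds : [/\ 3 <= T, 0 < e0 & e0 < 1 / 8]. Proof. by split. Qed.

Let inZ1 := [pred z : C | (2^-1 < Re z) && (`|Im z| <= T)].
Let Z1 := [seq z <- zs | inZ1 z].

Let SS a := \sum_(z <- Z1) ln (cabs (1 - mirror a z) / cabs (1 - z)) - ln (2 - 2 * a).

Lemma zeta_line_neq0 e t : 0 < e <= e0 -> `|t| <= T + 1 -> zeta ((2^-1 + e) +i* t) != 0.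
Proof.
have [b1 b2 b3] := bds; move=> /andP[e1 e2] ht; set s := _ +i* t.
have s1 : s != 1 by rewrite eq_complex /= lt_eqF//; lra.
have s4 : 4^-1 < Re s by rewrite /=; lra.
suff : Zt s != 0 by rewrite -(zeta_Zt hz s4 s1) mulf_eq0 => /norP[].
rewrite EH mulf_neq0//; last by apply: Hnz => //=; lra.
rewrite prodf_seq_neq0; apply/allP => z zz /=; rewrite subr_eq0.
apply/eqP => E; have [/(_ _)/wrap[|h _]] := e0P zz; first by rewrite -E /=; lra.
by move: h; rewrite -E /=; lra.
Qed.

Lemma strip_integral (D : R) e :
  (forall (a T d : R) (Zs : seq C) (H : C -> C),
    2^-1 < a -> a < 3 / 4 -> 3 <= T -> 0 < d -> d < 1 / 8 ->
    hol (strip a T d) H -> (forall s, strip a T d s -> H s != 0) ->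
    (forall s, Zt s = \prod_(z <- Zs) (s - z) * H s) ->
    (forall z, z \in Zs -> a + d < Re z < 1 /\ - T < Im z < T) ->
    exists2 F : R -> R,
      (forall t, - T <= t <= T -> is_derive t 1 F
        (ln (cabs (zeta (a +i* t))) * (2 * (1 - a) / ((1 - a) ^+ 2 + t ^+ 2)))) &
      `|F T - F (- T) - 2 * pi *
        (\sum_(z <- Zs) ln (cabs (1 - mirror a z) / cabs (1 - z)) - ln (2 - 2 * a))| <=
      D * (ln T / T ^+ 2)) ->
  0 < D -> 0 < e <= e0 -> exists2 J : R,
   (\int[mu]_(t in `[(- (T + e))%R, (T + e)%R]) (weighted_log zeta (2^-1 + e)%R t)%:E = J%:E)%E &
   `|J - 2 * pi * SS (2^-1 + e)| <= 2 * D * (ln T / T ^+ 2).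
Proof.
have [b1 b2 b3] := bds; move=> HD D0 he; have /andP[e1 e2] := he.
pose H' s := \prod_(z <- [seq z <- zs | ~~ inZ1 z]) (s - z) * H s.
have stripE s : strip (2^-1 + e) (T + e) (e / 2) s ->
    [/\ 2^-1 + e / 2 < Re s & `|Im s| < T + 2 * e].
  by move=> /stripP[h1 h2 h3]; split; [lra|rewrite ltr_norml; lra].
have [F DF Fle] : exists2 F : R -> R,
      (forall t, - (T + e) <= t <= T + e -> is_derive t 1 F (weighted_log zeta (2^-1 + e) t)) &
      `|F (T + e) - F (- (T + e)) - 2 * pi * SS (2^-1 + e)| <= D * (ln (T + e) / (T + e) ^+ 2).
  (* The abscissa is [1/2 + e], the height [T + e] and the margin [e / 2]. Zeros on the critical
     line or higher than [T] lie outside this strip and are put back into [H']. *)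
  apply: (HD _ _ (e / 2) Z1 H'); try lra.
  - apply: holM; first by apply: hol_prod => z; exact: hol_subc.
    by apply: hol_sub hH => s /stripE[h _]; rewrite /Hp /=; lra.
  - move=> s /stripE[h1 h2]; rewrite mulf_neq0//; last by apply: Hnz; lra.
    rewrite prodf_seq_neq0; apply/allP => z; rewrite mem_filter /= => /andP[h3 zz].
    rewrite subr_eq0; apply/eqP => E; have [q1 q2] := e0P zz.
    have z2 : 2^-1 < Re z by rewrite -E; lra.
    move: h3; rewrite z2 /= -ltNge => /q2; rewrite -E; lra.
  - move=> s; rewrite EH /H' mulrA; congr (_ * _).
    by rewrite /Z1 !big_filter [LHS](bigID inZ1).
  - move=> z; rewrite mem_filter => /andP[/andP[h1 h2] zz].
    have [q1 _] := e0P zz; have [_ _ h3 _] := zsP zz; have := q1 h1.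
    by move: h2; rewrite ler_norml => /andP[? ?] ?; split; lra.
exists (F (T + e) - F (- (T + e))).
  rewrite (@FTC_is_derive R (weighted_log zeta (2^-1 + e)) F)//; first by lra.
  move=> t ht; apply: cont_weighted_log_t; first by lra.
  by apply: zeta_line_neq0 => //; rewrite ler_norml; lra.
apply: le_trans Fle _.
rewrite (mulrC 2) -mulrA ler_pM2l//; apply: ln_over_sq_shift => //; lra.
Qed.

Let E a := (fun t => (weighted_log zeta a t)%:E : \bar R).

Lemma ln_le (x : R) : 0 < x -> ln x <= x.
Proof. by move=> /ln_le_sub1; lra. Qed.

(** The modulus lies between [|t - Im z|] and [2 * T + 4] whatever [e] is, so the horizontal
    distance to the zero does no harm. *)
Lemma abs_ln_factor e t z : 0 < e <= 1 / 8 -> `|t| <= T + 1 -> z \in zs -> t != Im z ->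
  `|ln (cabs ((2^-1 + e) +i* t - z))| <= 2 * T + 4 + `|ln `|t - Im z| |.
Proof.
have [b1 b2 b3] := bds; move=> /andP[e1 e2] ht zz tz; have [_ z1 z2 z3] := zsP zz.
set w := _ - z.
have h1 : `|t - Im z| <= cabs w by apply: le_trans (Im_le_cabs _); rewrite ImB.
have h2 : 0 < `|t - Im z| by rewrite normr_gt0 subr_eq0.
have h3 : cabs w <= 2 * T + 4.
  apply: le_trans (cabs_le_ReIm _) _; rewrite ReB ImB /=.
  have : `|2^-1 + e - Re z| <= 1 by rewrite ler_norml; lra.
  have := ler_normB t (Im z); lra.
have h4 : ln `|t - Im z| <= ln (cabs w) by rewrite ler_ln ?posrE//; exact: lt_le_trans h2 h1.
have h5 := ln_le (lt_le_trans h2 h1).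
have h6 := ler_norm (- ln `|t - Im z|); rewrite normrN in h6.
have h7 := normr_ge0 (ln `|t - Im z|).
rewrite ler_norml; lra.
Qed.

Lemma ln_prod_le (l : seq C) (G F : C -> R) : (forall z, z \in l -> 0 < G z) ->
  (forall z, z \in l -> `|ln (G z)| <= F z) -> `|ln (\prod_(z <- l) G z)| <= \sum_(z <- l) F z.
Proof.
move=> h1 h2; rewrite ln_prod_seq//; apply: le_trans (ler_norm_sum _ _ _) _.
by rewrite big_seq [leRHS]big_seq; apply: ler_sum => z; exact: h2.
Qed.

(** In [zeta = prod (s - z) H / (s - 1)] the factors [s - z] are bounded by [abs_ln_factor], while
    [H], its inverse and [s - 1] are under control near the line. The majorant does not depend on
    [e]; the 8 bounds the weight. *)
Lemma weighted_log_dominated : exists2 k : R, 0 < k & exists M : R, forall e t, 0 < e < k -> e <= e0 ->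
  `|t| <= T + 1 -> (forall z, z \in zs -> t != Im z) ->
  `|weighted_log zeta (2^-1 + e) t| <= 8 * (M + \sum_(z <- zs) `|ln `|t - Im z| |).
Proof.
have [b1 b2 b3] := bds.
have TT : - (T + 1) <= T + 1 by lra.
have Hp2 t : Hp (2^-1 +i* t : C) by rewrite /Hp /=; lra.
have [k1 k10 [M1 H1]] := near_line_bounded (x := 2^-1) TT (fun t _ => hol_cont hH (Hp2 t)).
have [|k2 k20 [M2 H2]] := near_line_bounded (f := fun s => (H s)^-1) (x := 2^-1) TT.
  move=> t ht; apply: contV; first exact: (hol_cont hH (Hp2 t)).
  by apply: Hnz; rewrite //= ler_norml.
exists (Num.min k1 k2); first by rewrite lt_min k10.
exists ((2 * T + 4) * (size zs)%:R + (M1 + M2) + (2 * T + 4 + 4)) => e t.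
rewrite lt_min => /andP[e1 /andP[ek1 ek2]] e2 ht tz.
set s := (2^-1 + e) +i* t.
have re : `|Re s - 2^-1| = e by rewrite /= addrC addKr gtr0_norm.
have ht' : - (T + 1) <= Im s <= T + 1 by rewrite -ler_norml.
have m1 : cabs (H s) <= M1 by apply: H1; rewrite ?re.
have m2 : cabs (H s)^-1 <= M2 by apply: H2; rewrite ?re.
have Hs : H s != 0 by apply: Hnz => //=; lra.
have s1 : s != 1 by rewrite eq_complex /= lt_eqF//; lra.
have s4 : 4^-1 < Re s by rewrite /=; lra.
have he : 0 < e <= e0 by rewrite e1.
have zn := zeta_line_neq0 he ht.
have Zn : Zt s != 0 by rewrite -(zeta_Zt hz s4 s1) mulf_neq0// subr_eq0.
have e8 : 0 < e <= 1 / 8 by lra.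
have pz z : z \in zs -> 0 < cabs (s - z).
  move=> zz; rewrite cabs_gt0 subr_eq0; apply: contraNneq (tz _ zz) => <-.
  by rewrite /=.
have hP : `|ln (\prod_(z <- zs) cabs (s - z))| <=
    (2 * T + 4) * (size zs)%:R + \sum_(z <- zs) `|ln `|t - Im z| |.
  rewrite -sum_const_seq -big_split /=; apply: ln_prod_le => // z zz.
  by apply: abs_ln_factor => //; exact: tz.
have hH' : `|ln (cabs (H s))| <= M1 + M2.
  by apply: abs_ln_le; rewrite ?cabs_gt0// -cabsV.
have q4 : 4^-1 <= cabs (s - 1).
  by rewrite cabsB; apply: le_trans (le_trans (ler_norm _) (Re_le_cabs _)); rewrite ReB /=; lra.
have p4 : 0 < cabs (s - 1) by apply: lt_le_trans q4; rewrite invr_gt0.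
have hs1 : `|ln (cabs (s - 1))| <= (2 * T + 4) + 4.
  apply: abs_ln_le => //; last by rewrite -[4]invrK lef_pV2 ?posrE ?invr_gt0.
  apply: le_trans (cabs_le_ReIm _) _; rewrite ReB ImB /= subr0.
  by have : `|2^-1 + e - 1| <= 1; [rewrite ler_norml|]; lra.
have lnE : ln (cabs (zeta s)) = ln (\prod_(z <- zs) cabs (s - z)) + ln (cabs (H s)) - ln (cabs (s - 1)).
  have pp : 0 < \prod_(z <- zs) cabs (s - z) by rewrite big_seq; apply: prodr_gt0.
  rewrite -lnM ?posrE ?cabs_gt0// -cabs_prod -cabsM -EH -(zeta_Zt hz s4 s1) cabsM lnM ?posrE ?cabs_gt0//.
    by rewrite addrC addKr.
  by rewrite subr_eq0.
have kle : `|2 * (1 - (2^-1 + e)) / ((1 - (2^-1 + e)) ^+ 2 + t ^+ 2)| <= 8.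
  by apply: kernel_le; lra.
rewrite /weighted_log normrM -/s mulrC ler_pM// lnE.
apply: le_trans (ler_normB _ _) _; apply: le_trans (lerD (ler_normD _ _) (lexx _)) _.
by move: hP hH' hs1; move: `|ln (\prod_(_ <- _) _)| `|ln (cabs (H _))| `|ln (cabs (s - 1))| (_ * (size zs)%:R) (\sum_(_ <- _) _) => *; lra.
Qed.

Lemma limit_integral : exists en : nat -> R, [/\ forall n, 0 < en n <= e0, en @ \oo --> 0,
  (\int[mu]_(t in `[(- T)%R, T]) E 2^-1 t)%E \is a fin_num &
  (fun n => \int[mu]_(t in `[(- (T + en n))%R, (T + en n)%R]) E (2^-1 + en n)%R t)%E @ \oo -->
    (\int[mu]_(t in `[(- T)%R, T]) E 2^-1 t)%E].
Proof.
have [b1 b2 b3] := bds; have [k k0 [M HM]] := weighted_log_dominated.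
pose e1 := Num.min e0 (k / 2); pose en n := e1 * harmonic n.
have e10 : 0 < e1 by rewrite /e1 lt_min b2; lra.
have enP n : 0 < en n <= e1.
  have h1 : 0 < harmonic n :> R by exact: harmonic_gt0.
  have h2 : harmonic n <= 1 :> R by rewrite /harmonic /= invf_le1 ?ler1n ?ltr0n.
  by rewrite /en mulr_gt0//= ler_piMr// ltW.
have e1e0 : e1 <= e0 by rewrite /e1 ge_min lexx.
have e1k : e1 <= k / 2 by rewrite /e1 ge_min lexx orbT.
have cen : en @ \oo --> 0.
  by rewrite -(mulr0 e1); apply: cvgM; [exact: cvg_cst|exact: cvg_harmonic].
pose D0 := `[- (T + 1), T + 1]%classic : set R.
pose A e := `[- (T + e), T + e]%classic : set R.
have AD e : 0 <= e <= 1 -> D0 `&` A e = A e.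
  move=> he; apply/setIidr => t; rewrite /A /D0 /= !in_itv /= => ht; lra.
have A0 : A 0 = `[- T, T]%classic by rewrite /A addr0.
have mA e : measurable (A e) by exact: measurable_itv.
have mD : measurable D0 by exact: measurable_itv.
have en01 n : 0 <= en n <= 1 by have /andP[? ?] := enP n; lra.
(* The intervals of integration shrink with [n]; cutting the functions off inside the fixed interval
   [D0] makes dominated convergence applicable. *)
pose f_ n := E (2^-1 + en n) \_ (A (en n)).
pose f := E 2^-1 \_ (A 0).
pose g t := (8 * (`|M| + \sum_(z <- zs) `|ln `|t - Im z| |))%:E : \bar R.
have ME a : a < 1 -> measurable_fun D0 (E a).
  by move=> a1; apply/measurable_EFinP; apply: measurable_funTS; exact: measurable_weighted_log.
have mres a e : a < 1 -> measurable_fun D0 (E a \_ (A e)).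
  move=> a1; apply/measurable_restrict => //.
  by apply: measurable_funS (ME a a1) => //; exact: subIsetl.
have ig : mu.-integrable D0 g.
  have i1 : mu.-integrable D0 (fun t => (8 * `|M|)%:E + 8%:E * \sum_(z <- zs) `|ln `|t - Im z| |%:E)%E.
    apply: integrableD => //; first exact: integrable_cst_itv.
    apply: integrableZl => //; apply: integrable_sum => // z _.
    by apply: integrable_lnabs; lra.
  apply: eq_integrable i1 => // t _.
  by rewrite sumEFin -EFinM -EFinD /g mulrDr.
have dom : \forall t \ae mu, forall n, D0 t -> (`|f_ n t| <= g t)%E.
  apply: (@ae_off_finite _ [seq Im z | z <- zs]) => t tz n; rewrite /D0 /= in_itv /= -ler_norml => ht.
  rewrite /f_ patchE; case: ifPn => [_|_]; last first.
    rewrite abse0 lee_fin mulr_ge0// addr_ge0// sumr_ge0// => z _; exact: normr_ge0.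
  rewrite /E /= lee_fin; have /andP[n1 n2] := enP n.
  apply: le_trans (HM _ _ _ _ ht _) _.
  - by apply/andP; split; lra.
  - by lra.
  - by move=> z zz; apply: contraNneq tz => ->; apply/mapP; exists z.
  - by rewrite ler_pM2l// lerD2r ler_norm.
(* Off the ordinates of the zeros: for [|t| <= T] the point lies in all the intervals and zeta does
   not vanish at [1/2 + it]; for [|t| > T] it is eventually outside them. *)
have cvf : \forall t \ae mu, D0 t -> f_ n t @[n --> \oo] --> f t.
  apply: (@ae_off_finite _ [seq Im z | z <- zs]) => t tz; rewrite /D0 /= in_itv /= -ler_norml => ht.
  have [tT|tT] := leP `|t| T.
    rewrite /f patchE A0 mem_set; last by rewrite /= in_itv /= -ler_norml.
    have zn : zeta (2^-1 +i* t) != 0.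
      set s := 2^-1 +i* t.
      have s1 : s != 1 by rewrite eq_complex /= lt_eqF//; lra.
      have s4 : 4^-1 < Re s by rewrite /=; lra.
      suff : Zt s != 0 by rewrite -(zeta_Zt hz s4 s1) mulf_eq0 => /norP[].
      rewrite EH mulf_neq0//; last by apply: Hnz => //=.
      rewrite prodf_seq_neq0; apply/allP => z zz /=; rewrite subr_eq0.
      by apply: contraNneq tz => E'; apply/mapP; exists z => //; rewrite -E'.
    have h : weighted_log zeta (2^-1 + en n) t @[n --> \oo] --> weighted_log zeta 2^-1 t.
      have c : {for 2^-1, continuous (weighted_log zeta ^~ t)} by apply: cont_weighted_log_a => //; lra.
      apply: (cvg_comp_cont (h := weighted_log zeta ^~ t) c).
      by rewrite -[X in _ --> X]addr0; apply: cvgD; [exact: cvg_cst|exact: cen].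
    rewrite (_ : f_ ^~ t = fun n => (weighted_log zeta (2^-1 + en n) t)%:E).
      by apply: cvg_EFin h; exact: nearW.
    apply/funext => n; rewrite /f_ patchE mem_set// /A /= in_itv /= -ler_norml.
    by have /andP[? ?] := enP n; lra.
  rewrite /f patchE A0 memNset; last by rewrite /= in_itv /= -ler_norml; apply/negP; rewrite -ltNge.
  apply: cvg_near_cst.
  have d0 : 0 < `|t| - T by rewrite subr_gt0.
  have [N _ HN] := cvgr_lt 0 cen (`|t| - T) d0; exists N => // n /HN /= hn.
  rewrite /f_ patchE memNset// /A /= in_itv /= -ler_norml; apply/negP; rewrite -ltNge; lra.
have mf_ n : measurable_fun D0 (f_ n) by apply: mres; have /andP[? ?] := enP n; lra.
have mf : measurable_fun D0 f by apply: mres; lra.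
have [fI _ cI] := @dominated_convergence _ _ _ mu D0 ltac:(exact: measurable_itv) f_ f g mf_ mf cvf ig dom.
have fE : (\int[mu]_(t in D0) f t = \int[mu]_(t in `[(- T)%R, T]) E 2^-1 t)%E.
  by rewrite /f -integral_mkcondr AD ?A0//; lra.
exists en; split => //.
- by move=> n; have := enP n; lra.
- by rewrite -fE; apply: integrable_fin_num.
rewrite -fE; move: cI; rewrite (_ : (fun _ => _) = (fun n => \int[mu]_(t in `[(- (T + en n))%R, (T + en n)%R]) E (2^-1 + en n)%R t)%E)//.
by apply/funext => n; rewrite /= /f_ -integral_mkcondr AD.
Qed.

(** At [a = 1/2] the number [1 - mirror a z] is the conjugate of [z], so the terms become
    [ln |z / (1 - z)|], and the extra term is [ln 1 = 0]. *)
Lemma cvg_SS (en : nat -> R) : en @ \oo --> 0 ->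
  SS (2^-1 + en n) @[n --> \oo] --> \sum_(z <- Z1) ln (cabs (z / (1 - z))).
Proof.
have [b1 b2 b3] := bds; move=> cen.
have ce : (2^-1 + en n) @[n --> \oo] --> (2^-1 : R).
  by rewrite -[X in _ --> X]addr0; apply: cvgD; [exact: cvg_cst|exact: cen].
have -> : \sum_(z <- Z1) ln (cabs (z / (1 - z))) =
    \sum_(z <- Z1) ln (cabs (1 - mirror 2^-1 z) / cabs (1 - z)) - ln (2 - 2 * 2^-1).
  rewrite mulfV// (_ : 2 - 1 = 1) ?ln1 ?subr0; last by ring.
  apply: eq_bigr => z _; rewrite cabsM cabsV; congr (ln (_ / _)).
  by rewrite !cabsE ReB ImB /= mulfV// sub0r sqrrN subKr.
rewrite /SS; apply: cvgB; last first.
  apply: (cvg_comp_cont (h := fun a => ln (2 - 2 * a)) _ ce).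
  have D2 : is_derive (2^-1 : R) 1 (fun a => 2 - 2 * a) (- 2).
    apply: is_derive_eq; rewrite /GRing.scale /=; ring.
  apply/rcont_real_cont; apply: (cont_real_fun (f := fun a => 2 - 2 * a)) (rcont_poly D2).
  by apply: continuous_ln; lra.
apply: (@cvg_sum_seq _ Z1 (fun z n => ln (cabs (1 - mirror (2^-1 + en n) z) / cabs (1 - z)))) => z.
rewrite mem_filter => /andP[_ zz].
have [_ z1 z2 _] := zsP zz.
apply: (cvg_comp_cont (h := fun a => ln (cabs (1 - mirror a z) / cabs (1 - z))) _ ce).
have p1 : 0 < cabs (1 - z).
  by rewrite cabs_gt0 subr_eq0; apply: contraTneq z2 => <-; rewrite /= ltxx.
have p2 : 0 < cabs (1 - mirror 2^-1 z).
  apply: lt_le_trans (le_trans (ler_norm _) (Re_le_cabs _)); rewrite ReB /=; lra.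
apply/rcont_real_cont; apply: (cont_real_fun (f := fun a => cabs (1 - mirror a z) / cabs (1 - z))).
  by apply: continuous_ln; rewrite divr_gt0.
have c1 : rcont (fun a => (cabs (1 - mirror a z))%:C) 2^-1.
  apply: (cont_comp (F := fun w => (cabs w)%:C) (@ccont_cabs _ _)); apply: rcont_ReIm.
    have D2 : is_derive (2^-1 : R) 1 (fun a => Re (1 - mirror a z)) (- 2).
      rewrite (_ : (fun _ => _) = fun a => 1 - (2 * a - Re z)); last by apply/funext => a; rewrite ReB.
      apply: is_derive_eq; rewrite /GRing.scale /=; ring.
    exact: rcont_poly D2.
  by apply: cont_ext (cont_cst _ (- Im z)%:C _) => a; rewrite ImB /= sub0r.
by apply: cont_ext (contM c1 (cont_cst _ (cabs (1 - z))^-1%:C _)) => a; rewrite -rmorphM.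
Qed.

End fixedT.
End zeta.
End Limit.

Theorem theorem2 (R : realType) (zeta : R[i] -> R[i])
    (hzeta : is_riemann_zeta zeta) :
  exists C : R, forall T : R, 3 <= T ->
    (`| log_zeta_integral zeta T - (2 * pi * right_zeros_sum zeta T)%:E |
     <= (C * (ln T / T ^+ 2))%:E)%E.
Proof.
(* The constant is fixed before [T]. The factor 2 pays for replacing [T + e] by [T] in the error
   term, so the bound at each [en n] is already the final one and passes to the limit. *)
have [D D0 HD] := strip_formula hzeta; exists (2 * D) => T hT.
have [zs [H [hH EH zsP Hnz]]] := zeros_factor hzeta hT.
have [e1 e10 e1P] := strip_eps zs T.
pose e0 := Num.min e1 (1 / 16).
have e00 : 0 < e0 by rewrite /e0 lt_min e10; lra.
have e08 : e0 < 1 / 8 by rewrite /e0 gt_min; apply/orP; right; lra.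
have e0e1 : e0 <= e1 by rewrite /e0 ge_min lexx.
have e0P z : z \in zs -> (2^-1 < complex.Re z -> 2 * e0 < complex.Re z - 2^-1) /\
    (T < `|complex.Im z| -> 2 * e0 < `|complex.Im z| - T).
  by move=> /e1P[h1 h2]; split => [/h1|/h2]; lra.
have [en [enP cen fin cJ]] := limit_integral hzeta hT hH EH zsP Hnz e00 e08 e0P.
have cS := cvg_SS hT zsP e00 e08 cen.
rewrite (right_zeros_sumE hzeta hH EH zsP Hnz).
have -> : log_zeta_integral zeta T =
    (\int[lebesgue_measure]_(t in `[(- T)%R, T]) (weighted_log zeta 2^-1 t)%:E)%E.
  apply: eq_integral => t _; congr (_%:E); rewrite /weighted_log; congr (_ * _).
  rewrite (_ : 1 - 2^-1 = 2^-1 :> R); last by field.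
  by rewrite mulfV// mul1r; congr (_^-1); rewrite exprVn; congr (_^-1 + _); ring.
move: fin cJ; set I := (\int[_]_(_ in _) _)%E => fin cJ.
rewrite -(fineK fin) in cJ *.
rewrite -EFinB /= lee_fin.
have cR := cvg_norm (cvgB (fine_cvg cJ) (cvgM (cvg_cst (2 * pi)) cS)).
have eF : Filter (\oo : set_system nat) by exact: _.
have {}cR := cR eF eF eF eF eF.
rewrite -(cvg_lim (@Rhausdorff R) cR); apply: limr_le; first exact: cvgP cR.
apply: nearW => n /=.
have [J EJ Jle] := strip_integral hzeta hT hH EH zsP Hnz e00 e08 e0P HD D0 (enP n).
by move: Jle; rewrite -[J]/(fine J%:E) -EJ.
Qed.
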